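(* Let $p$ and $q$ be positive integers with $q>p$, and let $G/K$ be one of the symmetric spaces $\mathbf{SO}_0(p,q)/\mathbf{SO}(p)\times\mathbf{SO}(q)$, $\mathbf{SU}(p,q)/\mathbf{S}(\mathbf{U}(p)\times\mathbf{U}(q))$ or $\mathbf{Sp}(p,q)/\mathbf{Sp}(p)\times\mathbf{Sp}(q)$. For every nonzero $X\in\mathfrak{a}$, the $p$-th convolution power $(\delta_{e^X}^\natural)^{p}$ is absolutely continuous with respect to the Haar measure of $G$. Moreover, $p$ is the smallest value for which this is true: if $X\in\mathfrak{a}$ has configuration $[1;p-1]$, then the $(p-1)$-th convolution power $(\delta_{e^X}^\natural)^{p-1}$ is singular with respect to the Haar measure of $G$.
   Context: Let $I_{p,q}=\mathrm{diag}(-I_p,I_q)$. $\mathbf{SO}_0(p,q)$ is the identity component of $\mathbf{SO}(p,q)=\{g\in\mathbf{SL}(p+q,\mathbf{R}): g^TI_{p,q}g=I_{p,q}\}$; $\mathbf{SU}(p,q)=\{g\in\mathbf{SL}(p+q,\mathbf{C}): g^*I_{p,q}g=I_{p,q}\}$; $\mathbf{Sp}(p,q)=\{g\in\mathbf{SL}(p+q,\mathbf{H}): g^*I_{p,q}g=I_{p,q}\}$, where $\mathbf{H}$ denotes the quaternions. The maximal compact subgroup $K$ is the subgroup of block-diagonal matrices with blocks of size $p\times p$ and $q\times q$ in $\mathbf{SO}(p)\times\mathbf{SO}(q)$, $\mathbf{S}(\mathbf{U}(p)\times\mathbf{U}(q))$, $\mathbf{Sp}(p)\times\mathbf{Sp}(q)$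 respectively. In all cases, $\mathfrak{a}$ is the real vector space of matrices $$H=\begin{pmatrix}0_{p\times p}&\mathcal{D}_H&0\\ \mathcal{D}_H&0_{p\times p}&0\\0&0&0_{(q-p)\times(q-p)}\end{pmatrix},\quad \mathcal{D}_H=\mathrm{diag}[H_1,\dots,H_p],\ H_i\in\mathbf{R}.$$ Let $m_K$ be the normalized Haar measure of $K$, viewed as a measure on $G$. For $X\in\mathfrak{a}$, $\delta_{e^X}^\natural=m_K\star\delta_{e^X}\star m_K$, where $\star$ is convolution of measures on $G$, and $(\delta_{e^X}^\natural)^l$ denotes the $l$-fold convolution of $\delta_{e^X}^\natural$ with itself. An element $X\in\mathfrak{a}$ has configuration $[1;p-1]$ if exactly one of the diagonal entries of $\mathcal{D}_X$ is nonzero (and the other $p-1$ are zero).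
   Formalization: Absolute continuity of the p-th convolution power is stated only for p ≥ 2: for p = 1 it is false for every nonzero X, since the measure is carried by K e^X K, which is Haar-null (|g_11| is constant on it); the singularity claim keeps all p ≥ 1. *)

(* Defs.v *)
From HB Require Import structures.
From mathcomp Require Import all_boot all_order all_algebra.
From mathcomp Require Import complex ring.
From mathcomp Require Import all_classical all_reals all_analysis.
Import Order.TTheory GRing.Theory Num.Theory numFieldNormedType.Exports.

Set Implicit Arguments.
Unset Strict Implicit.
Unset Printing Implicit Defensive.

Local Open Scope classical_set_scope.
Local Open Scope ring_scope.

Section second_countability.

Lemma second_countableP (T : topologicalType) :
  @second_countable T <->
  exists2 B : nat -> set T, (forall k, open (B k)) &
    forall x P, nbhs x P -> exists2 k, B k x & B k `<=` P.
Proof.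
split=> [[B /countable_injP[f finj] [Bo Bb]]|[B Bo Bb]].
  exists (fun k => xget set0 [set b | B b /\ f b = k]).
    by move=> k; case: xgetP => [b _ [Bb' _]|_]; [exact: Bo|exact: open0].
  move=> x P /Bb[b [Bb' bx] bP]; exists (f b);
    case: xgetP => [c _ [Bc /finj]|/(_ b)];
    by [move=> ->//; exact/mem_set|case].
exists (range B); first exact: (sub_countable (card_image_le _ _)).
split; first by move=> _ [k _ <-].
by move=> x P /Bb[k Bkx BkP]; exists (B k) => //; split => //; exists k.
Qed.

Lemma second_countable_prod (T U : topologicalType) :
  @second_countable T -> @second_countable U ->
  @second_countable (T * U)%type.
Proof.
move=> [B cB [Bo Bb]] [C cC [Co Cb]].
exists ((fun bc => bc.1 `*` bc.2) @` (B `*` C)).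
  exact: (sub_countable (card_image_le _ _) (countableX cB cC)).
split=> [_ [[b c] /= [Bb' Cc] <-]|[x y] A [[P Q] [/= Px Qy] PQA]].
  rewrite openE => -[x y] [/= bx cy]; exists (b, c) => //=.
  by split; apply: open_nbhs_nbhs; split => //; [exact: Bo|exact: Co].
have [b [Bb' bx] bP] := Bb x P Px; have [c [Cc cy] cQ] := Cb y Q Qy.
exists (b `*` c); first by split=> //; exists (b, c).
by move=> z [z1 z2]; apply: PQA; split; [exact: bP|exact: cQ].
Qed.

Lemma second_countable_mx (T : topologicalType) m n :
  @second_countable T -> @second_countable 'M[T]_(m, n).
Proof.
move=> /second_countableP[B Bo Bb].
pose box (k : 'M[nat]_(m, n)) :=
  [set M : 'M[T]_(m, n) | forall i j, B (k i j) (M i j)].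
exists (range box).
  exact: (sub_countable (card_image_le _ _) (countableP setT)).
split=> [_ [k _ <-]|M A [P PM PA]].
  rewrite openE => M kM; exists (fun i j => B (k i j)) => // i j.
  by apply: open_nbhs_nbhs; split; [exact: Bo|exact: kM].
have /choice[k kP] ij : exists k,
  B k (M ij.1 ij.2) /\ B k `<=` P ij.1 ij.2.
  by have [k] := Bb _ _ (PM ij.1 ij.2); exists k.
exists (box (\matrix_(i, j) k (i, j))); first split.
  by exists (\matrix_(i, j) k (i, j)).
  by move=> i j; rewrite mxE; have [] := kP (i, j).
move=> N BN; apply: PA => i j; have [_] := kP (i, j); apply.
by have := BN i j; rewrite mxE.
Qed.

Lemma second_countable_dense (K : numFieldType) (V : pseudoMetricType K)
    (I : countType) (D : I -> V) :
  (forall e : K, 0 < e -> exists n, n.+1%:R^-1 <= e) ->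
  (forall (x : V) n, exists i, ball x (n.+1%:R^-1) (D i)) ->
  @second_countable V.
Proof.
move=> archi dense; pose B (k : I * nat) := (ball (D k.1) (k.2.+1%:R^-1))°.
exists (range B).
  exact: (sub_countable (card_image_le _ _) (countableP setT)).
split=> [_ [k _ <-]|x A]; first exact: open_interior.
rewrite -nbhs_ballE => -[e /= e0 eA].
have [n ne] := archi (e / 2) (divr_gt0 e0 (ltr0Sn _ 1)).
have half : (n.*2.+1.+1%:R : K)^-1 + n.*2.+1.+1%:R^-1 = n.+1%:R^-1.
  rewrite -doubleS -muln2 natrM invfM mulrC -mulrDl.
  by rewrite -[X in _ = X]mul1r [X in _ = X * _](splitr 1) mul1r.
have [i iD] := dense x n.*2.+1.
exists (B (i, n)).
  split; first by exists (i, n).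
  rewrite /B/interior/= -nbhs_ballE; exists (n.*2.+1.+1%:R^-1) => /=.
    by rewrite invr_gt0 ltr0Sn.
  by move=> y xy; rewrite -half; apply: ball_triangle xy; exact: ball_sym.
move=> y /interior_subset /= iy; apply: eA.
rewrite (splitr e); apply: (@ball_triangle _ _ (D i)); last exact: le_ball iy.
by apply: le_ball iD; apply: le_trans ne;
  rewrite lef_pV2 ?posrE// ler_nat ltnS -addnn leqW ?leq_addr.
Qed.

Lemma open_prod_bigcup (T U : topologicalType) (W : set (T * U)) :
  @second_countable T -> @second_countable U -> open W ->
  exists A : nat * nat -> set T, exists B : nat * nat -> set U,
    [/\ forall k, open (A k), forall k, open (B k) &
        W = \bigcup_k (A k `*` B k)].
Proof.
move=> /second_countableP[B Bo Bb] /second_countableP[C Co Cb] oW.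
exists (fun k => if `[< B k.1 `*` C k.2 `<=` W >] then B k.1 else set0).
exists (fun k => C k.2); split => [k|k|]; last 2 first.
- exact: Co.
- apply/seteqP; split=> [[x y] xyW|z [k _]]; last first.
    by case: asboolP => [+ zk|_ []//]; apply.
  have [[P Q] [/= Px Qy] PQ] : nbhs (x, y) W by exact: open_nbhs_nbhs.
  have [b bx bP] := Bb _ _ Px; have [c cy cQ] := Cb _ _ Qy.
  exists (b, c) => //=; case: asboolP => // -[].
  by move=> z [z1 z2]; apply: PQ; split; [exact: bP|exact: cQ].
- by case: asboolP => _; [exact: Bo|exact: open0].
Qed.

End second_countability.

(* The data common to the real, complex and quaternionic scalars.  Nothing is *)
(* required of [of_real] and [conj] because only the three instances below *)
(* are ever used; the continuity and countability fields make matrix *)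
(* multiplication measurable for the product of the Borel sigma-algebras. *)
HB.mixin Record isHypercomplex (R : realType) F
    of GRing.NzRing F & Topological F := {
  of_real : R -> F ;
  conj : F -> F ;
  hadd_continuous : continuous (fun z : F * F => z.1 + z.2) ;
  hmul_continuous : continuous (fun z : F * F => z.1 * z.2) ;
  h_second_countable : @second_countable F
}.

#[short(type="hypercomplexType")]
HB.structure Definition Hypercomplex (R : realType) :=
  {F of GRing.NzRing F & Topological F & isHypercomplex R F}.

Section hypercomplex_continuity.
Context (R : realType) (F : hypercomplexType R) (X : topologicalType).
Implicit Types f g : X -> F.

Lemma hcontinuousD f g : continuous f -> continuous g ->
  continuous (fun x => f x + g x).
Proof.
move=> fc gc x; apply: (@continuous_comp _ _ _ (fun x => (f x, g x))
  (fun z : F * F => z.1 + z.2)); last exact: hadd_continuous.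
by apply: cvg_pair; [exact: fc|exact: gc].
Qed.

Lemma hcontinuousM f g : continuous f -> continuous g ->
  continuous (fun x => f x * g x).
Proof.
move=> fc gc x; apply: (@continuous_comp _ _ _ (fun x => (f x, g x))
  (fun z : F * F => z.1 * z.2)); last exact: hmul_continuous.
by apply: cvg_pair; [exact: fc|exact: gc].
Qed.

Lemma hcontinuous_sum I (s : seq I) (f : I -> X -> F) :
  (forall i, continuous (f i)) -> continuous (fun x => \sum_(i <- s) f i x).
Proof.
move=> fc; elim: s => [|i s ih].
  by under eq_fun do rewrite big_nil; move=> x; exact: cvg_cst.
by under eq_fun do rewrite big_cons; exact: hcontinuousD.
Qed.

End hypercomplex_continuity.

Section matrix_continuity.
Context (T : topologicalType) (m n : nat).

Lemma entry_continuous i j : continuous (fun M : 'M[T]_(m, n) => M i j).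
Proof.
move=> M A MA; exists (fun k l => if (k == i) && (l == j) then A else setT).
  move=> k l; case: ifP => [/andP[/eqP-> /eqP->]//|_]; exact: filterT.
by move=> N /(_ i j); rewrite /= !eqxx.
Qed.

Lemma matrix_continuous (X : topologicalType) (f : X -> 'M[T]_(m, n)) :
  (forall i j, continuous (fun x => f x i j)) -> continuous f.
Proof.
move=> fc x A [P fP PA].
have : \forall y \near x, forall i, forall j, P i j (f y i j).
  by apply: filter_forall => i; apply: filter_forall => j; exact: fc.
by apply: filterS => y Py; apply: PA => i j; exact: Py.
Qed.

End matrix_continuity.

Section real_scalars.
Context (R : realType).

Lemma real_second_countable : @second_countable R.
Proof.
apply: (@second_countable_dense R R rat ratr) => [e e0|x n].
  have [n] := ltr_add_invr (y := 0) (x := e) e0.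
  by rewrite add0r => /ltW ne; exists n.
have /rat_in_itvoo[q] : x - n.+1%:R^-1 < x + n.+1%:R^-1.
  by rewrite ltrD2l gtrN ?invr_gt0.
rewrite in_itv /= => /andP[q1 q2]; exists q.
by rewrite /ball /= distrC ltr_distl q1 q2.
Qed.

HB.instance Definition _ :=
  isHypercomplex.Build R R id id add_continuous mul_continuous
    real_second_countable.

End real_scalars.

HB.instance Definition _ (R : realType) := PointedTopological.copy R[i] R[i]^o.

Section complex_scalars.
Context (R : realType).
Local Open Scope complex_scope.

Lemma normc_le (x : R[i]) : `|x| <= (`|complex.Re x| + `|complex.Im x|)%:C.
Proof.
case: x => a b; rewrite normc_def lecR /= -[leRHS]ger0_norm ?addr_ge0//.
rewrite -sqrtr_sqr ler_wsqrtr// sqrrD !real_normK ?num_real//.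
by rewrite lerD2r lerDl mulrn_wge0// mulr_ge0.
Qed.

Lemma complex_second_countable : @second_countable R[i].
Proof.
apply: (@second_countable_dense R[i] R[i]^o (rat * rat)%type
  (fun q => ratr q.1 +i* ratr q.2)) => [e e0|[x y] n].
  have /complex_realP[r er] : e \is Num.real by exact: gtr0_real.
  move: e0; rewrite er ltcR => r0.
  have [n] := ltr_add_invr (y := 0) (x := r) r0.
  rewrite add0r => /ltW nr; exists n.
  by rewrite -(rmorph_nat (real_complex R)) -fmorphV lecR.
pose d : R := n.+1%:R^-1 / 2.
have d0 : 0 < d by rewrite divr_gt0// invr_gt0.
have approx (z : R) : exists q : rat, `|z - ratr q| < d.
  have /rat_in_itvoo[q] : z - d < z + d by rewrite ltrD2l gtrN.
  rewrite in_itv /= => /andP[q1 q2]; exists q.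
  by rewrite distrC ltr_distl q1 q2.
have [a xa] := approx x; have [b yb] := approx y; exists (a, b).
rewrite -ball_normE /=; apply: le_lt_trans (normc_le _) _.
rewrite -(rmorph_nat (real_complex R)) -fmorphV ltcR /=.
by rewrite [ltRHS]splitr ltrD.
Qed.

Lemma conjc_continuous : continuous (Num.conj : R[i] -> R[i]).
Proof.
move=> x A /(@nbhs_ballP R[i] R[i]^o)[e /= e0 eA].
apply/(@nbhs_ballP R[i] R[i]^o); exists e => //= y xy; apply: eA.
by move: xy; rewrite -!ball_normE /= -rmorphB norm_conjC.
Qed.

HB.instance Definition _ :=
  isHypercomplex.Build R R[i] (real_complex R) Num.conj
    (@add_continuous R[i]^o) (@mul_continuous R[i]) complex_second_countable.

End complex_scalars.

(* [(a, b)] stands for the quaternion [a + b j], with [j * a = conj a * j] *)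
(* and [j * j = -1]. *)
Definition quaternion (R : realType) : Type := (R[i] * R[i])%type.

Section quaternions.
Context (R : realType).
Local Notation H := (quaternion R).
Implicit Types x y z : H.

HB.instance Definition _ := GRing.Zmodule.copy H (R[i] * R[i])%type.
HB.instance Definition _ := Topological.copy H (R[i] * R[i])%type.

Definition quat_one : H := (1, 0).

Definition quat_mul x y : H :=
  (x.1 * y.1 - x.2 * y.2^*, x.1 * y.2 + x.2 * y.1^*).

Definition quat_conj x : H := (x.1^*, - x.2).

Lemma quat_mulA : associative quat_mul.
Proof.
move=> [a b] [c d] [e f]; rewrite /quat_mul /=.
rewrite !(rmorphD, rmorphN, rmorphM) /= !conjCK.
by congr pair; ring.
Qed.

Lemma quat_mul1q : left_id quat_one quat_mul.
Proof. by move=> [a b]; rewrite /quat_mul /= !mul1r !mul0r subr0 addr0. Qed.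

Lemma quat_mulq1 : right_id quat_one quat_mul.
Proof.
by move=> [a b]; rewrite /quat_mul /= rmorph1 rmorph0 !mulr1 !mulr0 subr0 add0r.
Qed.

Lemma quat_mulDl : left_distributive quat_mul +%R.
Proof.
by move=> [a b] [c d] [e f]; rewrite /quat_mul /=; congr pair; rewrite /=; ring.
Qed.

Lemma quat_mulDr : right_distributive quat_mul +%R.
Proof.
move=> [a b] [c d] [e f]; rewrite /quat_mul /= !rmorphD.
by congr pair; rewrite /=; ring.
Qed.

Lemma quat_one_neq0 : quat_one != 0.
Proof. by apply/eqP => -[/eqP]; rewrite oner_eq0. Qed.

HB.instance Definition _ := GRing.Zmodule_isNzRing.Build H
  quat_mulA quat_mul1q quat_mulq1 quat_mulDl quat_mulDr quat_one_neq0.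

Let pair_continuous (X : topologicalType) (f g : X -> R[i]) :
  continuous f -> continuous g -> continuous (fun x : X => ((f x, g x) : H)).
Proof.
move=> fc gc x.
exact: (@cvg_pair _ _ _ (nbhs x) (nbhs (f x)) (nbhs (g x)) _ _ _ f g
  (fc x) (gc x)).
Qed.

Let coord1_continuous (X : topologicalType) (f : X -> H) :
  continuous f -> continuous (fun x : X => (f x).1 : R[i]).
Proof.
move=> fc x; apply: (@continuous_comp X (R[i] * R[i])%type R[i] f fst);
  [exact: fc|exact: cvg_fst].
Qed.

Let coord2_continuous (X : topologicalType) (f : X -> H) :
  continuous f -> continuous (fun x : X => (f x).2 : R[i]).
Proof.
move=> fc x; apply: (@continuous_comp X (R[i] * R[i])%type R[i] f snd);
  [exact: fc|exact: cvg_snd].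
Qed.

Let fst_continuous : continuous (fst : H * H -> H).
Proof. by move=> z; exact: cvg_fst. Qed.

Let snd_continuous : continuous (snd : H * H -> H).
Proof. by move=> z; exact: cvg_snd. Qed.

Let conj_continuous (X : topologicalType) (f : X -> R[i]) :
  continuous f -> continuous (fun x : X => (f x)^*).
Proof.
by move=> fc x; apply: continuous_comp; [exact: fc|exact: conjc_continuous].
Qed.

Lemma quat_add_continuous : continuous (fun z : H * H => z.1 + z.2).
Proof.
have c11 := coord1_continuous fst_continuous.
have c12 := coord2_continuous fst_continuous.
have c21 := coord1_continuous snd_continuous.
have c22 := coord2_continuous snd_continuous.
exact: (pair_continuous (hcontinuousD c11 c21) (hcontinuousD c12 c22)).
Qed.

Lemma quat_mul_continuous : continuous (fun z : H * H => z.1 * z.2).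
Proof.
have c11 := coord1_continuous fst_continuous.
have c12 := coord2_continuous fst_continuous.
have c21 := coord1_continuous snd_continuous.
have c22 := coord2_continuous snd_continuous.
have cN1 : continuous (fun _ : H * H => -1 : R[i]).
  by move=> z; exact: cvg_cst.
have c12N := hcontinuousM cN1 c12.
have mulE (z : H * H) : z.1 * z.2 =
    (z.1.1 * z.2.1 + -1 * z.1.2 * z.2.2^*, z.1.1 * z.2.2 + z.1.2 * z.2.1^*).
  by rewrite mulN1r mulNr.
rewrite (funext mulE); exact: (pair_continuous
  (hcontinuousD (hcontinuousM c11 c21)
    (hcontinuousM c12N (conj_continuous c22)))
  (hcontinuousD (hcontinuousM c11 c22)
    (hcontinuousM c12 (conj_continuous c21)))).
Qed.

Lemma quat_second_countable : @second_countable H.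
Proof.
exact: second_countable_prod (@complex_second_countable R)
  (@complex_second_countable R).
Qed.

HB.instance Definition _ := isHypercomplex.Build R H
  (fun a => (real_complex R a, 0)) quat_conj
  quat_add_continuous quat_mul_continuous quat_second_countable.

End quaternions.

Section matrices.
Context (R : realType) (F : hypercomplexType R).

Lemma mulmx_continuous n :
  continuous (fun z : 'M[F]_n * 'M[F]_n => z.1 *m z.2).
Proof.
apply: matrix_continuous => i j; under eq_fun do rewrite mxE.
apply: hcontinuous_sum => k; apply: hcontinuousM => z.
  by apply: (@continuous_comp _ _ _ fst (fun M : 'M[F]_n => M i k));
    [exact: cvg_fst|exact: entry_continuous].
by apply: (@continuous_comp _ _ _ snd (fun M : 'M[F]_n => M k j));
  [exact: cvg_snd|exact: entry_continuous].
Qed.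

Definition borel_mx n : Type := 'M[F]_n.

HB.instance Definition _ n := Choice.copy (borel_mx n) 'M[F]_n.
HB.instance Definition _ n := isPointed.Build (borel_mx n) (0 : 'M[F]_n).
HB.instance Definition _ n :=
  @isMeasurable.Build (sigma_display (@open 'M[F]_n)) (borel_mx n)
    <<s @open 'M[F]_n >> (@sigma_algebra0 _ setT _)
    (@sigma_algebraC (borel_mx n) _)
    (@sigma_algebra_bigcup _ setT _).

Definition mulmx_pair n (z : borel_mx n * borel_mx n) : borel_mx n :=
  (z.1 : 'M[F]_n) *m (z.2 : 'M[F]_n).

Lemma mulmx_pair_measurable n : measurable_fun setT (@mulmx_pair n).
Proof.
apply: (@measurability _ _ _ (borel_mx n) setT (@mulmx_pair n)
  (@open 'M[F]_n) erefl) => _ [W oW <-].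
rewrite setTI.
have /open_prod_bigcup : open ((@mulmx_pair n : _ -> 'M[F]_n) @^-1` W).
  by have /continuousP := @mulmx_continuous n; exact.
have sc := second_countable_mx n n (@h_second_countable R F).
case/(_ sc sc) => A [B [oA oB ->]].
apply: countable_bigcupT_measurable => // k.
by apply: measurableX; apply: sub_gen_smallest; [exact: oA|exact: oB].
Qed.

HB.instance Definition _ n :=
  isMeasurableFun.Build _ _ _ _ (@mulmx_pair n) (@mulmx_pair_measurable n).

Definition convolution n (mu nu : probability (borel_mx n) R) :
  probability (borel_mx n) R := distribution (mu \x nu)%E (@mulmx_pair n).

Definition dirac_mx n (g : 'M[F]_n) : probability (borel_mx n) R :=
  \d_(g : borel_mx n).

(* The empty convolution product is the Dirac measure at the identity. *)
Fixpoint convolution_pow n (mu : probability (borel_mx n) R) (l : nat) :=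
  if l is l'.+1 then convolution mu (convolution_pow mu l')
  else dirac_mx 1%:M.

(* A measure on a closed subgroup [G] of the invertible matrices is *)
(* identified with a Borel measure on all matrices for which the complement *)
(* of [G] is negligible; this is compatible with convolution.  Finiteness on *)
(* compact sets makes such a measure regular, the space being Polish.  As *)
(* [G] is a group, invariance of the measure of [g^-1 A] for all [g] in [G] *)
(* is left invariance. *)
Definition haar_measure n (G : set 'M[F]_n)
    (mu : {measure set (borel_mx n) -> \bar R}) : Prop :=
  [/\ mu.-negligible (~` G), mu setT != 0%E,
      forall C : set 'M[F]_n, compact C -> (mu C < +oo)%E &
      forall (g : 'M[F]_n) (A : set (borel_mx n)), G g -> measurable A ->
        mu [set x | A (g *m (x : 'M[F]_n))] = mu A].

Definition real_mx m n (A : 'M[R]_(m, n)) : 'M[F]_(m, n) := map_mx of_real A.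

Definition adjoint_mx m n (A : 'M[F]_(m, n)) : 'M[F]_(n, m) :=
  (map_mx conj A)^T.

Definition signature_mx p q : 'M[F]_(p + q) := block_mx (- 1%:M) 0 0 1%:M.

Definition unitary n : set 'M[F]_n := [set k | adjoint_mx k *m k = 1%:M].

Definition pseudo_unitary p q : set 'M[F]_(p + q) :=
  [set g | adjoint_mx g *m signature_mx p q *m g = signature_mx p q].

Definition block_diag_mx p q (k1 : 'M[F]_p) (k2 : 'M[F]_q) : 'M[F]_(p + q) :=
  block_mx k1 0 0 k2.

End matrices.
Arguments signature_mx {R F} p q.
Arguments unitary {R F} n _.
Arguments pseudo_unitary {R F} p q _.
Arguments real_mx {R} F {m n} A.

Definition mutually_singular d (T : measurableType d) (R : realType)
    (mu nu : set T -> \bar R) : Prop :=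
  exists A : set T, [/\ measurable A, mu A = 0%E & nu (~` A) = 0%E].

Unset Implicit Arguments.

Section symmetric_spaces.
Context {R : realType}.

Definition SO n : set 'M[R]_n := [set k | unitary n k /\ \det k = 1].

Definition SO_pq p q : set 'M[R]_(p + q) :=
  [set g | pseudo_unitary p q g /\ \det g = 1].

Definition SO0_pq p q : set 'M[R]_(p + q) :=
  connected_component (SO_pq p q) 1%:M.

Definition SO_x_SO p q : set 'M[R]_(p + q) :=
  [set k | exists k1 k2,
    [/\ SO p k1, SO q k2 & k = block_diag_mx k1 k2]].

Definition SU_pq p q : set 'M[R[i]]_(p + q) :=
  [set g | pseudo_unitary p q g /\ \det g = 1].

Definition S_UxU p q : set 'M[R[i]]_(p + q) :=
  [set k | exists k1 k2,
    [/\ unitary p k1, unitary q k2, \det k = 1 &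
        k = block_diag_mx k1 k2]].

(* The complex matrix of a quaternionic one, via *)
(* [a + b j |-> [[a, b], [- conj b, conj a]]]; its determinant is what *)
(* defines [SL(n, H)], the entries of the matrix not commuting. *)
Definition complexify_mx {n} (g : 'M[quaternion R]_n) : 'M[R[i]]_(n + n) :=
  let a := map_mx (fun x : quaternion R => x.1 : R[i]) g in
  let b := map_mx (fun x : quaternion R => x.2 : R[i]) g in
  block_mx a b (- map_mx conj b) (map_mx conj a).

Definition Sp_pq p q : set 'M[quaternion R]_(p + q) :=
  [set g | pseudo_unitary p q g /\
    \det (complexify_mx g) = 1].

Definition Sp_x_Sp p q : set 'M[quaternion R]_(p + q) :=
  [set k | exists k1 k2,
    [/\ unitary p k1, unitary q k2 &
        k = block_diag_mx k1 k2]].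

Inductive symmetric_pair (p q : nat) : forall F : hypercomplexType R,
    set 'M[F]_(p + q) -> set 'M[F]_(p + q) -> Prop :=
| SO_pair : symmetric_pair p q R (SO0_pq p q) (SO_x_SO p q)
| SU_pair : symmetric_pair p q R[i] (SU_pq p q) (S_UxU p q)
| Sp_pair : symmetric_pair p q (quaternion R) (Sp_pq p q) (Sp_x_Sp p q).

Definition expmx {n} (A : 'M[R]_n) : 'M[R]_n :=
  limn (series (fun k => k`!%:R^-1 *: A ^+ k)).

(* For [p <= q], the upper right block is the [p x q] matrix [(D_H 0)]. *)
Definition cartan_mx {p} q (H : 'rV[R]_p) : 'M[R]_(p + q) :=
  let D := \matrix_(i < p, j < q) (H 0 i *+ (i == j :> nat)) in
  block_mx 0 D D^T 0.

Definition cartan_space p q : set 'M[R]_(p + q) := range (cartan_mx q).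

(* Configuration [1; p-1]. *)
Definition one_nonzero_entry {p q} (X : 'M[R]_(p + q)) : Prop :=
  exists2 H : 'rV[R]_p, X = cartan_mx q H & #|[pred i | H 0 i != 0]| = 1%N.

Definition delta_natural {F : hypercomplexType R} {n}
    (mK : probability (borel_mx F n) R) (X : 'M[R]_n) :
    probability (borel_mx F n) R :=
  convolution (convolution mK (dirac_mx (real_mx F (expmx X)))) mK.

End symmetric_spaces.
Arguments symmetric_pair {R} p q {F} _ _.

(* Main.v *)
(* A word [k_0 a k_1 a ... a k_p] with independent Haar distributed [k_i] in *)
(* [K] and [a = e^X] has the law of the [p]-th power.  [K] is generated by the *)
(* rotations [r_C(t) = 1 + sin t C + (1 - cos t) C^2] with [C^3 = - C], along *)
(* which a word is a trigonometric polynomial.  At a word built from signed *)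
(* permutations the directions in which these rotations move it span the *)
(* tangent space of [G]: a tangent vector orthogonal to all of them is block *)
(* off-diagonal and commutes with [p] conjugates of [a], hence vanishes. *)
(* Hence the Jacobian minor is non-zero at one point, so almost everywhere. *)
(* Where it is bounded below, translating by a fine grid of rotations gives *)
(* many disjoint sets of equal probability, so that a ball of radius [r] has *)
(* probability [O(r^n)], whereas its Haar measure is at least [c r^n]; this *)
(* gives absolute continuity without a change of variables. *)
(* For [X] with one non-zero entry, [a - 1] has rank two and the upper right *)
(* block of a word with [l] letters [a] has rank at most [l].  The block being *)
(* rank deficient is a Haar null condition, since along [e^(tY) g] the Gram *)
(* determinant is a non-zero polynomial in [coth t]. *)

Require Import Defs.
From mathcomp Require Import all_boot all_order all_algebra.
From mathcomp Require Import perm.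
From mathcomp Require Import complex ring lra zify.
From mathcomp Require Import all_classical all_reals all_analysis.
From mathcomp Require Import measurable_realfun.
Import Order.TTheory GRing.Theory Num.Theory numFieldNormedType.Exports.

Set Implicit Arguments.
Unset Strict Implicit.
Unset Printing Implicit Defensive.

Local Open Scope classical_set_scope.
Local Open Scope ring_scope.

(** The argument runs once, over scalars [F] with a [scalar_structure] (real coordinates, a
    conjugation, and a real part that is a trace form and gives the Euclidean inner product) and for
    groups [G], [K] with a [cartan_pair]. The three families enter only through [so_pair], [su_pair]
    and [sp_pair].

    Absolute continuity. The power is the law of a random word whose slots are independent Haar
    elements of [K] ([represents_pow]); all that is kept of this law is its invariance under
    translating each slot by its own element of [K]. The heart is [pair_span]: at one configuration
    [kstar] the word map is a submersion onto [G]. Translated to the identity, moving a slot along C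
    in the Lie algebra of [K] gives C conjugated by the prefix of the word. Let Y in the Lie algebra
    of [G] be trace-orthogonal to all these directions. Orthogonality to the Lie algebra of [K]
    makes Y block off-diagonal, hence self-adjoint. Orthogonality to its conjugate by kappa a makes
    the corresponding conjugate of Y self-adjoint too, and this forces kappa^-1 Y kappa to commute
    with a^2, hence with the positive matrix a ([commute_step]). If every factor of the word is
    kappa a kappa^-1, it commutes with Y and the argument repeats for the next factor
    ([commute_all]). With p suitable signed permutations kappa only Y = 0 is left
    ([vanishing_pattern]). That last step needs two rows. For p = 1 the first power is carried by
    the double coset K e^X K, of smaller dimension than [G], whence the condition [1 < p].

    From one configuration to almost all: the Jacobian is polynomial in the slots, so it is a
    trigonometric polynomial of bounded degree along each rotation, and rotations generate [K];
    being nonzero at [kstar], it is nonzero almost surely ([polyfn_null]). Where it is bounded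
    below, a ball of radius of order 1/m has probability at most m^-d ([concentration]). Its Haar
    measure, for a centre in a bounded part of [G], is at least a constant times m^-d, with the same
    d ([haar_nball_lower]). A packing argument compares the two on closed null sets
    ([ball_domination]), and inner regularity gives all null sets ([represented_dominated]).

    Singularity. When [X] has one nonzero entry, the upper right block of a word with l letters a
    has rank at most l ([corner_factors]). For l < p the law is therefore carried by the zero set of
    the polynomial [corner], which is Haar null ([corner_null]). A probability that is both singular
    and dominated cannot exist, so no exponent below p works. *)

Record scalar_structure (R : realType) (F : hypercomplexType R) :=
  ScalarStructure {
  sdim : nat;
  co : 'I_sdim -> F -> R;
  un : 'I_sdim -> F;
  re_idx : 'I_sdim;
  coD : forall e x y, co e (x + y) = co e x + co e y;
  coZ : forall e a x, co e (of_real a * x) = a * co e x;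
  co_decomp : forall x, x = \sum_e of_real (co e x) * un e;
  co_un : forall e e', co e (un e') = (e == e')%:R;
  of_realD : forall a b, of_real (a + b) = of_real a + of_real b :> F;
  of_realM : forall a b, of_real (a * b) = of_real a * of_real b :> F;
  of_real1 : of_real 1 = 1 :> F;
  of_realC : forall a (x : F), of_real a * x = x * of_real a;
  co_continuous : forall e, continuous (co e);
  nbhs_co : forall (x : F) U, nbhs x U ->
    exists2 r : R, 0 < r & forall y, (forall e, `|co e (y - x)| < r) -> U y;
  sum_coM : forall x y, \sum_e `|co e (x * y)| <=
    (\sum_e `|co e x|) * (\sum_e `|co e y|);
  hconjD : forall x y : F, conj (x + y) = conj x + conj y;
  hconjM : forall x y : F, conj (x * y) = conj y * conj x;
  hconjK : forall x : F, conj (conj x) = x;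
  hconj_real : forall a, conj (of_real a) = of_real a :> F;
  co_conj : forall e x, `|co e (conj x)| = `|co e x|;
  reM : forall x y, co re_idx (x * y) = co re_idx (y * x);
  re_conjM : forall x y, co re_idx (x * conj y) = \sum_e co e x * co e y;
  un_conjr : forall e, un e * conj (un e) = 1;
  un_conjl : forall e, conj (un e) * un e = 1
}.

(** * Scalars and matrix norms *)

Section scalars.
Context (R : realType) (F : hypercomplexType R) (S : scalar_structure F).
Local Notation co := (@co R F S).
Local Notation un := (@un R F S).
Local Notation re := (co (re_idx S)).
Implicit Types (x y : F) (a : R).

Lemma co0 e : co e 0 = 0.
Proof. by apply: (addrI (co e 0)); rewrite -coD !addr0. Qed.

Lemma coN e x : co e (- x) = - co e x.
Proof. by apply: (addrI (co e x)); rewrite -coD !subrr co0. Qed.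

Lemma coB e x y : co e (x - y) = co e x - co e y.
Proof. by rewrite coD coN. Qed.

Lemma co_sum T (s : seq T) P (f : T -> F) e :
  co e (\sum_(i <- s | P i) f i) = \sum_(i <- s | P i) co e (f i).
Proof. exact: (big_morph _ (coD (s := S) e) (co0 e)). Qed.

Lemma co_inj x y : (forall e, co e x = co e y) -> x = y.
Proof.
by move=> xy; rewrite (co_decomp S x) (co_decomp S y); apply: eq_bigr => e _;
  rewrite xy.
Qed.

Lemma of_real0 : of_real 0 = 0 :> F.
Proof.
by apply: (addrI (of_real 0)); rewrite -(of_realD S) !addr0.
Qed.

Lemma of_realN a : of_real (- a) = - of_real a :> F.
Proof.
by apply: (addrI (of_real a)); rewrite -(of_realD S) !subrr of_real0.
Qed.

Lemma of_realB a b : of_real (a - b) = of_real a - of_real b :> F.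
Proof. by rewrite (of_realD S) of_realN. Qed.

Lemma of_real_sum T (s : seq T) P (f : T -> R) :
  of_real (\sum_(i <- s | P i) f i) = \sum_(i <- s | P i) of_real (f i) :> F.
Proof. exact: (big_morph _ (of_realD S) of_real0). Qed.

Lemma hconj0 : conj 0 = 0 :> F.
Proof. by rewrite -of_real0 (hconj_real S). Qed.

Lemma hconj1 : conj 1 = 1 :> F.
Proof. by rewrite -(of_real1 S) (hconj_real S). Qed.

Lemma hconjN x : conj (- x) = - conj x.
Proof.
by apply: (addrI (conj x)); rewrite -(hconjD S) !subrr hconj0.
Qed.

Lemma hconj_sum T (s : seq T) P (f : T -> F) :
  conj (\sum_(i <- s | P i) f i) = \sum_(i <- s | P i) conj (f i).
Proof. exact: (big_morph _ (hconjD S) hconj0). Qed.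

Lemma re_conj x : re (conj x) = re x.
Proof.
have -> : re x = re (x * conj 1) by rewrite hconj1 mulr1.
rewrite -[conj x]mul1r !(re_conjM S).
by apply: eq_bigr => e _; rewrite mulrC.
Qed.

(** Testing against [conj x] gives the sum of the squares of the coordinates: the real trace form is
    nondegenerate. *)
Lemma re_eq0 x : (forall y, re (x * y) = 0) -> x = 0.
Proof.
move=> /(_ (conj x)); rewrite (re_conjM S) => /eqP.
rewrite psumr_eq0; last by move=> e _; rewrite -expr2 sqr_ge0.
move=> /allP c0; apply: co_inj => e.
have /implyP/(_ isT) := c0 e (mem_index_enum e).
by rewrite mulf_eq0 orbb => /eqP ->; rewrite co0.
Qed.

Lemma re_un_eq0 x : (forall e, re (x * un e) = 0) -> x = 0.
Proof.
move=> xu; apply: re_eq0 => y; rewrite (co_decomp S y) mulr_sumr co_sum big1//.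
by move=> e _; rewrite mulrA -[x * of_real _](of_realC S) -mulrA coZ xu mulr0.
Qed.

Lemma re_mul_self_ge0 x : 0 <= re (x * conj x).
Proof. by rewrite (re_conjM S) sumr_ge0// => e _; rewrite -expr2 sqr_ge0. Qed.

Lemma re_mul_self_eq0 x : re (x * conj x) = 0 -> x = 0.
Proof.
rewrite (re_conjM S) => /eqP.
rewrite psumr_eq0; last by move=> e _; rewrite -expr2 sqr_ge0.
move=> /allP c0; apply: co_inj => e.
have /implyP/(_ isT) := c0 e (mem_index_enum e).
by rewrite mulf_eq0 orbb => /eqP ->; rewrite co0.
Qed.

End scalars.

Section matrix_norm.
Context (R : realType) (F : hypercomplexType R) (S : scalar_structure F).
Local Notation co := (@co R F S).
Local Notation un := (@un R F S).

Definition coidx m n := ('I_m * 'I_n * 'I_(sdim S))%type.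

Definition mco m n (A : 'M[F]_(m, n)) (x : coidx m n) : R :=
  co x.2 (A x.1.1 x.1.2).

(** The l1 norm of the real coordinates; it is submultiplicative because the l1 norm of the scalars
    is, and it carries all the estimates. *)
Definition nrm m n (A : 'M[F]_(m, n)) : R := \sum_x `|mco A x|.

Definition rscale m n (a : R) (A : 'M[F]_(m, n)) : 'M[F]_(m, n) :=
  of_real a *: A.

Lemma mcoD m n (A B : 'M[F]_(m, n)) x : mco (A + B) x = mco A x + mco B x.
Proof. by rewrite /mco mxE coD. Qed.

Lemma mcoN m n (A : 'M[F]_(m, n)) x : mco (- A) x = - mco A x.
Proof. by rewrite /mco mxE coN. Qed.

Lemma mcoB m n (A B : 'M[F]_(m, n)) x : mco (A - B) x = mco A x - mco B x.
Proof. by rewrite mcoD mcoN. Qed.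

Lemma mco0 m n x : mco (0 : 'M[F]_(m, n)) x = 0.
Proof. by rewrite /mco mxE co0. Qed.

Lemma mcoZ m n a (A : 'M[F]_(m, n)) x : mco (rscale a A) x = a * mco A x.
Proof. by rewrite /mco mxE coZ. Qed.

Lemma mco_inj m n (A B : 'M[F]_(m, n)) : (forall x, mco A x = mco B x) -> A = B.
Proof.
by move=> AB; apply/matrixP => i j; apply: (co_inj (S := S)) => e;
  exact: (AB (i, j, e)).
Qed.

Lemma nrm_ge0 m n (A : 'M[F]_(m, n)) : 0 <= nrm A.
Proof. by apply: sumr_ge0 => x _. Qed.

Lemma mco_le_nrm m n (A : 'M[F]_(m, n)) x : `|mco A x| <= nrm A.
Proof. by rewrite /nrm (bigD1 x)//= lerDl sumr_ge0. Qed.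

Lemma nrm0 m n : nrm (0 : 'M[F]_(m, n)) = 0.
Proof. by rewrite /nrm big1// => x _; rewrite mco0 normr0. Qed.

Lemma nrm_eq0 m n (A : 'M[F]_(m, n)) : nrm A = 0 -> A = 0.
Proof.
move=> A0; apply: mco_inj => x; rewrite mco0; apply/eqP; rewrite -normr_le0.
by rewrite -A0 mco_le_nrm.
Qed.

Lemma nrmD m n (A B : 'M[F]_(m, n)) : nrm (A + B) <= nrm A + nrm B.
Proof.
rewrite /nrm -big_split/=; apply: ler_sum => x _.
by rewrite mcoD ler_normD.
Qed.

Lemma nrmN m n (A : 'M[F]_(m, n)) : nrm (- A) = nrm A.
Proof. by apply: eq_bigr => x _; rewrite mcoN normrN. Qed.

Lemma nrmBC m n (A B : 'M[F]_(m, n)) : nrm (A - B) = nrm (B - A).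
Proof. by rewrite -nrmN opprB. Qed.

Lemma nrm_triangle m n (B A C : 'M[F]_(m, n)) :
  nrm (A - C) <= nrm (A - B) + nrm (B - C).
Proof. by rewrite -[A - C](subrKA B) nrmD. Qed.

Lemma nrmZ m n a (A : 'M[F]_(m, n)) : nrm (rscale a A) = `|a| * nrm A.
Proof.
by rewrite /nrm mulr_sumr; apply: eq_bigr => x _; rewrite mcoZ normrM.
Qed.

Lemma nrm_sum T (s : seq T) (P : pred T) m n (f : T -> 'M[F]_(m, n)) :
  nrm (\sum_(i <- s | P i) f i) <= \sum_(i <- s | P i) nrm (f i).
Proof.
elim/big_rec2: _ => [|i a B _ ih]; first by rewrite nrm0.
by apply: le_trans (nrmD _ _) _; rewrite lerD2l.
Qed.

Lemma nrmE m n (A : 'M[F]_(m, n)) :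
  nrm A = \sum_i \sum_j \sum_e `|co e (A i j)|.
Proof.
rewrite /nrm -(pair_big xpredT xpredT
  (fun (ij : 'I_m * 'I_n) e => `|co e (A ij.1 ij.2)|))/=.
by rewrite -(pair_big xpredT xpredT
  (fun i j => \sum_e `|co e (A i j)|)).
Qed.

Lemma nrmM m n k (A : 'M[F]_(m, n)) (B : 'M[F]_(n, k)) :
  nrm (A *m B) <= nrm A * nrm B.
Proof.
pose s (x : F) := \sum_e `|co e x|.
have s0 x : 0 <= s x by exact: sumr_ge0.
have sD (T : finType) (f : T -> F) : s (\sum_i f i) <= \sum_i s (f i).
  rewrite /s exchange_big /=; apply: ler_sum => e _.
  by rewrite co_sum ler_norm_sum.
rewrite !nrmE -/s; apply: (@le_trans _ _
    (\sum_i \sum_j \sum_k s (A i k) * s (B k j))).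
  apply: ler_sum => i _; apply: ler_sum => j _; rewrite mxE.
  by apply: le_trans (sD _ _) _; apply: ler_sum => l _; exact: sum_coM.
rewrite mulr_suml; apply: ler_sum => i _.
rewrite exchange_big mulr_suml /=; apply: ler_sum => l _.
rewrite -mulr_sumr ler_wpM2l//.
rewrite [leRHS](bigD1 l)//= lerDl; apply: sumr_ge0 => a _.
by apply: sumr_ge0 => j _; exact: s0.
Qed.

Lemma rscaleBl m n a b (A : 'M[F]_(m, n)) :
  rscale (a - b) A = rscale a A - rscale b A.
Proof. by rewrite /rscale (of_realB S) scalerBl. Qed.

Lemma rscaleDr m n a (A B : 'M[F]_(m, n)) :
  rscale a (A + B) = rscale a A + rscale a B.
Proof. exact: scalerDr. Qed.

Lemma rscale0r m n (A : 'M[F]_(m, n)) : rscale 0 A = 0.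
Proof. by rewrite /rscale (of_real0 S) scale0r. Qed.

Lemma rscale1r m n (A : 'M[F]_(m, n)) : rscale 1 A = A.
Proof. by rewrite /rscale (of_real1 S) scale1r. Qed.

Lemma rscaleAl m n k a (A : 'M[F]_(m, n)) (B : 'M[F]_(n, k)) :
  rscale a A *m B = rscale a (A *m B).
Proof. exact: (esym (scalemxAl _ _ _)). Qed.

Lemma rscaleAr m n k a (A : 'M[F]_(m, n)) (B : 'M[F]_(n, k)) :
  A *m rscale a B = rscale a (A *m B).
Proof.
apply/matrixP => i j; rewrite !mxE mulr_sumr; apply: eq_bigr => l _.
by rewrite !mxE mulrA -(of_realC S) mulrA.
Qed.

(** Real coordinate vectors give access to rank and determinant over the reals, although the scalars
    [F] need not commute. *)
Definition mvec m n (A : 'M[F]_(m, n)) : 'rV[R]_#|{: coidx m n}| :=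
  \row_x mco A (enum_val x).

Definition munvec m n (v : 'rV[R]_#|{: coidx m n}|) : 'M[F]_(m, n) :=
  \matrix_(i, j) \sum_e of_real (v 0 (enum_rank (i, j, e))) * un e.

Lemma mvec_inj m n (A B : 'M[F]_(m, n)) : mvec A = mvec B -> A = B.
Proof.
move=> /rowP AB; apply: mco_inj => x; have := AB (enum_rank x).
by rewrite !mxE enum_rankK.
Qed.

Lemma mvecK m n (A : 'M[F]_(m, n)) : munvec (mvec A) = A.
Proof.
apply/matrixP => i j; rewrite mxE [RHS](co_decomp S).
by apply: eq_bigr => e _; rewrite mxE enum_rankK.
Qed.

Lemma munvecK m n (v : 'rV[R]_#|{: coidx m n}|) : mvec (munvec v) = v.
Proof.
apply/rowP => x; rewrite -[x]enum_valK; move: (enum_val x) => [[i j] e].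
rewrite mxE /mco enum_rankK mxE co_sum (bigD1 e)//= big1 ?addr0 => [|e' /negPf ee'].
  by rewrite coZ co_un eqxx mulr1.
by rewrite coZ co_un eq_sym ee' mulr0.
Qed.

Lemma mvecD m n (A B : 'M[F]_(m, n)) : mvec (A + B) = mvec A + mvec B.
Proof. by apply/rowP => x; rewrite !mxE mcoD. Qed.

Lemma mvecZ m n a (A : 'M[F]_(m, n)) : mvec (rscale a A) = a *: mvec A.
Proof. by apply/rowP => x; rewrite !mxE mcoZ. Qed.

End matrix_norm.

Section matrix_topology.
Context (R : realType) (F : hypercomplexType R) (S : scalar_structure F).
Local Notation co := (@co R F S).
Local Notation un := (@un R F S).
Local Notation nrm := (nrm S).

Definition nball n (A : 'M[F]_n) (r : R) : set 'M[F]_n :=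
  [set B | nrm (B - A) < r].

Lemma mco_continuous n x : continuous (fun A : 'M[F]_n => mco (S := S) A x).
Proof.
move=> A; rewrite /mco.
apply: (@continuous_comp _ _ _ (fun A : 'M[F]_n => A x.1.1 x.1.2) (co x.2)).
  exact: entry_continuous.
exact: co_continuous.
Qed.

Lemma nrmB_continuous n (A : 'M[F]_n) :
  continuous (fun B : 'M[F]_n => nrm (B - A)).
Proof.
rewrite /nrm; under eq_fun do under eq_bigr do rewrite mcoB.
apply: (@hcontinuous_sum R R) => x B.
apply: (@continuous_comp _ R R (fun B => mco (S := S) B x - mco (S := S) A x)
  Num.norm); last exact: norm_continuous.
by apply: (@continuousB _ R _ (fun B => mco (S := S) B x) (fun=> mco (S := S) A x)); [exact: mco_continuous|exact: cst_continuous].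
Qed.

Lemma nball_open n (A : 'M[F]_n) r : open (nball A r).
Proof.
have -> : nball A r = (fun B => nrm (B - A)) @^-1` [set x | x < r] by [].
by apply: open_comp; [move=> B _; exact: nrmB_continuous|exact: open_lt].
Qed.

(** Matrices carry the product topology; the least of the finitely many radii found entry by entry
    serves as the radius of a norm ball. *)
Lemma nbhs_nball n (A : 'M[F]_n) U : nbhs A U ->
  exists2 r, 0 < r & nball A r `<=` U.
Proof.
move=> [P PA PU].
have /choice[r rP] (ij : 'I_n * 'I_n) : exists r : R, 0 < r /\
    forall y, (forall e, `|co e (y - A ij.1 ij.2)| < r) -> P ij.1 ij.2 y.
  by have [r r0 rP] := nbhs_co S (PA ij.1 ij.2); exists r.
pose r0 := \big[Num.min/1]_ij r ij.
exists r0.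
  by rewrite /r0; elim/big_ind: _ => // [x y x0 y0|ij _];
    [rewrite lt_min x0|case: (rP ij)].
move=> B BA; apply: PU => i j; case: (rP (i, j)) => _; apply => e.
apply: (@lt_le_trans _ _ r0); last by rewrite /r0; exact: bigmin_le.
apply: le_lt_trans BA.
by have := mco_le_nrm (S := S) (B - A) (i, j, e); rewrite /mco /= mxE mxE.
Qed.

(** The ball lies in the continuous image of a compact box of real coordinates. *)
Lemma nball_compact n (A : 'M[F]_n) r :
  exists2 C : set 'M[F]_n, compact C & nball A r `<=` C.
Proof.
pose D := #|{: coidx S n n}|.
pose bx := [set v : 'rV[R]_D | forall i, (`[-r, r]%classic : set R) (v ord0 i)].
pose f (v : 'rV[R]_D) : 'M[F]_n := A + munvec v.
have real_cont : continuous (of_real : R -> F).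
  move=> a U /(nbhs_co S)[e e0 eU].
  pose m := 1 + \sum_i `|co i 1|.
  have m0 : 0 < m by rewrite ltr_pwDl// sumr_ge0.
  apply/nbhs_ballP; exists (e / m) => /=; first exact: divr_gt0.
  move=> b; rewrite /ball/= => ab; apply: eU => i.
  rewrite -(of_realB S) -[of_real _]mulr1 coZ normrM distrC.
  apply: (@le_lt_trans _ _ (`|a - b| * m)); last by rewrite -ltr_pdivlMr.
  rewrite ler_wpM2l// /m (bigD1 i)//= addrCA lerDl addr_ge0// sumr_ge0//.
exists (f @` bx).
  apply: continuous_compact; last first.
    apply: (@rV_compact R D (fun=> `[-r, r]%classic)) => i.
    exact: segment_compact.
  apply: continuous_subspaceT => v; rewrite /f /munvec.
  apply: (@matrix_continuous F n n) v => i j.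
  under eq_fun do rewrite !mxE.
  apply: (@hcontinuousD R F _ (fun=> A i j) (fun v : 'rV[R]_D =>
      \sum_e of_real (v 0 (enum_rank (i, j, e))) * un e)).
    exact: cst_continuous.
  apply: hcontinuous_sum => e; apply: hcontinuousM; last first.
    exact: cst_continuous.
  move=> v; apply: (@continuous_comp _ _ _ (fun v : 'rV[R]_D => v 0 _)).
    exact: coord_continuous.
  exact: real_cont.
move=> B BA; exists (mvec S (B - A)); last by rewrite /f mvecK addrC subrK.
move=> k; rewrite /= mxE in_itv /= -ler_norml.
by apply: le_trans (ltW BA); exact: mco_le_nrm.
Qed.

End matrix_topology.

(** * Borel and Haar measures of small balls *)

Section measure_tools.
Context d (T : measurableType d) (R : realType).
Variable mu : {measure set T -> \bar R}.
Local Open Scope ereal_scope.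

(** Double counting: integrate the number of sets [E j] containing a point, which is at most [c] on
    [A] and zero elsewhere. It serves both for disjoint families ([c = 1]) and for families of
    bounded multiplicity. *)
Lemma measure_overlap (J : finType) (E : J -> set T) (A : set T) (c : nat) :
  (forall j, measurable (E j)) -> measurable A -> (forall j, E j `<=` A) ->
  (forall x, (#|[pred j | `[< E j x >]]| <= c)%N) ->
  \sum_j mu (E j) <= c%:R%:E * mu A.
Proof.
move=> mE mA EA Ec.
have -> : \sum_j mu (E j) = \int[mu]_x (\sum_j (\1_(E j) x)%:E).
  rewrite ge0_integral_sum//.
  - by apply: eq_bigr => j _; rewrite integral_indic// setIT.
  - by move=> j; apply/measurable_EFinP; exact: measurable_indic.
have -> : c%:R%:E * mu A = \int[mu]_x (c%:R * \1_A x)%:E.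
  under eq_integral do rewrite EFinM.
  rewrite ge0_integralZl//; last 2 first.
  - by rewrite integral_indic// setIT.
  - by apply/measurable_EFinP; exact: measurable_indic.
apply: ge0_le_integral => //.
- by move=> x _; exact: sume_ge0.
- by apply: emeasurable_sum => j; apply/measurable_EFinP; exact: measurable_indic.
- by apply/measurable_EFinP; apply: measurable_funM => //; exact: measurable_indic.
move=> x _; rewrite sumEFin lee_fin.
have [xA|xA] := pselect (A x); last first.
  rewrite big1 ?mulr_ge0// => j _; rewrite indicE memNset//.
  by move/EA.
rewrite [\1_A x]indicE mem_set// mulr1.
under eq_bigr do rewrite indicE.
rewrite -natr_sum ler_nat; apply: leq_trans (Ec x).
rewrite -sum1_card [leqRHS]big_mkcond /=; apply: leq_sum => j _.
have -> : (x \in E j) = (j \in [pred j | `[< E j x >]]).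
  by rewrite [RHS]inE /=; apply/idP/asboolP => [/set_mem|/mem_set].
by case: ifP.
Qed.

Lemma measure_cover (J : finType) (E : J -> set T) (A : set T) :
  (forall j, measurable (E j)) -> measurable A ->
  A `<=` \bigcup_j E j -> mu A <= \sum_j mu (E j).
Proof.
move=> mE mA AE.
pose E' (k : nat) := if insub k is Some i then E (enum_val (A := J) i) else set0.
have mE' k : measurable (E' k) by rewrite /E'; case: insub.
have := @content_subadditive _ _ _ mu A E' #|J|.
have -> : \sum_(k < #|J|) mu (E' k) = \sum_j mu (E j).
  rewrite [RHS]big_enum_val; apply: eq_bigr => k _.
  by rewrite /E' valK.
apply=> // x /AE[j _ Ej]; rewrite -bigcup_mkord.
exists (enum_rank j); first exact: ltn_ord.
by rewrite /E' valK enum_rankK.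
Qed.

Lemma measure_shrink (F : nat -> set T) (e : R) :
  mu (F 0%N) < +oo -> (forall i, measurable (F i)) -> nonincreasing_seq F ->
  mu (\bigcap_n F n) = 0 -> (0 < e)%R -> exists n, mu (F n) < e%:E.
Proof.
move=> F0 mF niF cF0 e0.
have mc : measurable (\bigcap_n F n) by exact: bigcap_measurable.
have := nonincreasing_cvg_mu F0 mF mc niF; rewrite cF0 => /fine_cvgP[fF cF].
move/cvgrPdist_lt : cF => /(_ _ e0) H.
have [n _ nP] := filterI fF H; exists n.
have [] := nP n (leqnn n) => /= fn; rewrite sub0r normrN => h.
rewrite -(fineK fn) lte_fin; apply: le_lt_trans h; exact: ler_norm.
Qed.

End measure_tools.

Section borel_matrices.
Context (R : realType) (F : hypercomplexType R) (S : scalar_structure F).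
Context (n : nat).
Local Notation M := (borel_mx F n).
Local Notation nrm := (nrm S).
Local Notation nball := (nball S).
Local Open Scope ereal_scope.

Lemma open_borel (U : set 'M[F]_n) : open U -> measurable (U : set M).
Proof. by move=> oU; exact: sub_gen_smallest. Qed.

Lemma closed_borel (U : set 'M[F]_n) : closed U -> measurable (U : set M).
Proof.
rewrite -openC => /open_borel /measurableC; by rewrite setCK.
Qed.

Lemma nball_borel A r : measurable (nball A r : set M).
Proof. apply: open_borel; exact: nball_open. Qed.

Lemma nball_center (A : 'M[F]_n) r : (0 < r)%R -> nball A r A.
Proof. by move=> r0; rewrite /nball/= subrr nrm0. Qed.

Definition thicken (C : set 'M[F]_n) (r : R) : set 'M[F]_n :=
  \bigcup_(x in C) nball x r.

Lemma thicken_open C r : open (thicken C r).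
Proof. by apply: bigcup_open => x _; exact: nball_open. Qed.

Lemma thicken_sub C r s : (r <= s)%R -> thicken C r `<=` thicken C s.
Proof. by move=> rs x [y Cy xy]; exists y => //; exact: lt_le_trans rs. Qed.

Lemma bigcap_thicken C : closed C ->
  \bigcap_k thicken C k.+1%:R^-1 = C.
Proof.
move=> cC; apply/seteqP; split=> [x xC|x Cx k _]; last first.
  by exists x => //; apply: nball_center; rewrite invr_gt0.
apply: contrapT => nCx; have : open (~` C) by rewrite openC.
move=> oC; have : nbhs x (~` C) by exact: open_nbhs_nbhs.
move=> /(nbhs_nball S)[r r0 rC].
have [k kr] := ltr_add_invr (y := 0%R) (x := r) r0.
have [y Cy xy] := xC k Logic.I.
have : ~ C y; last by [].
apply: rC; rewrite /nball/= nrmBC; apply: lt_trans kr; rewrite add0r.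
exact: xy.
Qed.

(** The sets that can be squeezed between a closed and an open set of nearly equal measure form a
    sigma-algebra containing the open sets. Asking for both sides at once is what makes the property
    stable under complement. *)
Lemma borel_regular (mu : {measure set M -> \bar R}) (A : set M) (e : R) :
  mu setT < +oo -> measurable A -> (0 < e)%R ->
  exists C : set 'M[F]_n, [/\ closed C, C `<=` A & mu (A `\` C) < e%:E].
Proof.
move=> muT mA.
have fin B : measurable B -> mu B < +oo.
  by move=> mB; apply: le_lt_trans muT; apply: le_measure; rewrite ?inE.
pose reg (A : set M) := forall e : R, (0 < e)%R -> exists C U : set 'M[F]_n,
  [/\ closed C, open U, C `<=` A, A `<=` U & mu ((U : set M) `\` C) < e%:E].
suff : reg A.
  move=> rA e0; have [C [U [cC oU CA AU h]]] := rA e e0; exists C; split=> //.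
  apply: le_lt_trans h; apply: le_measure; rewrite ?inE.
  - by apply: measurableD => //; exact: closed_borel.
  - by apply: measurableD; [exact: open_borel|exact: closed_borel].
  - by move=> x [Ax Cx]; split=> //; exact: AU.
pose G := [set A : set M | reg A].
suff : <<s @open 'M[F]_n >> `<=` G by apply.
apply: smallest_sub.
  split.
  - move=> r r0; exists set0, set0; split; [exact: closed0|exact: open0|by []|by []|].
    by rewrite setDv measure0 lte_fin.
  - move=> B rB r r0; have [C [U [cC oU CA AU h]]] := rB r r0.
    exists (~` U), (~` C); split.
    + exact: open_closedC.
    + exact: closed_openC.
    + by rewrite setTD; exact: subsetC.
    + by rewrite setTD; exact: subsetC.
    + by rewrite setDE setCK setIC -setDE.
  - move=> B rB r r0.
    have /choice[CU CUP] k : exists CU : set 'M[F]_n * set 'M[F]_n,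
        [/\ closed CU.1, open CU.2, CU.1 `<=` B k, B k `<=` CU.2 &
          mu ((CU.2 : set M) `\` CU.1) < (r / 2 / (2 ^ k.+1)%:R)%:E].
      have [|C [U h]] := rB k (r / 2 / (2 ^ k.+1)%:R)%R; last by exists (C, U).
      by rewrite !divr_gt0// ltr0n expn_gt0.
    pose C k := (CU k).1; pose U k := (CU k).2.
    have mC k : measurable (C k : set M).
      by apply: closed_borel; case: (CUP k).
    have mU k : measurable (U k : set M).
      by apply: open_borel; case: (CUP k).
    have mDk k : measurable (U k `\` C k : set M) by exact: measurableD.
    have mbC : measurable (\bigcup_k C k : set M) by exact: bigcupT_measurable.
    have mbU : measurable (\bigcup_k U k : set M) by exact: bigcupT_measurable.
    (* An infinite union of closed sets need not be closed; a finite part of it is kept, at the cost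
       of the second half of [r]. *)
    have [K hK] : exists K, mu ((\bigcup_k C k) `\` (\bigcup_(k < K) C k)) < (r / 2)%:E.
      apply: (@measure_shrink _ M R mu (fun K => (\bigcup_k C k) `\` (\bigcup_(k < K) C k))).
      - apply: fin; apply: measurableD => //; exact: bigcup_measurable.
      - move=> i; apply: measurableD => //; exact: bigcup_measurable.
      - move=> i j ij; apply/subsetPset => x [? h]; split=> // -[k ki Ck].
        by apply: h; exists k => //=; exact: leq_trans ij.
      - rewrite (_ : bigcap _ _ = set0) ?measure0// -subset0 => x h.
        have [[k _ Ck] _] := h 0%N Logic.I.
        by have [_] := h k.+1 Logic.I; apply; exists k => /=.
      - by rewrite divr_gt0.
    exists (\bigcup_(k < K) C k), (\bigcup_k U k); split.
    + rewrite bigcup_mkord; apply: closed_bigsetU => k _.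
      by case: (CUP k).
    + by apply: bigcup_open => k _; case: (CUP k).
    + by move=> x [k kK Ck]; exists k => //; case: (CUP k) => _ _ + _ _; apply.
    + by move=> x [k _ Bk]; exists k => //; case: (CUP k) => _ _ _ + _; apply.
    + apply: (@le_lt_trans _ _ (mu ((\bigcup_k U k) `\` (\bigcup_k C k) : set M) +
        mu ((\bigcup_k C k) `\` (\bigcup_(k < K) C k) : set M))).
        have mbK : measurable (\bigcup_(k < K) C k : set M) by exact: bigcup_measurable.
        apply: (@le_trans _ _ (mu (((\bigcup_k U k) `\` (\bigcup_k C k)) `|` ((\bigcup_k C k) `\` (\bigcup_(k < K) C k)) : set M))).
          apply: le_measure; rewrite ?inE.
          * exact: measurableD.
          * by apply: measurableU; exact: measurableD.
          * move=> x [Ux Cx]; have [h|h] := pselect ((\bigcup_k C k) x); by [right|left].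
        by apply: measureU2; exact: measurableD.
      rewrite [r in r%:E](splitr r) EFinD; apply: lee_ltD => //.
      * by rewrite ge0_fin_numE//; apply: fin; exact: measurableD.
      * apply: (@le_trans _ _ (\sum_(k <oo) mu (U k `\` C k : set M))).
          apply: measure_sigma_subadditive => //; first exact: measurableD.
          move=> x [[k _ Uk] nC]; exists k => //; split=> // Ck; apply: nC.
          by exists k.
        apply: le_trans (epsilon_trick0 xpredT (ltW (divr_gt0 r0 (ltr0Sn R 1)))).
        apply: lee_nneseries => // k _; by case: (CUP k) => _ _ _ _ /ltW.
move=> U oU r r0; pose V : set M := U.
(* An open set is the increasing union of the closed sets of points at distance at least 1/(k+1)
   from its complement. *)
pose B (k : nat) : set 'M[F]_n := ~` thicken (~` U) k.+1%:R^-1.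
have mB k : measurable (B k : set M).
  by apply: measurableC; apply: open_borel; exact: thicken_open.
have [k hk] : exists k, mu (V `\` B k) < r%:E.
  apply: (@measure_shrink _ M R mu (fun k => V `\` B k)) => //.
  - by apply: fin; apply: measurableD => //; exact: open_borel.
  - by move=> i; apply: measurableD => //; exact: open_borel.
  - move=> i j ij; apply/subsetPset => x [Vx]; rewrite /B/= notK => h.
    split=> //; rewrite /B/= notK; apply: thicken_sub h.
    by rewrite lef_pV2 ?posrE// ler_nat ltnS.
  - rewrite (_ : bigcap _ _ = set0) ?measure0// -subset0 => x h.
    have [Vx _] := h 0%N Logic.I; have : (~` U) x; last by apply.
    rewrite -(@bigcap_thicken (~` U)); last by rewrite closedC.
    by move=> i _; have [_] := h i Logic.I; rewrite /B/= notK.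
exists (B k), U; split=> //; first by rewrite closedC; exact: thicken_open.
move=> x; rewrite /B/= => h; apply: contrapT => nU; apply: h; exists x => //.
by apply: nball_center; rewrite invr_gt0.
Qed.

End borel_matrices.

(** * Lower bounds for the Haar measure of balls *)

Section haar_balls.
Context (R : realType) (F : hypercomplexType R) (S : scalar_structure F).
Context (n : nat) (G : set 'M[F]_n).
Variable mu : {measure set (borel_mx F n) -> \bar R}.
Local Notation M := (borel_mx F n).
Local Notation nrm := (nrm S).
Local Notation nball := (nball S).

Hypothesis haar : haar_measure G mu.
Hypothesis G1 : G 1%:M.
Variable Ci : R.
Hypothesis Ginv : forall g, G g ->
  exists h, [/\ G h, h *m g = 1%:M, g *m h = 1%:M & nrm h <= Ci * nrm g].

Lemma mx_hausdorff : hausdorff_space 'M[F]_n.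
Proof.
move=> p q pq; apply/eqP; apply: contrapT => /negP npq.
have d0 : 0 < nrm (p - q).
  rewrite lt0r nrm_ge0 andbT; apply: contra_neq npq => /(@nrm_eq0 _ _ S _ _ _).
  by move/subr0_eq.
pose r := nrm (p - q) / 2; have r0 : 0 < r by rewrite divr_gt0.
have pb (x : 'M[F]_n) : nbhs x (nball x r).
  by apply: open_nbhs_nbhs; split; [exact: nball_open|exact: nball_center].
have [x [px qx]] := pq _ _ (pb p) (pb q).
have := nrm_triangle S x p q; rewrite leNgt => /negP; apply.
rewrite [X in _ < X]splitr -/r; apply: ltrD => //.
by rewrite nrmBC; exact: px.
Qed.

Lemma haar_nball_fin A r : (mu (nball A r) < +oo)%E.
Proof.
have [C cC AC] := nball_compact S A r; have [_ _ muC _] := haar.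
apply: le_lt_trans (muC _ cC); apply: le_measure; rewrite ?inE //.
  exact: nball_borel.
by apply: closed_borel; exact: compact_closed mx_hausdorff cC.
Qed.

Definition ltrans (h : 'M[F]_n) (A : set M) : set M :=
  [set x | A (h *m (x : 'M[F]_n))].

Lemma ltrans_open h A : open (A : set 'M[F]_n) -> open (ltrans h A : set 'M[F]_n).
Proof.
move=> oA; rewrite /ltrans; apply: (@open_comp _ _ (fun x : 'M[F]_n => h *m x)) => //.
move=> x _; apply: (@matrix_continuous F n n) x => i j.
under eq_fun do rewrite mxE; apply: hcontinuous_sum => k.
by apply: hcontinuousM; [exact: cst_continuous|exact: entry_continuous].
Qed.

Lemma haar_ltrans h A : G h -> measurable A -> mu (ltrans h A) = mu A.
Proof. by move=> Gh mA; have [_ _ _] := haar; apply. Qed.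

(** If a ball at the identity were null, every point of [G] would have a null neighbourhood by
    translation. Second countability would then cover [G] by countably many null open sets. *)
Lemma haar_nball_gt0 r : 0 < r -> (0 < mu (nball 1%:M r))%E.
Proof.
move=> r0; rewrite lt0e measure_ge0 andbT; apply/negP => /eqP mu0.
have [[N [mN N0 GN]] /negP muT _ _] := haar; apply: muT; apply/eqP.
have sc := second_countable_mx n n (@h_second_countable R F).
have [B oB Bb] := (second_countableP _).1 sc.
pose U k : set M := if `[< mu (B k) = 0%E >] then B k else set0.
have mU k : measurable (U k).
  by rewrite /U; case: asboolP => // _; apply: open_borel.
have U0 k : mu (U k) = 0%E.
  by rewrite /U; case: asboolP => // _; rewrite measure0.
have mbU : measurable (\bigcup_k U k) by exact: bigcupT_measurable.
have muU : mu (\bigcup_k U k) = 0%E.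
  apply/eqP; rewrite eq_le measure_ge0 andbT.
  apply: (@le_trans _ _ (\sum_(k <oo) mu (U k))%E).
    exact: measure_sigma_subadditive.
  by rewrite eseries0.
apply/eqP; rewrite eq_le measure_ge0 andbT.
apply: (@le_trans _ _ (mu (N `|` \bigcup_k U k))).
  apply: le_measure; rewrite ?inE//; first exact: measurableU.
  move=> g _; have [Gg|Gg] := pselect (G g); last by left; exact: GN.
  right; have [h [Gh hg _ _]] := Ginv Gg.
  have : nbhs (g : 'M[F]_n) (ltrans h (nball 1%:M r)).
    apply: open_nbhs_nbhs; split; first by apply: ltrans_open; exact: nball_open.
    by rewrite /ltrans/= hg; exact: nball_center.
  move=> /Bb[k Bg BV]; exists k => //; rewrite /U; case: asboolP => // -[].
  apply/eqP; rewrite eq_le measure_ge0 andbT -mu0.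
  rewrite -(haar_ltrans Gh (nball_borel S _ _)).
  apply: le_measure; rewrite ?inE//; first by apply: open_borel.
  by apply: open_borel; apply: ltrans_open; exact: nball_open.
rewrite -[leRHS](adde0 (0 : \bar R)) -[X in (_ <= X + _)%E]N0 -muU.
exact: measureU2.
Qed.

Context (d : nat) (l : 'I_d -> 'M[F]_n -> R).
Variables (rho L Cl : R).
Hypothesis rho0 : 0 < rho.
Hypothesis lB : forall i g, nball 1%:M rho g -> `|l i g| <= Cl.
Hypothesis lL : forall g g', G g -> G g' -> nball 1%:M rho g ->
  nball 1%:M rho g' -> nrm (g - g') <= L * \sum_i `|l i g - l i g'|.

(** Pigeonhole. The [d] functions [l i] control distances in [G] near the identity. Cutting their
    range into intervals of length 1/(m a) cuts the ball of radius [rho] into at most (m b)^d cells,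
    and each cell is carried by a translation into the ball of radius [K0 / m]. Hence the fixed
    positive measure of the large ball is at most (m b)^d times that of the small one. *)
Lemma haar_nball1_lower K0 : 0 < K0 -> exists2 c : R, 0 < c &
  forall m, (0 < m)%N ->
    ((c / (m ^ d)%:R)%:E <= mu (nball 1%:M (K0 / m%:R)))%E.
Proof.
move=> K00.
(* [C1] bounds the inverses of the points of the ball. The integer [a] is so large that a translated
   cell fits in radius [K0 / m]. The integer [b] counts intervals: the values [l i g], shifted by
   [Cl'] to be nonnegative, stay below [2 * Cl']. *)
pose C1 := 1 + `|Ci| * (nrm (1%:M : 'M[F]_n) + rho).
have C10 : 0 < C1.
  by rewrite ltr_pwDl// mulr_ge0// addr_ge0 ?nrm_ge0 ?ltW.
pose C2 := C1 * `|L| * d%:R / K0.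
have C20 : 0 <= C2.
  by rewrite /C2 divr_ge0 ?(ltW K00)// !mulr_ge0 ?(ltW C10).
have [a aC] : exists a : nat, C2 < a%:R.
  by exists (Num.truncn C2).+1; exact: truncnS_gt.
have a0 : 0 < a%:R :> R by exact: le_lt_trans aC.
pose Cl' := `|Cl| + 1; have Cl'0 : 0 < Cl' by rewrite ltr_pwDr.
have [b bC] : exists b : nat, 2 * Cl' * a%:R < b%:R.
  by exists (Num.truncn (2 * Cl' * a%:R)).+1; exact: truncnS_gt.
have b0 : (0 < b)%N by rewrite -(ltr0n R); apply: lt_trans bC; rewrite !mulr_gt0.
have muB0 := haar_nball_gt0 rho0; have muBf := haar_nball_fin 1%:M rho.
have muBfin : mu (nball 1%:M rho) \is a fin_num by rewrite ge0_fin_numE.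
exists (fine (mu (nball 1%:M rho)) / (b ^ d)%:R).
  by rewrite divr_gt0 ?ltr0n ?expn_gt0 ?b0// -lte_fin fineK.
move=> m m0; have m0R : 0 < m%:R :> R by rewrite ltr0n.
have [[N [mN N0 GN]] _ _ _] := haar.
pose cell (f : {ffun 'I_d -> 'I_(m * b)}) : set 'M[F]_n := [set g | [/\ G g,
  nball 1%:M rho g & forall i, Num.truncn ((l i g + Cl') * (m%:R * a%:R)) = f i]].
have /choice[h hP] f : exists h : 'M[F]_n, G h /\
    cell f `<=` ltrans h (nball 1%:M (K0 / m%:R)).
  have [[g [Gg gb gf]]|ne] := pselect (exists g, cell f g); last first.
    by exists 1%:M; split => // x fx; case: ne; exists x.
  have [h [Gh hg _ hC]] := Ginv Gg; exists h; split=> // x [Gx xb xf].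
  rewrite /ltrans/nball/= -hg -mulmxBr; apply: le_lt_trans (nrmM _ _ _) _.
  have h1 : nrm h <= C1.
    apply: le_trans hC _; apply: (@le_trans _ _ (`|Ci| * nrm g)).
      by rewrite ler_wpM2r ?nrm_ge0 ?ler_norm.
    rewrite /C1 -[leLHS]add0r lerD// ler_wpM2l//.
    rewrite -[g](subrK 1%:M) addrC; apply: le_trans (nrmD _ _ _) _.
    by rewrite lerD2l; apply: ltW; exact: gb.
  have ma0 : 0 < m%:R * a%:R :> R by exact: mulr_gt0.
  have ll i : `|l i x - l i g| <= (m%:R * a%:R)^-1.
    have pos y : nball 1%:M rho y -> 0 <= (l i y + Cl') * (m%:R * a%:R).
      move=> yb; rewrite mulr_ge0 ?(ltW ma0)//.
      have := lB i yb; rewrite ler_norml => /andP[h2 _].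
      have := ler_norm Cl; rewrite /Cl'; lra.
    have /andP[x1 x2] := truncn_itv (pos x xb).
    have /andP[g1 g2] := truncn_itv (pos g gb).
    move: x1 x2 g1 g2; rewrite xf gf -!natr1 => x1 x2 g1 g2.
    have : `|(l i x - l i g) * (m%:R * a%:R)| <= 1.
      have -> : (l i x - l i g) * (m%:R * a%:R) =
        (l i x + Cl') * (m%:R * a%:R) - (l i g + Cl') * (m%:R * a%:R) by ring.
      by rewrite ler_norml; apply/andP; split; lra.
    by rewrite normrM (gtr0_norm ma0) -ler_pdivlMr// div1r.
  apply: (@le_lt_trans _ _ (C1 * (`|L| * (d%:R * (m%:R * a%:R)^-1)))).
    apply: ler_pM => //; [exact: nrm_ge0|exact: nrm_ge0|].
    apply: le_trans (lL Gx Gg xb gb) _.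
    apply: le_trans (ler_wpM2r _ (ler_norm L)) _; first exact: sumr_ge0.
    rewrite ler_wpM2l//; apply: le_trans (ler_sum _ (fun i _ => ll i)) _.
    by rewrite sumr_const card_ord [leRHS]mulr_natl.
  rewrite invfM (_ : C1 * _ = C2 / a%:R * (K0 / m%:R)); last first.
    by rewrite /C2; field; rewrite !gt_eqF.
  rewrite -[ltRHS]mul1r ltr_pM2r ?divr_gt0//.
  by rewrite ltr_pdivrMr// mul1r.
have mV f : measurable (ltrans (h f) (nball 1%:M (K0 / m%:R))).
  by apply: open_borel; apply: ltrans_open; exact: nball_open.
have : (mu (nball 1%:M rho) <=
    \sum_(f : option {ffun 'I_d -> 'I_(m * b)}) mu (if f is Some f
      then ltrans (h f) (nball 1%:M (K0 / m%:R)) else N))%E.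
  apply: (@measure_cover _ M R mu _ (fun f => if f is Some f
      then ltrans (h f) (nball 1%:M (K0 / m%:R)) else N)).
  - by case.
  - exact: nball_borel.
  move=> g gb; have [Gg|Gg] := pselect (G g); last by exists None => //; exact: GN.
  have bnd i : (Num.truncn ((l i g + Cl') * (m%:R * a%:R)) < m * b)%N.
    rewrite -(ltr_nat R); apply: (@le_lt_trans _ _ ((l i g + Cl') * (m%:R * a%:R))).
      apply: (andP (truncn_itv _)).1; rewrite mulr_ge0 ?mulr_ge0 ?ler0n//.
      have := lB i gb; rewrite ler_norml => /andP[h2 _].
      have := ler_norm Cl; rewrite /Cl'; lra.
    rewrite natrM mulrCA ltr_pM2l//; apply: le_lt_trans bC.
    rewrite ler_wpM2r ?ler0n//.
    have := lB i gb; rewrite ler_norml => /andP[_ h2].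
    have := ler_norm Cl; rewrite /Cl'; lra.
  exists (Some [ffun i => Ordinal (bnd i)]) => //.
  by apply: (hP _).2; split=> // i; rewrite ffunE.
have -> : (\sum_(f : option {ffun 'I_d -> 'I_(m * b)}) mu (if f is Some f
      then ltrans (h f) (nball 1%:M (K0 / m%:R)) else N) =
    \sum_(f : {ffun 'I_d -> 'I_(m * b)}) mu (nball 1%:M (K0 / m%:R)))%E.
  rewrite (bigD1 None)//= N0 add0e (reindex_omap Some id)/=; last by case.
  apply: eq_big => [f|f _]; first by rewrite eqxx.
  by rewrite (haar_ltrans (hP f).1 (nball_borel S _ _)).
have muK := haar_nball_fin 1%:M (K0 / m%:R).
have muKfin : mu (nball 1%:M (K0 / m%:R)) \is a fin_num by rewrite ge0_fin_numE.
rewrite -(fineK muKfin) -(fineK muBfin) sumEFin !lee_fin sumr_const.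
rewrite card_ffun !card_ord expnMn -[X in _ <= X -> _]mulr_natr natrM => H.
rewrite ler_pdivrMr ?ltr0n ?expn_gt0 ?m0// ler_pdivrMr ?ltr0n ?expn_gt0 ?b0//.
by rewrite -mulrA.
Qed.

(** Left translation by [g] stretches distances by at most [R0], so the ball at [g] contains the
    translate of the ball at the identity of radius [K0 / R0 / m]. *)
Lemma haar_nball_lower K0 R0 : 0 < K0 -> 0 < R0 -> exists2 c : R, 0 < c &
  forall m g, (0 < m)%N -> G g -> nrm g <= R0 ->
    ((c / (m ^ d)%:R)%:E <= mu (nball g (K0 / m%:R)))%E.
Proof.
move=> K00 R00; have [c c0 cP] := haar_nball1_lower (divr_gt0 K00 R00).
exists c => // m g m0 Gg gR; apply: le_trans (cP m m0) _.
have [h [Gh hg gh _]] := Ginv Gg.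
rewrite -(haar_ltrans Gh (nball_borel S _ _)).
apply: le_measure; rewrite ?inE; last 2 first.
- exact: nball_borel.
- move=> x; rewrite /ltrans/nball/= => hx.
  have -> : (x : 'M[F]_n) - g = g *m (h *m x - 1%:M).
    by rewrite mulmxBr mulmxA gh mul1mx mulmx1.
  apply: le_lt_trans (nrmM _ _ _) _.
  apply: (@le_lt_trans _ _ (R0 * nrm (h *m x - 1%:M))).
    by rewrite ler_wpM2r ?nrm_ge0.
  by rewrite mulrC -ltr_pdivlMr//; move: hx; rewrite mulrAC.
by apply: open_borel; apply: ltrans_open; exact: nball_open.
Qed.

End haar_balls.

(** * Random words *)

Section integral_law.
Context d1 d2 (T1 : measurableType d1) (T2 : measurableType d2) (R : realType).

Lemma ge0_integral_law (P : probability T1 R) (mu : probability T2 R)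
    (X : T1 -> T2) (f : T2 -> \bar R) :
  measurable_fun setT X ->
  (forall A, measurable A -> mu A = P (X @^-1` A)) ->
  measurable_fun setT f -> (forall x, (0 <= f x)%E) ->
  (\int[mu]_x f x = \int[P]_x f (X x))%E.
Proof.
move=> mX muX mf f0.
transitivity (\int[pushforward P X]_x f x)%E; last first.
  by rewrite ge0_integral_pushforward.
by apply: eq_measure_integral => A mA _; exact: muX.
Qed.

End integral_law.

Section words.
Context (F : nzRingType) (n : nat).
Implicit Types (w : seq (option 'M[F]_n)) (k : nat -> 'M[F]_n).

(** A letter [Some c] is constant and a letter [None] is a slot; the slots are filled from left to
    right by [k 0], [k 1] and so on. *)
Fixpoint ev w k : 'M[F]_n :=
  match w with
  | [::] => 1%:M
  | Some c :: w' => c *m ev w' k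
  | None :: w' => k 0%N *m ev w' (fun i => k i.+1)
  end.

Definition slots w := count (fun o => o == None) w.

Lemma eq_ev w k k' : (forall i, (i < slots w)%N -> k i = k' i) ->
  ev w k = ev w k'.
Proof.
elim: w k k' => [//|[c|] w ih] k k' kk' /=; first by rewrite (ih k k').
by rewrite kk'// (ih _ (fun i => k' i.+1))// => i iw; apply: kk'.
Qed.

Lemma ev_cat w1 w2 k :
  ev (w1 ++ w2) k = ev w1 k *m ev w2 (fun i => k (slots w1 + i)%N).
Proof.
elim: w1 k => [|[c|] w ih] k /=; first by rewrite mul1mx.
  by rewrite ih mulmxA.
by rewrite ih mulmxA.
Qed.

End words.

Section representation.
Context (R : realType) (F : hypercomplexType R) (n : nat).
Local Notation M := (borel_mx F n).
Variable K : set 'M[F]_n.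

(** [nu] is the law of the word [w] with random slots lying almost surely in [K]. The last clause is
    what is retained of independence and of Haar invariance: translating each slot by its own
    element of [K] lifts to a measure-preserving map of the sample space. *)
Definition represents (nu : probability M R) (w : seq (option 'M[F]_n)) :=
  exists d (T : measurableType d) (P : probability T R) (k : T -> nat -> M),
  [/\ forall i, measurable_fun setT (fun x => k x i),
      P.-negligible [set x | exists2 i, (i < slots w)%N & ~ K (k x i)],
      forall A, measurable A -> nu A = P [set x | A (ev w (k x))] &
      forall u : nat -> 'M[F]_n, (forall i, K (u i)) ->
        exists t : T -> T, [/\ measurable_fun setT t,
          forall x i, (i < slots w)%N -> k (t x) i = u i *m (k x i : 'M[F]_n) &
          forall E, measurable E -> P (t @^-1` E) = P E]].

Lemma mulmx_measurable d (T : measurableType d) (f g : T -> M) :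
  measurable_fun setT f -> measurable_fun setT g ->
  measurable_fun setT (fun x => (f x : 'M[F]_n) *m (g x : 'M[F]_n) : M).
Proof.
move=> mf mg.
exact: (measurableT_comp (@mulmx_pair_measurable R F n)
  (measurable_fun_pair mf mg)).
Qed.

Lemma ev_measurable d (T : measurableType d) w (k : T -> nat -> M) :
  (forall i, measurable_fun setT (fun x => k x i)) ->
  measurable_fun setT (fun x => ev w (k x) : M).
Proof.
elim: w k => [|[c|] w ih] k mk /=; first exact: measurable_cst.
  by apply: mulmx_measurable; [exact: measurable_cst|exact: ih].
by apply: mulmx_measurable => //; exact: ih.
Qed.

Lemma represents_dirac c : represents (dirac_mx c) [:: Some c].
Proof.
exists _, M, (dirac_mx c), (fun=> fun=> 1%:M); split => //.
- apply: negligibleS (negligible_set0 _); by move=> x [].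
- move=> A mA; rewrite /= mulmx1 /dirac_mx /= /dirac/= !indicE.
  by congr (_%:R)%:E; congr nat_of_bool; apply/idP/idP; rewrite !inE.
- by move=> u _; exists id.
Qed.

Lemma represents_haar (mK : probability M R) :
  haar_measure K mK -> represents mK [:: None].
Proof.
move=> [nK _ _ inv]; exists _, M, mK, (fun x _ => x); split => //.
- by apply: negligibleS nK; move=> x [].
- move=> A mA; congr (mK _); apply/seteqP; split=> x /=; rewrite mulmx1//.
- move=> u uK; exists (fun x => u 0%N *m (x : 'M[F]_n)); split.
  + by apply: mulmx_measurable => //; exact: measurable_cst.
  + by move=> x [|].
  + by move=> E mE; exact: inv.
Qed.

(** On the product of the sample spaces the slots of the two words are juxtaposed, and the lifted
    translations act factor by factor; Fubini identifies the law. *)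
Lemma represents_convolution nu1 nu2 w1 w2 :
  represents nu1 w1 -> represents nu2 w2 ->
  represents (convolution nu1 nu2) (w1 ++ w2).
Proof.
move=> [d1 [T1 [P1 [k1 [mk1 K1 law1 inv1]]]]].
move=> [d2 [T2 [P2 [k2 [mk2 K2 law2 inv2]]]]].
pose s := slots w1.
pose k (x : T1 * T2) i := if (i < s)%N then k1 x.1 i else k2 x.2 (i - s)%N.
have evk x : ev (w1 ++ w2) (k x) = ev w1 (k1 x.1) *m ev w2 (k2 x.2).
  rewrite ev_cat; congr (_ *m _); apply: eq_ev => i iw.
    by rewrite /k iw.
  by rewrite /k ltnNge leq_addr /= addKn.
have mk i : measurable_fun setT (fun x => k x i).
  rewrite /k; case: ltnP => _.
    exact: (measurableT_comp (mk1 i) measurable_fst).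
  exact: (measurableT_comp (mk2 (i - s)%N) measurable_snd).
have slotsE : slots (w1 ++ w2) = (s + slots w2)%N by rewrite /slots count_cat.
have prodE (E : set (T1 * T2)) :
  (P1 \x P2)%E E = (\int[P1]_x P2 (xsection E x))%E by [].
exists _, (T1 * T2)%type, (P1 \x P2)%E, k; split => //.
- case: K1 => N1 [mN1 N10 KN1]; case: K2 => N2 [mN2 N20 KN2].
  exists (N1 `*` setT `|` setT `*` N2); split.
  + by apply: measurableU; exact: measurableX.
  + apply/eqP; rewrite eq_le measure_ge0 andbT.
    apply: (@le_trans _ _ ((P1 \x P2) (N1 `*` setT) + (P1 \x P2) (setT `*` N2))%E).
      by apply: measureU2; exact: measurableX.
    have -> : (P1 \x P2)%E (N1 `*` setT) = 0%E.
      apply: etrans (product_measure1E P1 P2 mN1 measurableT) _.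
      by rewrite [X in (X * _)%E](N10 : _ = 0%E) mul0e.
    have -> : (P1 \x P2)%E (setT `*` N2) = 0%E.
      apply: etrans (product_measure1E P1 P2 measurableT mN2) _.
      by rewrite [X in (_ * X)%E](N20 : _ = 0%E) mule0.
    by rewrite adde0.
  + move=> [x1 x2]; case=> i; rewrite slotsE /k /=; case: (ltnP i s) => h1 h2 h3.
      by left; split; [apply: KN1; exists i; [exact: h1|exact: h3]|].
    by right; split; [|apply: KN2; exists (i - s)%N; [rewrite ltn_subLR|]].
- move=> A mA.
  transitivity ((nu1 \x nu2)%E (@mulmx_pair R F n @^-1` A)); first by [].
  have mS : measurable (@mulmx_pair R F n @^-1` A).
    by rewrite -[X in measurable X]setTI; exact: mulmx_pair_measurable.
  transitivity (\int[nu1]_x nu2 (xsection (@mulmx_pair R F n @^-1` A) x))%E.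
    by [].
  rewrite (ge0_integral_law (P := P1) (X := fun x => ev w1 (k1 x) : M))//; last 2 first.
  + exact: ev_measurable.
  + exact: measurable_fun_xsection.
  apply: etrans (esym (prodE [set x | A (ev (w1 ++ w2) (k x))])).
  apply: eq_integral => x _.
  rewrite law2; last exact: measurable_xsection.
  congr (P2 _); apply/seteqP; split => y /=; rewrite /xsection /= !inE/= evk//.
- move=> u uK; have [t1 [mt1 kt1 Pt1]] := inv1 u uK.
  have [t2 [mt2 kt2 Pt2]] := inv2 (fun i => u (s + i)%N) (fun i => uK _).
  exists (fun x => (t1 x.1, t2 x.2)); split.
  + apply: measurable_fun_pair.
      exact: (measurableT_comp mt1 measurable_fst).
    exact: (measurableT_comp mt2 measurable_snd).
  + move=> x i; rewrite slotsE /k /=; case: (ltnP i s) => h1 h2; first exact: kt1.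
    by rewrite kt2 ?ltn_subLR// subnKC.
  + move=> E mE; apply: etrans (prodE _) _; apply: etrans (esym (prodE E)).
    transitivity (\int[P1]_x P2 (xsection E (t1 x)))%E.
      apply: eq_integral => x _; rewrite -(Pt2 (xsection _ _)); last first.
        exact: measurable_xsection.
      by congr (P2 _); apply/seteqP; split => y /=; rewrite /xsection /= !inE.
    rewrite -(ge0_integral_law (mu := P1) (f := fun x => P2 (xsection E x)))//.
  by move=> B mB; rewrite Pt1.
    exact: measurable_fun_xsection.
Qed.

(** Adjacent slots of consecutive factors are kept separate, so there are [2 * l] slots; this
    freedom allows every factor to be set to a conjugate of [a]. *)
Definition delta_word (a : 'M[F]_n) (l : nat) : seq (option 'M[F]_n) :=
  iter l (fun w => [:: None, Some a, None & w]) [:: Some 1%:M].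

Lemma represents_pow (mK : probability M R) X l : haar_measure K mK ->
  represents (convolution_pow (delta_natural mK X) l)
    (delta_word (real_mx F (expmx X)) l).
Proof.
move=> hK; elim: l => [|l ih]; first exact: represents_dirac.
have := represents_convolution (represents_convolution (represents_convolution
  (represents_haar hK) (represents_dirac (real_mx F (expmx X))))
  (represents_haar hK)) ih.
by [].
Qed.

End representation.

(** * Rotation curves and analytic functions on compact groups *)

Section rodrigues.
Context (R : realType) (F : hypercomplexType R) (S : scalar_structure F).
Context (n : nat).
Implicit Types (C A B : 'M[F]_n) (t : R).
Local Notation rscale := (@rscale R F n n).

(* The exponential of [t C] when [C ^ 3 = - C]. *)
Definition rodr C t : 'M[F]_n := 1%:M + rscale (sin t) C + rscale (1 - cos t) (C *m C).

Lemma rodr0 C : rodr C 0 = 1%:M.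
Proof.
by rewrite /rodr sin0 cos0 subrr !(rscale0r S) !addr0.
Qed.

Lemma rodr_mulE C t A : rodr C t *m A =
  (A + C *m C *m A) + rscale (cos t) (- (C *m C *m A)) + rscale (sin t) (C *m A).
Proof.
rewrite /rodr !mulmxDl mul1mx !rscaleAl (rscaleBl S) (rscale1r S).
apply: (@mco_inj _ _ S) => x; rewrite !(mcoD, mcoN, mcoZ).
by move: (mco _ x) (mco _ x) (mco _ x) => a b c; ring.
Qed.

(** Since also [C^4 = - C^2], the product reduces to the span of 1, C, C^2, where the coefficients
    follow the addition formulas. *)
Lemma rodrD C s t : C *m C *m C = - C -> rodr C s *m rodr C t = rodr C (s + t).
Proof.
move=> C3; have C4 : C *m C *m (C *m C) = - (C *m C).
  by rewrite mulmxA C3 mulNmx.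
have C3' : C *m (C *m C) = - C by rewrite mulmxA.
rewrite rodr_mulE /rodr !(mulmxDr, mulmx1, rscaleAr S) C3 C4 C3'.
rewrite sinD cosD; apply: (@mco_inj _ _ S) => x.
rewrite !(mcoD, mcoN, mcoZ, mulrDr, mulrN).
by move: (mco _ x) (mco _ x) (mco _ x) => a b c; ring.
Qed.

Lemma rodrNK C t : C *m C *m C = - C -> rodr C (- t) *m rodr C t = 1%:M.
Proof. by move=> C3; rewrite rodrD// addNr rodr0. Qed.

End rodrigues.

Section polynomial_functions.
Context (R : realType) (F : hypercomplexType R) (S : scalar_structure F).
Context (n L : nat).
Local Notation M := 'M[F]_n.
Local Notation rscale := (@rscale R F n n).
Local Notation co := (@co R F S).
Local Notation un := (@un R F S).
Implicit Types (k : nat -> M).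

Definition upd k i (A : M) : nat -> M := fun j => if j == i then A else k j.

(** Real polynomials in the coordinates of the first [L] slots. The inductive form yields
    measurability, locality and the trigonometric degree by induction on the construction. *)
Inductive polyfn : ((nat -> M) -> R) -> Prop :=
| polyfn_cst c : polyfn (fun=> c)
| polyfn_co i x : (i < L)%N -> polyfn (fun k => mco (S := S) (k i) x)
| polyfnD f g : polyfn f -> polyfn g -> polyfn (fun k => f k + g k)
| polyfnM f g : polyfn f -> polyfn g -> polyfn (fun k => f k * g k).

Definition mpolyfn (W : (nat -> M) -> M) :=
  forall x, polyfn (fun k => mco (S := S) (W k) x).

Lemma polyfn_sum (I : Type) (s : seq I) (P : pred I) (f : I -> (nat -> M) -> R) :
  (forall i, polyfn (f i)) -> polyfn (fun k => \sum_(i <- s | P i) f i k).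
Proof.
move=> fp; elim: s => [|i s ih].
  by under eq_fun do rewrite big_nil; exact: polyfn_cst.
under eq_fun do rewrite big_cons; case: (P i) => //.
exact: (polyfnD (fp i) ih).
Qed.

Lemma polyfn_prod (I : Type) (s : seq I) (P : pred I) (f : I -> (nat -> M) -> R) :
  (forall i, polyfn (f i)) -> polyfn (fun k => \prod_(i <- s | P i) f i k).
Proof.
move=> fp; elim: s => [|i s ih].
  by under eq_fun do rewrite big_nil; exact: polyfn_cst.
under eq_fun do rewrite big_cons; case: (P i) => //.
exact: (polyfnM (fp i) ih).
Qed.

Lemma polyfn_det m (f : 'I_m -> 'I_m -> (nat -> M) -> R) :
  (forall i j, polyfn (f i j)) -> polyfn (fun k => \det (\matrix_(i, j) f i j k)).
Proof.
move=> fp; rewrite /determinant; apply: polyfn_sum => s.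
apply: polyfnM; first exact: polyfn_cst.
under eq_fun do under eq_bigr do rewrite mxE.
by apply: polyfn_prod => i; exact: fp.
Qed.

Lemma coM e (x y : F) : co e (x * y) =
  \sum_e1 \sum_e2 co e (un e1 * un e2) * (co e1 x * co e2 y).
Proof.
rewrite {1}(co_decomp S x) {1}(co_decomp S y) mulr_suml co_sum.
apply: eq_bigr => e1 _; rewrite mulr_sumr co_sum; apply: eq_bigr => e2 _.
rewrite mulrA -[of_real _ * un e1 * _]mulrA -[un e1 * of_real _](of_realC S).
rewrite -[_ * un e2]mulrA -[of_real (co e2 y) * un e1 * un e2]mulrA.
by rewrite mulrA -(of_realM S) coZ mulrC.
Qed.

Lemma mpolyfn_cst A : mpolyfn (fun=> A).
Proof. by move=> x; exact: polyfn_cst. Qed.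

Lemma mpolyfn_slot i : (i < L)%N -> mpolyfn (fun k => k i).
Proof. by move=> iL x; exact: polyfn_co. Qed.

Lemma mpolyfnM V W : mpolyfn V -> mpolyfn W -> mpolyfn (fun k => V k *m W k).
Proof.
move=> pV pW [[a b] e].
have -> : (fun k => mco (V k *m W k) (a, b, e)) = fun k =>
    \sum_c \sum_e1 \sum_e2 co e (un e1 * un e2) *
      (mco (S := S) (V k) (a, c, e1) * mco (S := S) (W k) (c, b, e2)).
  apply/funext => k; rewrite /mco /= mxE co_sum; apply: eq_bigr => c _.
  exact: coM.
do 3 apply: polyfn_sum => ?; apply: polyfnM; first exact: polyfn_cst.
by apply: polyfnM; [exact: pV|exact: pW].
Qed.

Lemma polyfn_local f k k' : polyfn f ->
  (forall i, (i < L)%N -> k i = k' i) -> f k = f k'.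
Proof.
by move=> pf kk'; elim: pf => // [i x iL|g h _ -> _ ->//|g h _ -> _ ->//];
  rewrite kk'.
Qed.

Lemma polyfn_upd f i A : polyfn f -> polyfn (fun k => f (upd k i (A *m k i))).
Proof.
elim=> [c|j x jL|g h _ pg _ ph|g h _ pg _ ph].
- exact: polyfn_cst.
- rewrite /upd; have [ji|ji] := eqVneq j i; last exact: polyfn_co.
  by subst j; apply: mpolyfnM; [exact: mpolyfn_cst|exact: mpolyfn_slot].
- exact: (polyfnD pg ph).
- exact: (polyfnM pg ph).
Qed.

Lemma polyfn_measurable d (T : measurableType d) (k : T -> nat -> borel_mx F n) f :
  polyfn f -> (forall i, measurable_fun setT (fun x => k x i)) ->
  measurable_fun setT (fun x => f (k x)).
Proof.
move=> pf mk; elim: pf => [c|i x _|g h _ mg _ mh|g h _ mg _ mh].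
- exact: measurable_cst.
- apply: (measurableT_comp (f := fun A : borel_mx F n => mco (S := S) A x)) => //.
  apply: (measurability _ (RGenOInfty.measurableE R)) => _ [_ [a ->] <-].
  rewrite setTI; apply: open_borel.
  apply: open_comp; first by move=> A _; exact: mco_continuous.
  exact: interval_open.
- exact: measurable_funD.
- exact: measurable_funM.
Qed.

Local Open Scope complex_scope.

Definition circ (t : R) : R[i] := cos t +i* sin t.

Lemma circ_neq0 t : circ t != 0.
Proof.
apply/eqP => /eqP; rewrite eq_complex /= => /andP[/eqP c0 /eqP s0].
by have := cos2Dsin2 t; rewrite c0 s0 expr0n addr0 => /eqP; rewrite eq_sym oner_eq0.
Qed.

(** When one slot runs along an ellipse, [f] is a trigonometric polynomial of degree at most [D]:
    times the [D]-th power of z = e^(it) it is a polynomial in z of degree at most [2 * D]. The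
    bound [D] does not depend on the ellipse. *)
Definition trig_degree (f : (nat -> M) -> R) (D : nat) :=
  forall k i A0 A1 A2, exists2 Q : {poly R[i]}, (size Q <= 2 * D + 1)%N &
    forall t, Q.[circ t] = circ t ^+ D *
      (f (upd k i (A0 + rscale (cos t) A1 + rscale (sin t) A2)))%:C.

Lemma polyfn_trig f : polyfn f -> exists D, trig_degree f D.
Proof.
elim=> [c|j x jL|g h _ [D1 pg] _ [D2 ph]|g h _ [D1 pg] _ [D2 ph]].
- exists 0%N => k i A0 A1 A2; exists c%:C%:P; first by rewrite size_polyC leq_b1.
  by move=> t; rewrite hornerC expr0 mul1r.
- exists 1%N => k i A0 A1 A2; rewrite /upd; have [ji|ji] := eqVneq j i; last first.
    exists ((mco (S := S) (k j) x)%:C *: 'X); last by move=> t; rewrite hornerZ hornerX mulrC expr1.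
    by apply: leq_trans (size_scale_leq _ _) _; rewrite size_polyX.
  pose a0 := mco (S := S) A0 x; pose a1 := mco (S := S) A1 x.
  pose a2 := mco (S := S) A2 x.
  (* For z = e^(it) one has z cos t = (z^2 + 1)/2 and z sin t = -i (z^2 - 1)/2. *)
  exists ((a0%:C) *: 'X + (a1 / 2)%:C *: ('X^2 + 1) + (0 +i* (- (a2 / 2))) *: ('X^2 - 1)).
    have s2 c : (size ('X^2 + c%:P : {poly R[i]})%R <= 3)%N.
      apply: leq_trans (size_polyD _ _) _; rewrite size_polyXn geq_max /=.
      by apply: leq_trans (size_polyC_leq1 _) _.
    apply: leq_trans (size_polyD _ _) _; rewrite geq_max; apply/andP; split.
      apply: leq_trans (size_polyD _ _) _; rewrite geq_max; apply/andP; split.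
        by apply: leq_trans (size_scale_leq _ _) _; rewrite size_polyX.
      by apply: leq_trans (size_scale_leq _ _) _; exact: (s2 1).
    by apply: leq_trans (size_scale_leq _ _) _; rewrite -polyCN; exact: (s2 (-1)).
  move=> t; rewrite !hornerE /= !mcoD !mcoZ -/a0 -/a1 -/a2 expr1.
  have := cos2Dsin2 t; rewrite /circ; move: (cos t) (sin t) => c s cs.
  apply/eqP; rewrite eq_complex /=; apply/andP; split; apply/eqP.
    apply/subr0_eq; transitivity (- (a1 / 2) * (c ^+ 2 + s ^+ 2 - 1)).
      by field.
    by rewrite cs subrr mulr0.
  apply/subr0_eq; transitivity (- (a2 / 2) * (c ^+ 2 + s ^+ 2 - 1)).
    by field.
  by rewrite cs subrr mulr0.
- exists (D1 + D2)%N => k i A0 A1 A2.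
  have [Q sQ Qt] := pg k i A0 A1 A2; have [Q' sQ' Qt'] := ph k i A0 A1 A2.
  exists (Q * 'X^D2 + Q' * 'X^D1).
    apply: leq_trans (size_polyD _ _) _; rewrite geq_max; apply/andP; split.
      apply: leq_trans (size_polyMleq _ _) _; rewrite size_polyXn; lia.
    apply: leq_trans (size_polyMleq _ _) _; rewrite size_polyXn; lia.
  by move=> t; rewrite !hornerE Qt Qt' rmorphD /= exprD; ring.
- exists (D1 + D2)%N => k i A0 A1 A2.
  have [Q sQ Qt] := pg k i A0 A1 A2; have [Q' sQ' Qt'] := ph k i A0 A1 A2.
  exists (Q * Q').
    apply: leq_trans (size_polyMleq _ _) _; lia.
  by move=> t; rewrite !hornerE Qt Qt' rmorphM /= exprD; ring.
Qed.

(** Test angles between 0 and 1, where the cosine is injective. There are countably many, so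
    quantifying over them preserves measurability, and infinitely many, so they detect every nonzero
    trigonometric polynomial. *)
Definition sample (j : nat) : R := j.+1%:R^-1.

Lemma circ_sample_inj : injective (circ \o sample).
Proof.
move=> i j /= /eqP; rewrite eq_complex => /andP[/eqP /= cij _].
have sin01 l : sample l \in `[0, pi].
  rewrite in_itv /= invr_ge0 ler0n /=; apply: (@le_trans _ _ 1).
    by rewrite invf_le1 ?ler1n// ltr0n.
  by apply: le_trans (pi_ge2 R); rewrite ler1n.
have := cos_inj (sin01 i) (sin01 j) cij.
by move=> /invr_inj /eqP; rewrite eqr_nat eqSS => /eqP.
Qed.

Lemma trig_degree_zero f D k i A0 A1 A2 (s : seq nat) : trig_degree f D ->
  uniq s -> (2 * D < size s)%N ->
  (forall j, j \in s ->
    f (upd k i (A0 + rscale (cos (sample j)) A1 + rscale (sin (sample j)) A2)) = 0) ->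
  forall t, f (upd k i (A0 + rscale (cos t) A1 + rscale (sin t) A2)) = 0.
Proof.
move=> /(_ k i A0 A1 A2)[Q sQ Qt] us ss s0 t.
have Q0 : Q = 0.
  apply/eqP; apply: contraT => nQ.
  have := max_poly_roots nQ (rs := map (circ \o sample) s).
  rewrite map_inj_uniq ?us; last exact: circ_sample_inj.
  have -> : all (root Q) (map (circ \o sample) s).
    apply/allP => _ /mapP[j js ->]; rewrite rootE /= Qt s0// rmorph0 mulr0//.
  by move=> /(_ isT isT); rewrite size_map => h; have := leq_trans h sQ; lia.
have := Qt t; rewrite Q0 horner0 => /esym /eqP.
rewrite mulf_eq0 expf_eq0 (negbTE (circ_neq0 t)) andbF /=.
by rewrite eq_complex /= => /andP[/eqP].
Qed.

End polynomial_functions.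

Section generated.
Context (R : realType) (F : hypercomplexType R) (n : nat).
Variable gens : seq 'M[F]_n.

Inductive generated : 'M[F]_n -> Prop :=
| generated1 : generated 1%:M
| generatedS C t g : C \in gens -> generated g -> generated (rodr C t *m g).

Lemma generatedM g h : generated g -> generated h -> generated (g *m h).
Proof.
by move=> + gh; elim=> [|C t g' Cg _ ih]; rewrite ?mul1mx// -mulmxA;
  exact: generatedS.
Qed.

Lemma generated_rodr C t : C \in gens -> generated (rodr C t).
Proof.
by move=> Cg; rewrite -[rodr C t]mulmx1; apply: generatedS => //;
  exact: generated1.
Qed.

End generated.

(** * Zero sets of polynomial functions of the slots *)

Section null_sets.
Context (R : realType) (F : hypercomplexType R) (S : scalar_structure F).
Context (n : nat) (K : set 'M[F]_n) (gens : seq 'M[F]_n).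
Local Notation M := (borel_mx F n).
Local Notation polyfn := (polyfn S).
Local Notation rscale := (@rscale R F n n).
Local Notation sample := (@sample R).

Hypothesis K1 : K 1%:M.
Hypothesis gens_cube : forall C, C \in gens -> C *m C *m C = - C.
Hypothesis gens_K : forall C t, C \in gens -> K (rodr C t).

Context d (T : measurableType d) (P : probability T R) (k : T -> nat -> M).
Variable L : nat.
Hypothesis mk : forall i, measurable_fun setT (fun x => k x i).
Hypothesis kinv : forall u : nat -> 'M[F]_n, (forall i, K (u i)) ->
  exists t : T -> T, [/\ measurable_fun setT t,
    forall x i, (i < L)%N -> k (t x) i = u i *m (k x i : 'M[F]_n) &
    forall E, measurable E -> P (t @^-1` E) = P E].

Definition rot C t (v : nat -> 'M[F]_n) i := upd v i (rodr C t *m v i).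

Lemma rotE C t v i : rot C t v i =
  upd v i ((v i + C *m C *m v i) + rscale (cos t) (- (C *m C *m v i)) +
    rscale (sin t) (C *m v i)).
Proof. by rewrite /rot (rodr_mulE S). Qed.

Definition rot_bad f i C : set T :=
  [set x | f (k x) = 0 :> R /\ exists j, f (rot C (sample j) (k x) i) != 0].

(** Rotating slot [i] by [sample j] preserves probability. A point in more than [2 * D] of the
    pulled-back bad sets would give [f] more than [2 * D] zeros along its rotation orbit, so [f]
    would vanish on the whole orbit, while badness provides a nonzero value there. Hence [J] sets of
    equal probability have total mass at most [2 * D], for every [J]. *)
Lemma rot_bad_null f i C : (i < L)%N -> C \in gens -> polyfn L f ->
  P.-negligible (rot_bad f i C).
Proof.
move=> iL Cg pf; have [D trigf] := polyfn_trig pf.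
have mf g : polyfn L g -> measurable_fun setT (fun x => g (k x)).
  by move=> pg; exact: polyfn_measurable pg mk.
have m0 g : polyfn L g -> measurable [set x | g (k x) = 0].
  move=> pg; rewrite (_ : [set x | _] = (fun x => g (k x)) @^-1` [set 0])//.
  by rewrite -[X in measurable X]setTI; apply: mf.
have mbad : measurable (rot_bad f i C).
  rewrite (_ : rot_bad f i C = [set x | f (k x) = 0] `&`
      \bigcup_j ~` [set x | f (rot C (sample j) (k x) i) = 0]); last first.
    apply/seteqP; split=> x /= [f0 fj]; split=> //.
      by case: fj => j /eqP fj; exists j.
    by case: fj => j _ /eqP fj; exists j.
  apply: measurableI; first exact: m0.
  apply: bigcupT_measurable => j; apply: measurableC.
  exact: (m0 _ (polyfn_upd i (rodr C (sample j)) pf)).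
exists (rot_bad f i C); split=> //.
pose u j := upd (fun=> 1%:M : 'M[F]_n) i (rodr C (sample j)).
have uK j l : K (u j l) by rewrite /u /upd; case: ifP => _; [exact: gens_K|].
have /choice[t tP] j := kinv (uK j).
have ktE j g x : polyfn L g -> g (k (t j x)) = g (rot C (sample j) (k x) i).
  move=> pg; apply: (polyfn_local pg) => l lL; case: (tP j) => _ + _.
  move=> /(_ x l lL) ->; rewrite /u /rot /upd; case: ifP => [/eqP->//|_].
  by rewrite mul1mx.
have mE J (j : 'I_J) : measurable (t j @^-1` rot_bad f i C).
  by rewrite -[X in measurable X]setTI; case: (tP j) => mt _ _; exact: mt.
have small (J : nat) : (J%:R%:E * P (rot_bad f i C) <= (2 * D)%:R%:E)%E.
  have H : (forall x, (#|[pred j : 'I_J | `[< (t j @^-1` rot_bad f i C) x >]]| <= 2 * D)%N) ->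
      (\sum_(j < J) P (t j @^-1` rot_bad f i C) <= (2 * D)%:R%:E * P setT)%E.
    by move=> h; apply: measure_overlap.
  rewrite probability_setT mule1 in H; apply: le_trans (H _).
    rewrite (eq_bigr (fun=> P (rot_bad f i C))); last first.
      by move=> j _; case: (tP j) => _ _; apply.
    have Pfin : P (rot_bad f i C) \is a fin_num by exact: fin_num_measure.
    by rewrite -(fineK Pfin) sumEFin sumr_const card_ord -EFinM mulr_natl.
  move=> x; rewrite leqNgt; apply/negP => big.
  pose s := map val (enum [pred j : 'I_J | `[< (t j @^-1` rot_bad f i C) x >]]).
  have us : uniq s by rewrite map_inj_uniq ?enum_uniq//; exact: val_inj.
  have ss : (2 * D < size s)%N by rewrite size_map -cardE.
  have memE j : j \in enum [pred j : 'I_J | `[< (t j @^-1` rot_bad f i C) x >]] ->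
      rot_bad f i C (t j x).
    by rewrite mem_enum => h; apply/asboolP; move: h; rewrite inE.
  have all0 : forall th, f (rot C th (k x) i) = 0.
    move=> th; rewrite rotE.
    apply: (trig_degree_zero trigf us ss) => j /mapP[j' + ->].
    by move=> /memE[f0 _]; rewrite -rotE -(ktE j' f x pf).
  have /hasP[j js _] : has predT s by rewrite has_predT; apply: leq_ltn_trans ss.
  move/mapP : js => [j' /memE[_ [l nz]] _]; move: nz.
  have -> : f (rot C (sample l) (k (t j' x)) i) =
      f (rot C (sample l + sample j') (k x) i).
    rewrite (ktE j' (fun v => f (rot C (sample l) v i))); last exact: polyfn_upd.
    congr f; apply/funext => r; rewrite /rot /upd eqxx; case: eqVneq => [_|//].
    by rewrite mulmxA (rodrD S)// gens_cube.
  by rewrite all0 eqxx.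
apply/eqP; rewrite eq_le measure_ge0 andbT leNgt; apply/negP => P0.
have Pfin : P (rot_bad f i C) \is a fin_num by exact: fin_num_measure.
move: P0 small; rewrite -(fineK Pfin) lte_fin => P0 small.
have [J JD] : exists J : nat, (2 * D)%:R / fine (P (rot_bad f i C)) < J%:R.
  by exists (Num.truncn ((2 * D)%:R / fine (P (rot_bad f i C)))).+1; exact: truncnS_gt.
have := small J; rewrite -EFinM lee_fin leNgt => /negP; apply.
by rewrite -ltr_pdivrMr.
Qed.

(** [W] records the slot and the generator of each rotation leading from [v] to [v'] but not the
    angle, so that only countably many [W] occur. *)
Fixpoint wreach (W : seq (nat * nat)) (v v' : nat -> 'M[F]_n) : Prop :=
  match W with
  | [::] => v' = v
  | (i, c) :: W' => [/\ (i < L)%N, (c < size gens)%N &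
      exists v'' t, wreach W' v v'' /\ v' = rot (nth 0 gens c) t v'' i]
  end.

(** Induction, removing the last rotation. Off [rot_bad], a zero of [f] is also a zero of the
    rotated function [g j] for each sample angle. By induction each [g j] almost surely vanishes on
    all that the shorter word reaches, and vanishing at enough sample angles extends to all
    angles. *)
Lemma wreach_null W f : polyfn L f -> P.-negligible
  [set x | f (k x) = 0 :> R /\ exists v, wreach W (k x) v /\ f v != 0].
Proof.
elim: W f => [|[i c] W ih] f pf.
  apply: negligibleS (negligible_set0 _) => x [f0]; case=> v [/= ->].
  by rewrite f0 eqxx.
have [/andP[iL cg]|h] := boolP ((i < L) && (c < size gens))%N; last first.
  apply: negligibleS (negligible_set0 _) => x [f0]; case=> v [/= [iL cg _] _].
  by move/negP: h; apply; rewrite iL.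
pose C := nth 0 gens c; have Cg : C \in gens by exact: mem_nth.
pose g j := fun v => f (rot C (sample j) v i).
have pg j : polyfn L (g j) by exact: polyfn_upd.
apply: (negligibleS (A := rot_bad f i C `|` \bigcup_j
  [set x | g j (k x) = 0 /\ exists v, wreach W (k x) v /\ g j v != 0])); last first.
  apply: negligibleU; first exact: rot_bad_null.
  by apply: negligible_bigcup => j; exact: ih.
move=> x [f0]; case=> v [/= [_ _ [v' [t [v'r ->]]]]] fv.
have [|nbad] := pselect (rot_bad f i C x); first by left.
right; apply: contrapT => ncup; move/negP: fv; apply; apply/eqP.
have [D trigf] := polyfn_trig pf.
rewrite rotE; apply: (trig_degree_zero trigf (iota_uniq 0 (2 * D).+1)).
  by rewrite size_iota.
move=> j _; rewrite -rotE; apply/eqP; apply: contrapT => /negP gv'.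
apply: ncup; exists j => //; split; last by exists v'.
apply/eqP; apply: contrapT => /negP gk; apply: nbad; split => //.
by exists j.
Qed.

Lemma wreach_generated g i v v' W : generated gens g -> (i < L)%N ->
  wreach W v v' -> exists W', wreach W' v (upd v' i (g *m v' i)).
Proof.
move=> + iL; elim=> [|C t h Cg _ ih] vv'.
  exists W; rewrite mul1mx (_ : upd _ _ _ = v')//.
  by apply/funext => j; rewrite /upd; case: ifP => // /eqP ->.
have [W' vW'] := ih vv'; exists ((i, index C gens) :: W') => /=; split => //.
  by rewrite index_mem.
exists (upd v' i (h *m v' i)), t; split=> //.
apply/funext => j; rewrite /rot /upd nth_index// eqxx; case: ifP => // _.
by rewrite mulmxA.
Qed.

(** As rotations generate [K], every configuration in [K] reaches [kstar] along one of countably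
    many words. For each word, the zeros of [f] from which a nonzero value can be reached are
    negligible. *)
Lemma polyfn_null f (kstar : nat -> 'M[F]_n) :
  (forall g, K g -> exists h, K h /\ h *m g = 1%:M) ->
  (forall g h, K g -> K h -> K (g *m h)) ->
  (forall g, K g -> generated gens g) ->
  P.-negligible [set x | exists2 i, (i < L)%N & ~ K (k x i)] ->
  polyfn L f -> (forall i, (i < L)%N -> K (kstar i)) -> f kstar != 0 ->
  P.-negligible [set x | f (k x) = 0 :> R].
Proof.
move=> KV KM Kgen nK pf Kstar fstar.
(* Words are enumerated through [pickle]; codes that decode to nothing give the empty word. *)
pose N W := [set x | f (k x) = 0 :> R /\ exists v, wreach W (k x) v /\ f v != 0].
apply: (negligibleS (A := [set x | exists2 i, (i < L)%N & ~ K (k x i)] `|`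
    \bigcup_l N (odflt [::] (unpickle l)))); last first.
  apply: negligibleU => //; apply: negligible_bigcup => l.
  exact: wreach_null.
move=> x f0; have [h|h] := pselect (exists2 i, (i < L)%N & ~ K (k x i)); first by left.
right; have Kx i : (i < L)%N -> K (k x i).
  by move=> iL; apply: contrapT => nKi; apply: h; exists i.
have [W [v [kv vstar]]] : exists W v, wreach W (k x) v /\
    forall i, (i < L)%N -> v i = kstar i.
  suff : forall m, (m <= L)%N -> exists W v, [/\ wreach W (k x) v,
      forall i, (i < m)%N -> v i = kstar i &
      forall i, (m <= i)%N -> v i = k x i].
    by move=> /(_ L (leqnn L))[W [v [? ? _]]]; exists W, v.
  elim=> [|m ih] mL; first by exists [::], (k x).
  have [W [v [Wv vs vk]]] := ih (ltnW mL).
  have [h' [Kh' h'k]] := KV _ (Kx m mL).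
  have kh' : (k x m : 'M[F]_n) *m h' = 1%:M.
    have [h2 [_ h2h']] := KV _ Kh'.
    by rewrite -[LHS]mul1mx -h2h' -!mulmxA (mulmxA h') h'k mul1mx.
  have [W' Wv'] := wreach_generated (Kgen _ (KM _ _ (Kstar m mL) Kh')) mL Wv.
  exists W', (upd v m (kstar m *m h' *m v m)); split=> // i im; rewrite /upd.
    case: eqVneq => [->|im']; first by rewrite vk// -mulmxA h'k mulmx1.
    by rewrite vs// ltn_neqAle im'.
  by case: eqVneq => [im'|_]; [rewrite im' ltnn in im|rewrite vk// ltnW].
exists (pickle W) => //; rewrite pickleK; split => //; exists v; split => //.
by rewrite (polyfn_local pf vstar).
Qed.

End null_sets.

(** * Concentration of random words *)

Section trigonometric_bounds.
Context (R : realType).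
Implicit Types x y : R.

Lemma derive_lipschitz (f df : R -> R) (c r x y : R) :
  (forall z, is_derive z (1 : R) f (df z)) -> (forall z, `|z| <= r -> `|df z| <= c) ->
  `|x| <= r -> `|y| <= r -> `|f x - f y| <= c * `|x - y|.
Proof.
move=> fd fc; wlog yx : x y / y <= x.
  move=> H xr yr; have [yx|/ltW xy] := leP y x; first exact: H.
  by rewrite distrC [in leRHS]distrC; exact: H.
move=> xr yr; have := @MVT_segment R f df y x yx (fun z _ => fd z).
case.
  apply: continuous_subspaceT => z; apply: differentiable_continuous.
  by apply/derivable1_diffP; case: (fd z).
move=> z zyx ->; rewrite normrM ler_wpM2r//; apply: fc.
move: zyx xr yr; rewrite in_itv /= !ler_norml => /andP[yz zx] /andP[_ xr] /andP[yr _].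
by rewrite (le_trans yr yz) (le_trans zx xr).
Qed.

Lemma sin_lipschitz r x y : `|x| <= r -> `|y| <= r -> `|sin x - sin y| <= `|x - y|.
Proof.
move=> xr yr; rewrite -[leRHS]mul1r; apply: (@derive_lipschitz sin cos _ r) => //.
by move=> z _; exact: cos_max.
Qed.

Lemma sin_le_norm x : `|sin x| <= `|x|.
Proof.
have := @sin_lipschitz `|x| x 0 (lexx _); rewrite normr0 sin0 !subr0; exact.
Qed.

Lemma cos_lipschitz r x y : `|x| <= r -> `|y| <= r ->
  `|cos x - cos y| <= r * `|x - y|.
Proof.
apply: (@derive_lipschitz cos (fun x => - sin x)) => z zr.
by rewrite normrN (le_trans (sin_le_norm z)).
Qed.

Lemma sinB_lipschitz r x y : r <= 1 -> `|x| <= r -> `|y| <= r ->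
  `|sin x - sin y - (x - y)| <= r * `|x - y|.
Proof.
move=> r1 xr yr.
have -> : sin x - sin y - (x - y) = (sin x - x) - (sin y - y) by ring.
apply: (@derive_lipschitz (fun x => sin x - x) (fun x => cos x - 1) _ r) => // z zr.
rewrite -(cos0 R); apply: le_trans (@cos_lipschitz `|z| z 0 (lexx _) _) _.
  by rewrite normr0.
rewrite subr0; apply: le_trans (ler_pM (normr_ge0 z) (normr_ge0 z) zr zr) _.
by rewrite ler_piMr// (le_trans _ zr).
Qed.

End trigonometric_bounds.

(** * Strict differentiability, uniform in a parameter *)

Section uniform_C1.
Context (R : realType) (F : hypercomplexType R) (S : scalar_structure F).
Context (n d : nat).
Local Notation M := 'M[F]_n.
Local Notation nrm := (nrm S).
Local Notation rscale := (@rscale R F n n).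
Context (I : Type) (dom : I -> Prop).
Implicit Types (psi phi : I -> ('I_d -> R) -> M) (D E : I -> 'I_d -> M).

Definition in_cube (r : R) (t : 'I_d -> R) := forall j, `|t j| <= r.

Definition incr D k (t t' : 'I_d -> R) := \sum_j rscale (t j - t' j) (D k j).

Definition l1dist (t t' : 'I_d -> R) := \sum_j `|t j - t' j|.

(* Differentiability at the origin, strictly and uniformly over [dom]. *)
Definition unif_C1 psi D := exists2 c : R, 0 <= c &
  forall k, dom k ->
    (forall j, nrm (D k j) <= c) /\
    forall r, 0 <= r -> r <= 1 -> forall t t', in_cube r t -> in_cube r t' ->
      nrm (psi k t) <= c /\
      nrm (psi k t - psi k t' - incr D k t t') <= c * r * l1dist t t'.

Lemma in_cube0 r : 0 <= r -> in_cube r (fun=> 0).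
Proof. by move=> r0 j; rewrite normr0. Qed.

Lemma l1dist_ge0 t t' : 0 <= l1dist t t'.
Proof. exact: sumr_ge0. Qed.

Lemma l1dist0 r t : in_cube r t -> l1dist t (fun=> 0) <= d%:R * r.
Proof.
move=> tr; rewrite /l1dist -[X in X%:R * _]card_ord -sumr_const mulr_suml.
by apply: ler_sum => j _; rewrite subr0 mul1r; exact: tr.
Qed.

Lemma nrm_incr c D k t t' : (forall j, nrm (D k j) <= c) ->
  nrm (incr D k t t') <= c * l1dist t t'.
Proof.
move=> Dc; apply: le_trans (nrm_sum _ _ _ _) _; rewrite mulr_sumr.
by apply: ler_sum => j _; rewrite nrmZ mulrC ler_wpM2r.
Qed.

Lemma unif_C1_lipschitz psi D : unif_C1 psi D -> exists2 c : R, 0 <= c &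
  forall k, dom k -> forall r, 0 <= r -> r <= 1 -> forall t, in_cube r t ->
    nrm (psi k t - psi k (fun=> 0)) <= c * r.
Proof.
move=> [c c0 H]; exists (2 * c * d%:R); first by rewrite !mulr_ge0.
move=> k /H[Dc {}H] r r0 r1 t tr; have [_ h] := H r r0 r1 t _ tr (in_cube0 r0).
rewrite -[X in nrm X](subrK (incr D k t (fun=> 0))); apply: le_trans (nrmD _ _ _) _.
apply: (@le_trans _ _ (c * r * (d%:R * r) + c * (d%:R * r))).
  apply: lerD.
    apply: le_trans h _; apply: ler_wpM2l; last exact: l1dist0.
    exact: mulr_ge0.
  apply: le_trans (nrm_incr _ _ Dc) _; apply: ler_wpM2l => //; exact: l1dist0.
have rr : r * r <= r by rewrite ler_piMr.
have cd : 0 <= c * d%:R by rewrite mulr_ge0.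
have := ler_wpM2l cd rr; nra.
Qed.

Lemma unif_C1_eq psi D psi' D' : (forall k t, psi k t = psi' k t) ->
  (forall k j, D k j = D' k j) -> unif_C1 psi D -> unif_C1 psi' D'.
Proof.
move=> e e'; suff [-> ->] : psi = psi' /\ D = D' by [].
by split; apply/funext => k; apply/funext => j.
Qed.

Lemma unif_C1_const (A : I -> M) c : (forall k, dom k -> nrm (A k) <= c) ->
  unif_C1 (fun k _ => A k) (fun _ _ => 0).
Proof.
move=> Ac; exists `|c| => // k kd; split=> [j|r r0 r1 t t' tr tr']; first by rewrite nrm0.
split; first exact: le_trans (Ac k kd) (ler_norm c).
rewrite subrr /incr big1 ?subr0 ?nrm0; last first.
  by move=> j _; rewrite /rscale scaler0.
by rewrite !mulr_ge0 ?l1dist_ge0.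
Qed.

(** The product rule at the origin. The error consists of the errors of the two factors and of two
    products of a linear increment with a deviation from the value at 0, which is of order [r]. *)
Lemma unif_C1M psi D phi E : unif_C1 psi D -> unif_C1 phi E ->
  unif_C1 (fun k t => psi k t *m phi k t)
    (fun k j => D k j *m phi k (fun=> 0) + psi k (fun=> 0) *m E k j).
Proof.
move=> Hpsi Hphi.
have [a a0 La] := unif_C1_lipschitz Hpsi; have [b b0 Lb] := unif_C1_lipschitz Hphi.
case: Hpsi => c c0 Hc; case: Hphi => e e0 He.
exists (2 * c * e + c * b + a * e).
  by rewrite !addr_ge0// !mulr_ge0.
move=> k kd; have [Dc Hck] := Hc k kd; have [Ee Hek] := He k kd.
have cc r t : 0 <= r -> r <= 1 -> in_cube r t -> nrm (psi k t) <= c.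
  by move=> r0 r1 tr; have [] := Hck r r0 r1 t t tr tr.
have ee r t : 0 <= r -> r <= 1 -> in_cube r t -> nrm (phi k t) <= e.
  by move=> r0 r1 tr; have [] := Hek r r0 r1 t t tr tr.
split=> [j|r r0 r1 t t' tr tr'].
  apply: le_trans (nrmD _ _ _) _.
  apply: (@le_trans _ _ (c * e + c * e)).
    apply: lerD; apply: le_trans (nrmM _ _ _) _; apply: ler_pM => //;
      rewrite ?nrm_ge0//; [apply: (ee 0)|apply: (cc 0)] => //; exact: in_cube0.
  have := mulr_ge0 c0 e0; have := mulr_ge0 c0 b0; have := mulr_ge0 a0 e0; nra.
have [_ h1] := Hck r r0 r1 t t' tr tr'; have [_ h2] := Hek r r0 r1 t t' tr tr'.
split.
  apply: le_trans (nrmM _ _ _) _.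
  apply: le_trans (ler_pM (nrm_ge0 _ _) (nrm_ge0 _ _) (cc r t r0 r1 tr) (ee r t r0 r1 tr)) _.
  have := mulr_ge0 c0 e0; have := mulr_ge0 c0 b0; have := mulr_ge0 a0 e0; nra.
have -> : incr (fun k j => D k j *m phi k (fun=> 0) + psi k (fun=> 0) *m E k j) k t t' =
    incr D k t t' *m phi k (fun=> 0) + psi k (fun=> 0) *m incr E k t t'.
  rewrite /incr mulmx_suml mulmx_sumr -big_split /=; apply: eq_bigr => j _.
  by rewrite rscaleDr rscaleAl (rscaleAr S).
set DD := incr D k t t'; set EE := incr E k t t'.
have -> : psi k t *m phi k t - psi k t' *m phi k t' -
    (DD *m phi k (fun=> 0) + psi k (fun=> 0) *m EE) =
    (psi k t - psi k t' - DD) *m phi k t + DD *m (phi k t - phi k (fun=> 0)) +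
    (psi k t' *m (phi k t - phi k t' - EE) + (psi k t' - psi k (fun=> 0)) *m EE).
  apply: (@mco_inj _ _ S) => x.
  by rewrite !(mulmxBl, mulmxBr, mcoD, mcoN); ring.
have L0 := l1dist_ge0 t t'; have cr0 : 0 <= c * r by exact: mulr_ge0.
have nDD := nrm_incr t t' Dc; have nEE := nrm_incr t t' Ee.
have P1 : nrm ((psi k t - psi k t' - DD) *m phi k t) <= c * r * l1dist t t' * e.
  apply: le_trans (nrmM _ _ _) _; apply: ler_pM; rewrite ?nrm_ge0//.
  exact: ee tr.
have P2 : nrm (DD *m (phi k t - phi k (fun=> 0))) <= c * l1dist t t' * (b * r).
  apply: le_trans (nrmM _ _ _) _; apply: ler_pM; rewrite ?nrm_ge0//.
  exact: (Lb k kd).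
have P3 : nrm (psi k t' *m (phi k t - phi k t' - EE)) <= c * (e * r * l1dist t t').
  apply: le_trans (nrmM _ _ _) _; apply: ler_pM; rewrite ?nrm_ge0//.
  exact: cc tr'.
have P4 : nrm ((psi k t' - psi k (fun=> 0)) *m EE) <= a * r * (e * l1dist t t').
  apply: le_trans (nrmM _ _ _) _; apply: ler_pM; rewrite ?nrm_ge0//.
  exact: (La k kd).
apply: le_trans (nrmD _ _ _) _.
apply: le_trans (lerD (nrmD _ _ _) (nrmD _ _ _)) _.
apply: le_trans (lerD (lerD P1 P2) (lerD P3 P4)) _.
by rewrite le_eqVlt; apply/orP; left; apply/eqP; ring.
Qed.

Lemma unif_C1_rodr C j0 : unif_C1 (fun _ t => rodr C (t j0))
  (fun _ j => if j == j0 then C else 0).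
Proof.
pose c := nrm (1%:M : M) + 2 * nrm C + 2 * nrm (C *m C).
have C0 := nrm_ge0 S C; have CC0 := nrm_ge0 S (C *m C).
have I0 := nrm_ge0 S (1%:M : M).
have c0 : 0 <= c by rewrite /c; lra.
exists c => // k kd; split=> [j|r r0 r1 t t' tr tr'].
  by case: ifP => _; rewrite ?nrm0// /c; lra.
split.
  rewrite /rodr; apply: le_trans (nrmD _ _ _) _.
  apply: le_trans (lerD (nrmD _ _ _) (lexx _)) _; rewrite !nrmZ.
  have h1 : `|sin (t j0)| <= 1 by exact: sin_max.
  have h2 : `|1 - cos (t j0)| <= 2.
    by apply: le_trans (ler_normB _ _) _; rewrite normr1; have := cos_max (t j0); lra.
  have := ler_wpM2r C0 h1; have := ler_wpM2r CC0 h2; rewrite /c; lra.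
have -> : incr (fun _ j => if j == j0 then C else 0) k t t' =
    rscale (t j0 - t' j0) C.
  rewrite /incr (bigD1 j0)//= eqxx big1 ?addr0// => j /negPf ->.
  by rewrite /rscale scaler0.
have -> : rodr C (t j0) - rodr C (t' j0) - rscale (t j0 - t' j0) C =
    rscale (sin (t j0) - sin (t' j0) - (t j0 - t' j0)) C +
    rscale (cos (t' j0) - cos (t j0)) (C *m C).
  by apply: (@mco_inj _ _ S) => x; rewrite /rodr !(mcoD, mcoN, mcoZ); ring.
apply: le_trans (nrmD _ _ _) _; rewrite !nrmZ.
have h1 := sinB_lipschitz r1 (tr j0) (tr' j0).
have h2 := cos_lipschitz (tr' j0) (tr j0); rewrite distrC in h2.
rewrite [X in _ <= r * X]distrC in h2; rewrite distrC in h2.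
have h3 : `|t j0 - t' j0| <= l1dist t t'.
  by rewrite /l1dist (bigD1 j0)//= lerDl sumr_ge0.
have h4 := ler_wpM2l r0 h3.
apply: le_trans (lerD (ler_wpM2r C0 (le_trans h1 h4)) (ler_wpM2r CC0 (le_trans h2 h4))) _.
have L0 : 0 <= r * l1dist t t' by rewrite mulr_ge0 ?l1dist_ge0.
rewrite -mulrDr mulrC -mulrA ler_wpM2r//.
by rewrite /c; lra.
Qed.

End uniform_C1.

Section words_C1.
Context (R : realType) (F : hypercomplexType R) (S : scalar_structure F).
Context (n d : nat).
Local Notation M := 'M[F]_n.
Local Notation nrm := (nrm S).
Context (I : Type) (dom : I -> Prop).
Local Notation unif_C1 := (@unif_C1 R F S n d I dom).

(** The Leibniz rule along the word, with one term per slot. *)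
Lemma unif_C1_ev (w : seq (option M)) (psi : nat -> I -> ('I_d -> R) -> M)
    (D : nat -> I -> 'I_d -> M) :
  (forall i, (i < slots w)%N -> unif_C1 (psi i) (D i)) ->
  unif_C1 (fun k t => ev w (fun i => psi i k t))
    (fun k j => \sum_(i < slots w)
      ev w (upd (fun i => psi i k (fun=> 0)) i (D i k j))).
Proof.
elim: w psi D => [|[c|] w ih] psi D H.
- apply: unif_C1_eq (unif_C1_const d (c := nrm (1%:M : M)) (fun _ _ => lexx _)) => // k j.
  by rewrite big_ord0.
- apply: unif_C1_eq (unif_C1M (unif_C1_const d (c := nrm c) (fun _ _ => lexx _)) (ih psi D H)) => // k j.
  by rewrite mul0mx add0r /= mulmx_sumr.
- have H0 : unif_C1 (psi 0%N) (D 0%N) by exact: H.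
  apply: unif_C1_eq (unif_C1M H0 (ih (fun i => psi i.+1) (fun i => D i.+1) _)) => //.
    move=> k j; rewrite /= big_ord_recl /=; congr (_ + _).
    by rewrite mulmx_sumr.
  by move=> i iw; apply: H.
Qed.

Lemma big_rodr0 (s : seq 'I_d) (P : pred 'I_d) (C : 'I_d -> M) :
  \big[mulmx/1%:M]_(j <- s | P j) rodr (C j) 0 = 1%:M.
Proof.
elim: s => [|j s ih]; first by rewrite big_nil.
by rewrite big_cons ih (rodr0 S) mulmx1; case: ifP.
Qed.

Lemma unif_C1_prod (s : seq 'I_d) (P : pred 'I_d) (C : 'I_d -> M) : uniq s ->
  unif_C1 (fun _ t => \big[mulmx/1%:M]_(j <- s | P j) rodr (C j) (t j))
    (fun _ j => if (j \in s) && P j then C j else 0).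
Proof.
elim: s => [_|a s ih /= /andP[as_ us]].
  apply: unif_C1_eq (unif_C1_const d (c := nrm (1%:M : M)) (fun _ _ => lexx _)) => // k t.
  by rewrite big_nil.
have [Pa|Pa] := boolP (P a); last first.
  apply: unif_C1_eq (ih us) => k j; first by rewrite big_cons (negPf Pa).
  rewrite inE; case: eqVneq => [->|//].
  by rewrite (negPf Pa) andbF.
apply: unif_C1_eq (unif_C1M (unif_C1_rodr S dom (C a) a) (ih us)) => k j.
  by rewrite big_cons Pa.
rewrite (rodr0 S) mul1mx big_rodr0 mulmx1.
rewrite inE; case: eqVneq => [->|_] /=; last by rewrite add0r.
by rewrite Pa (negPf as_) addr0.
Qed.

Lemma ev_upd0 (w : seq (option M)) k i : (i < slots w)%N -> ev w (upd k i 0) = 0.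
Proof.
elim: w k i => [//|[c|] w ih] k i /= iw; first by rewrite ih// mulmx0.
case: i iw => [|i] iw; first by rewrite /upd /= mul0mx.
have -> : (fun l => upd k i.+1 0 l.+1) = upd (fun l => k l.+1) i 0 by [].
by rewrite ih// mulmx0.
Qed.

Context (w : seq (option M)) (sg : 'I_d -> nat) (C : 'I_d -> M).

(* [ev w (moved t k)] has the partial derivatives [dev j k] at [t = 0]. *)
Definition moves (t : 'I_d -> R) i : M :=
  \big[mulmx/1%:M]_(j <- index_enum 'I_d | sg j == i) rodr (C j) (t j).

Definition moved t (k : nat -> M) i : M := moves t i *m k i.

Definition dev j (k : nat -> M) : M := ev w (upd k (sg j) (C j *m k (sg j))).

Lemma moves0 i : moves (fun=> 0) i = 1%:M.
Proof. exact: big_rodr0. Qed.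

Lemma moved0 k : moved (fun=> 0) k = k.
Proof. by apply/funext => i; rewrite /moved moves0 mul1mx. Qed.

End words_C1.

Section words_moved.
Context (R : realType) (F : hypercomplexType R) (S : scalar_structure F).
Context (n d : nat).
Local Notation M := 'M[F]_n.
Local Notation nrm := (nrm S).
Context (w : seq (option M)) (sg : 'I_d -> nat) (C : 'I_d -> M).
Hypothesis sgw : forall j, (sg j < slots w)%N.
Variable (B : R).
Local Notation dom := (fun k : nat -> M => forall i, (i < slots w)%N -> nrm (k i) <= B).
Local Notation unif_C1 := (@unif_C1 R F S n d (nat -> M) dom).
Local Notation moved := (moved (R := R) sg C).
Local Notation dev := (dev w sg C).

Lemma unif_C1_slot i : (i < slots w)%N ->
  unif_C1 (fun k t => moved t k i)
    (fun k j => if sg j == i then C j *m k i else 0).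
Proof.
move=> iw; apply: unif_C1_eq (unif_C1M (unif_C1_prod S dom (fun j => sg j == i) C
  (index_enum_uniq _)) (unif_C1_const d (A := fun k : nat -> M => k i) (c := B) _)).
- by [].
- by move=> k j; rewrite mulmx0 addr0 mem_index_enum /=; case: ifP; rewrite ?mul0mx.
- by move=> k; exact.
Qed.

Lemma unif_C1_moved : unif_C1 (fun k t => ev w (moved t k)) (fun k j => dev j k).
Proof.
have H := unif_C1_ev (w := w) unif_C1_slot.
apply: unif_C1_eq H => // k j.
rewrite (bigD1 (Ordinal (sgw j)))//= eqxx big1 ?addr0; last first.
  move=> i /eqP ij; case: eqVneq => [e|_]; last exact: ev_upd0.
  by case: ij; apply: val_inj.
rewrite /dev; congr ev; apply/funext => i; rewrite /upd; case: ifP => // _.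
by rewrite (moved0 S).
Qed.

(** The derivative [dev j] is itself the value of the word, with [C j] multiplied into slot [sg j],
    so it is again uniformly differentiable. *)
Lemma dev_lipschitz j : exists2 c : R, 0 <= c & forall k, dom k ->
  forall r, 0 <= r -> r <= 1 -> forall t, in_cube r t ->
    nrm (dev j (moved t k) - dev j k) <= c * r.
Proof.
pose psi i (k : nat -> M) t := if i == sg j then C j *m moved t k i else moved t k i.
have Hpsi i : (i < slots w)%N -> exists D, unif_C1 (psi i) D.
  move=> iw; rewrite /psi; case: eqP => _; last by eexists; exact: unif_C1_slot.
  eexists; apply: unif_C1M (unif_C1_slot iw).
  by apply: (unif_C1_const d (A := fun=> C j) (c := nrm (C j))).
have /choice[D HD] i : exists D, (i < slots w)%N -> unif_C1 (psi i) D.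
  have [/Hpsi[D HD]|_] := ltnP i (slots w); first by exists D.
  by exists (fun _ _ => 0).
have [c c0 H] := unif_C1_lipschitz (unif_C1_ev (w := w) HD).
exists c => // k kd r r0 r1 t tr; have := H k kd r r0 r1 t tr.
have e t' : ev w (fun i => psi i k t') = dev j (moved t' k).
  by rewrite /dev; congr ev; apply/funext => i; rewrite /psi /upd; case: eqP => [->|].
by rewrite !e (moved0 S).
Qed.

End words_moved.

Section determinant_bounds.
Context (R : realType).

Lemma det_norm_le m (A : 'M[R]_m) b : (forall i j, `|A i j| <= b) ->
  `|\det A| <= (m`!)%:R * b ^+ m.
Proof.
move=> Ab; rewrite /determinant; apply: le_trans (ler_norm_sum _ _ _) _.
have -> : (m`!)%:R * b ^+ m = \sum_(s : {perm 'I_m}) b ^+ m.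
  by rewrite sumr_const card_Sn mulr_natl.
apply: ler_sum => s _; rewrite normrM normr_sign mul1r normr_prod.
rewrite -[X in b ^+ X]card_ord -prodr_const.
by apply: ler_prod => i _; rewrite normr_ge0 Ab.
Qed.

(** The adjugate has bounded entries and the determinant is at least [eps], so the inverse is
    bounded uniformly in [A]. *)
Lemma mulmx_lower_bound d b eps : 0 < eps -> exists2 c : R, 0 < c &
  forall A : 'M[R]_d, (forall i j, `|A i j| <= b) -> eps <= `|\det A| ->
  forall v : 'I_d -> R, c * \sum_j `|v j| <= \sum_i `|\sum_j A i j * v j|.
Proof.
move=> eps0; pose a := (d.-1`!)%:R * `|b| ^+ d.-1 + 1.
have a0 : 0 < a by rewrite ltr_wpDl// mulr_ge0// exprn_ge0.
exists (eps / (d.+1%:R * a)).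
  by rewrite divr_gt0// mulr_gt0// ltr0n.
move=> A Ab dA v; set s := (X in _ <= X).
have s0 : 0 <= s by exact: sumr_ge0.
have vj j : `|v j| <= a / eps * s.
  pose cv := \col_j v j.
  have /matrixP/(_ j 0) : (\adj A) *m (A *m cv) = \det A *: cv.
    by rewrite mulmxA mul_adj_mx mul_scalar_mx.
  rewrite !mxE => e; rewrite mulrAC ler_pdivlMr// mulrC.
  apply: (@le_trans _ _ `|\det A * v j|).
    by rewrite normrM ler_wpM2r.
  rewrite -e; apply: le_trans (ler_norm_sum _ _ _) _; rewrite /s mulr_sumr.
  apply: ler_sum => i _; rewrite normrM; apply: ler_pM => //.
    rewrite mxE /cofactor normrM normr_sign mul1r.
    apply: le_trans (det_norm_le (b := `|b|) _) _.
      by move=> l l'; rewrite !mxE (le_trans (Ab _ _))// ler_norm.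
    by rewrite /a lerDl.
  rewrite mxE le_eqVlt; apply/orP; left; apply/eqP; congr (`|_|).
  by apply: eq_bigr => l _; rewrite mxE.
rewrite mulrAC ler_pdivrMr ?mulr_gt0 ?ltr0n//.
apply: (@le_trans _ _ (eps * (d%:R * (a / eps * s)))).
  rewrite ler_pM2l//; apply: le_trans (ler_sum _ (fun j _ => vj j)) _.
  by rewrite sumr_const card_ord [leRHS]mulr_natl.
have -> : eps * (d%:R * (a / eps * s)) = s * (d%:R * a) by field; rewrite gt_eqF.
by rewrite ler_wpM2l// ler_pM2r// ler_nat.
Qed.

End determinant_bounds.

Section inner_product.
Context (R : realType) (F : hypercomplexType R) (S : scalar_structure F).
Context (n : nat).
Local Notation M := 'M[F]_n.

Definition ip (A B : M) : R := \sum_x mco (S := S) A x * mco (S := S) B x.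

Lemma ipDl A B C : ip (A + B) C = ip A C + ip B C.
Proof.
by rewrite /ip -big_split; apply: eq_bigr => x _; rewrite mcoD mulrDl.
Qed.

Lemma ipBl A B C : ip (A - B) C = ip A C - ip B C.
Proof.
by rewrite /ip -sumrB; apply: eq_bigr => x _; rewrite mcoB mulrBl.
Qed.

Lemma ipZl a A C : ip (rscale a A) C = a * ip A C.
Proof.
by rewrite /ip mulr_sumr; apply: eq_bigr => x _; rewrite mcoZ mulrA.
Qed.

Lemma ip_suml (T : Type) (s : seq T) (P : pred T) (f : T -> M) C :
  ip (\sum_(i <- s | P i) f i) C = \sum_(i <- s | P i) ip (f i) C.
Proof.
apply: (big_morph (ip^~ C)) => [A B|]; first exact: ipDl.
by rewrite /ip big1// => x _; rewrite mco0 mul0r.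
Qed.

Lemma ip_norm_le A B : `|ip A B| <= nrm S A * nrm S B.
Proof.
rewrite /ip; apply: le_trans (ler_norm_sum _ _ _) _; rewrite {1}/nrm mulr_suml.
by apply: ler_sum => x _; rewrite normrM ler_wpM2l// mco_le_nrm.
Qed.

End inner_product.

Section concentration.
Context (R : realType) (F : hypercomplexType R) (S : scalar_structure F).
Context (n : nat) (K : set 'M[F]_n) (gens : seq 'M[F]_n).
Local Notation M := (borel_mx F n).
Local Notation nrm := (nrm S).
Local Notation ip := (ip S).

Hypothesis K1 : K 1%:M.
Hypothesis KM : forall g h, K g -> K h -> K (g *m h).
Hypothesis KV : forall g, K g -> exists h, K h /\ h *m g = 1%:M.
Variable B : R.
Hypothesis KB : forall g, K g -> nrm g <= B.
Hypothesis gens_K : forall C t, C \in gens -> K (rodr C t).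

Context (w : seq (option 'M[F]_n)).
Local Notation L := (slots w).

Context d0 (T : measurableType d0) (P : probability T R) (k : T -> nat -> M).
Hypothesis mk : forall i, measurable_fun setT (fun x => k x i).
Hypothesis kinv : forall u : nat -> 'M[F]_n, (forall i, K (u i)) ->
  exists t : T -> T, [/\ measurable_fun setT t,
    forall x i, (i < L)%N -> k (t x) i = u i *m (k x i : 'M[F]_n) &
    forall E, measurable E -> P (t @^-1` E) = P E].
Variable Gd : set T.
Hypothesis mGd : measurable Gd.
Hypothesis GdK : forall x i, Gd x -> (i < L)%N -> K (k x i).

Context (d : nat) (sg : 'I_d -> nat) (C : 'I_d -> 'M[F]_n) (e : 'I_d -> 'M[F]_n).
Hypothesis sgL : forall j, (sg j < L)%N.
Hypothesis Cgens : forall j, C j \in gens.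

(** A [d] by [d] minor of the derivative of the word map: slot directions [C j] against target
    directions [e i]. *)
Definition jac (v : nat -> 'M[F]_n) : R :=
  \det (\matrix_(i < d, j < d) ip (dev w sg C j v) (e i)).

Lemma mpolyfn_ev (w' : seq (option 'M[F]_n)) L' (W : nat -> (nat -> 'M[F]_n) -> 'M[F]_n) :
  (forall i, (i < slots w')%N -> mpolyfn S L' (W i)) ->
  mpolyfn S L' (fun v => ev w' (fun i => W i v)).
Proof.
elim: w' W => [|[c|] w' ih] W H /=; first exact: mpolyfn_cst.
  by apply: mpolyfnM; [exact: mpolyfn_cst|exact: ih].
apply: mpolyfnM; first exact: H.
by apply: (ih (fun i => W i.+1)) => i iw; exact: H.
Qed.

Lemma mpolyfn_dev j : mpolyfn S L (dev w sg C j).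
Proof.
apply: mpolyfn_ev => i iw; rewrite /upd; case: (i == sg j); last exact: mpolyfn_slot.
by apply: mpolyfnM; [exact: mpolyfn_cst|exact: mpolyfn_slot].
Qed.

Lemma polyfn_jac : polyfn S L jac.
Proof.
apply: polyfn_det => i j; apply: polyfn_sum => x.
by apply: polyfnM; [exact: mpolyfn_dev|exact: polyfn_cst].
Qed.

Lemma K_moves t i : K (moves sg C t i).
Proof.
rewrite /moves; elim/big_rec: _ => // j A _ KA.
by apply: KM => //; exact: gens_K.
Qed.

Local Notation dom := (fun v : nat -> 'M[F]_n => forall i, (i < L)%N -> nrm (v i) <= B).

(** A quantitative inverse function theorem. Where the Jacobian is at least [eps], the linear
    increment dominates both the error of strict differentiability and the change of the derivative
    between 0 and [t], on a cube whose size depends on [eps] alone. *)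
Lemma moved_expansive eps : 0 < eps -> exists r c : R, [/\ 0 < r, 0 < c &
  forall v t t', dom v -> dom (moved sg C t v) -> eps <= `|jac (moved sg C t v)| ->
    in_cube r t -> in_cube r t' ->
    c * l1dist t t' <= nrm (ev w (moved sg C t v) - ev w (moved sg C t' v))].
Proof.
move=> eps0.
have [a a0 Ha] := unif_C1_moved S C sgL B.
have /choice[b Hb] j : exists b : R, 0 <= b /\ forall v, dom v ->
    forall r, 0 <= r -> r <= 1 -> forall t, in_cube r t ->
    nrm (dev w sg C j (moved sg C t v) - dev w sg C j v) <= b * r.
  by have [b b0 H] := @dev_lipschitz _ _ S _ _ w sg C B j; exists b.
pose E := \sum_i nrm (e i).
have E0 : 0 <= E by apply: sumr_ge0 => i _; exact: nrm_ge0.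
have eE i : nrm (e i) <= E.
  by rewrite /E (bigD1 i)//= lerDl sumr_ge0// => j _; exact: nrm_ge0.
have [c1 c10 Hc1] := mulmx_lower_bound d (a * E) eps0.
pose bb := \sum_j b j.
have bb0 : 0 <= bb by apply: sumr_ge0 => j _; case: (Hb j).
have bj j : b j <= bb.
  by rewrite /bb (bigD1 j)//= lerDl sumr_ge0// => i _; case: (Hb i).
pose c2 := (a + bb) * E * d%:R.
have c20 : 0 <= c2 by rewrite !mulr_ge0// addr_ge0.
(* [c1] is the lower bound for the linear part and [c2 * r] bounds all the errors; this [r] makes
   them at most [c1 / 2]. *)
pose r := c1 / (2 * (c1 + c2)).
have cc : 0 < c1 + c2 by rewrite ltr_pwDl.
have r0 : 0 < r by rewrite divr_gt0// mulr_gt0.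
have r1 : r <= 1 by rewrite ler_pdivrMr ?mulr_gt0// mul1r; lra.
have rc2 : c2 * r <= c1 / 2.
  rewrite /r mulrA ler_pdivrMr ?mulr_gt0//.
  have -> : c1 / 2 * (2 * (c1 + c2)) = c1 * (c1 + c2) by field.
  by rewrite mulrDr mulrC lerDr mulr_ge0// ltW.
exists r, (c1 / 2 / (E * d%:R + 1)); split=> //.
  by rewrite !divr_gt0// ltr_wpDl// mulr_ge0.
move=> v t t' vd vtd jt tr t'r.
have [Dc Hv] := Ha v vd; have [_ h] := Hv r (ltW r0) r1 t t' tr t'r.
set X := ev w _ - ev w _; rewrite -/X in h.
pose tau j := t j - t' j.
have [Dc' _] := Ha _ vtd.
have low := Hc1 (\matrix_(i, j) ip (dev w sg C j (moved sg C t v)) (e i)) _ jt tau.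
have {}low : c1 * l1dist t t' <= \sum_i `|\sum_j ip (dev w sg C j (moved sg C t v)) (e i) * tau j|.
  apply: le_trans (low _) _ => [i j|].
    rewrite mxE; apply: le_trans (ip_norm_le _ _ _) _.
    by apply: ler_pM; rewrite ?nrm_ge0.
  apply: ler_sum => i _; rewrite le_eqVlt; apply/orP; left; apply/eqP.
  by congr (`|_|); apply: eq_bigr => j _; rewrite mxE.
have L0 := l1dist_ge0 t t'.
have up i : `|\sum_j ip (dev w sg C j (moved sg C t v)) (e i) * tau j| <=
    nrm X * E + (a + bb) * E * r * l1dist t t'.
  have -> : \sum_j ip (dev w sg C j (moved sg C t v)) (e i) * tau j =
      ip X (e i) - ip (X - incr (fun v j => dev w sg C j v) v t t') (e i) +
      \sum_j ip (dev w sg C j (moved sg C t v) - dev w sg C j v) (e i) * tau j.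
    rewrite [ip (X - _) _]ipBl /incr ip_suml subKr -big_split /=; apply: eq_bigr => j _.
    by rewrite ipZl ipBl /tau; ring.
  apply: le_trans (ler_normD _ _) _; apply: le_trans (lerD (ler_normB _ _) (lexx _)) _.
  have h1 : `|ip X (e i)| <= nrm X * E.
    by apply: le_trans (ip_norm_le _ _ _) _; rewrite ler_wpM2l ?nrm_ge0.
  have h2 : `|ip (X - incr (fun v j => dev w sg C j v) v t t') (e i)| <=
      a * r * l1dist t t' * E.
    by apply: le_trans (ip_norm_le _ _ _) _; apply: ler_pM; rewrite ?nrm_ge0.
  have h3 : `|\sum_j ip (dev w sg C j (moved sg C t v) - dev w sg C j v) (e i) * tau j| <=
      bb * r * E * l1dist t t'.
    apply: le_trans (ler_norm_sum _ _ _) _; rewrite /l1dist mulr_sumr.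
    apply: ler_sum => j _; rewrite normrM ler_wpM2r//.
    apply: le_trans (ip_norm_le _ _ _) _; apply: ler_pM; rewrite ?nrm_ge0//.
    apply: le_trans ((Hb j).2 v vd r (ltW r0) r1 t tr) _.
    by rewrite ler_wpM2r// ltW.
  apply: le_trans (lerD (lerD h1 h2) h3) _.
  by rewrite le_eqVlt; apply/orP; left; apply/eqP; ring.
have {}up := le_trans low (ler_sum _ (fun i _ => up i)).
move: up; rewrite sumr_const card_ord -[X in _ <= X -> _]mulr_natr => up.
have up2 : c1 / 2 * l1dist t t' <= nrm X * (E * d%:R).
  have : c2 * r * l1dist t t' <= c1 / 2 * l1dist t t' by rewrite ler_wpM2r.
  rewrite /c2; lra.
rewrite mulrAC ler_pdivrMr; last by rewrite ltr_wpDl// mulr_ge0.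
apply: le_trans up2 _; rewrite ler_wpM2l ?nrm_ge0//.
by rewrite lerDl.
Qed.

(** Move the slots by the m^d rotation vectors of a grid of mesh r/m; each move preserves
    probability. If two moves of one configuration fell in the event, their words would be at least
    c r/m apart by expansiveness, yet both lie in a ball of half that radius. So the m^d preimages
    of the event are disjoint and of equal probability. *)
Lemma concentration eps : 0 < eps -> exists2 c : R, 0 < c & forall m x, (0 < m)%N ->
  (P [set z | [/\ Gd z, (eps <= `|jac (k z)|)%R & nball S x (c / m%:R) (ev w (k z))]] <=
   ((m ^ d)%:R^-1)%:E)%E.
Proof.
move=> eps0; have [r [c [r0 c0 exp]]] := moved_expansive eps0.
exists (c * r / 2); first by rewrite divr_gt0// mulr_gt0.
move=> m x m0; have m0R : 0 < m%:R :> R by rewrite ltr0n.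
set E := [set z | _].
have mE : measurable E.
  have -> : E = Gd `&` (fun z => `|jac (k z)|) @^-1` `[eps, +oo[ `&`
      (fun z => ev w (k z) : M) @^-1` nball S x (c * r / 2 / m%:R).
    apply/seteqP; split=> z /=; rewrite in_itv /= andbT.
      by move=> [].
    by move=> [[]].
  apply: measurableI; first apply: measurableI => //.
    rewrite -[X in measurable X]setTI; apply: measurableT_comp => //.
    exact: polyfn_measurable polyfn_jac mk.
  rewrite -[X in measurable X]setTI; apply: ev_measurable => //.
  exact: nball_borel.
pose J := {ffun 'I_d -> 'I_m}.
pose tt (f : J) j : R := r * (f j)%:R / m%:R.
have ttr f : in_cube r (tt f).
  move=> j; rewrite /tt ger0_norm; last first.
    exact: divr_ge0 (mulr_ge0 (ltW r0) (ler0n _ _)) (ler0n _ _).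
  by rewrite ler_pdivrMr// ler_pM2l// ler_nat ltnW.
have /choice[tr trP] (f : J) := kinv (K_moves (tt f)).
have mtr f : measurable (tr f @^-1` E).
  by rewrite -[X in measurable X]setTI; case: (trP f) => mt _ _; exact: mt.
have H : (forall z, (#|[pred f : J | `[< (tr f @^-1` E) z >]]| <= 1)%N) ->
    (\sum_(f : J) P (tr f @^-1` E) <= 1%:R%:E * P setT)%E.
  by move=> h; apply: measure_overlap.
rewrite probability_setT mule1 in H.
have {}H : (\sum_(f : J) P (tr f @^-1` E) <= 1%:E)%E.
  apply: H => z; rewrite leqNgt; apply/negP => /card_gt1P[f [f' [+ + ff']]].
  have memE g : g \in [pred f : J | `[< (tr f @^-1` E) z >]] -> E (tr g z).
    by move=> h; apply/asboolP; move: h; rewrite inE.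
  move=> /memE[Gf jf nf] /memE[Gf' _ nf'].
  have kE g i : (i < L)%N -> k (tr g z) i = moved sg C (tt g) (k z) i.
    by move=> iL; case: (trP g) => _ h _; rewrite h.
  (* The good event is known at the moved configuration; undoing the move shows that the original
     one lies in [K] as well. *)
  have Kz i : (i < L)%N -> K (k z i).
    move=> iL; have [h [Kh hu]] := KV (K_moves (tt f) i).
    have -> : k z i = h *m (k (tr f z) i : 'M[F]_n).
      by rewrite kE// /moved mulmxA hu mul1mx.
    by apply: KM => //; exact: GdK.
  have vd : dom (k z) by move=> i iL; apply: KB; exact: Kz.
  have vtd : dom (moved sg C (tt f) (k z)).
    by move=> i iL; rewrite -kE//; apply: KB; exact: GdK.
  have jE : jac (k (tr f z)) = jac (moved sg C (tt f) (k z)).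
    by apply: (polyfn_local polyfn_jac) => i iL; exact: kE.
  rewrite jE in jf.
  have evE g : ev w (k (tr g z)) = ev w (moved sg C (tt g) (k z)).
    by apply: eq_ev => i iL; exact: kE.
  have := exp _ _ _ vd vtd jf (ttr f) (ttr f').
  rewrite -!evE leNgt => /negP; apply.
  apply: le_lt_trans (nrm_triangle S x _ _) _.
  apply: (@lt_le_trans _ _ (c * r / 2 / m%:R + c * r / 2 / m%:R)).
    by apply: ltrD; [exact: nf|rewrite nrmBC; exact: nf'].
  have -> : c * r / 2 / m%:R + c * r / 2 / m%:R = c * (r / m%:R).
    by field; rewrite gt_eqF.
  rewrite ler_pM2l//.
  have [j jff'] : exists j, f j != f' j.
    apply/existsP; apply: contraNT ff'; rewrite negb_exists => /forallP eq.
    by apply/eqP/ffunP => j; apply/eqP; move: (eq j); rewrite negbK.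
  rewrite /l1dist (bigD1 j)//=; apply: (@le_trans _ _ `|tt f j - tt f' j|); last first.
    by rewrite lerDl sumr_ge0.
  have -> : tt f j - tt f' j = r / m%:R * ((f j)%:R - (f' j)%:R).
    by rewrite /tt; field; rewrite gt_eqF.
  have rm0 : 0 <= r / m%:R by exact: divr_ge0 (ltW r0) (ltW m0R).
  rewrite normrM (ger0_norm rm0) ler_peMr//.
  have neq : (f j : nat) != f' j by [].
  case: (ltngtP (f j) (f' j)) neq => // lt _.
    rewrite distrC ger0_norm ?subr_ge0 ?ler_nat 1?ltnW//.
    by rewrite lerBrDr -[1]/(1%:R) -natrD ler_nat add1n.
  rewrite ger0_norm ?subr_ge0 ?ler_nat 1?ltnW//.
  by rewrite lerBrDr -[1]/(1%:R) -natrD ler_nat add1n.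
have Pfin : P E \is a fin_num by exact: fin_num_measure.
move: H; rewrite (eq_bigr (fun=> P E)); last first.
  by move=> f _; case: (trP f) => _ _; apply.
rewrite -(fineK Pfin) sumEFin !lee_fin sumr_const card_ffun !card_ord.
rewrite -[X in X <= _ -> _]mulr_natr => H.
by rewrite -[leRHS]mul1r ler_pdivlMr// ltr0n expn_gt0 m0.
Qed.

End concentration.

(** Greedy extension stops because the sizes are bounded; the induction is on the room left below
    [N]. *)
Lemma maximal_sequence (T : eqType) (X : T -> Prop) (r : rel T) (N : nat) :
  (forall s, pairwise r s -> (forall x, x \in s -> X x) -> (size s <= N)%N) ->
  exists s, [/\ pairwise r s, forall x, x \in s -> X x &
    forall x, X x -> exists2 y, y \in s & ~~ r x y].
Proof.
move=> bnd; suff : forall n s, pairwise r s -> (forall x, x \in s -> X x) ->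
    (N <= size s + n)%N -> exists s, [/\ pairwise r s, forall x, x \in s -> X x &
    forall x, X x -> exists2 y, y \in s & ~~ r x y].
  by move=> /(_ N [::]); apply.
elim=> [|n ih] s rs sX Ns; have [[x [Xx xs]]|h] :=
    pselect (exists x, X x /\ forall y, y \in s -> r x y).
- have xrs : pairwise r (x :: s) by rewrite /= rs andbT; apply/allP.
  have xsX y : y \in x :: s -> X y by rewrite inE => /orP[/eqP->//|/sX].
  have := bnd _ xrs xsX; rewrite addn0 in Ns.
  by move=> /= h2; have := leq_trans h2 Ns; rewrite ltnn.
- exists s; split => // x Xx; apply: contrapT => nx; apply: h; exists x.
  split => // y ys; apply: contraT => nr; exfalso; apply: nx; by exists y.
- apply: (ih (x :: s)); last by rewrite /= addSnnS.
    by rewrite /= rs andbT; apply/allP.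
  by move=> y; rewrite inE => /orP[/eqP->//|/sX].
- exists s; split => // x Xx; apply: contrapT => nx; apply: h; exists x.
  split => // y ys; apply: contraT => nr; exfalso; apply: nx; by exists y.
Qed.

(** * A criterion for absolute continuity *)

Section absolute_continuity.
Context (R : realType) (F : hypercomplexType R) (S : scalar_structure F).
Context (n d : nat) (G : set 'M[F]_n).
Local Notation M := (borel_mx F n).
Local Notation nrm := (nrm S).
Local Notation nball := (nball S).
Variable mu : {measure set M -> \bar R}.
Hypothesis mu_fin : forall A r, (mu (nball A r) < +oo)%E.
Hypothesis mu_low : forall K0 R0, 0 < K0 -> 0 < R0 -> exists2 c : R, 0 < c &
  forall m g, (0 < m)%N -> G g -> nrm g <= R0 ->
    ((c / (m ^ d)%:R)%:E <= mu (nball g (K0 / m%:R)))%E.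

Lemma nrm_le_closed R0 : closed [set x : 'M[F]_n | nrm x <= R0].
Proof.
have -> : [set x : 'M[F]_n | nrm x <= R0] = (fun x => nrm (x - 0)) @^-1` [set y | y <= R0].
  by apply/seteqP; split => x /=; rewrite subr0.
by apply: closed_comp; [move=> x _; exact: nrmB_continuous|exact: closed_le].
Qed.

Context d0 (T : measurableType d0) (P : probability T R) (f : T -> M).
Hypothesis mf : measurable_fun setT f.
Variables (E : set T) (R0 c : R).
Hypothesis mE : measurable E.
Hypothesis R00 : 0 < R0.
Hypothesis c0 : 0 < c.
Hypothesis EG : forall z, E z -> G (f z) /\ nrm (f z) <= R0.
Hypothesis conc : forall m x, (0 < m)%N ->
  (P [set z | E z /\ nball x (c / m%:R) (f z)] <= ((m ^ d)%:R^-1)%:E)%E.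

(** Packing against covering. A bounded closed null set has thickenings of measure below any [e].
    Take in it a maximal family of points of [G] at mutual distance at least c/m. The balls of
    radius c/(2m) are disjoint inside the thickening and each has measure at least cl/m^d, so there
    are at most e m^d/cl of them. The balls of radius c/m cover, each with probability at most m^-d,
    which leaves probability at most e/cl. *)
Lemma ball_domination (C : set 'M[F]_n) : closed C -> mu C = 0%E ->
  P (E `&` f @^-1` C) = 0%E.
Proof.
move=> cC muC.
have [cl cl0 low] := mu_low (divr_gt0 c0 (ltr0Sn R 1)) R00.
pose C1 : set 'M[F]_n := C `&` [set x | nrm x <= R0].
have cC1 : closed C1 by apply: closedI => //; exact: nrm_le_closed.
have muC1 : mu C1 = 0%E.
  apply/eqP; rewrite eq_le measure_ge0 andbT -muC.
  by apply: le_measure; rewrite ?inE; [exact: closed_borel|exact: closed_borel|move=> x []].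
have mfC : measurable (f @^-1` C).
  by rewrite -[X in measurable X]setTI; apply: mf => //; exact: closed_borel.
have mEC : measurable (E `&` f @^-1` C) by exact: measurableI.
have mth i : measurable (thicken S C1 i.+1%:R^-1 : set M).
  by apply: open_borel; exact: thicken_open.
have fin0 : (mu (thicken S C1 1%:R^-1) < +oo)%E.
  apply: le_lt_trans (mu_fin 0 (R0 + 1)); apply: le_measure; rewrite ?inE.
  - exact: (mth 0%N).
  - exact: nball_borel.
  move=> x [y [_ yR]]; rewrite /nball /= subr0 invr1 => xy.
  rewrite -[x](subrK y); apply: le_lt_trans (nrmD _ _ _) _.
  by rewrite addrC; apply: ler_ltD.
suff small e : 0 < e -> (P (E `&` f @^-1` C) <= (e / cl)%:E)%E.
  apply/eqP; rewrite eq_le measure_ge0 andbT; apply/lee_addgt0Pr => e e0.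
  rewrite add0e; apply: le_trans (small (e * cl) (mulr_gt0 e0 cl0)) _.
  by rewrite mulfK ?gt_eqF.
move=> e0.
have [i hi] : exists i, (mu (thicken S C1 i.+1%:R^-1) < e%:E)%E.
  apply: (@measure_shrink _ M R mu (fun i => thicken S C1 i.+1%:R^-1)) => //.
    move=> i j ij; apply/subsetPset; apply: thicken_sub.
    by rewrite lef_pV2 ?posrE// ler_nat ltnS.
  by rewrite bigcap_thicken.
have [m m0 mi] : exists2 m, (0 < m)%N & c / 2 / m%:R <= i.+1%:R^-1.
  exists (Num.truncn (c / 2 * i.+1%:R)).+1 => //.
  rewrite ler_pdivrMr ?ltr0n// ler_pdivlMl ?ltr0n// mulrC.
  by apply: ltW; exact: truncnS_gt.
have m0R : 0 < m%:R :> R by rewrite ltr0n.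
pose X x := C1 x /\ G x.
pose r (x y : 'M[F]_n) := c / m%:R <= nrm (x - y).
have hc2 : c / 2 / m%:R + c / 2 / m%:R = c / m%:R by field; rewrite gt_eqF.
have cm0 : 0 < c / 2 / m%:R by rewrite !divr_gt0.
have size_bound s : pairwise r s -> (forall x, x \in s -> X x) ->
    (size s)%:R * (cl / (m ^ d)%:R) <= e.
  move=> rs sX; rewrite -lee_fin; apply: le_trans (ltW hi).
  have sep (j l : 'I_(size s)) z : nball (nth 0 s j) (c / 2 / m%:R) z ->
      nball (nth 0 s l) (c / 2 / m%:R) z -> (j < l)%N -> False.
    move=> zj zl jl; have := pairwiseP 0 rs; move=> /(_ j l (ltn_ord j) (ltn_ord l) jl).
    rewrite /r leNgt => /negP; apply; rewrite -hc2.
    apply: le_lt_trans (nrm_triangle S z _ _) _.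
    by apply: ltrD => //; rewrite nrmBC.
  have H : (\sum_(j < size s) mu (nball (nth 0%R s j) (c / 2 / m%:R) : set M) <=
      1%:R%:E * mu (thicken S C1 i.+1%:R^-1))%E.
    apply: measure_overlap => [j|||z].
    - exact: nball_borel.
    - exact: mth.
    - move=> j z zj; exists (nth 0 s j); first by have [] := sX _ (mem_nth 0 (ltn_ord j)).
      exact: lt_le_trans mi.
    - rewrite leqNgt; apply/negP => /card_gt1P[j [l [+ + jl]]].
      have memE g : g \in [pred j : 'I_(size s) | `[< nball (nth 0 s j) (c / 2 / m%:R) z >]] ->
          nball (nth 0 s g) (c / 2 / m%:R) z.
        by move=> h; apply/asboolP; move: h; rewrite inE.
      move=> /memE zj /memE zl.
      have neq : (j : nat) != l by [].
      by case: (ltngtP j l) neq => // lt _; [exact: sep zj zl lt|exact: sep zl zj lt].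
  rewrite mul1e in H; apply: le_trans H.
  rewrite -[X in X%:R * _]card_ord -sumr_const mulr_suml -sumEFin.
  apply: lee_sum => j _; rewrite mul1r; have [[_ xR] Gx] := sX _ (mem_nth 0 (ltn_ord j)).
  exact: low.
have clm : 0 < cl / (m ^ d)%:R by rewrite divr_gt0 ?ltr0n ?expn_gt0 ?m0.
have [s [rs sX smax]] : exists s, [/\ pairwise r s, forall x, x \in s -> X x &
    forall x, X x -> exists2 y, y \in s & ~~ r x y].
  apply: (@maximal_sequence _ X r (Num.truncn (e / (cl / (m ^ d)%:R)))) => s rs sX.
  rewrite truncn_ge_nat; last by rewrite divr_ge0 ?ltW.
  by rewrite ler_pdivlMr//; exact: size_bound.
have mball x : measurable [set z | E z /\ nball x (c / m%:R) (f z)].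
  apply: measurableI => //; rewrite -[X in measurable X]setTI; apply: mf => //.
  exact: nball_borel.
have H : (P (E `&` f @^-1` C) <= \sum_(j < size s)
    P [set z | E z /\ nball (nth 0%R s j) (c / m%:R) (f z)])%E.
  apply: (@measure_cover _ T R P _ (fun j : 'I_(size s) =>
    [set z | E z /\ nball (nth 0 s j) (c / m%:R) (f z)])) => //.
  move=> z [Ez Cz]; have [Gz zR] := EG Ez.
  have Xz : X (f z) by [].
  have [y ys nr] := smax (f z) Xz.
  have ys' : (index y s < size s)%N by rewrite index_mem.
  exists (Ordinal ys') => //; split=> //=; rewrite nth_index//.
  by rewrite /nball/= ltNge.
apply: le_trans H _.
apply: (@le_trans _ _ (\sum_(j < size s) ((m ^ d)%:R^-1)%:E)%E).
  by apply: lee_sum => j _; exact: conc.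
rewrite sumEFin lee_fin sumr_const card_ord -[leLHS]mulr_natl ler_pdivlMr//.
by have := size_bound s rs sX; rewrite mulrA mulrAC.
Qed.

End absolute_continuity.

Section absolute_continuity_law.
Context (R : realType) (F : hypercomplexType R) (S : scalar_structure F).
Context (n : nat).
Local Notation M := (borel_mx F n).

(* By inner regularity of finite Borel measures. *)
Lemma closed_null_dominates (nu : probability M R)
    (mu : {measure set M -> \bar R}) :
  (forall C : set 'M[F]_n, closed C -> mu C = 0%E -> nu C = 0%E) -> nu `<< mu.
Proof.
move=> H A nA B mB BA; have muB := nA B mB BA.
apply/eqP; rewrite eq_le measure_ge0 andbT leNgt; apply/negP => nuB.
have nuBfin : nu B \is a fin_num by exact: fin_num_measure.
have e0 : 0 < fine (nu B) by rewrite -lte_fin fineK.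
have [|C [cC CB h]] := borel_regular S (mu := nu) _ mB e0.
  by rewrite [X in (X < _)%E](probability_setT nu : _ = 1%E) ltry.
have muC : mu C = 0%E.
  apply/eqP; rewrite eq_le measure_ge0 andbT -muB.
  by apply: le_measure; rewrite ?inE //; exact: closed_borel.
have mC : measurable (C : set M) by exact: closed_borel.
have : (nu B <= nu (B `\` C) + nu C)%E.
  apply: (@le_trans _ _ (nu (B `\` C `|` C))).
    apply: le_measure; rewrite ?inE//; first by apply: measurableU => //; exact: measurableD.
    by move=> x Bx; have [Cx|Cx] := pselect (C x); [right|left].
  by apply: measureU2 => //; exact: measurableD.
by rewrite (H C cC muC) adde0 leNgt -[X in (_ < X)%E](fineK nuBfin) h.
Qed.

End absolute_continuity_law.

(** A vector [u] killed by the Gram matrix gives [u *m W] Euclidean norm zero. *)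
Lemma row_free_gram (R : realType) m k (W : 'M[R]_(m, k)) :
  row_free W -> \det (W *m W^T) != 0.
Proof.
move=> frW; suff : W *m W^T \in unitmx by rewrite unitmxE unitfE.
rewrite -row_free_unit -kermx_eq0.
apply/eqP/row_matrixP => i; rewrite row0; set u := row i _.
have uW : u *m (W *m W^T) = 0 by rewrite -row_mul mulmx_ker row0.
have : u *m W = 0.
  have : (u *m W *m (u *m W)^T) 0 0 = 0.
    by rewrite trmx_mul mulmxA -(mulmxA u) uW mul0mx mxE.
  rewrite mxE => /eqP; rewrite psumr_eq0; last first.
    by move=> y _; rewrite [_^T _ _]mxE -expr2 sqr_ge0.
  move=> /allP h; apply/rowP => y; rewrite [RHS]mxE; apply/eqP.
  by have := h y (mem_index_enum y); rewrite [_^T _ _]mxE mulf_eq0 orbb.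
by move/eqP; rewrite mulmx_free_eq0// => /eqP.
Qed.

Section linear_functionals.
Context (R : realType) (F : hypercomplexType R) (S : scalar_structure F).
Context (n : nat).
Local Notation M := 'M[F]_n.
Local Notation nrm := (nrm S).
Local Notation ip := (ip S).
Local Notation mvec := (mvec S).
Local Notation un := (@un R F S).

Definition real_linear (f : M -> R) :=
  (forall A B, f (A + B) = f A + f B) /\ (forall a A, f (rscale a A) = a * f A).

Definition mbasis (y : coidx S n n) : M := un y.2 *: delta_mx y.1.1 y.1.2.

Lemma mbasis_sum A : A = \sum_y rscale (mco A y) (mbasis y).
Proof.
apply/matrixP => i j; rewrite summxE [LHS](co_decomp S).
rewrite -(pair_big xpredT xpredT (fun (ij : 'I_n * 'I_n) e =>
  (rscale (mco A (ij, e)) (mbasis (ij, e))) i j))/=.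
rewrite (bigD1 (i, j))//= [X in _ + X]big1 ?addr0; last first.
  move=> [a b] /negP ab; rewrite big1// => e _; rewrite !mxE /=.
  case: (i =P a) (j =P b) ab => [<-|_] [<-|_] ab; rewrite ?mulr0//.
by apply: eq_bigr => e _; rewrite !mxE !eqxx mulr1.
Qed.

Lemma real_linear_sum f (T : Type) (s : seq T) (P : pred T) (g : T -> M) :
  real_linear f -> f (\sum_(i <- s | P i) g i) = \sum_(i <- s | P i) f (g i).
Proof.
move=> [fD fZ]; apply: (big_morph f) => //.
by have := fZ 0 0; rewrite (rscale0r S) mul0r.
Qed.

(** Functionals without common kernel have a coordinate matrix with a right inverse, whose entries
    provide the constant. *)
Lemma real_linear_lower_bound (X : finType) (f : X -> M -> R) :
  (forall x, real_linear (f x)) -> (forall A, (forall x, f x A = 0) -> A = 0) ->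
  exists2 c : R, 0 < c & forall A, nrm A <= c * \sum_x `|f x A|.
Proof.
move=> fl f0; pose D := #|{: coidx S n n}|.
pose W : 'M[R]_(D, #|X|) := \matrix_(i, x) f (enum_val x) (mbasis (enum_val i)).
have WE A x : (mvec A *m W) 0 x = f (enum_val x) A.
  rewrite mxE [A in RHS]mbasis_sum real_linear_sum// (reindex (@enum_val _ {: coidx S n n}))/=; last first.
    by exists enum_rank => y _; rewrite ?enum_valK ?enum_rankK.
  by apply: eq_bigr => i _; rewrite !mxE (fl _).2.
have free : row_free W.
  rewrite -kermx_eq0; apply/eqP/row_matrixP => i; rewrite row0.
  set v := row i _; have vW : v *m W = 0.
    by rewrite -row_mul mulmx_ker row0.
  have vA := esym (munvecK v); set A := munvec v in vA.
  have : A = 0.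
    by apply: f0 => x; rewrite -[x]enum_rankK -WE -vA vW mxE.
  by rewrite vA => ->; apply/rowP => y; rewrite !mxE mco0.
have [Wi WWi] : exists Wi, W *m Wi = 1%:M by apply/row_freeP.
pose c := 1 + \sum_i \sum_y `|Wi i y|.
have c0 : 0 < c by rewrite ltr_pwDl// sumr_ge0// => i _; exact: sumr_ge0.
exists c => // A.
have mE y : mco A y = \sum_i f (enum_val i) A * Wi i (enum_rank y).
  have : mvec A = mvec A *m W *m Wi by rewrite -mulmxA WWi mulmx1.
  move/rowP/(_ (enum_rank y)); rewrite mxE enum_rankK => ->.
  by rewrite mxE; apply: eq_bigr => i _; rewrite WE.
rewrite /nrm; apply: (@le_trans _ _
    (\sum_y \sum_i `|f (enum_val i) A| * `|Wi i (enum_rank y)|)).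
  apply: ler_sum => y _; rewrite mE; apply: le_trans (ler_norm_sum _ _ _) _.
  by apply: ler_sum => i _; rewrite normrM.
rewrite exchange_big /= mulr_sumr (reindex (@enum_val _ X))/=; last first.
  by exists enum_rank => x _; rewrite ?enum_valK ?enum_rankK.
apply: ler_sum => i _; rewrite -mulr_sumr mulrC ler_wpM2r//.
rewrite /c (bigD1 i)//= (reindex (@enum_rank _ ))/=; last first.
  by exists enum_val => x _; rewrite ?enum_valK ?enum_rankK.
by rewrite addrCA lerDl addr_ge0// sumr_ge0// => j _; exact: sumr_ge0.
Qed.

Lemma ip_real_linear B : real_linear (fun A => ip A B).
Proof. by split=> [A A'|a A]; [exact: ipDl|exact: ipZl]. Qed.

(* A maximal independent subfamily. *)
Lemma gram_subfamily m (v : 'I_m -> M) : exists d (g : 'I_d -> 'I_m),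
  \det (\matrix_(i, j) ip (v (g j)) (v (g i))) != 0 /\
  forall A, (forall i, ip A (v (g i)) = 0) -> forall j, ip A (v j) = 0.
Proof.
pose V : 'M[R]_(m, #|{: coidx S n n}|) := \matrix_j mvec (v j).
have ipE A B : ip A B = (mvec A *m (mvec B)^T) 0 0.
  transitivity (\sum_y mco (S := S) A y * mco (S := S) B y); first by [].
  by rewrite mxE big_enum_val; apply: eq_bigr => i _; rewrite !mxE.
exists (\rank V), (maxrankfun V).
have frW := maxrowsub_free V; have eqW := eq_maxrowsub V.
set g := maxrankfun V in frW eqW *; set W := rowsub g V in frW eqW *.
have WE i : row i W = mvec (v (g i)) by apply/rowP => y; rewrite !mxE.
split.
  have -> : \matrix_(i, j) ip (v (g j)) (v (g i)) = W *m W^T.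
    apply/matrixP => i j; rewrite mxE ipE !mxE.
    by apply: eq_bigr => y _; rewrite !mxE mulrC.
  exact: row_free_gram.
move=> A HA j; have : (mvec (v j) <= W)%MS.
  rewrite eqW; apply: submx_trans (row_sub j V).
  by rewrite (_ : row j V = mvec (v j))//; apply/rowP => y; rewrite !mxE.
case/submxP => u vu; rewrite ipE vu trmx_mul mulmxA mxE big1// => i _.
have -> : (mvec A *m W^T) 0 i = ip A (v (g i)).
  by rewrite ipE !mxE; apply: eq_bigr => y _; rewrite -WE !mxE.
by rewrite HA mul0r.
Qed.

End linear_functionals.

(** * Absolute continuity from one spanning configuration *)

Section abstract_dominated.
Context (R : realType) (F : hypercomplexType R) (S : scalar_structure F).
Context (n : nat) (G K : set 'M[F]_n) (gens : seq 'M[F]_n).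
Local Notation M := (borel_mx F n).
Local Notation nrm := (nrm S).
Local Notation ip := (@ip R F S n).
Variables (X : finType) (lam : X -> 'M[F]_n -> R).
Hypothesis lam_linear : forall x, real_linear (lam x).
Hypothesis lam_small : forall x e, 0 < e -> exists2 rho, 0 < rho &
  forall g g', G g -> G g' -> nball S 1%:M rho g -> nball S 1%:M rho g' ->
    `|lam x (g - g')| <= e * nrm (g - g').

Lemma common_radius (e : R) : 0 < e -> exists2 rho, 0 < rho &
  forall x g g', G g -> G g' -> nball S 1%:M rho g -> nball S 1%:M rho g' ->
    `|lam x (g - g')| <= e * nrm (g - g').
Proof.
move=> e0; have /choice[r rP] x : exists r, 0 < r /\
    forall g g', G g -> G g' -> nball S 1%:M r g -> nball S 1%:M r g' ->
    `|lam x (g - g')| <= e * nrm (g - g').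
  by have [r r0 h] := lam_small x e0; exists r.
exists (\big[Num.min/1]_x r x).
  by elim/big_ind: _ => // [a b a0 b0|x _]; [rewrite lt_min a0|case: (rP x)].
move=> x g g' Gg Gg' gb gb'; case: (rP x) => _; apply => //.
  by apply: lt_le_trans gb _; exact: bigmin_le.
by apply: lt_le_trans gb' _; exact: bigmin_le.
Qed.

(** This stands in for a manifold structure on [G]. The [lam x] cut out the tangent space at the
    identity, and on a difference of two nearby points of [G] they are small compared with the
    difference. Their share in the norm bound is therefore absorbed, and the inner products with the
    [v i] alone control distances. *)
Lemma transverse_coordinates d (v : 'I_d -> 'M[F]_n) :
  (forall A, (forall x, lam x A = 0) -> (forall i, ip A (v i) = 0) -> A = 0) ->
  exists rho L : R, 0 < rho /\ forall g g', G g -> G g' ->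
    nball S 1%:M rho g -> nball S 1%:M rho g' ->
    nrm (g - g') <= L * \sum_i `|ip g (v i) - ip g' (v i)|.
Proof.
move=> inj; pose f (z : X + 'I_d) A := match z with inl x => lam x A | inr i => ip A (v i) end.
have [z|A fA|c c0 H] := @real_linear_lower_bound _ _ S n _ f.
- by case: z => [x|i]; [exact: lam_linear|exact: ip_real_linear].
- by apply: inj => z; [exact: (fA (inl z))|exact: (fA (inr z))].
(* So small that all the [lam] terms together contribute at most half of [nrm (g - g')]. *)
pose e := (2 * c * (#|X|%:R + 1))^-1.
have e0 : 0 < e by rewrite invr_gt0 !mulr_gt0// ltr_wpDl.
have [rho rho0 small] := common_radius e0.
exists rho, (2 * c); split => // g g' Gg Gg' gb gb'.
have := H (g - g'); rewrite big_sumType /= => h.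
have h1 : \sum_x `|lam x (g - g')| <= #|X|%:R * (e * nrm (g - g')).
  rewrite mulr_natl -sumr_const; apply: ler_sum => x _; exact: small.
have h2 : \sum_i `|ip (g - g') (v i)| = \sum_i `|ip g (v i) - ip g' (v i)|.
  by apply: eq_bigr => i _; rewrite ipBl.
rewrite h2 in h.
have h3 : c * (#|X|%:R * (e * nrm (g - g'))) <= nrm (g - g') / 2.
  have -> : c * (#|X|%:R * (e * nrm (g - g'))) =
      (#|X|%:R / (#|X|%:R + 1)) * (nrm (g - g') / 2).
    by rewrite /e; field; rewrite !gt_eqF// ltr_wpDl.
  rewrite ler_piMl// ?divr_ge0 ?nrm_ge0// ler_pdivrMr ?ltr_wpDl//.
  by rewrite mul1r lerDl.
have h4 := ler_wpM2l (ltW c0) h1.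
move: h; rewrite mulrDr => h; lra.
Qed.

Hypothesis K1 : K 1%:M.
Hypothesis KM : forall g h, K g -> K h -> K (g *m h).
Hypothesis KV : forall g, K g -> exists h, K h /\ h *m g = 1%:M.
Variable B : R.
Hypothesis KB : forall g, K g -> nrm g <= B.
Hypothesis gens_cube : forall C, C \in gens -> C *m C *m C = - C.
Hypothesis gens_K : forall C t, C \in gens -> K (rodr C t).
Hypothesis Kgen : forall g, K g -> generated gens g.
Hypothesis G1 : G 1%:M.
Variable Ci : R.
Hypothesis Ginv : forall g, G g ->
  exists h, [/\ G h, h *m g = 1%:M, g *m h = 1%:M & nrm h <= Ci * nrm g].

Lemma ev_bounded (w : seq (option 'M[F]_n)) : exists2 b, 0 < b &
  forall v, (forall i, (i < slots w)%N -> K (v i)) -> nrm (ev w v) <= b.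
Proof.
have B0 : 0 <= B by apply: le_trans (KB K1); exact: nrm_ge0.
elim: w => [|[c|] w [b b0 H]].
- exists (nrm (1%:M : 'M[F]_n) + 1); first by rewrite ltr_wpDl ?nrm_ge0.
  by move=> v _; rewrite lerDl.
- exists (nrm c * b + 1); first by rewrite ltr_wpDl// mulr_ge0 ?nrm_ge0// ltW.
  move=> v vK /=; apply: le_trans (nrmM _ _ _) _.
  apply: (@le_trans _ _ (nrm c * b)); last by rewrite lerDl.
  by rewrite ler_wpM2l ?nrm_ge0// H.
- exists (B * b + 1); first by rewrite ltr_wpDl// mulr_ge0// ltW.
  move=> v vK /=; apply: le_trans (nrmM _ _ _) _.
  apply: (@le_trans _ _ (B * b)); last by rewrite lerDl.
  apply: ler_pM; rewrite ?nrm_ge0//; first by apply: KB; exact: vK.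
  by apply: H => i iw; exact: vK.
Qed.

Variable mu : {measure set M -> \bar R}.
Hypothesis haar : haar_measure G mu.

Context (w : seq (option 'M[F]_n)) (kstar : nat -> 'M[F]_n) (gi : 'M[F]_n).
Hypothesis wG : forall v, (forall i, (i < slots w)%N -> K (v i)) -> G (ev w v).
Hypothesis kstarK : forall i, K (kstar i).
Hypothesis span : forall A, (forall x, lam x A = 0) ->
  (forall i C, (i < slots w)%N -> C \in gens ->
    ip A (ev w (upd kstar i (C *m kstar i)) *m gi) = 0) -> A = 0.

(** A maximal independent subfamily of the directions at [kstar] has two uses. Its members are
    coordinates on [G] near the identity, which gives Haar balls measure at least of order m^-d. Its
    Gram determinant is the value of the Jacobian at [kstar], so the Jacobian is almost surely
    nonzero and words concentrate with the same exponent [d]. *)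
Lemma represented_dominated nu : represents K nu w -> nu `<< mu.
Proof.
move=> [d0 [T [P [k [mk nK law inv]]]]].
pose J : finType := ('I_(slots w) * 'I_(size gens))%type.
pose dir (j : J) := ev w (upd kstar j.1 (nth 0 gens j.2 *m kstar j.1)) *m gi.
have [d [g [gram ortho]]] := @gram_subfamily _ _ S n _ (fun j : 'I_#|J| => dir (enum_val j)).
pose sg i := (enum_val (g i)).1 : nat.
pose C i := nth 0 gens (enum_val (g i)).2.
pose e i := dir (enum_val (g i)).
have Cg i : C i \in gens by exact: mem_nth.
(* The final letter [gi], in the application the inverse of the word at [kstar], brings the
   derivatives at [kstar] to the identity. *)
pose w' := w ++ [:: Some gi].
have slotsE : slots w' = slots w by rewrite /slots count_cat addn0.
have evE v : ev w' v = ev w v *m gi by rewrite ev_cat /= mulmx1.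
have sgL i : (sg i < slots w')%N.
  by rewrite slotsE; exact: (ltn_ord (enum_val (g i)).1).
have inj A : (forall x, lam x A = 0) -> (forall i, ip A (e i) = 0) -> A = 0.
  move=> A0 Ae; apply: span => // i D iw Dg.
  have Di : (index D gens < size gens)%N by rewrite index_mem.
  have := ortho A Ae (enum_rank ((Ordinal iw, Ordinal Di) : J)).
  by rewrite enum_rankK /dir /= nth_index.
have [rho [L [rho0 HL]]] := transverse_coordinates inj.
have mu_low := haar_nball_lower haar G1 Ginv (l := fun i g => ip g (e i)) (rho := rho)
  (L := L) (Cl := (rho + nrm (1%:M : 'M[F]_n)) * \sum_i nrm (e i)) rho0 _ HL.
have {}mu_low K0 R0 : 0 < K0 -> 0 < R0 -> exists2 c : R, 0 < c &
    forall m g, (0 < m)%N -> G g -> nrm g <= R0 ->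
    ((c / (m ^ d)%:R)%:E <= mu (nball S g (K0 / m%:R)))%E.
  apply: mu_low => i h hb; apply: le_trans (ip_norm_le _ _ _) _.
  apply: ler_pM; rewrite ?nrm_ge0//.
    rewrite -[h](subrK 1%:M); apply: le_trans (nrmD _ _ _) _.
    by rewrite lerD2r; apply: ltW; exact: hb.
  by rewrite (bigD1 i)//= lerDl sumr_ge0// => j _; exact: nrm_ge0.
have mu_fin A r := haar_nball_fin S haar A r.
have [b b0 Hb] := ev_bounded w.
have jac_star : jac S w' sg C e kstar != 0.
  rewrite /jac (_ : \matrix_(_, _) _ = \matrix_(i, j) ip (e j) (e i))//.
  by apply/matrixP => i j; rewrite !mxE /dev evE.
have njac : P.-negligible [set z | jac S w' sg C e (k z) = 0].
  apply: (@polyfn_null _ _ S n K gens K1 gens_cube gens_K _ _ P k (slots w') mk _ _ kstar) => //.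
  - by rewrite slotsE.
  - by rewrite slotsE.
  - exact: polyfn_jac.
case: nK => N [mN N0 KN].
pose Gd := ~` N; have mGd : measurable Gd by exact: measurableC.
have GdK z i : Gd z -> (i < slots w)%N -> K (k z i).
  by move=> nz iw; apply: contrapT => nK; apply: nz; apply: KN; exists i.
have mf : measurable_fun setT (fun z => ev w (k z) : M) by exact: ev_measurable.
apply: (closed_null_dominates S) => D cD muD; rewrite law; last exact: closed_borel.
have mfD : measurable [set z | D (ev w (k z))].
  by rewrite -[X in measurable X]setTI; apply: mf => //; exact: closed_borel.
apply: (measure_negligible mfD).
(* Up to a null set the sample space is the union of these events, on each of which [concentration]
   applies with its own constant. *)
pose E l := Gd `&` [set z | l.+1%:R^-1 <= `|jac S w' sg C e (k z)|].
apply: (negligibleS (A := N `|` [set z | jac S w' sg C e (k z) = 0] `|`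
    \bigcup_l (E l `&` [set z | D (ev w (k z))]))).
  move=> z Dz; have [Nz|nNz] := pselect (N z); first by left; left.
  have [j0|/eqP j0] := pselect (jac S w' sg C e (k z) = 0); first by left; right.
  right; have [l hl] := ltr_add_invr (y := 0) (x := `|jac S w' sg C e (k z)|)
    (etrans (normr_gt0 _) j0).
  by exists l => //; split => //; split => //=; rewrite add0r in hl; exact: ltW.
apply: negligibleU; first by apply: negligibleU => //; exists N; split.
apply: negligible_bigcup => l.
have mE : measurable (E l).
  apply: measurableI => //.
  rewrite (_ : [set z | _] = (fun z => `|jac S w' sg C e (k z)|) @^-1` `[l.+1%:R^-1, +oo[); last first.
    by apply/seteqP; split => z /=; rewrite in_itv /= andbT.
  rewrite -[X in measurable X]setTI; apply: measurableT_comp => //.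
  by apply: polyfn_measurable mk; exact: polyfn_jac.
have [|||c c0 conc] := @concentration _ _ S n K gens K1 KM KV B KB gens_K w' _ _ P k mk _
  Gd mGd _ d sg C e sgL Cg l.+1%:R^-1 _.
- by rewrite slotsE.
- by rewrite slotsE.
- by rewrite invr_gt0.
have gi0 : 0 < nrm gi + 1 by rewrite ltr_wpDl// nrm_ge0.
(* Concentration is known for words times [gi]; right multiplication by [gi] stretches distances by
   at most [nrm gi + 1]. *)
have c'0 : 0 < c / (nrm gi + 1) by rewrite divr_gt0.
exists (E l `&` [set z | D (ev w (k z))]); split=> //; first exact: measurableI.
apply: (@ball_domination _ _ S n d G mu mu_fin mu_low _ T P (fun z => ev w (k z)) mf
  (E l) b (c / (nrm gi + 1)) mE b0 c'0) => // [z [Gz _]|m x m0].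
  have kK i : (i < slots w)%N -> K (k z i) by exact: GdK.
  by split; [exact: wG|exact: Hb].
have mball (h : T -> M) y r : measurable_fun setT h -> measurable (h @^-1` nball S y r).
  move=> mh; rewrite -[X in measurable X]setTI; apply: mh => //; exact: nball_borel.
apply: le_trans (conc m (x *m gi) m0); apply: le_measure; rewrite ?inE.
- by apply: measurableI => //; exact: mball.
- rewrite (_ : [set z | _] = E l `&` ((fun z => ev w' (k z) : M) @^-1` nball S (x *m gi) (c / m%:R))).
    by apply: measurableI => //; apply: mball; exact: ev_measurable.
  by apply/seteqP; split => z /= => [[]|[[]]].
move=> z [[Gz jz] bz]; split=> //; rewrite evE /nball /= -mulmxBl.
apply: le_lt_trans (nrmM _ _ _) _.
apply: (@le_lt_trans _ _ (nrm (ev w (k z) - x) * (nrm gi + 1))).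
  by rewrite ler_wpM2l ?nrm_ge0// lerDl.
by rewrite -ltr_pdivlMr//; move: bz; rewrite /nball/= mulrAC.
Qed.

End abstract_dominated.

(** * The three scalar algebras *)

Section real_structure.
Context (R : realType).

Let rco (e : 'I_1) (x : R) : R := x.
Let run (e : 'I_1) : R := 1.

Let rnbhs (x : R) U : nbhs x U ->
  exists2 r : R, 0 < r & forall y, (forall e, `|rco e (y - x)| < r) -> U y.
Proof.
move=> /nbhs_ballP[r /= r0 rU]; exists r => // y h; apply: rU.
by rewrite /ball /= distrC; exact: (h ord0).
Qed.

Definition real_structure : scalar_structure R.
Proof.
apply: (@ScalarStructure R R 1 rco run ord0) => //.
- by move=> x; rewrite big_ord1 /rco /run mulr1.
- by move=> [[|//] ?] [[|//] ?].
- by move=> a x; rewrite mulrC.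
- by move=> e x; exact: cvg_id.
- by move=> x y; rewrite !big_ord1 /rco normrM.
- by move=> x y; rewrite /= mulrC.
- by move=> x y; rewrite /rco mulrC.
- by move=> x y; rewrite big_ord1.
- by move=> e; rewrite /run mulr1.
- by move=> e; rewrite /run mulr1.
Defined.

End real_structure.

Section complex_structure.
Context (R : realType).
Local Open Scope complex_scope.
Implicit Types x y : R[i].

Let cco (e : 'I_2) x : R := if e == 0%N :> nat then complex.Re x else complex.Im x.
Let cun (e : 'I_2) : R[i] := if e == 0%N :> nat then 1 else 0 +i* 1.

Lemma Re_Im_le x : (`|complex.Re x|%:C <= `|x|) /\ (`|complex.Im x|%:C <= `|x|).
Proof.
case: x => a b; rewrite normc_def !lecR /= -!sqrtr_sqr.
by split; rewrite ler_sqrt ?addr_ge0 ?sqr_ge0// ?lerDl ?lerDr sqr_ge0.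
Qed.

Lemma cpart_continuous (f : R[i] -> R) :
  (forall x y, f (x - y) = f x - f y) -> (forall x, `|f x|%:C <= `|x|) -> continuous f.
Proof.
move=> fB fle x U /nbhs_ballP[r /= r0 rU].
apply/(@nbhs_ballP R[i] R[i]^o); exists r%:C; first by rewrite /= ltcR.
move=> y; rewrite -ball_normE /= => xy; apply: rU; rewrite /ball /= -fB.
by rewrite -ltcR; apply: le_lt_trans xy.
Qed.

Lemma Re_continuous : continuous (@complex.Re R).
Proof.
apply: cpart_continuous => x; last exact: (Re_Im_le x).1.
by move=> y; case: x y => a b [].
Qed.

Lemma Im_continuous : continuous (@complex.Im R).
Proof.
apply: cpart_continuous => x; last exact: (Re_Im_le x).2.
by move=> y; case: x y => a b [].
Qed.

Lemma all_ord2 (Q : 'I_2 -> Prop) : Q ord0 -> Q (lift ord0 ord0) -> forall e, Q e.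
Proof.
move=> h0 h1 [[|[|//]] h].
- by rewrite (_ : Ordinal h = ord0)//; apply: val_inj.
- by rewrite (_ : Ordinal h = lift ord0 ord0)//; apply: val_inj.
Qed.

Lemma nbhs_Re_Im x U : nbhs x U -> exists2 r : R, 0 < r &
  forall y, `|complex.Re (y - x)| < r -> `|complex.Im (y - x)| < r -> U y.
Proof.
move=> /(@nbhs_ballP R[i] R[i]^o)[e /= e0 eU].
have /complex_realP[r er] : e \is Num.real by exact: gtr0_real.
move: e0 eU; rewrite er ltcR => r0 eU.
exists (r / 2); first by rewrite divr_gt0.
move=> y hr hi; apply: eU; rewrite -ball_normE /= distrC.
apply: le_lt_trans (normc_le _) _; rewrite ltcR [ltRHS]splitr.
exact: ltrD.
Qed.

Lemma normr_le2 (a b c d : R) : `|a * c - b * d| <= `|a| * `|c| + `|b| * `|d|.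
Proof. by rewrite -!normrM; exact: ler_normB. Qed.

Lemma normr_le2D (a b c d : R) : `|a * c + b * d| <= `|a| * `|c| + `|b| * `|d|.
Proof. by rewrite -!normrM; exact: ler_normD. Qed.

Let sum2 (T : nmodType) (f : 'I_2 -> T) : \sum_e f e = f ord0 + f (lift ord0 ord0).
Proof. by rewrite big_ord_recl big_ord1. Qed.

Definition complex_structure : scalar_structure R[i].
Proof.
apply: (@ScalarStructure R R[i] 2 cco cun ord0).
- by move=> e [a b] [c d]; rewrite /cco; case: ifP.
- by move=> e a [b c]; rewrite /cco; case: ifP => _ /=; rewrite mul0r ?subr0 ?addr0.
- move=> [a b]; rewrite sum2 /cco /cun /=; apply/eqP.
  by rewrite eq_complex /= !(mulr0, mulr1, mul0r, subr0, addr0, add0r) !eqxx.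
- by move=> [[|[|//]] ?] [[|[|//]] ?].
- by move=> a b; exact: rmorphD.
- by move=> a b; exact: rmorphM.
- by [].
- by move=> a x; rewrite mulrC.
- by apply: all_ord2; [exact: Re_continuous|exact: Im_continuous].
- move=> x U /nbhs_Re_Im[r r0 rU]; exists r => // y h.
  by apply: rU; [exact: (h ord0)|exact: (h (lift ord0 ord0))].
- move=> [a b] [c d]; rewrite !sum2 /cco /=.
  by have := normr_le2 a b c d; have := normr_le2D a b d c; lra.
- by move=> x y; exact: rmorphD.
- by move=> x y; rewrite mulrC; exact: rmorphM.
- by move=> x; exact: conjCK.
- by move=> a; apply/eqP; rewrite eq_complex /= oppr0 !eqxx.
- by move=> e [a b]; rewrite /cco; case: ifP => _ //=; rewrite normrN.
- by move=> x y; rewrite mulrC.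
- by move=> [a b] [c d]; rewrite sum2 /cco /= mulrN opprK.
- by move=> e; rewrite /cun; case: ifP => _; apply/eqP; rewrite eq_complex /=;
    apply/andP; split; apply/eqP; ring.
- by move=> e; rewrite /cun; case: ifP => _; apply/eqP; rewrite eq_complex /=;
    apply/andP; split; apply/eqP; ring.
Defined.

End complex_structure.

Section quaternion_structure.
Context (R : realType).
Local Open Scope complex_scope.
Local Notation H := (quaternion R).
Implicit Types x y : H.

Let qco (e : 'I_4) x : R :=
  [:: complex.Re x.1; complex.Im x.1; complex.Re x.2; complex.Im x.2]`_e.
Let qun (e : 'I_4) : H :=
  nth (1 : H) [:: (1, 0); (0 +i* 1, 0); (0, 1); (0, 0 +i* 1)] e.

Let sum4 (T : nmodType) (f : 'I_4 -> T) : \sum_e f e =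
  f ord0 + (f (lift ord0 ord0) + (f (lift ord0 (lift ord0 ord0)) +
    f (lift ord0 (lift ord0 (lift ord0 ord0))))).
Proof. by rewrite !big_ord_recl big_ord0 addr0. Qed.

Let all4 (Q : 'I_4 -> Prop) : Q ord0 -> Q (lift ord0 ord0) ->
  Q (lift ord0 (lift ord0 ord0)) -> Q (lift ord0 (lift ord0 (lift ord0 ord0))) ->
  forall e, Q e.
Proof.
move=> h0 h1 h2 h3 [[|[|[|[|//]]]] h].
- by rewrite (_ : Ordinal h = ord0)//; apply: val_inj.
- by rewrite (_ : Ordinal h = lift ord0 ord0)//; apply: val_inj.
- by rewrite (_ : Ordinal h = lift ord0 (lift ord0 ord0))//; apply: val_inj.
- by rewrite (_ : Ordinal h = lift ord0 (lift ord0 (lift ord0 ord0)))//; apply: val_inj.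
Qed.

Let qeq x y : (forall e, qco e x = qco e y) -> x = y.
Proof.
case: x y => [[a b] [c d]] [[a' b'] [c' d']] h.
have := h ord0; have := h (lift ord0 ord0); have := h (lift ord0 (lift ord0 ord0)).
have := h (lift ord0 (lift ord0 (lift ord0 ord0))).
by rewrite /qco /= => -> -> -> ->.
Qed.

Let qnbhs x U : nbhs x U ->
  exists2 r : R, 0 < r & forall y, (forall e, `|qco e (y - x)| < r) -> U y.
Proof.
case: x => x1 x2 [[P Q] [/= Px Qx] PQU].
have [r r0 rP] := nbhs_Re_Im Px; have [s s0 sQ] := nbhs_Re_Im Qx.
exists (Num.min r s); first by rewrite lt_min r0.
move=> [y1 y2] h; have := h ord0; have := h (lift ord0 ord0).
have := h (lift ord0 (lift ord0 ord0)).
have := h (lift ord0 (lift ord0 (lift ord0 ord0))).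
rewrite !lt_min /qco /= => /andP[_ h3] /andP[_ h2] /andP[h1 _] /andP[h0 _].
by apply: PQU; split; [exact: rP|exact: sQ].
Qed.

Definition quaternion_structure : scalar_structure H.
Proof.
apply: (@ScalarStructure R H 4 qco qun ord0).
- move=> e [[a b] [c d]] [[a' b'] [c' d']]; move: e; apply: all4; rewrite /qco //=.
- by move=> e a [[b c] [d f]]; move: e; apply: all4; rewrite /qco /=; ring.
- by move=> [[a b] [c d]]; apply: qeq => e; rewrite sum4 /qco /qun; move: e; apply: all4 => /=; ring.
- by apply: all4; apply: all4; rewrite /qco /qun.
- by move=> a b; apply: qeq; apply: all4; rewrite /qco /= ?addr0.
- by move=> a b; apply: qeq; apply: all4; rewrite /qco /=; ring.
- by apply: qeq; apply: all4.
- by move=> a [[b c] [d f]]; apply: qeq; apply: all4; rewrite /qco /=; ring.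
- apply: all4 => x.
  + apply: (@continuous_comp _ _ _ (fun x : H => x.1 : R[i]) (@complex.Re R)).
      exact: cvg_fst.
    exact: Re_continuous.
  + apply: (@continuous_comp _ _ _ (fun x : H => x.1 : R[i]) (@complex.Im R)).
      exact: cvg_fst.
    exact: Im_continuous.
  + apply: (@continuous_comp _ _ _ (fun x : H => x.2 : R[i]) (@complex.Re R)).
      exact: cvg_snd.
    exact: Re_continuous.
  + apply: (@continuous_comp _ _ _ (fun x : H => x.2 : R[i]) (@complex.Im R)).
      exact: cvg_snd.
    exact: Im_continuous.
- exact: qnbhs.
(* Each of the sixteen products of coordinates occurs exactly once, up to sign, in the four
   coordinates of the product. *)
- move=> [[a b] [c d]] [[a' b'] [c' d']]; rewrite !sum4 /qco /=.
  have t4 (x y z t : R) : `|x + y + z + t| <= `|x| + `|y| + `|z| + `|t|.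
    by do !(apply: le_trans (ler_normD _ _) _; rewrite lerD2r).
  have h0 : `|a * a' - b * b' - (c * c' - d * - d')| <=
      `|a| * `|a'| + `|b| * `|b'| + `|c| * `|c'| + `|d| * `|d'|.
    rewrite (_ : _ - _ = a * a' + (- (b * b')) + (- (c * c')) + (- (d * d'))); last by ring.
    by apply: le_trans (t4 _ _ _ _) _; rewrite !normrN !normrM.
  have h1 : `|a * b' + b * a' - (c * - d' + d * c')| <=
      `|a| * `|b'| + `|b| * `|a'| + `|c| * `|d'| + `|d| * `|c'|.
    rewrite (_ : _ - _ = a * b' + b * a' + c * d' + (- (d * c'))); last by ring.
    by apply: le_trans (t4 _ _ _ _) _; rewrite !normrN !normrM.
  have h2 : `|a * c' - b * d' + (c * a' - d * - b')| <=
      `|a| * `|c'| + `|b| * `|d'| + `|c| * `|a'| + `|d| * `|b'|.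
    rewrite (_ : _ + _ = a * c' + (- (b * d')) + c * a' + d * b'); last by ring.
    by apply: le_trans (t4 _ _ _ _) _; rewrite !normrN !normrM.
  have h3 : `|a * d' + b * c' + (c * - b' + d * a')| <=
      `|a| * `|d'| + `|b| * `|c'| + `|c| * `|b'| + `|d| * `|a'|.
    rewrite (_ : _ + _ = a * d' + b * c' + (- (c * b')) + d * a'); last by ring.
    by apply: le_trans (t4 _ _ _ _) _; rewrite !normrN !normrM.
  apply: le_trans (lerD h0 (lerD h1 (lerD h2 h3))) _.
  by rewrite le_eqVlt; apply/orP; left; apply/eqP; ring.
- by move=> [[a b] [c d]] [[a' b'] [c' d']]; apply: qeq; apply: all4; rewrite /qco /=; ring.
- by move=> [[a b] [c d]] [[a' b'] [c' d']]; apply: qeq; apply: all4; rewrite /qco /=; ring.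
- by move=> [[a b] [c d]]; apply: qeq; apply: all4; rewrite /qco /= ?opprK.
- by move=> a; apply: qeq; apply: all4; rewrite /qco /= ?oppr0.
- by apply: all4 => -[[a b] [c d]]; rewrite /qco /= ?normrN.
- by move=> [[a b] [c d]] [[a' b'] [c' d']]; rewrite /qco /=; ring.
- by move=> [[a b] [c d]] [[a' b'] [c' d']]; rewrite sum4 /qco /=; ring.
- by apply: all4; apply: qeq; apply: all4; rewrite /qco /qun /=; ring.
- by apply: all4; apply: qeq; apply: all4; rewrite /qco /qun /=; ring.
Defined.

End quaternion_structure.

(** * Adjoints and the real trace form *)

Section adjoint_matrices.
Context (R : realType) (F : hypercomplexType R) (S : scalar_structure F).
Local Notation re := (@co R F S (re_idx S)).

Lemma adjoint_mul m n k (A : 'M[F]_(m, n)) (B : 'M[F]_(n, k)) :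
  adjoint_mx (A *m B) = adjoint_mx B *m adjoint_mx A.
Proof.
apply/matrixP => i j; rewrite !mxE (hconj_sum S); apply: eq_bigr => l _.
by rewrite (hconjM S) !mxE.
Qed.

Lemma adjointK m n (A : 'M[F]_(m, n)) : adjoint_mx (adjoint_mx A) = A.
Proof. by apply/matrixP => i j; rewrite !mxE (hconjK S). Qed.

Lemma adjointD m n (A B : 'M[F]_(m, n)) : adjoint_mx (A + B) = adjoint_mx A + adjoint_mx B.
Proof. by apply/matrixP => i j; rewrite !mxE (hconjD S). Qed.

Lemma adjointN m n (A : 'M[F]_(m, n)) : adjoint_mx (- A) = - adjoint_mx A.
Proof. by apply/matrixP => i j; rewrite !mxE (hconjN S). Qed.

Lemma adjointB m n (A B : 'M[F]_(m, n)) : adjoint_mx (A - B) = adjoint_mx A - adjoint_mx B.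
Proof. by rewrite adjointD adjointN. Qed.

Lemma adjoint0 m n : adjoint_mx (0 : 'M[F]_(m, n)) = 0.
Proof. by apply/matrixP => i j; rewrite !mxE (hconj0 S). Qed.

Lemma adjoint1 n : adjoint_mx (1%:M : 'M[F]_n) = 1%:M.
Proof.
by apply/matrixP => i j; rewrite !mxE eq_sym; case: (i == j); rewrite ?(hconj1 S) ?(hconj0 S).
Qed.

Lemma adjoint_block m1 m2 n1 n2 (A : 'M[F]_(m1, n1)) B C (D : 'M[F]_(m2, n2)) :
  adjoint_mx (block_mx A B C D) =
  block_mx (adjoint_mx A) (adjoint_mx C) (adjoint_mx B) (adjoint_mx D).
Proof. by rewrite /adjoint_mx map_block_mx tr_block_mx. Qed.

Lemma nrm_adjoint m n (A : 'M[F]_(m, n)) : nrm S (adjoint_mx A) = nrm S A.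
Proof.
rewrite !nrmE exchange_big /=; apply: eq_bigr => i _; apply: eq_bigr => j _.
by apply: eq_bigr => e _; rewrite !mxE co_conj.
Qed.

Lemma adjoint_scale m n a (A : 'M[F]_(m, n)) : adjoint_mx (rscale a A) = rscale a (adjoint_mx A).
Proof. by apply/matrixP => i j; rewrite !mxE (hconjM S) (hconj_real S) (of_realC S). Qed.

Lemma real_mxM m n k (A : 'M[R]_(m, n)) (B : 'M[R]_(n, k)) :
  real_mx F (A *m B) = real_mx F A *m real_mx F B.
Proof.
apply/matrixP => i j; rewrite !mxE (of_real_sum S); apply: eq_bigr => l _.
by rewrite !mxE (of_realM S).
Qed.

Lemma real_mx1 n : real_mx F (1%:M : 'M[R]_n) = 1%:M.
Proof. by apply/matrixP => i j; rewrite !mxE; case: eqP; rewrite ?(of_real1 S) ?(of_real0 S). Qed.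

Lemma real_mx0 m n : real_mx F (0 : 'M[R]_(m, n)) = 0.
Proof. by apply/matrixP => i j; rewrite !mxE (of_real0 S). Qed.

Lemma real_mxN m n (A : 'M[R]_(m, n)) : real_mx F (- A) = - real_mx F A.
Proof. by apply/matrixP => i j; rewrite !mxE (of_realN S). Qed.

Lemma real_mx_block m1 m2 n1 n2 (A : 'M[R]_(m1, n1)) B C (D : 'M[R]_(m2, n2)) :
  real_mx F (block_mx A B C D) = block_mx (real_mx F A) (real_mx F B) (real_mx F C) (real_mx F D).
Proof. exact: map_block_mx. Qed.

Lemma adjoint_real m n (A : 'M[R]_(m, n)) : adjoint_mx (real_mx F A) = real_mx F A^T.
Proof. by apply/matrixP => i j; rewrite !mxE (hconj_real S). Qed.

Definition retr n (A : 'M[F]_n) : R := re (\tr A).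

Lemma retr_mulC m n (A : 'M[F]_(m, n)) (B : 'M[F]_(n, m)) : retr (A *m B) = retr (B *m A).
Proof.
rewrite /retr /mxtrace !co_sum.
under eq_bigr do rewrite mxE co_sum.
rewrite exchange_big /=; apply: eq_bigr => i _; rewrite mxE co_sum.
by apply: eq_bigr => j _; rewrite reM.
Qed.

Lemma ip_retr n (A B : 'M[F]_n) : ip S A B = retr (A *m adjoint_mx B).
Proof.
rewrite /ip /retr /mxtrace co_sum.
rewrite -(pair_big xpredT xpredT (fun (ij : 'I_n * 'I_n) e =>
  mco A (ij, e) * mco (S := S) B (ij, e)))/=.
rewrite -(pair_big xpredT xpredT (fun i j => \sum_e mco A (i, j, e) * mco (S := S) B (i, j, e)))/=.
apply: eq_bigr => i _; rewrite mxE co_sum; apply: eq_bigr => j _.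
by rewrite !mxE re_conjM.
Qed.

Lemma ip_eq0 n (A : 'M[F]_n) : ip S A A = 0 -> A = 0.
Proof.
move=> /eqP; rewrite psumr_eq0; last by move=> x _; rewrite -expr2 sqr_ge0.
move=> /allP h; apply: (@mco_inj _ _ S) => x; apply/eqP.
by have := h x (mem_index_enum x); rewrite mulf_eq0 orbb mco0.
Qed.

Lemma ip_ge0 n (A : 'M[F]_n) : 0 <= ip S A A.
Proof. by apply: sumr_ge0 => x _; rewrite -expr2 sqr_ge0. Qed.

(* A self-adjoint [b] makes [Q |-> b ^ 2 Q + Q b ^ 2] positive. *)
Lemma commute_of_square n (a b bi A : 'M[F]_n) : b *m b = a -> adjoint_mx b = b ->
  bi *m b = 1%:M -> a *m a *m A = A *m (a *m a) -> a *m A = A *m a.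
Proof.
move=> ba bs bib aA; set Q := a *m A - A *m a.
have aQ : a *m Q + Q *m a = 0.
  by rewrite mulmxBr mulmxBl !mulmxA subrKA aA mulmxA subrr.
have h1 : ip S (a *m Q) Q = ip S (b *m Q) (b *m Q).
  by rewrite !ip_retr adjoint_mul bs -ba -!mulmxA retr_mulC !mulmxA.
have h2 : ip S (Q *m a) Q = ip S (Q *m b) (Q *m b).
  by rewrite !ip_retr adjoint_mul bs -ba !mulmxA.
have : ip S (b *m Q) (b *m Q) = 0.
  have : ip S (a *m Q + Q *m a) Q = 0.
    by rewrite aQ ip_retr mul0mx /retr mxtrace0 co0.
  rewrite ipDl h1 h2 => /eqP; rewrite paddr_eq0 ?ip_ge0// => /andP[/eqP].
  by [].
move/ip_eq0 => bQ; have : Q = 0 by rewrite -[Q]mul1mx -bib -mulmxA bQ mulmx0.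
by move/subr0_eq.
Qed.

End adjoint_matrices.

(** * The Cartan subgroup and transversality *)

Section cartan_exponential.
Context (R : realType) (p q : nat).
Hypothesis pq : (p <= q)%N.
Implicit Types (v w : 'rV[R]_p).

Definition incl : 'M[R]_(p, q) := \matrix_(i, j) (i == j :> nat)%:R.

Lemma incl_tr : incl *m incl^T = 1%:M.
Proof.
apply/matrixP => i j; rewrite !mxE.
have iq : (i < q)%N by exact: leq_trans pq.
rewrite (bigD1 (Ordinal iq))//= big1 ?addr0 => [|l /eqP li].
  by rewrite !mxE /= eqxx mul1r eq_sym.
by rewrite !mxE (_ : _ == _ = false) ?mul0r//; apply/eqP => il; apply: li; apply: val_inj.
Qed.

(** These matrices multiply like [p] copies of the split-complex numbers v + w j with j^2 = 1
    ([hypm0M]). Their unit is the projection onto the first 2p coordinates, and [hyp_rest] is the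
    complementary projection. *)
Definition hypm0 v w : 'M[R]_(p + q) :=
  block_mx (diag_mx v) (diag_mx w *m incl) (incl^T *m diag_mx w)
    (incl^T *m diag_mx v *m incl).

Definition rowM v w : 'rV[R]_p := \row_i (v 0 i * w 0 i).

Lemma diag_mxM v w : diag_mx v *m diag_mx w = diag_mx (rowM v w).
Proof. by rewrite mulmx_diag; congr diag_mx; apply/rowP => i; rewrite !mxE. Qed.

Lemma hypm0D v w v' w' : hypm0 v w + hypm0 v' w' = hypm0 (v + v') (w + w').
Proof.
by rewrite /hypm0 add_block_mx !raddfD /= !(mulmxDl, mulmxDr).
Qed.

Lemma hypm0M v w v' w' : hypm0 v w *m hypm0 v' w' =
  hypm0 (rowM v v' + rowM w w') (rowM v w' + rowM w v').
Proof.
rewrite /hypm0 mulmx_block !raddfD /= -!diag_mxM !(mulmxDl, mulmxDr) !mulmxA.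
have e k (A : 'M[R]_(k, p)) : A *m incl *m incl^T = A by rewrite -mulmxA incl_tr mulmx1.
by congr block_mx; rewrite ?e //; rewrite addrC ?e.
Qed.

Definition hyp_rest : 'M[R]_(p + q) := 1%:M - hypm0 (const_mx 1) 0.

Definition hypm v w := hypm0 v w + hyp_rest.

Lemma rowMC v w : rowM v w = rowM w v.
Proof. by apply/rowP => i; rewrite !mxE mulrC. Qed.

Lemma rowM1 v : rowM v (const_mx 1) = v.
Proof. by apply/rowP => i; rewrite !mxE mulr1. Qed.

Lemma rowM0 v : rowM v 0 = 0.
Proof. by apply/rowP => i; rewrite !mxE mulr0. Qed.

Lemma hypm0_rest v w : hypm0 v w *m hyp_rest = 0.
Proof. by rewrite /hyp_rest mulmxBr mulmx1 hypm0M !rowM1 !rowM0 addr0 add0r subrr. Qed.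

Lemma hyp_rest_hypm0 v w : hyp_rest *m hypm0 v w = 0.
Proof.
by rewrite /hyp_rest mulmxBl mul1mx hypm0M ![rowM (const_mx 1) _]rowMC !rowM1
  ![rowM 0 _]rowMC !rowM0 !addr0 subrr.
Qed.

Lemma hyp_rest_idem : hyp_rest *m hyp_rest = hyp_rest.
Proof. by rewrite {1}/hyp_rest mulmxBl mul1mx hypm0_rest subr0. Qed.

Lemma hypmM v w v' w' : hypm v w *m hypm v' w' =
  hypm (rowM v v' + rowM w w') (rowM v w' + rowM w v').
Proof.
rewrite /hypm -hypm0M mulmxDl mulmxDr [hyp_rest *m _]mulmxDr.
by rewrite hypm0_rest hyp_rest_hypm0 hyp_rest_idem addr0 add0r.
Qed.

Lemma hypm1 : hypm (const_mx 1) 0 = 1%:M.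
Proof. by rewrite /hypm /hyp_rest addrC subrK. Qed.

Lemma hypm0_tr v w : (hypm0 v w)^T = hypm0 v w.
Proof.
by rewrite /hypm0 tr_block_mx !trmx_mul !tr_diag_mx trmxK mulmxA.
Qed.

Lemma hypm_tr v w : (hypm v w)^T = hypm v w.
Proof. by rewrite /hypm /hyp_rest linearD linearB /= trmx1 !hypm0_tr. Qed.

Lemma cartan_mxE (H : 'rV[R]_p) : cartan_mx q H = hypm0 0 H.
Proof.
have e : \matrix_(i < p, j < q) (H 0 i *+ (i == j :> nat)) = diag_mx H *m incl.
  by apply/matrixP => i j; rewrite mul_diag_mx !mxE mulr_natr.
rewrite /cartan_mx e /hypm0 trmx_mul tr_diag_mx; congr block_mx.
  by apply/matrixP => i j; rewrite !mxE mul0rn.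
rewrite (_ : diag_mx 0 = 0) ?mulmx0 ?mul0mx//.
by apply/matrixP => i j; rewrite !mxE mul0rn.
Qed.

Definition evens (H : 'rV[R]_p) k : 'rV[R]_p := \row_i ((H 0 i ^+ k + (- H 0 i) ^+ k) / 2).
Definition odds (H : 'rV[R]_p) k : 'rV[R]_p := \row_i ((H 0 i ^+ k - (- H 0 i) ^+ k) / 2).

Lemma cartan_mx_pow H k : (cartan_mx q H : 'M[R]_(p + q)) ^+ k =
  hypm0 (evens H k) (odds H k) + hyp_rest *+ (k == 0%N).
Proof.
elim: k => [|k ih].
  rewrite expr0 mulr1n; apply: (etrans (esym hypm1)); rewrite /hypm; congr (_ + _).
  congr hypm0.
    by apply/rowP => i; rewrite !mxE !expr0; field.
  by apply/rowP => i; rewrite !mxE !expr0; field.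
rewrite exprSr ih mulr0n addr0.
rewrite (_ : ?[x] * ?[y] = ?x *m ?y)// cartan_mxE mulmxDl hypm0M.
have -> : hyp_rest *+ (k == 0%N) *m hypm0 0 H = 0.
  by case: (k == 0%N); rewrite ?mulr0n ?mul0mx// mulr1n hyp_rest_hypm0.
by rewrite addr0; congr hypm0; apply/rowP => i; rewrite !mxE !exprSr; field.
Qed.

Definition cosh_row (H : 'rV[R]_p) : 'rV[R]_p := \row_i ((expR (H 0 i) + expR (- H 0 i)) / 2).
Definition sinh_row (H : 'rV[R]_p) : 'rV[R]_p := \row_i ((expR (H 0 i) - expR (- H 0 i)) / 2).

Lemma cvg_mx m n (u : nat -> 'M[R]_(m, n)) (A : 'M[R]_(m, n)) :
  (forall i j, (fun k => u k i j) @ \oo --> A i j) -> u @ \oo --> A.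
Proof.
move=> ucv B [P PA PB].
have : \forall k \near \oo, forall i, forall j, P i j (u k i j).
  by apply: filter_forall => i; apply: filter_forall => j; exact: (ucv i j _ (PA i j)).
by apply: filterS => k Pk; apply: PB => i j; exact: Pk.
Qed.

Lemma hypm0Z a v w : a *: hypm0 v w = hypm0 (a *: v) (a *: w).
Proof. by rewrite /hypm0 scale_block_mx !linearZ /= !(scalemxAl, scalemxAr). Qed.

Lemma hypm0_delta v w : hypm0 v w = \sum_i (v 0 i *: hypm0 (delta_mx 0 i) 0 +
  w 0 i *: hypm0 0 (delta_mx 0 i)).
Proof.
rewrite (eq_bigr (fun i => hypm0 (v 0 i *: delta_mx 0 i) (w 0 i *: delta_mx 0 i))); last first.
  by move=> i _; rewrite !hypm0Z hypm0D !scaler0 addr0 add0r.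
have h0 : hypm0 0 0 = 0.
  by have := hypm0Z 0 0 0; rewrite !scale0r.
rewrite {1}(row_sum_delta v) {1}(row_sum_delta w).
elim/big_rec3: _ => [//|i x y z _ <-].
by rewrite hypm0D.
Qed.

(** The generator is the split-complex number H j, so the partial sums of its exponential are
    combinations of those of the scalar series at H and -H. The complement [hyp_rest] enters only
    through the term of index 0, which is why the sequence is shifted by one. *)
Lemma expmx_cartan H : expmx (cartan_mx q H) = hypm (cosh_row H) (sinh_row H).
Proof.
pose e (x : R) n := series (exp_coeff x) n.
have ecvg x : e x @ \oo --> expR x by exact: is_cvg_series_exp_coeff.
have eS x n : e x n.+1 = e x n + n`!%:R^-1 * x ^+ n.
  by rewrite /e /series /= big_nat_recr//= /exp_coeff mulrC.
have e0 x : e x 0%N = 0 by rewrite /e /series /= big_geq.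
pose E n : 'rV[R]_p := \row_i ((e (H 0 i) n + e (- H 0 i) n) / 2).
pose O n : 'rV[R]_p := \row_i ((e (H 0 i) n - e (- H 0 i) n) / 2).
have sumE n : series (fun k => k`!%:R^-1 *: (cartan_mx q H : 'M[R]_(p + q)) ^+ k) n =
    hypm0 (E n) (O n) + hyp_rest *+ (0 < n)%N.
  rewrite /series /=; elim: n => [|n ih].
    have -> : E 0%N = 0 by apply/rowP => i; rewrite !mxE !e0 addr0 mul0r.
    have -> : O 0%N = 0 by apply/rowP => i; rewrite !mxE !e0 subrr mul0r.
    rewrite mulr0n addr0; have := hypm0Z 0 0 0; rewrite !scale0r => <-.
    by apply: big_geq.
  rewrite big_nat_recr//= ih cartan_mx_pow scalerDr addrACA hypm0Z hypm0D.
  congr (_ + _); first congr hypm0.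
  - by apply/rowP => i; rewrite !mxE !eS; field; rewrite pnatr_eq0 -lt0n fact_gt0.
  - by apply/rowP => i; rewrite !mxE !eS; field; rewrite pnatr_eq0 -lt0n fact_gt0.
  - by case: n {ih} => [|n]; rewrite ?mulr0n ?scaler0 ?addr0// add0r fact0 invr1 scale1r.
have Ecv i : (fun n => E n 0 i) @ \oo --> cosh_row H 0 i.
  rewrite mxE; under eq_fun do rewrite mxE.
  by apply: cvgM; [apply: cvgD; exact: ecvg|exact: cvg_cst].
have Ocv i : (fun n => O n 0 i) @ \oo --> sinh_row H 0 i.
  rewrite mxE; under eq_fun do rewrite mxE.
  by apply: cvgM; [apply: cvgB; exact: ecvg|exact: cvg_cst].
apply: cvg_lim; first exact: (mx_hausdorff (real_structure R)).
rewrite -(cvg_shiftS _); apply: cvg_mx => i j /=.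
have hE v w : hypm v w i j = \sum_k (v 0 k * hypm0 (delta_mx 0 k) 0 i j +
    w 0 k * hypm0 0 (delta_mx 0 k) i j) + hyp_rest i j.
  rewrite /hypm hypm0_delta mxE summxE; congr (_ + _); apply: eq_bigr => k _.
  by rewrite mxE; congr (_ + _); exact: mxE.
under eq_fun do rewrite sumE mulr1n -/(hypm _ _) hE.
rewrite hE; apply: cvgD; last exact: cvg_cst.
elim: (index_enum _) => [|k s ih].
  by rewrite big_nil; under eq_fun do rewrite big_nil; exact: cvg_cst.
rewrite big_cons; under eq_fun do rewrite big_cons.
apply: cvgD; last exact: ih.
have := Ecv k; rewrite -(cvg_shiftS _) => Ek.
have := Ocv k; rewrite -(cvg_shiftS _) => Ok.
by apply: cvgD; apply: cvgM; by [exact: Ek|exact: Ok|exact: cvg_cst].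
Qed.

End cartan_exponential.

(** * The combinatorics of commuting with p conjugates *)

Section vanishing_pattern.
Variables (p q : nat) (T : eqType) (c : 'I_p -> T) (d : 'I_q -> T) (one : T).
Variables (w : 'I_p -> 'I_q) (o : 'I_q) (i0 : 'I_p) (z : 'I_p -> 'I_q -> Prop).
Hypothesis w_inj : injective w.
Hypothesis wo : forall i, w i != o.
Hypothesis wP : forall m, (exists i, m = w i) \/ (forall i, w i != m).
Hypothesis dw : forall i, d (w i) = c i.
Hypothesis ci0 : c i0 != one.
Hypothesis p2 : (1 < p)%N.

(** The [j]-th conjugation puts the index [i0], where [c] is nontrivial, in row [j]. On columns it
    sends [w i0] to the spare column [o], sends [o] to [w j] and, for [j] other than [i0], sends
    [w j] to [w i0]. *)
Let sig j : {perm 'I_p} := tperm i0 j.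
Let tau j : {perm 'I_q} := (tperm (w i0) (w j) * tperm (w j) o)%g.

Hypothesis diag_eq : forall (j i : 'I_p) (m : 'I_q), d m != c i -> z (sig j i) (tau j m).
Hypothesis sym_eq : forall j i l : 'I_p, c l != one ->
  z (sig j l) (tau j (w i)) -> z (sig j i) (tau j (w l)).
Hypothesis out_eq : forall (j i : 'I_p) (m : 'I_q), c i != one -> (forall l, w l != m) -> z (sig j i) (tau j m).

Let sig_jE j : sig j i0 = j. Proof. exact: tpermL. Qed.
Let sig_K j i : sig j (sig j i) = i. Proof. exact: tpermK. Qed.
Let tau_w j i : sig j i != j -> tau j (w i) = w (sig j i).
Proof.
move=> sj; rewrite permM.
have -> : tperm (w i0) (w j) (w i) = w (sig j i).
  rewrite /sig; case: tpermP => [/w_inj ->|/w_inj ->|n1 n2].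
  - by rewrite tpermL.
  - by rewrite tpermR.
  - by rewrite tpermD//; apply/eqP => e; [apply: n1|apply: n2]; rewrite e.
by rewrite tpermD ?(inj_eq w_inj)// eq_sym.
Qed.
Let tau_i0 j : tau j (w i0) = o.
Proof. by rewrite permM tpermL tpermL. Qed.
Let tau_o j : tau j o = w j.
Proof. by rewrite permM (@tpermD _ _ _ o) ?tpermR. Qed.
Let tau_N j m : (forall i, w i != m) -> m != o -> tau j m = m.
Proof. by move=> mw mo; rewrite permM !tpermD// eq_sym. Qed.

Let zo j r : c (sig j r) != c i0 -> z r o.
Proof.
move=> h; have := @diag_eq j (sig j r) (w i0).
by rewrite sig_K tau_i0 dw; apply; rewrite eq_sym.
Qed.

Let zdiag j r : r != j -> c (sig j r) != one -> z r (w j).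
Proof.
move=> rj h; have := @out_eq j (sig j r) o h wo.
by rewrite sig_K tau_o.
Qed.

Let zo_sym j r : r != j -> z j (w r) -> z r o.
Proof.
move=> rj h; have := @sym_eq j (sig j r) i0 ci0.
by rewrite sig_jE sig_K tau_i0 tau_w ?sig_K//; apply.
Qed.

(** If the value of [c] met at row [r] differs from [c i0], the diagonal equation applies. Otherwise
    [out_eq] kills the entry whose mirror image under [sym_eq] is the wanted one. For [r = i0] this
    takes some [j] other than [i0], and here two rows are needed. *)
Let z_col_o r : z r o.
Proof.
have [->|ri0] := eqVneq r i0; last first.
  have [cr|cr] := eqVneq (c r) (c i0); last first.
    by apply: (@zo i0); rewrite /sig tperm1 perm1.
  apply: (@zo_sym i0) => //; apply: zdiag; first by rewrite eq_sym.
  by rewrite /sig tpermL cr.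
have [j ji0] : exists j, j != i0.
  have [e|] := eqVneq i0 (Ordinal p2); last by exists (Ordinal p2); rewrite eq_sym.
  by exists (Ordinal (ltnW p2)); rewrite e.
have [cr|cr] := eqVneq (c j) (c i0); last first.
  by apply: (@zo j); rewrite /sig tpermL.
apply: (@zo_sym j); first by rewrite eq_sym.
by apply: zdiag => //; rewrite /sig tperm1 perm1 cr.
Qed.

(** The conjugation with [j = r] puts the nontrivial index in row [r]. Then [out_eq] kills the
    columns outside the image of [w], column [o] being already done, and also column [w r], into
    which [o] is moved. Each remaining entry falls to [diag_eq] or, through [sym_eq], to the
    vanishing of column [o]. *)
Lemma vanishing_pattern r m : z r m.
Proof.
case: (wP m) => [[i ->]|mw]; last first.
  have [->//|mo] := eqVneq m o.
  have := @out_eq r i0 m ci0 mw; rewrite sig_jE tau_N//.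
have [->|ir] := eqVneq i r.
  have := @out_eq r i0 o ci0 wo; rewrite sig_jE tau_o//.
have [c1|c1] := eqVneq (c (sig r i)) one.
  have := @diag_eq r i0 (w (sig r i)).
  by rewrite sig_jE tau_w ?sig_K//; apply; rewrite dw c1 eq_sym.
have := @sym_eq r i0 (sig r i) c1.
by rewrite sig_K sig_jE tau_i0 tau_w ?sig_K//; apply.
Qed.

End vanishing_pattern.

Section cartan_group.
Context (R : realType) (p q : nat).
Hypothesis pq : (p <= q)%N.
Implicit Types H : 'rV[R]_p.

Definition cart H : 'M[R]_(p + q) := hypm q (cosh_row H) (sinh_row H).

Lemma cartD H H' : cart (H + H') = cart H *m cart H'.
Proof.
rewrite /cart hypmM//.
have <- : cosh_row (H + H') = rowM (cosh_row H) (cosh_row H') + rowM (sinh_row H) (sinh_row H').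
  by apply/rowP => i; rewrite !mxE opprD !expRD; field.
suff <- : sinh_row (H + H') = rowM (cosh_row H) (sinh_row H') + rowM (sinh_row H) (cosh_row H') by [].
by apply/rowP => i; rewrite !mxE opprD !expRD; field.
Qed.

Lemma cart0 : cart 0 = 1%:M.
Proof.
rewrite -(hypm1 R p q) /cart.
have -> : cosh_row 0 = const_mx 1 :> 'rV[R]_p.
  by apply/rowP => i; rewrite !mxE oppr0 expR0; field.
by have -> : sinh_row 0 = 0 :> 'rV[R]_p by apply/rowP => i; rewrite !mxE oppr0 expR0 subrr mul0r.
Qed.

Lemma cartNK H : cart (- H) *m cart H = 1%:M.
Proof. by rewrite -cartD addNr cart0. Qed.

Lemma cart_tr H : (cart H)^T = cart H.
Proof. exact: hypm_tr. Qed.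

(** The self-adjoint square root required by [commute_of_square], and the reason for determinant 1
    in [det_cart]. *)
Lemma cart_half H : cart (2^-1 *: H) *m cart (2^-1 *: H) = cart H.
Proof. by rewrite -cartD -scalerDl [_ + _](_ : _ = 1) ?scale1r//; field. Qed.

Lemma cosh_sqr H i : cosh_row H 0 i ^+ 2 - sinh_row H 0 i ^+ 2 = 1.
Proof.
by rewrite !mxE expRN; field; rewrite gt_eqF// expR_gt0.
Qed.

Lemma cosh_gt0 H i : 0 < cosh_row H 0 i.
Proof. by rewrite mxE divr_gt0// addr_gt0// expR_gt0. Qed.

Lemma sinh_eq0 H i : (sinh_row H 0 i == 0) = (H 0 i == 0).
Proof.
rewrite mxE mulf_eq0 invr_eq0 pnatr_eq0 orbF subr_eq0 (inj_eq (@expR_inj R)).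
by rewrite -addr_eq0 -mulr2n mulrn_eq0.
Qed.

Lemma cosh_eq1 H i : (cosh_row H 0 i == 1) = (sinh_row H 0 i == 0).
Proof.
have cs := cosh_sqr H i; have c0 := cosh_gt0 H i; apply/eqP/eqP => h.
  by move: cs; rewrite h => cs; apply/eqP; rewrite -sqrf_eq0; apply/eqP; lra.
move: cs; rewrite h => cs; have : (cosh_row H 0 i - 1) * (cosh_row H 0 i + 1) = 0 by nra.
by move=> /eqP; rewrite mulf_eq0 => /orP[/eqP|/eqP]; lra.
Qed.

Lemma cartE H : cart H = block_mx (diag_mx (cosh_row H))
  (diag_mx (sinh_row H) *m incl R p q) ((incl R p q)^T *m diag_mx (sinh_row H))
  (1%:M + (incl R p q)^T *m diag_mx (cosh_row H - const_mx 1) *m incl R p q).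
Proof.
rewrite /cart /hypm /hyp_rest /hypm0 -[X in _ + (X - _)]submxK.
rewrite scalar_mx_block block_mxKul block_mxKur block_mxKdl block_mxKdr.
rewrite opp_block_mx !add_block_mx.
have d1 : diag_mx (const_mx 1) = 1%:M :> 'M[R]_p.
  by apply/matrixP => i j; rewrite !mxE.
rewrite d1.
have d0 : diag_mx 0 = 0 :> 'M[R]_p by rewrite raddf0.
rewrite subrr d0 mul0mx mulmx0 !subr0 !addr0 mulmx1.
by rewrite raddfB /= d1 mulmxBr mulmxBl mulmx1 addrCA.
Qed.

Lemma incl_diag (v : 'rV[R]_p) m m' : ((incl R p q)^T *m diag_mx v *m incl R p q) m m' =
  (\sum_(i < p | i == m :> nat) v 0 i) *+ (m == m').
Proof.
rewrite mxE -sumrMnl [RHS]big_mkcond; apply: eq_bigr => i _.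
rewrite mul_mx_diag !mxE.
case: (eqVneq (i : nat) m) => im; rewrite ?mul1r ?mul0r ?mul0rn//.
by rewrite im mulr_natr -val_eqE.
Qed.

End cartan_group.

Section cartan_pairs.
Context (R : realType) (F : hypercomplexType R) (S : scalar_structure F).
Context (p q : nat).
Local Notation M := 'M[F]_(p + q).
Local Notation Sg := (signature_mx p q : M).
Variables (G K : set M).

(* The [pair_gens] generate [K] through the rotations [rodr C t], and the *)
(* [pair_lam] are the differentials at [1] of equations satisfied on [G]. *)
Record cartan_pair := CartanPair {
  pair_gens : seq M;
  pair_idx : finType;
  pair_lam : pair_idx -> M -> R;
  pair_lam_linear : forall x, real_linear (pair_lam x);
  pair_lam_small : forall x e, 0 < e -> exists2 rho, 0 < rho &
    forall g g', G g -> G g' -> nball S 1%:M rho g -> nball S 1%:M rho g' ->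
      `|pair_lam x (g - g')| <= e * nrm S (g - g');
  tangent_skew : forall Z, (forall x, pair_lam x Z = 0) ->
    adjoint_mx Z *m Sg + Sg *m Z = 0;
  tangent_conj : forall h h' Z, pseudo_unitary p q h -> h *m h' = 1%:M -> h' *m h = 1%:M ->
    (forall x, pair_lam x Z = 0) -> forall x, pair_lam x (h' *m Z *m h) = 0;
  tangent_orth : forall Z, (forall x, pair_lam x Z = 0) ->
    (forall C, C \in pair_gens -> retr S (Z *m C) = 0) ->
    ulsubmx Z = 0 /\ drsubmx Z = 0;
  gens_skew : forall C, C \in pair_gens -> adjoint_mx C = - C;
  gens_block : forall C, C \in pair_gens -> C *m Sg = Sg *m C;
  pair_gens_cube : forall C, C \in pair_gens -> C *m C *m C = - C;
  pair_gens_K : forall C t, C \in pair_gens -> K (rodr C t);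
  pair_generated : forall g, K g -> generated pair_gens g;
  pair_KM : forall g h, K g -> K h -> K (g *m h);
  pair_K_adj : forall g, K g -> K (adjoint_mx g);
  pair_K_unitary : K `<=` unitary (p + q);
  pair_KG : K `<=` G;
  pair_SO : forall k1 k2, SO p k1 -> SO q k2 ->
    K (block_diag_mx (real_mx F k1) (real_mx F k2));
  pair_GM : forall g h, G g -> G h -> G (g *m h);
  pair_G_adj : forall g, G g -> G (Sg *m adjoint_mx g *m Sg);
  pair_G_pseudo : G `<=` pseudo_unitary p q;
  pair_cart : forall H, G (real_mx F (cart q H))
}.

End cartan_pairs.

Section signatures.
Context (R : realType) (F : hypercomplexType R) (S : scalar_structure F).
Context (p q : nat).
Local Notation M := 'M[F]_(p + q).
Local Notation Sg := (signature_mx p q : M).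
Local Notation PU := (@pseudo_unitary R F p q).

Lemma sig_sqr : Sg *m Sg = 1%:M.
Proof.
rewrite /signature_mx mulmx_block !mul0mx !mulmx0 mulNmx mulmxN opprK !mulmx1.
by rewrite !addr0 add0r -scalar_mx_block.
Qed.

Lemma sig_adj : adjoint_mx Sg = Sg.
Proof.
by rewrite /signature_mx adjoint_block !(adjoint0 S) (adjointN S) !(adjoint1 S).
Qed.

Lemma sigK m (A : 'M[F]_(_, m)) : Sg *m (Sg *m A) = A.
Proof. by rewrite mulmxA sig_sqr mul1mx. Qed.

Lemma sigKr m (A : 'M[F]_(m, _)) : A *m Sg *m Sg = A.
Proof. by rewrite -mulmxA sig_sqr mulmx1. Qed.

Lemma real_sig : real_mx F (signature_mx p q : 'M[R]_(p + q)) = Sg.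
Proof.
by rewrite /signature_mx real_mx_block (real_mxN S) !(real_mx0 S) !(real_mx1 S).
Qed.

(** The inverse on pseudo-unitary matrices, extended to an involutive anti-automorphism of all
    matrices; on the Lie algebra it is the change of sign. *)
Definition pinv (g : M) : M := locked (Sg *m adjoint_mx g *m Sg).

Lemma pinvE g : pinv g = Sg *m adjoint_mx g *m Sg.
Proof. by rewrite /pinv -lock. Qed.

Lemma pseudo_pinv g : PU g -> pinv g *m g = 1%:M.
Proof. by move=> gu; rewrite !pinvE -!mulmxA [adjoint_mx _ *m _]mulmxA gu sig_sqr. Qed.

Lemma pinvK g : pinv (pinv g) = g.
Proof.
by rewrite !pinvE !(adjoint_mul S) sig_adj (adjointK S) !mulmxA sig_sqr mul1mx sigKr.
Qed.

Lemma pinvM g h : pinv (g *m h) = pinv h *m pinv g.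
Proof. by rewrite !pinvE (adjoint_mul S) !mulmxA sigKr. Qed.

Lemma pinv1 : pinv 1%:M = 1%:M.
Proof. by rewrite !pinvE (adjoint1 S) mulmx1 sig_sqr. Qed.

Lemma pseudo_of_pinv g : pinv g *m g = 1%:M -> PU g.
Proof.
rewrite /pseudo_unitary pinvE /= => h.
by have := congr1 (mulmx Sg) h; rewrite !mulmxA sig_sqr mul1mx mulmx1.
Qed.

Lemma pseudoM g h : PU g -> PU h ->
  PU (g *m h).
Proof.
move=> /pseudo_pinv gu /pseudo_pinv hu; apply: pseudo_of_pinv.
by rewrite pinvM mulmxA -(mulmxA (pinv h)) gu mulmx1.
Qed.

Lemma pseudo1 : PU (1%:M : M).
Proof. by apply: pseudo_of_pinv; rewrite pinv1 mulmx1. Qed.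

Lemma pseudo_sig : PU Sg.
Proof. by rewrite /pseudo_unitary /= sig_adj sig_sqr mul1mx. Qed.

Lemma unitary_pseudo g : unitary (p + q) g -> g *m Sg = Sg *m g -> PU g.
Proof.
by rewrite /unitary /pseudo_unitary /= => gu gI; rewrite -mulmxA -gI mulmxA gu mul1mx.
Qed.

Lemma sig_cart H : (p <= q)%N ->
  (signature_mx p q : 'M[R]_(p + q)) *m cart q H *m signature_mx p q = cart q (- H).
Proof.
move=> pq; rewrite !cartE// /signature_mx !mulmx_block !mul0mx !mulmx0 !mulNmx !mulmxN.
have -> : sinh_row (- H) = - sinh_row H.
  by apply/rowP => i; rewrite !mxE opprK -mulNr opprB.
have -> : cosh_row (- H) = cosh_row H.
  by apply/rowP => i; rewrite !mxE opprK addrC.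
rewrite !(mul1mx, mulmx1, addr0, add0r) opprK raddfN /=.
by rewrite !(mulNmx, mulmxN).
Qed.

Lemma adjoint_cart (H : 'rV[R]_p) : adjoint_mx (real_mx F (cart q H)) = real_mx F (cart q H).
Proof. by rewrite (adjoint_real S) cart_tr. Qed.

Lemma pseudo_cart H : (p <= q)%N -> PU (real_mx F (cart q H)).
Proof.
move=> pq; apply: pseudo_of_pinv; rewrite pinvE adjoint_cart -real_sig.
by rewrite -!(real_mxM S) sig_cart// cartNK// (real_mx1 S).
Qed.

(** The scalars need not commute, so the claim is transported to the real matrices of left
    multiplication acting on coordinate vectors. *)
Lemma mulmx_left_inv (A B : M) : A *m B = 1%:M -> B *m A = 1%:M.
Proof.
pose L (C : M) : 'M[R]_#|{: coidx S (p + q) (p + q)}| := \matrix_i mvec S (C *m @mbasis R F S (p + q) (enum_val i)).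
have LE C X : mvec S (C *m X) = mvec S X *m L C.
  rewrite mulmx_sum_row {1}(mbasis_sum S X) mulmx_sumr.
  rewrite (big_morph _ (@mvecD _ _ S _ _) (_ : mvec S 0 = 0)); last first.
    by apply/rowP => x; rewrite !mxE mco0.
  rewrite (reindex (@enum_val _ {: coidx S (p + q) (p + q)}))/=; last first.
    by exists enum_rank => y _; rewrite ?enum_valK ?enum_rankK.
  by apply: eq_bigr => i _; rewrite (rscaleAr S) mvecZ rowK mxE.
move=> AB.
have LL : L B *m L A = 1%:M.
  apply/row_matrixP => i; have := LE A (B *m munvec (delta_mx 0 i)).
  by rewrite mulmxA AB mul1mx LE !munvecK => e; rewrite !rowE mulmx1 mulmxA -e.
move/mulmx1C: LL => LL.
apply: (@mvec_inj _ _ S); rewrite -[A]mulmx1 !LE -!mulmxA LL mulmx1.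
by [].
Qed.

Lemma pseudo_pinvr g : PU g -> g *m pinv g = 1%:M.
Proof. by move/pseudo_pinv/mulmx_left_inv. Qed.

End signatures.

(** * Tangent vectors orthogonal to the derivatives of a word *)

Section transversality.
Context (R : realType) (F : hypercomplexType R) (S : scalar_structure F).
Context (p q : nat) (G K : set 'M[F]_(p + q)).
Local Notation M := 'M[F]_(p + q).
Local Notation Sg := (signature_mx p q : M).
Local Notation PU := (@pseudo_unitary R F p q).
Variable P : cartan_pair S G K.
Local Notation gens := (pair_gens P).
Hypothesis pq : (p < q)%N.
Let pq' := ltnW pq.
Variable H : 'rV[R]_p.
Local Notation a := (real_mx F (cart q H) : M).
Local Notation word l := (delta_word a l).
Implicit Types (k : nat -> M) (Y Z : M).

Lemma slots_delta_word l : slots (word l) = l.*2.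
Proof. by elim: l => [//|l ih]; rewrite /= -/(slots _) ih. Qed.

(** The derivative in slot [i] along [C], translated to the identity: [C] conjugated by the part of
    the word that precedes the slot. *)
Definition dev_ratio (w : seq (option M)) k i C :=
  ev w (upd k i (C *m k i)) *m pinv (ev w k).

Lemma pair_K_pseudo g : K g -> PU g.
Proof. by move=> Kg; apply: (pair_G_pseudo P); exact: (pair_KG P). Qed.

Lemma pair_K_pinv g : K g -> pinv g = adjoint_mx g.
Proof.
move=> Kg; have gu := pair_K_unitary P Kg.
rewrite -[pinv g]mulmx1 -(pair_K_unitary P (pair_K_adj P Kg)) (adjointK S) mulmxA.
by rewrite pseudo_pinv ?mul1mx//; exact: pair_K_pseudo.
Qed.

Lemma ev_pseudo l k : (forall i, K (k i)) -> PU (ev (word l) k).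
Proof.
elim: l k => [|l ih] k Kk /=; first by rewrite mulmx1; exact: pseudo1.
apply: (pseudoM S); first exact: pair_K_pseudo.
apply: (pseudoM S); first exact: pseudo_cart.
apply: (pseudoM S); first exact: pair_K_pseudo.
by apply: ih => i; exact: Kk.
Qed.

Lemma dev_ratio0 l k C : (forall i, K (k i)) -> dev_ratio (word l.+1) k 0 C = C.
Proof.
move=> Kk; rewrite /dev_ratio.
have -> : ev (word l.+1) (upd k 0 (C *m k 0%N)) = C *m ev (word l.+1) k.
  by rewrite /= /upd /= !mulmxA.
by rewrite -mulmxA (pseudo_pinvr S) ?mulmx1//; exact: ev_pseudo.
Qed.

Lemma dev_ratio1 l k C : (forall i, K (k i)) ->
  dev_ratio (word l.+1) k 1 C = (k 0%N *m a) *m C *m pinv (k 0%N *m a).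
Proof.
move=> Kk; rewrite /dev_ratio.
have -> : ev (word l.+1) (upd k 1 (C *m k 1%N)) =
    (k 0%N *m a *m C) *m (k 1%N *m ev (word l) (fun i => k i.+2)).
  by rewrite /= /upd /= !mulmxA.
have -> : ev (word l.+1) k = k 0%N *m a *m (k 1%N *m ev (word l) (fun i => k i.+2)).
  by rewrite /= !mulmxA.
set h := k 0%N *m a; set g := k 1%N *m _.
rewrite (pinvM S) mulmxA -[h *m C *m g *m pinv g]mulmxA (pseudo_pinvr S) ?mulmx1//.
apply: (pseudoM S); first exact: pair_K_pseudo.
by apply: ev_pseudo => i; exact: Kk.
Qed.

Lemma dev_ratioS l k i C :
  dev_ratio (word l.+1) k i.+2 C =
  (k 0%N *m a *m k 1%N) *m dev_ratio (word l) (fun i => k i.+2) i C *m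
    pinv (k 0%N *m a *m k 1%N).
Proof.
rewrite /dev_ratio.
have -> : ev (word l.+1) k = (k 0%N *m a *m k 1%N) *m ev (word l) (fun i => k i.+2).
  by rewrite /= !mulmxA.
have -> : ev (word l.+1) (upd k i.+2 (C *m k i.+2)) =
   (k 0%N *m a *m k 1%N) *m ev (word l) (upd (fun i => k i.+2) i (C *m k i.+2)).
  by rewrite /= !mulmxA.
by rewrite (pinvM S) !mulmxA.
Qed.

Lemma pinv_gens C : C \in gens -> pinv C = - C.
Proof.
move=> Cg; rewrite pinvE (gens_skew Cg) mulmxN mulNmx -(gens_block Cg).
by rewrite -mulmxA sig_sqr mulmx1.
Qed.

Lemma pinv_conj (h A : M) : pinv (h *m A *m pinv h) = h *m pinv A *m pinv h.
Proof. by rewrite !(pinvM S) (pinvK S) mulmxA. Qed.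

Lemma dev_ratio_skew l k i C : (forall i, K (k i)) -> C \in gens -> (i < l.*2)%N ->
  pinv (dev_ratio (word l) k i C) = - dev_ratio (word l) k i C.
Proof.
move=> + Cg; elim: l k i => [//|l ih] k [|[|i]] Kk il.
- by rewrite dev_ratio0// pinv_gens.
- by rewrite dev_ratio1// pinv_conj pinv_gens// mulmxN mulNmx.
- by rewrite dev_ratioS pinv_conj ih// mulmxN mulNmx.
Qed.

Definition tangent Z := forall x, pair_lam (c := P) x Z = 0.

Lemma tangent_pinv h Z : PU h -> tangent Z -> tangent (pinv h *m Z *m h).
Proof.
by move=> hu; apply: (tangent_conj hu); [exact: (pseudo_pinvr S)|exact: pseudo_pinv].
Qed.

Lemma offdiag_sig Z : ulsubmx Z = 0 -> drsubmx Z = 0 -> Sg *m Z = - (Z *m Sg).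
Proof.
move=> u d; rewrite -[Z]submxK u d /signature_mx !mulmx_block !mul0mx !mulmx0.
by rewrite !mulNmx !mulmxN !mul1mx !mulmx1 !addr0 !add0r opp_block_mx !oppr0 opprK.
Qed.

(** Orthogonality to the Lie algebra of [K] leaves a block off-diagonal matrix, which anticommutes
    with [Sg]; together with the tangency equation this is self-adjointness. *)
Lemma tangent_adj Z : tangent Z -> (forall C, C \in gens -> retr S (Z *m C) = 0) ->
  adjoint_mx Z = Z.
Proof.
move=> tZ oZ; have [u d] := tangent_orth tZ oZ.
have := tangent_skew tZ; rewrite offdiag_sig// => /subr0_eq e.
by rewrite -[LHS](sigKr (q := q)) e sigKr.
Qed.

(** Both Z and a^-1 Z a are tangent and orthogonal to the Lie algebra of [K], hence self-adjoint. As
    a is self-adjoint, a^-1 Z a = a Z a^-1, so Z commutes with a^2, and then with a because a has a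
    self-adjoint invertible square root. *)
Lemma commute_step (kap : M) Y : K kap -> tangent Y ->
  (forall C, C \in gens -> retr S (Y *m C) = 0) ->
  (forall C, C \in gens -> retr S (Y *m (kap *m a *m C *m pinv (kap *m a))) = 0) ->
  let Z := adjoint_mx kap *m Y *m kap in a *m Z = Z *m a.
Proof.
move=> Kk tY oY oY' Z.
have ku := pair_K_pseudo Kk; have au : PU a by exact: pseudo_cart.
have aa : adjoint_mx a = a by exact: (adjoint_cart S).
have kY : Z = pinv kap *m Y *m kap by rewrite pair_K_pinv.
have Zs : adjoint_mx Z = Z.
  by rewrite /Z !(adjoint_mul S) (adjointK S) (tangent_adj tY oY) mulmxA.
have hZ : pinv (kap *m a) *m Y *m (kap *m a) = pinv a *m Z *m a.
  by rewrite (pinvM S) kY !mulmxA.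
have : adjoint_mx (pinv a *m Z *m a) = pinv a *m Z *m a.
  rewrite -hZ; apply: tangent_adj.
    by apply: tangent_pinv => //; exact: (pseudoM S).
  by move=> C Cg; rewrite -(oY' C Cg) -!mulmxA retr_mulC !mulmxA.
move: Z Zs kY hZ => Z Zs _ _; rewrite !(adjoint_mul S) aa Zs => e.
have aps : adjoint_mx (pinv a) = pinv a.
  by rewrite pinvE !(adjoint_mul S) (sig_adj S) (adjointK S) aa mulmxA.
rewrite aps in e.
apply: (@commute_of_square _ _ S _ _ (real_mx F (cart q (2^-1 *: H)))
  (real_mx F (cart q (- (2^-1 *: H))))).
- by rewrite -(real_mxM S) (cart_half pq').
- exact: (adjoint_cart S).
- by rewrite -(real_mxM S) (cartNK pq') (real_mx1 S).
have := congr1 (fun x => a *m x *m a) e; rewrite !mulmxA (pseudo_pinvr S)// mul1mx.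
by rewrite -!mulmxA pseudo_pinv// mulmx1 !mulmxA.
Qed.

(** The first factor b = kappa a kappa^-1 of the word commutes with Y by [commute_step]. Conjugation
    by b therefore drops out of the trace forms for the later slots, and the hypotheses descend to
    the shorter word. *)
Lemma commute_all l k Y : (forall i, K (k i)) -> (forall j, k j.*2.+1 = adjoint_mx (k j.*2)) ->
  tangent Y -> (forall i C, (i < l.*2)%N -> C \in gens ->
    retr S (Y *m dev_ratio (word l) k i C) = 0) ->
  forall j, (j < l)%N -> let Z := adjoint_mx (k j.*2) *m Y *m k j.*2 in a *m Z = Z *m a.
Proof.
elim: l k => [//|l ih] k Kk ka tY oY.
have k1 := ka 0%N; rewrite double0 in k1.
have h0 : a *m (adjoint_mx (k 0%N) *m Y *m k 0%N) = adjoint_mx (k 0%N) *m Y *m k 0%N *m a.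
  apply: commute_step => // C Cg; first by rewrite -(oY 0%N C)// dev_ratio0.
  by rewrite -(oY 1%N C) ?(dev_ratio1 l C Kk)//.
move=> [_|j jl]; first by rewrite double0.
apply: (ih (fun i => k i.+2)) => // [i|i C il Cg]; first exact: (ka i.+1).
rewrite -(oY i.+2 C)// dev_ratioS.
have ku := pair_K_pseudo (Kk 0%N); have kk := pair_K_unitary P (Kk 0%N).
have kk' : k 0%N *m adjoint_mx (k 0%N) = 1%:M by rewrite -pair_K_pinv// (pseudo_pinvr S).
set b := k 0%N *m a *m k 1%N.
have bu : PU b.
  by apply: (pseudoM S); [apply: (pseudoM S) => //; exact: pseudo_cart|exact: pair_K_pseudo].
have bY : Y *m b = b *m Y.
  rewrite /b k1; have := congr1 (fun x => k 0%N *m x *m adjoint_mx (k 0%N)) h0.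
  rewrite !mulmxA kk' mul1mx => e; rewrite -[k 0%N *m a *m _ *m Y]mulmx1 -kk' !mulmxA e.
  by rewrite -!mulmxA.
move: (dev_ratio _ _ _ _) b bu bY {oY} => D b bu bY.
by rewrite !mulmxA bY -!(mulmxA b) [RHS]retr_mulC -!mulmxA pseudo_pinv// mulmx1.
Qed.

End transversality.

Section signed_permutations.
Context (R : realType) (n : nat).
Implicit Types (x : 'I_n) (s : {perm 'I_n}).

Definition perm_sign s x i : R := (-1) ^+ (odd_perm s && (i == x)).

(* Sign changed in row [x] when [s] is odd, so that the determinant is [1]. *)
Definition sperm_mx s x : 'M[R]_n := \matrix_(i, j) (perm_sign s x i *+ (s j == i)).

Lemma perm_sign_sqr s x i : perm_sign s x i * perm_sign s x i = 1.
Proof. by rewrite /perm_sign -expr2 sqrr_sign. Qed.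

Lemma sperm_mx_SO s x : SO n (sperm_mx s x).
Proof.
split.
  apply/matrixP => i j; rewrite !mxE (bigD1 (s i))//= big1 ?addr0; last first.
    by move=> l /negPf li; rewrite !mxE eq_sym li mulr0n mul0r.
  rewrite !mxE eqxx mulr1n (inj_eq perm_inj) eq_sym.
  by case: eqP => _; rewrite ?mulr0// mulr1n perm_sign_sqr.
have -> : sperm_mx s x = diag_mx (\row_i perm_sign s x i) *m perm_mx s^-1%g.
  apply/matrixP => i j; rewrite mul_diag_mx !mxE mulr_natr; congr (_ *+ nat_of_bool _).
  by apply/eqP/eqP => [<-|<-]; rewrite ?permK ?permKV.
rewrite det_mulmx det_diag det_perm odd_permV (bigD1 x)//= big1 ?mulr1.
  by rewrite !mxE /perm_sign eqxx andbT -expr2 sqrr_sign.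
by move=> i /negPf ix; rewrite !mxE /perm_sign ix andbF.
Qed.

End signed_permutations.

Section span.
Context (R : realType) (F : hypercomplexType R) (S : scalar_structure F).
Context (p q : nat) (G K : set 'M[F]_(p + q)).
Local Notation M := 'M[F]_(p + q).
Variable P : cartan_pair S G K.
Hypothesis pq : (p < q)%N.
Hypothesis p2 : (1 < p)%N.
Variable H : 'rV[R]_p.
Variable i0 : 'I_p.
Hypothesis Hi0 : H 0 i0 != 0.
Local Notation a := (real_mx F (cart q H) : M).
Local Notation word := (delta_word a p).
Local Notation c := (cosh_row H 0).
Local Notation s := (sinh_row H 0).
Let pq' := ltnW pq.

Let wd : 'I_p -> 'I_q := widen_ord pq'.
Let o : 'I_q := Ordinal pq.
Let sig j : {perm 'I_p} := tperm i0 j.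
Let tau j : {perm 'I_q} := (tperm (wd i0) (wd j) * tperm (wd j) o)%g.

(** The permutations of [vanishing_pattern], signed so that both blocks have determinant 1; such
    real matrices lie in [K] for all three scalars. *)
Definition kappa j : M := block_diag_mx (real_mx F (sperm_mx R (sig j) i0))
  (real_mx F (sperm_mx R (tau j) o)).

Let kap_nat (m : nat) : M := kappa (insubd i0 m).

(** Slots 2j and 2j+1 hold [kappa j] and its inverse, so that each factor of the word is a conjugate
    of [a]. *)
Definition kstar (i : nat) : M :=
  if odd i then adjoint_mx (kap_nat i./2) else kap_nat i./2.

Lemma kstarK i : K (kstar i).
Proof.
have Kk m : K (kap_nat m) by apply: (pair_SO P); exact: sperm_mx_SO.
by rewrite /kstar; case: odd => //; exact: (pair_K_adj P).
Qed.

(** The lower right diagonal of [a]: hyperbolic cosines in the first p columns, and 1 in the columns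
    that [H] does not reach. *)
Let dd (m : 'I_q) : R := if insub (m : nat) is Some i then c i else 1.

Lemma cart_blocks : a = block_mx (diag_mx (map_mx of_real (cosh_row H)))
  (\matrix_(i, m) of_real (s i *+ (wd i == m)))
  (\matrix_(m, i) of_real (s i *+ (wd i == m)))
  (diag_mx (\row_m of_real (dd m))).
Proof.
rewrite cartE// real_mx_block; congr block_mx.
- by apply/matrixP => i j; rewrite !mxE; case: eqP => _ //; exact: (of_real0 S).
- apply/matrixP => i j; rewrite mxE mul_diag_mx !mxE -val_eqE /=.
  by rewrite mulr_natr.
- apply/matrixP => i j; rewrite mxE mul_mx_diag !mxE -val_eqE /=.
  by rewrite mulr_natl.
- apply/matrixP => i j; rewrite mxE mxE incl_diag !mxE -mulrnDl.
  case: eqP => _; rewrite ?mulr0n ?(of_real0 S)// !mulr1n; congr of_real.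
  rewrite /dd; case: insubP => [k _ ki|ip].
    rewrite (bigD1 k) ?ki//= big1 ?addr0.
      by rewrite !mxE addrC subrK.
    by move=> l /andP[/eqP li /eqP lk]; case: lk; apply: val_inj; rewrite /= ki.
  rewrite big1 ?addr0// => k /eqP ki.
  by have := ltn_ord k; rewrite ki (negPf ip).
Qed.

Section vanishing.
Variable B : 'M[F]_(p, q).
Let Y : M := block_mx 0 B (adjoint_mx B) 0.
Hypothesis comm : forall j, let Z := adjoint_mx (kappa j) *m Y *m kappa j in
  a *m Z = Z *m a.

Let Bj j : 'M[F]_(p, q) := \matrix_(i, m)
  (of_real (perm_sign R (sig j) i0 (sig j i)) * B (sig j i) (tau j m) *
   of_real (perm_sign R (tau j) o (tau j m))).

Lemma kappa_conj j : adjoint_mx (kappa j) *m Y *m kappa j =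
  block_mx 0 (Bj j) (adjoint_mx (Bj j)) 0.
Proof.
have e : adjoint_mx (real_mx F (sperm_mx R (sig j) i0)) *m B *m
    real_mx F (sperm_mx R (tau j) o) = Bj j.
  apply/matrixP => i m; rewrite !mxE (bigD1 (tau j m))//= [X in _ + X]big1 ?addr0; last first.
    move=> l /negPf lm; rewrite [real_mx _ _ _ _]mxE [sperm_mx _ _ _ _ _]mxE eq_sym lm.
    by rewrite (of_real0 S) mulr0.
  rewrite [real_mx _ _ _ _]mxE [sperm_mx _ _ _ _ _]mxE eqxx mulr1n; congr (_ * _).
  rewrite mxE (bigD1 (sig j i))//= big1 ?addr0; last first.
    by move=> l /negPf lm; rewrite !mxE eq_sym lm (of_real0 S) (hconj0 S) mul0r.
  by rewrite !mxE eqxx mulr1n (hconj_real S).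
rewrite /kappa /block_diag_mx adjoint_block !(adjoint0 S) /Y !mulmx_block.
rewrite !(mul0mx, mulmx0, addr0, add0r) -e !(adjoint_mul S) (adjointK S) mulmxA.
by [].
Qed.

Let z i m : Prop := B i m = 0.

Let Bj0 j i m : Bj j i m = 0 <-> z (sig j i) (tau j m).
Proof.
rewrite /z mxE; split=> [h|->]; last by rewrite mulr0 mul0r.
set e := perm_sign _ _ _ _ in h *; set e' := perm_sign R (tau j) _ _ in h *.
have -> : B (sig j i) (tau j m) =
    of_real e * (of_real e * B (sig j i) (tau j m) * of_real e') * of_real e'.
  rewrite !mulrA -(of_realM S) perm_sign_sqr (of_real1 S) mul1r -mulrA.
  by rewrite -(of_realM S) perm_sign_sqr (of_real1 S) mulr1.
by rewrite h mulr0 mul0r.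
Qed.

Let of_real_eq0 (x : F) t : of_real t * x = 0 -> t != 0 -> x = 0.
Proof.
move=> h t0; rewrite -[x]mul1r -(of_real1 S) -(mulVf t0) (of_realM S) -mulrA h.
by rewrite mulr0.
Qed.

Let comm_blocks j :
  [/\ forall i m, of_real (c i) * Bj j i m = Bj j i m * of_real (dd m),
      forall i l, of_real (s i) * conj (Bj j l (wd i)) = Bj j i (wd l) * of_real (s l) &
      forall i m, (forall l, wd l != m) -> conj (Bj j i m) * of_real (s i) = 0].
Proof.
have := comm j; rewrite /= kappa_conj cart_blocks !mulmx_block.
rewrite !(mul0mx, mulmx0, addr0, add0r) => /eq_block_mx[h1 h2 h3 h4]; split.
- by move=> i m; have /matrixP/(_ i m) := h2; rewrite mul_diag_mx mul_mx_diag !mxE.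
- move=> i l; have /matrixP/(_ i l) := h1; rewrite !mxE.
  rewrite (bigD1 (wd i))//= big1 ?addr0; last first.
    by move=> m /negPf mi; rewrite mxE eq_sym mi (of_real0 S) mul0r.
  rewrite (bigD1 (wd l))//= big1 ?addr0; last first.
    by move=> m /negPf mi; rewrite [in X in _ * X]mxE eq_sym mi (of_real0 S) mulr0.
  by rewrite !mxE !eqxx !mulr1n.
- move=> i m mw; have /matrixP/(_ m (wd i)) := h4; rewrite !mxE.
  rewrite big1; last first.
    by move=> l _; rewrite mxE (negPf (mw l)) (of_real0 S) mul0r.
  move=> ->; rewrite (bigD1 i)//= big1 ?addr0; last first.
    move=> l li; rewrite [in X in _ * X]mxE (_ : wd l == wd i = false) ?(of_real0 S) ?mulr0//.
    by apply/eqP => /(congr1 val) /= /val_inj e; rewrite e eqxx in li.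
  by rewrite !mxE eqxx mulr1n.
Qed.

(** Block by block, commutation with [a] gives scalar equations whose coefficients [c i - dd m],
    [s l] and [s i] are nonzero exactly under the conditions in the hypotheses of
    [vanishing_pattern]. *)
Lemma offdiag_vanishes : B = 0.
Proof.
apply/matrixP => r m; rewrite mxE.
have sc i : c i != 1 -> s i != 0 by rewrite cosh_eq1.
apply: (@vanishing_pattern p q R c dd 1 wd o i0 z) => //.
- by move=> i l /(congr1 val) /= /val_inj.
- by move=> i; rewrite -val_eqE /= ltn_eqF.
- move=> m'; case: (ltnP m' p) => h; [left; exists (Ordinal h)|right].
    exact: val_inj.
  by move=> i; rewrite -val_eqE /= ltn_eqF// (leq_trans _ h).
- by move=> i; rewrite /dd insubT//= => ip; congr c; exact: val_inj.
- by rewrite cosh_eq1 sinh_eq0.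
- move=> j i m' dc; have [h _ _] := comm_blocks j; apply/Bj0.
  apply: (@of_real_eq0 _ (c i - dd m')); last by rewrite subr_eq0 eq_sym.
  by rewrite (of_realB S) mulrBl h (of_realC S) subrr.
- move=> j i l cl /Bj0 h0; have [_ h _] := comm_blocks j; apply/Bj0.
  apply: (@of_real_eq0 _ (s l)); last exact: sc.
  by rewrite (of_realC S) -h h0 (hconj0 S) mulr0.
- move=> j i m' cl mw; have [_ _ h] := comm_blocks j; apply/Bj0.
  rewrite -[LHS](hconjK S) (@of_real_eq0 (conj (Bj j i m')) (s i)) ?(hconj0 S)//.
    by rewrite (of_realC S) h.
  exact: sc.
Qed.

End vanishing.

Lemma pair_span Z : (forall x, pair_lam (c := P) x Z = 0) ->
  (forall i C, (i < slots word)%N -> C \in pair_gens P ->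
    ip S Z (ev word (upd kstar i (C *m kstar i)) *m pinv (ev word kstar)) = 0) ->
  Z = 0.
Proof.
move=> tZ oZ; pose Sg := signature_mx p q : M.
(* The directions W satisfy [pinv W = - W], so the adjoint of W is -Sg W Sg. Conjugating by [Sg]
   thus turns Euclidean orthogonality of [Z] into trace orthogonality of [Y]. *)
pose Y : M := pinv Sg *m Z *m Sg.
have tY : tangent P Y by apply: (tangent_pinv (S := S)) => //; exact: pseudo_sig.
have sgE : pinv Sg = Sg by rewrite pinvE (sig_adj S) sigKr.
have oY i C : (i < p.*2)%N -> C \in pair_gens P ->
    retr S (Y *m dev_ratio word kstar i C) = 0.
  move=> ip Cg; have := oZ i C; rewrite slots_delta_word => /(_ ip Cg).
  rewrite -/(dev_ratio word kstar i C) ip_retr.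
  have := dev_ratio_skew (P := P) pq H kstarK Cg ip.
  move: (dev_ratio _ _ _ _) => W Wk.
  have -> : adjoint_mx W = - (Sg *m W *m Sg).
    have := congr1 (fun A => Sg *m A *m Sg) Wk; rewrite mulmxN mulNmx => <-.
    by rewrite pinvE !mulmxA sig_sqr mul1mx sigKr.
  rewrite mulmxN => /eqP; rewrite /retr raddfN coN oppr_eq0 => /eqP.
  rewrite -/(retr S _) !mulmxA => h.
  by rewrite /Y sgE -!mulmxA retr_mulC !mulmxA.
have Kk := kstarK.
have comm := @commute_all _ _ _ _ _ _ _ P pq H p kstar Y kstarK.
have {}comm j : let Z := adjoint_mx (kappa j) *m Y *m kappa j in a *m Z = Z *m a.
  have := comm _ tY oY j (ltn_ord j).
  rewrite /kstar odd_double doubleK /kap_nat valKd; apply.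
  by move=> k; rewrite /= odd_double /= uphalf_double doubleK.
have oY0 C : C \in pair_gens P -> retr S (Y *m C) = 0.
  move=> Cg; have := oY 0%N C; rewrite double_gt0 (ltnW p2) => /(_ isT Cg).
  have pE : p = p.-1.+1 by rewrite prednK// ltnW.
  by rewrite (congr1 (delta_word a) pE) (dev_ratio0 P pq).
have [u d] := tangent_orth tY oY0; have adjY := tangent_adj tY oY0.
have YE : Y = block_mx 0 (ursubmx Y) (adjoint_mx (ursubmx Y)) 0.
  rewrite -[LHS]submxK u d; congr block_mx.
  rewrite -[X in dlsubmx X]adjY -[X in adjoint_mx X]submxK adjoint_block.
  by rewrite block_mxKdl.
have : ursubmx Y = 0.
  by apply: offdiag_vanishes => j; rewrite -YE; exact: comm.
move=> B0; move: YE; rewrite B0 (adjoint0 S) block_mx0 /Y sgE => h.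
by rewrite -[Z](sigK (p := p)) -[_ *m Z](sigKr (q := q)) h mul0mx mulmx0.
Qed.

End span.

(** * Absolute continuity of the p-th power *)

Section pair_dominated.
Context (R : realType) (F : hypercomplexType R) (S : scalar_structure F).
Context (p q : nat) (G K : set 'M[F]_(p + q)).
Local Notation M := 'M[F]_(p + q).
Local Notation nrm := (nrm S).
Local Notation Sg := (signature_mx p q : M).
Variable P : cartan_pair S G K.
Hypothesis pq : (p < q)%N.

Lemma pair_K1 : K 1%:M.
Proof.
have SO1 n : SO n (1%:M : 'M[R]_n).
  by split; [rewrite /unitary /= (adjoint1 (real_structure R)) mulmx1|exact: det1].
have := pair_SO P (SO1 p) (SO1 q).
by rewrite !(real_mx1 S) /block_diag_mx -scalar_mx_block.
Qed.

Lemma pair_G1 : G 1%:M.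
Proof. by apply: (pair_KG P); exact: pair_K1. Qed.

(** Each coordinate satisfies |x| <= 1 + x^2, and for a unitary matrix the squares sum to the trace
    of the identity. *)
Lemma pair_K_bounded g : K g -> nrm g <= #|{: coidx S (p + q) (p + q)}|%:R +
  retr S (1%:M : M).
Proof.
move=> Kg; have e : ip S g g = retr S (1%:M : M).
  rewrite ip_retr -[adjoint_mx g](pair_K_pinv P Kg) (pseudo_pinvr S)//.
  exact: pair_K_pseudo P _ Kg.
rewrite -e -sum1_card natr_sum /nrm /ip -big_split; apply: ler_sum => x _ /=.
rewrite -expr2 -real_normK ?num_real//; nra.
Qed.

Lemma pair_G_inv g : G g -> exists h, [/\ G h, h *m g = 1%:M, g *m h = 1%:M &
  nrm h <= (nrm Sg * nrm Sg) * nrm g].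
Proof.
move=> Gg; have gu := pair_G_pseudo P Gg; exists (pinv g); split.
- by rewrite pinvE; exact: (pair_G_adj P).
- exact: pseudo_pinv.
- exact: pseudo_pinvr.
- rewrite pinvE; apply: le_trans (nrmM _ _ _) _; rewrite [leRHS]mulrAC.
  by rewrite ler_wpM2r ?nrm_ge0// -(nrm_adjoint S g); exact: nrmM.
Qed.

Lemma pair_word_G l H v : (forall i, (i < slots (delta_word (real_mx F (cart q H)) l))%N ->
  K (v i)) -> G (ev (delta_word (real_mx F (cart q H)) l) v).
Proof.
elim: l v => [|l ih] v Kv /=; first by rewrite mulmx1; exact: pair_G1.
have KG i : (i < l.*2.+2)%N -> G (v i).
  by move=> il; apply: (pair_KG P); apply: Kv; rewrite slots_delta_word.
apply: (pair_GM P); first exact: KG.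
apply: (pair_GM P); first exact: (pair_cart P).
apply: (pair_GM P); first exact: KG.
apply: ih => i il; apply: Kv; by move: il; rewrite !slots_delta_word.
Qed.

Lemma pair_dominated (mK : probability (borel_mx F (p + q)) R)
    (haarG : {measure set (borel_mx F (p + q)) -> \bar R}) X :
  (1 < p)%N -> haar_measure K mK -> haar_measure G haarG ->
  cartan_space p q X -> X <> 0 ->
  convolution_pow (delta_natural mK X) p `<< haarG.
Proof.
move=> p2 hK hG [H _ HX] X0.
have [i0 Hi0] : exists i0, H 0 i0 != 0.
  apply: contrapT => h; apply: X0; rewrite -HX.
  have -> : H = 0.
    apply/rowP => i; rewrite mxE; apply/eqP/negPn/negP => Hi.
    by apply: h; exists i.
  rewrite cartan_mxE; have := hypm0Z q 0 (0 : 'rV[R]_p) 0.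
  by rewrite !scale0r => <-.
have := @represents_pow _ _ _ K mK X p hK.
have -> : expmx X = cart q H by rewrite -HX (expmx_cartan (ltnW pq)).
move=> rep; pose w := delta_word (real_mx F (cart q H) : M) p.
have wG : forall v, (forall i, (i < slots w)%N -> K (v i)) -> G (ev w v).
  by move=> v; exact: pair_word_G.
have KV g : K g -> exists h, K h /\ h *m g = 1%:M.
  move=> Kg; exists (adjoint_mx g); split; first exact: (pair_K_adj P).
  exact: (pair_K_unitary P).
exact: (represented_dominated (@pair_lam_linear _ _ _ _ _ _ _ P)
  (@pair_lam_small _ _ _ _ _ _ _ P) pair_K1 (pair_KM P) KV pair_K_bounded
  (@pair_gens_cube _ _ _ _ _ _ _ P) (@pair_gens_K _ _ _ _ _ _ _ P)
  (@pair_generated _ _ _ _ _ _ _ P) pair_G1 pair_G_inv hG wG (kstarK P pq i0)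
  (pair_span (P := P) p2 Hi0) rep).
Qed.

End pair_dominated.

(** * Singularity below p *)

Section realification.
Context (R : realType) (F : hypercomplexType R) (S : scalar_structure F).
Local Notation co := (@co R F S).
Local Notation un := (@un R F S).

Definition rdim m := #|{: 'I_m * 'I_(sdim S)}|.

(* The matrix over the reals of [x |-> x *m B], on row vectors. *)
Definition rho m n (B : 'M[F]_(m, n)) : 'M[R]_(rdim m, rdim n) :=
  \matrix_(x, y) co (enum_val y).2 (un (enum_val x).2 * B (enum_val x).1 (enum_val y).1).

Lemma sum_rdim m (f : 'I_m * 'I_(sdim S) -> R) :
  \sum_(x < rdim m) f (enum_val x) = \sum_i \sum_e f (i, e).
Proof.
rewrite pair_big /= (reindex (@enum_val _ {: 'I_m * 'I_(sdim S)}))/=.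
  by apply: eq_bigr => x _; case: (enum_val x).
by exists enum_rank => y _; rewrite ?enum_valK ?enum_rankK.
Qed.

Lemma co_mul e (x y : F) : co e (x * y) = \sum_f co f x * co e (un f * y).
Proof.
rewrite {1}(co_decomp S x) mulr_suml co_sum; apply: eq_bigr => f _.
by rewrite -mulrA coZ.
Qed.

Lemma rhoM m n k (A : 'M[F]_(m, n)) (B : 'M[F]_(n, k)) : rho (A *m B) = rho A *m rho B.
Proof.
apply/matrixP => x y; rewrite !mxE mulr_sumr co_sum.
under [RHS]eq_bigr do rewrite !mxE.
rewrite (sum_rdim (fun z => co z.2 (un (enum_val x).2 * A (enum_val x).1 z.1) *
  co (enum_val y).2 (un z.2 * B z.1 (enum_val y).1))).
by apply: eq_bigr => j _; rewrite mulrA co_mul.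
Qed.

Lemma rhoD m n (A B : 'M[F]_(m, n)) : rho (A + B) = rho A + rho B.
Proof. by apply/matrixP => x y; rewrite !mxE mulrDr coD. Qed.

Lemma rhoZ m n a (A : 'M[F]_(m, n)) : rho (rscale a A) = a *: rho A.
Proof. by apply/matrixP => x y; rewrite !mxE mulrA -(of_realC S) -mulrA coZ. Qed.

Lemma rho_row_free m n (D : 'M[F]_(m, n)) :
  (forall x : 'rV[F]_m, x *m D = 0 -> x = 0) -> row_free (rho D).
Proof.
move=> inj; rewrite -kermx_eq0; apply/eqP/row_matrixP => i; rewrite row0.
set u := row i _; have uD : u *m rho D = 0 by rewrite -row_mul mulmx_ker row0.
move: u uD => {i} u uD.
pose x : 'rV[F]_m := \row_i \sum_e of_real (u 0 (enum_rank (i, e))) * un e.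
have cox i' e : co e (x 0 i') = u 0 (enum_rank (i', e)).
  rewrite mxE co_sum (bigD1 e)//= big1 ?addr0 => [|e' /negPf ee'].
    by rewrite coZ co_un eqxx mulr1.
  by rewrite coZ co_un eq_sym ee' mulr0.
have x0 : x = 0.
  apply: inj; apply/rowP => j; rewrite [RHS]mxE mxE; apply: (co_inj (S := S)) => e.
  rewrite co0 co_sum; transitivity ((u *m rho D) 0 (enum_rank (j, e))); last by rewrite uD mxE.
  rewrite [RHS]mxE [RHS](eq_bigr (fun z => u 0 (enum_rank (enum_val z)) *
    co e (un (enum_val z).2 * D (enum_val z).1 j))); last first.
    by move=> z _; rewrite mxE enum_rankK enum_valK.
  rewrite (sum_rdim (fun z => u 0 (enum_rank z) * co e (un z.2 * D z.1 j))).
  by apply: eq_bigr => k _; rewrite co_mul; under eq_bigr do rewrite cox.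
apply/rowP => z; rewrite -[z]enum_valK; case: (enum_val z) => i' e.
by rewrite -cox x0 !mxE co0.
Qed.

(** The real map factors through dimension l times [sdim S], too small for the Gram matrix to have
    full rank. *)
Lemma rho_thin m l n (U : 'M[F]_(m, l)) (V : 'M[F]_(l, n)) : (l < m)%N -> (0 < sdim S)%N ->
  \det (rho (U *m V) *m (rho (U *m V))^T) = 0.
Proof.
move=> lm d0; rewrite rhoM; set W := _ *m (_ *m _)^T.
apply/eqP/negPn/negP => W0; have : row_free W by rewrite row_free_unit unitmxE unitfE.
rewrite /row_free => /eqP rW.
have : (\rank W <= rdim l)%N.
  rewrite /W -mulmxA; apply: leq_trans (mulmx_max_rank _ _); exact: leqnn.
by rewrite rW /rdim !card_prod !card_ord leq_mul2r gtn_eqF//= leqNgt lm.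
Qed.

End realification.

Section gram_pencil.
Context (R : realType).

Lemma poly_eventually_neq0 (P : {poly R}) : P != 0 ->
  exists n, forall j, (n <= j)%N -> P.[j.+2%:R] != 0.
Proof.
move=> P0; apply: contrapT => h.
have {}h n : exists2 j, (n <= j)%N & P.[j.+2%:R] = 0.
  apply: contrapT => hn; apply: h; exists n => j nj; apply/eqP => Pj.
  by apply: hn; exists j.
have [rs [urs srs ars]] : exists rs : seq nat, [/\ uniq rs, size rs = size P &
    all (fun j => root P j.+2%:R) rs].
  elim: (size P) => [|k [rs [urs srs ars]]]; first by exists [::].
  have [j nj Pj] := h (\max_(i <- rs) i.+1).
  exists (j :: rs); split => //=; last by rewrite /root Pj eqxx.
    rewrite urs andbT; apply/negP => jrs.
    by have := @leq_bigmax_seq _ rs xpredT succn j jrs isT; rewrite leqNgt ltnS nj.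
  by rewrite srs.
have := @max_poly_roots _ P [seq j.+2%:R | j <- rs] P0.
rewrite size_map srs ltnn all_map => /(_ ars) urs'; suff: false by []; apply: urs'.
by rewrite map_inj_uniq// => i j /eqP; rewrite eqr_nat => /eqP[].
Qed.

(** The Gram determinant of u A + Q is a polynomial in u that is nonzero at u = 0, hence has
    finitely many roots. *)
Lemma gram_pencil m k (A Q : 'M[R]_(m, k)) : row_free Q ->
  exists n, forall j, (n <= j)%N ->
    \det ((j.+2%:R *: A + Q) *m (j.+2%:R *: A + Q)^T) != 0.
Proof.
move=> Qf; pose L : 'M[{poly R}]_(m, k) := 'X *: map_mx polyC A + map_mx polyC Q.
pose P := \det (L *m L^T).
have PE u : P.[u] = \det ((u *: A + Q) *m (u *: A + Q)^T).
  rewrite -[LHS]/(horner_eval u P) /P -det_map_mx map_mxM -map_trmx.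
  have -> : map_mx (horner_eval u) L = u *: A + Q; last by [].
  by apply/matrixP => i j; rewrite !mxE /horner_eval !hornerE.
have [|n nP] := @poly_eventually_neq0 P.
  apply/eqP => P0; have := PE 0; rewrite P0 horner0 scale0r add0r => /esym/eqP.
  exact/negP/row_free_gram.
by exists n => j /nP; rewrite PE.
Qed.

End gram_pencil.

Section pair_singular.
Context (R : realType) (F : hypercomplexType R) (S : scalar_structure F).
Context (p q : nat) (G K : set 'M[F]_(p + q)).
Local Notation M := 'M[F]_(p + q).
Local Notation nrm := (nrm S).
Local Notation co := (@co R F S).
Local Notation un := (@un R F S).
Local Notation Sg := (signature_mx p q : M).
Variable P : cartan_pair S G K.
Hypothesis pq : (p < q)%N.
Let pq' := ltnW pq.

(** One real polynomial in [g] that vanishes exactly when the upper right block has rank less than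
    [p]. *)
Definition corner (g : M) : R := \det (rho S (ursubmx g) *m (rho S (ursubmx g))^T).

Lemma corner_measurable : measurable_fun setT (corner : borel_mx F (p + q) -> R).
Proof.
have mk (i : nat) : measurable_fun setT (fun x : borel_mx F (p + q) => x) by exact: measurable_id.
apply: (@polyfn_measurable _ _ S _ 1 _ _ (fun x _ => x) (fun k => corner (k 0%N))) mk.
have -> : (fun k : nat -> M => corner (k 0%N)) = fun k => \det (\matrix_(x, y)
    \sum_z (rho S (ursubmx (k 0%N))) x z * (rho S (ursubmx (k 0%N))) y z).
  apply/funext => k; rewrite /corner; congr (\det _); apply/matrixP => x y.
  by rewrite !mxE; apply: eq_bigr => z _; rewrite [X in _ * X]mxE.
have rp x z : polyfn S 1 (fun k : nat -> M => rho S (ursubmx (k 0%N)) x z).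
  have -> : (fun k : nat -> M => rho S (ursubmx (k 0%N)) x z) = fun k =>
      \sum_f co (enum_val z).2 (un (enum_val x).2 * un f) *
       mco (S := S) (k 0%N) (lshift q (enum_val x).1, rshift p (enum_val z).1, f).
    apply/funext => k; rewrite mxE /mco /= !mxE {1}(co_decomp S (k _ _ _)) mulr_sumr co_sum.
    by apply: eq_bigr => f _; rewrite mulrA -(of_realC S) -mulrA coZ mulrC.
  apply: polyfn_sum => f; apply: polyfnM; [exact: polyfn_cst|exact: polyfn_co].
apply: polyfn_det => x y; apply: polyfn_sum => z; exact: polyfnM.
Qed.

Lemma K_block g : K g -> ursubmx g = 0 /\ dlsubmx g = 0.
Proof.
move=> Kg; have kS : g *m Sg = Sg *m g.
  have := pair_K_pseudo P Kg; rewrite /pseudo_unitary /= => /(congr1 (mulmx g)).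
  rewrite !mulmxA -(pair_K_pinv P Kg) (pseudo_pinvr S) ?mul1mx//.
  exact: pair_K_pseudo P _ Kg.
have dbl m n (A : 'M[F]_(m, n)) : A = - A -> A = 0.
  move=> AN; apply: (@mco_inj _ _ S) => x; rewrite mco0.
  have : mco A x = mco (S := S) (- A) x by rewrite -AN.
  by rewrite mcoN => h; lra.
move: kS; rewrite -[g]submxK /signature_mx !mulmx_block !mul0mx !mulmx0.
rewrite !mulNmx !mulmxN !mul1mx !mulmx1 !addr0 !add0r => /eq_block_mx[_ u d _].
by rewrite block_mxKur block_mxKdl; split; [exact: dbl|apply: dbl; rewrite d].
Qed.

(** The slots are block diagonal, so each letter [a] adds to the upper right block one term
    containing the upper right block of [a]. That block has a single nonzero entry at most, at row
    [i0], so each letter raises the rank by at most one. *)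
Lemma corner_factors l (H : 'rV[R]_p) i0 v : (forall i, i != i0 -> H 0 i = 0) ->
  (forall i, (i < slots (delta_word (real_mx F (cart q H) : M) l))%N -> K (v i)) ->
  exists (U : 'M[F]_(p, l)) (V : 'M[F]_(l, q)),
    ursubmx (ev (delta_word (real_mx F (cart q H) : M) l) v) = U *m V.
Proof.
move=> H0; elim: l v => [|l ih] v Kv.
  exists 0, 0; rewrite mul0mx /= mulmx1 scalar_mx_block block_mxKur.
  by [].
rewrite /= -/(delta_word _ l); set g := ev _ _.
have [U [V UV]] : exists (U : 'M[F]_(p, l)) (V : 'M[F]_(l, q)), ursubmx g = U *m V.
  apply: ih => i il; apply: Kv; move: il; rewrite !slots_delta_word.
  by [].
have K0 : K (v 0%N) by apply: Kv; rewrite slots_delta_word.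
have K1 : K (v 1%N) by apply: Kv; rewrite slots_delta_word.
have [u0 d0] := K_block K0; have [u1 d1] := K_block K1.
pose e : 'M[R]_(p, 1) := sinh_row H 0 i0 *: delta_mx i0 0.
pose f : 'M[R]_(1, q) := row i0 (incl R p q).
have aur : ursubmx (real_mx F (cart q H)) = real_mx F e *m real_mx F f.
  rewrite cartE// real_mx_block block_mxKur -(real_mxM S); congr real_mx.
  apply/matrixP => i j; rewrite mul_diag_mx !mxE big_ord1 !mxE.
  have [->|ii0] := eqVneq i i0; first by rewrite mulr1.
  by rewrite mulr0 mul0r (H0 _ ii0) oppr0 subrr !mul0r.
exists (row_mx (ulsubmx (v 0%N) *m real_mx F e)
  (ulsubmx (v 0%N) *m ulsubmx (real_mx F (cart q H)) *m ulsubmx (v 1%N) *m U)).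
exists (col_mx (real_mx F f *m drsubmx (v 1%N) *m drsubmx g) V).
rewrite [RHS](@mul_row_col F p 1 l q) -[v 0%N in LHS]submxK u0 d0 -[real_mx F (cart q H) in LHS]submxK.
rewrite -[v 1%N in LHS]submxK u1 d1 -[g in LHS]submxK !mulmx_block block_mxKur.
rewrite !(mul0mx, mulmx0, addr0, add0r) aur UV mulmxDr !mulmxA addrC.
by [].
Qed.

(** The lower blocks C, D of [g] satisfy D D' = 1 + C C', the primes denoting adjoints; so x D = 0
    forces the squared norms of x and x C to add up to zero. *)
Lemma pseudo_bottom_injective (g : M) : pseudo_unitary (R := R) p q g ->
  forall x : 'rV[F]_q, x *m drsubmx g = 0 -> x = 0.
Proof.
move=> gu x xD; pose s n (y : 'rV[F]_n) := co (re_idx S) ((y *m adjoint_mx y) 0 0).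
have sE n (y : 'rV[F]_n) : s n y = \sum_j co (re_idx S) (y 0 j * conj (y 0 j)).
  by rewrite /s mxE co_sum; apply: eq_bigr => j _; rewrite !mxE.
have s0 n (y : 'rV[F]_n) : 0 <= s n y.
  by rewrite sE sumr_ge0// => j _; exact: re_mul_self_ge0.
have gS : g *m Sg *m adjoint_mx g = Sg.
  have := pseudo_pinvr S gu; rewrite pinvE => /(congr1 (fun A => A *m Sg)).
  by rewrite !mulmxA sigKr mul1mx.
have DD : drsubmx g *m adjoint_mx (drsubmx g) =
    1%:M + dlsubmx g *m adjoint_mx (dlsubmx g).
  have := congr1 drsubmx gS; rewrite -[g]submxK adjoint_block /signature_mx !mulmx_block.
  rewrite !block_mxKdr !mulmx0 !addr0 !add0r !mulmxN !mulmx1 !mulNmx => <-.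
  by rewrite submxK addrAC addNr add0r.
have : s _ x + s _ (x *m dlsubmx g) = 0.
  have := congr1 (fun A => x *m A *m adjoint_mx x) DD.
  rewrite mulmxDr mulmxDl mulmx1 !mulmxA xD !mul0mx -mulmxA -(adjoint_mul S).
  move/(congr1 (fun A : 'M[F]_1 => co (re_idx S) (A 0 0))).
  by rewrite mxE co0 [in RHS]mxE coD => <-.
move=> /eqP; rewrite paddr_eq0// => /andP[+ _]; rewrite sE psumr_eq0; last first.
  by move=> j _; exact: re_mul_self_ge0.
move=> /allP h; apply/rowP => j; rewrite mxE; apply: (re_mul_self_eq0 (S := S)).
by apply/eqP; exact: h (mem_index_enum j).
Qed.

(* The [t] whose hyperbolic cotangent is [j + 2]. *)
Definition arcoth j : R := ln (Num.sqrt (j.+3%:R / j.+1%:R)).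

Definition push j : M := real_mx F (cart q (const_mx (arcoth j))).

Lemma arcothE j : let c := (expR (arcoth j) + expR (- arcoth j)) / 2 in
  let s := (expR (arcoth j) - expR (- arcoth j)) / 2 in
  [/\ c = j.+2%:R * s, s != 0, `|c| <= 3 & `|s| <= 3].
Proof.
move=> c s; set y : R := j.+3%:R / j.+1%:R.
have y1 : 1 < y by rewrite ltr_pdivlMr// mul1r ltr_nat.
have y3 : y <= 3 by rewrite ler_pdivrMr// -natrM ler_nat; lia.
have E0 : 0 < Num.sqrt y by rewrite sqrtr_gt0 (lt_trans _ y1).
have EE : expR (arcoth j) = Num.sqrt y by rewrite /arcoth lnK// posrE.
have sq : Num.sqrt y ^+ 2 = y by rewrite sqr_sqrtr// ltW// (lt_trans _ y1).
rewrite /c /s expRN EE; set E := Num.sqrt y in E0 sq *.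
have E1 : 1 < E by rewrite -(ltr_pXn2r (n := 2)) ?nnegrE ?ltW// sq expr1n.
have E3 : E <= 3 by nra.
have Ei : E^-1 <= 1 by rewrite invf_le1// ltW.
have Ei0 : 0 < E^-1 by rewrite invr_gt0.
split.
- have yE : y * j.+1%:R = j.+3%:R by rewrite /y mulfVK.
  have -> : (E + E^-1) / 2 = (E ^+ 2 + 1) / (2 * E) by field; rewrite gt_eqF.
  have -> : j.+2%:R * ((E - E^-1) / 2) = j.+2%:R * (E ^+ 2 - 1) / (2 * E).
    by field; rewrite gt_eqF.
  congr (_ / _); rewrite sq; have j2 : j.+2%:R = j.+1%:R + 1 :> R by rewrite -natr1.
  have j3 : j.+3%:R = j.+1%:R + 2 :> R by rewrite -[in LHS]natr1 -[in LHS]natr1; ring.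
  by rewrite j2; move: yE; rewrite j3; move: (j.+1%:R : R) => z yE; lra.
- by rewrite gt_eqF// divr_gt0// subr_gt0 (le_lt_trans Ei).
- by rewrite ler_norml; apply/andP; split; lra.
- by rewrite ler_norml; apply/andP; split; lra.
Qed.

(** The upper right block of the product is cosh t B + sinh t (1 0) D; dividing by sinh t leaves the
    pencil with parameter coth t = j + 2. *)
Lemma corner_push j (g : M) : corner (push j *m g) = 0 ->
  \det ((j.+2%:R *: rho S (ursubmx g) + rho S (real_mx F (incl R p q) *m drsubmx g)) *m
    (j.+2%:R *: rho S (ursubmx g) + rho S (real_mx F (incl R p q) *m drsubmx g))^T) = 0.
Proof.
have [cs s0 _ _] := arcothE j.
set s := (expR _ - _) / 2 in cs s0.
have -> : corner (push j *m g) = \det ((s ^+ 2) *: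
   ((j.+2%:R *: rho S (ursubmx g) + rho S (real_mx F (incl R p q) *m drsubmx g)) *m
    (j.+2%:R *: rho S (ursubmx g) + rho S (real_mx F (incl R p q) *m drsubmx g))^T)).
  have e : rho S (ursubmx (push j *m g)) = s *: (j.+2%:R *: rho S (ursubmx g) +
      rho S (real_mx F (incl R p q) *m drsubmx g)).
    rewrite scalerDr scalerA [s * _]mulrC -cs -!rhoZ -rhoD; congr rho.
    rewrite /push cartE// real_mx_block -[g in LHS]submxK mulmx_block block_mxKur.
    have -> : cosh_row (const_mx (arcoth j)) = const_mx ((expR (arcoth j) + expR (- arcoth j)) / 2) :> 'rV[R]_p.
      by apply/rowP => i; rewrite !mxE.
    have -> : sinh_row (const_mx (arcoth j)) = const_mx s :> 'rV[R]_p.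
      by apply/rowP => i; rewrite !mxE.
    rewrite !diag_const_mx mul_scalar_mx.
    congr (_ + _).
      apply/matrixP => i l; rewrite mxE (bigD1 i)//= big1 ?addr0; last first.
        by move=> k /negPf ki; rewrite !mxE eq_sym ki mulr0n (of_real0 S) mul0r.
      by rewrite !mxE eqxx mulr1n.
    rewrite -rscaleAl; congr (_ *m _).
    by apply/matrixP => i l; rewrite !mxE (of_realM S).
  by rewrite /corner e linearZ /= -scalemxAl -scalemxAr scalerA.
rewrite detZ => /eqP; rewrite mulf_eq0 expf_eq0 => /orP[/andP[_]|/eqP//].
by rewrite sqrf_eq0 (negPf s0).
Qed.

Lemma corner_push_eventually g : G g -> exists n, forall j, (n <= j)%N ->
  corner (push j *m g) <> 0.
Proof.
move=> Gg; have gu := pair_G_pseudo P Gg.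
have [|n nP] := @gram_pencil R _ _ (rho S (ursubmx g))
    (rho S (real_mx F (incl R p q) *m drsubmx g)).
  apply: rho_row_free => x; rewrite mulmxA => /(pseudo_bottom_injective gu) x0.
  rewrite -[x]mulmx1 -(real_mx1 S) -(incl_tr R pq') (real_mxM S) mulmxA x0.
  by rewrite mul0mx.
exists n => j nj /corner_push /eqP; apply/negP; exact: nP.
Qed.

(** Hyperbolic sines and cosines stay below 3. In [corner_null] this keeps all translates of a
    bounded set in one ball, of finite Haar measure. *)
Lemma push_bounded : exists B : R, forall j,
  nrm (real_mx F (cart q (- const_mx (arcoth j) : 'rV[R]_p))) <= B.
Proof.
have nZ a (A : 'M[R]_(p + q)) : nrm (real_mx F (a *: A)) = `|a| * nrm (real_mx F A).
  rewrite -nrmZ; congr nrm; apply/matrixP => i j; rewrite !mxE (of_realM S).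
  by [].
have nD (A B : 'M[R]_(p + q)) : nrm (real_mx F (A + B)) <= nrm (real_mx F A) + nrm (real_mx F B).
  rewrite (_ : real_mx F (A + B) = real_mx F A + real_mx F B) ?nrmD//.
  by apply/matrixP => i j; rewrite !mxE (of_realD S).
exists (\sum_(k < p) (3 * nrm (real_mx F (hypm0 q (delta_mx 0 k) (0 : 'rV[R]_p))) +
   3 * nrm (real_mx F (hypm0 q (0 : 'rV[R]_p) (delta_mx 0 k)))) + nrm (real_mx F (hyp_rest R p q))).
move=> j; rewrite /cart /hypm; apply: le_trans (nD _ _) _; rewrite lerD2r.
rewrite hypm0_delta; elim: (index_enum _) => [|k s ih].
  rewrite !big_nil (_ : real_mx F 0 = 0) ?nrm0//; exact: (real_mx0 S).
rewrite !big_cons; apply: le_trans (nD _ _) _; apply: lerD => //.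
have [_ _ c3 s3] := arcothE j.
apply: le_trans (nD _ _) _; apply: lerD; rewrite nZ ler_wpM2r ?nrm_ge0//.
  by rewrite !mxE opprK addrC.
by rewrite !mxE opprK -normrN -mulNr opprB.
Qed.

Variable haarG : {measure set (borel_mx F (p + q)) -> \bar R}.
Hypothesis haar : haar_measure G haarG.

(** Take a bounded part of the zero set and its preimages [E j] under the translations [push j]; all
    have the same measure. By [corner_push_eventually] a point of [G] lies in only finitely many
    [E j], so the unions of the [E j] with j >= n decrease to a null set. Their measures are finite
    and tend to 0, yet each is at least the common measure. *)
Lemma corner_null : haarG [set g : borel_mx F (p + q) | corner g = 0] = 0%E.
Proof.
pose Z := [set g : borel_mx F (p + q) | corner g = 0].
have mZ : measurable Z.
  by have := corner_measurable measurableT (measurable_set1 (0 : R)); rewrite setTI.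
pose Zr r := Z `&` nball S (0 : M) r%:R.
have mZr r : measurable (Zr r) by apply: measurableI => //; exact: nball_borel.
suff Z0 r : haarG (Zr r) = 0%E.
  have -> : [set g : borel_mx F (p + q) | corner g = 0] = \bigcup_r Zr r.
    apply/seteqP; split=> [g gZ|g [r _ []]//].
    exists (Num.bound (nrm (g : M))) => //; split => //; rewrite /nball /= subr0.
    by apply: archi_boundP; exact: nrm_ge0.
  apply: measure_negligible; first exact: bigcup_measurable.
  by apply: negligible_bigcup => r; exists (Zr r); split.
apply/eqP; apply: contrapT => /negP; rewrite -measure_gt0 => Z0.
have [B HB] := push_bounded.
pose E j := ltrans (push j) (Zr r).
have mE j : measurable (E j).
  rewrite -[E j]setTI; apply: (@mulmx_measurable _ _ _ _ _ (fun=> push j) id) => //.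
have EZ j : haarG (E j) = haarG (Zr r).
  by rewrite (haar_ltrans haar)//; exact: (pair_cart P).
pose U n := \bigcup_(j in [set j | (n <= j)%N]) E j.
have mU n : measurable (U n) by apply: bigcup_measurable => j _; exact: mE.
have Zfin : (haarG (Zr r) < +oo)%E.
  apply: le_lt_trans (haar_nball_fin S haar 0 r%:R).
  by apply: le_measure; rewrite ?inE//; [exact: nball_borel|move=> g []].
have U0 : (haarG (U 0%N) < +oo)%E.
  apply: le_lt_trans (haar_nball_fin S haar 0 (B * r%:R + 1)).
  apply: le_measure; rewrite ?inE//; first exact: nball_borel.
  move=> g [j _ [_ gr]]; rewrite /nball /= subr0.
  rewrite /nball /= subr0 in gr.
  have -> : (g : M) = real_mx F (cart q (- const_mx (arcoth j) : 'rV[R]_p)) *m (push j *m (g : M)).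
    by rewrite mulmxA /push -(real_mxM S) cartNK// (real_mx1 S) mul1mx.
  apply: le_lt_trans (nrmM _ _ _) _; rewrite ltr_pwDr//.
  by apply: ler_pM; rewrite ?nrm_ge0//; exact: ltW.
have UI : haarG (\bigcap_n U n) = 0%E.
  have [nG _ _ _] := haar; apply: measure_negligible; first exact: bigcap_measurable.
  apply: negligibleS nG => g Ug Gg; have [n nP] := corner_push_eventually Gg.
  by have [j /= nj [/(nP j nj)]] := Ug n I.
have niU : nonincreasing_seq U.
  by move=> m n mn; apply/subsetPset => g [j /= nj Ej]; exists j => //=; exact: leq_trans nj.
have e0 : 0 < fine (haarG (Zr r)) by rewrite fine_gt0// Z0.
have [n] := measure_shrink U0 mU niU UI e0.
rewrite fineK ?ge0_fin_numE//; apply/negP; rewrite -leNgt -(EZ n).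
by apply: le_measure; rewrite ?inE// => g Eg; exists n => /=.
Qed.

Lemma pair_singular (mK : probability (borel_mx F (p + q)) R) X l : (0 < sdim S)%N ->
  (l < p)%N -> haar_measure K mK -> one_nonzero_entry X ->
  mutually_singular (convolution_pow (delta_natural mK X) l) haarG.
Proof.
move=> d0 lp hK [H HX H1].
have [i0 Hi0] := mem_card1 H1.
have H0 i : i != i0 -> H 0 i = 0.
  by move=> ii0; have := Hi0 i; rewrite !inE (negPf ii0) => /negbFE/eqP.
have [d [T [Pr [k [mk nK law _]]]]] := @represents_pow _ _ _ K mK X l hK.
have eX : expmx X = cart q H by rewrite HX (expmx_cartan pq').
rewrite {}eX in nK law.
pose A := [set g : borel_mx F (p + q) | corner g != 0].
have mA : measurable A.
  have -> : A = ~` (setT `&` corner @^-1` [set 0]).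
    by rewrite setTI; apply/seteqP; split=> g /= /eqP.
  apply: measurableC; exact: corner_measurable measurableT _ (measurable_set1 0).
exists A; split=> //; last first.
  by rewrite -corner_null; congr (haarG _); apply/seteqP; split=> g /=; [move/negP; rewrite negbK => /eqP|move=> g0; apply/negP; rewrite negbK; apply/eqP].
rewrite law//; apply: measure_negligible.
  by rewrite -[X in measurable X]setTI; apply: ev_measurable.
apply: negligibleS nK => x Ax; apply: contrapT => nK.
have Kx i : (i < slots (delta_word (real_mx F (cart q H) : M) l))%N -> K (k x i).
  by move=> il; apply: contrapT => nKi; apply: nK; exists i.
have [U [V UV]] := corner_factors H0 Kx.
by move: Ax; rewrite /A /= /corner UV (rho_thin _ _ lp d0) eqxx.
Qed.

End pair_singular.

(** * Generators of the compact groups *)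

Section block_matrices.
Context (R : realType) (F : hypercomplexType R) (S : scalar_structure F).
Context (p q : nat).
Local Notation M := 'M[F]_(p + q).
Local Notation N := (p + q)%N.
Local Notation Sg := (signature_mx p q : M).
Local Notation of_real := (of_real : R -> F).
Implicit Types (A Z g h : M) (i l k : 'I_N).

Definition eps i : F := if (i < p)%N then -1 else 1.

Lemma sig_diag : Sg = diag_mx (\row_i eps i).
Proof.
apply/matrixP => i l; rewrite !mxE /eps.
case: splitP => a ia; rewrite mxE; case: splitP => b lb; rewrite !mxE -?val_eqE /= ?ia ?lb.
- by rewrite mulNrn.
- by rewrite (ltn_eqF (ltn_addr _ (ltn_ord a))).
- by rewrite (gtn_eqF (ltn_addr _ (ltn_ord b))).
- by rewrite eqn_add2l.
Qed.

Lemma sigMl A i l : (Sg *m A) i l = eps i * A i l.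
Proof. by rewrite sig_diag mul_diag_mx !mxE. Qed.

Lemma sigMr A i l : (A *m Sg) i l = A i l * eps l.
Proof. by rewrite sig_diag mul_mx_diag !mxE. Qed.

Definition same i l := (i < p)%N == (l < p)%N.

Lemma same_eps i l : same i l -> eps i = eps l.
Proof. by rewrite /same /eps => /eqP ->. Qed.

Lemma eps_mul_sqr i (x : F) : eps i * (eps i * x) = x.
Proof. by rewrite /eps; case: ifP; rewrite ?mulN1r ?opprK ?mul1r. Qed.

Lemma epsC i (x : F) : eps i * x = x * eps i.
Proof. by rewrite /eps; case: ifP; rewrite ?mulN1r ?mulrN1 ?mul1r ?mulr1. Qed.

Lemma sig_commute_block A : (forall i l, ~~ same i l -> A i l = 0) -> A *m Sg = Sg *m A.
Proof.
move=> h; apply/matrixP => i l; rewrite sigMl sigMr -epsC.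
have [il|il] := boolP (same i l); first by rewrite (same_eps il).
by rewrite h// !mulr0.
Qed.

Lemma block_diag_sig (k1 : 'M[F]_p) (k2 : 'M[F]_q) :
  block_diag_mx k1 k2 *m Sg = Sg *m block_diag_mx k1 k2.
Proof.
rewrite /block_diag_mx /signature_mx !mulmx_block !mul0mx !mulmx0.
by rewrite !mulNmx !mulmxN !mul1mx !mulmx1 !addr0 !add0r.
Qed.

Lemma block_diag_unitary (k1 : 'M[F]_p) (k2 : 'M[F]_q) :
  unitary (R := R) N (block_diag_mx k1 k2) <-> unitary (R := R) p k1 /\ unitary (R := R) q k2.
Proof.
rewrite /unitary /block_diag_mx /= adjoint_block !(adjoint0 S) !mulmx_block.
rewrite !(mul0mx, mulmx0, addr0, add0r) scalar_mx_block.
by split => [/eq_block_mx[-> _ _ ->]|[-> ->]].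
Qed.

Lemma neg_fixed m n (A : 'M[F]_(m, n)) : A = - A -> A = 0.
Proof.
move=> AN; apply: (@mco_inj _ _ S) => x; rewrite mco0.
have : mco A x = mco (S := S) (- A) x by rewrite -AN.
by rewrite mcoN => h; lra.
Qed.

Lemma sig_commuteP g : g *m Sg = Sg *m g ->
  g = block_diag_mx (ulsubmx g) (drsubmx g) /\ (forall i l, ~~ same i l -> g i l = 0).
Proof.
move=> gS; have h : g = block_diag_mx (ulsubmx g) (drsubmx g).
  move: gS; rewrite -{1 2}[g]submxK /signature_mx !mulmx_block !mul0mx !mulmx0.
  rewrite !mulNmx !mulmxN !mul1mx !mulmx1 !addr0 !add0r => /eq_block_mx[_ u d _].
  rewrite -{1}[g]submxK /block_diag_mx; by congr block_mx; apply: neg_fixed.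
split=> // i l; rewrite h /block_diag_mx /same !mxE.
case: splitP => a ia; rewrite mxE; case: splitP => b lb; by rewrite ?mxE// ?ia ?lb.
Qed.

Lemma unitaryM n (g h : 'M[F]_n) : unitary (R := R) n g -> unitary (R := R) n h ->
  unitary (R := R) n (g *m h).
Proof.
rewrite /unitary /= => gu hu; rewrite (adjoint_mul S) mulmxA -(mulmxA _ _ g) gu mulmx1.
exact: hu.
Qed.

Lemma unitary_adj g : unitary (R := R) N g -> unitary (R := R) N (adjoint_mx g).
Proof. by rewrite /unitary /= (adjointK S) => /(mulmx_left_inv S). Qed.

Lemma adj_commute g : g *m Sg = Sg *m g -> adjoint_mx g *m Sg = Sg *m adjoint_mx g.
Proof. by move=> /(congr1 (@adjoint_mx _ _ _ _)); rewrite !(adjoint_mul S) (sig_adj S) => ->. Qed.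

Lemma rodr_adj n (C : 'M[F]_n) t : adjoint_mx C = - C -> adjoint_mx (rodr C t) = rodr C (- t).
Proof.
move=> CN; rewrite /rodr !(adjointD S) (adjoint1 S) !(adjoint_scale S) (adjoint_mul S) CN.
rewrite mulmxN mulNmx opprK sinN cosN; congr (_ + _ + _).
by apply/matrixP => i j; rewrite !mxE (of_realN S) mulNr mulrN.
Qed.

Lemma rodr_unitary n (C : 'M[F]_n) t : adjoint_mx C = - C -> C *m C *m C = - C ->
  unitary (R := R) n (rodr C t).
Proof. by move=> CN C3; rewrite /unitary /= rodr_adj// (rodrNK S). Qed.

Lemma rodr_commute (C : M) t : C *m Sg = Sg *m C -> rodr C t *m Sg = Sg *m rodr C t.
Proof.
move=> CS; rewrite /rodr !(mulmxDl, mulmxDr) mul1mx mulmx1 !rscaleAl !(rscaleAr S) CS.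
by rewrite -mulmxA CS mulmxA CS !mulmxA.
Qed.

(** The coordinates of the differential at the identity of the equation defining pseudo-unitary
    matrices. *)
Definition lam0 (x : coidx S N N) Z := mco (S := S) (adjoint_mx Z *m Sg + Sg *m Z) x.

Lemma lam0_linear x : real_linear (lam0 x).
Proof.
split=> [A B|a A]; rewrite /lam0.
  by rewrite (adjointD S) mulmxDl mulmxDr addrACA mcoD.
rewrite (adjoint_scale S) rscaleAl (rscaleAr S) -mcoZ; congr mco.
by rewrite /rscale scalerDr.
Qed.

Lemma lam0_skew Z : (forall x, lam0 x Z = 0) -> adjoint_mx Z *m Sg + Sg *m Z = 0.
Proof. by move=> h; apply: (@mco_inj _ _ S) => x; rewrite mco0; exact: h. Qed.

Lemma lam0_conj h h' Z : pseudo_unitary (R := R) p q h -> h *m h' = 1%:M ->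
  h' *m h = 1%:M -> (forall x, lam0 x Z = 0) -> forall x, lam0 x (h' *m Z *m h) = 0.
Proof.
move=> hu hh' h'h /lam0_skew Z0 x; rewrite /lam0 (_ : _ + _ = 0) ?mco0//.
have e : h' = pinv h.
  by rewrite -[pinv h]mulmx1 -hh' mulmxA (pseudo_pinv hu) mul1mx.
have Sh : Sg *m h' = adjoint_mx h *m Sg by rewrite e pinvE !mulmxA sig_sqr mul1mx.
have Sh' : adjoint_mx h' *m Sg = Sg *m h.
  by have := congr1 (@adjoint_mx _ _ _ _) Sh; rewrite !(adjoint_mul S) (adjointK S) (sig_adj S).
rewrite !(adjoint_mul S) -(mulmxA _ _ Sg) -(mulmxA _ _ Sg) Sh' !mulmxA Sh.
by rewrite -!mulmxA -mulmxDr !mulmxA -mulmxDl Z0 mul0mx mulmx0.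
Qed.

(** Subtracting the equations of [g] and [g'] expresses the differential at D = g - g' by products
    of D with [g - 1] or with the adjoint of [g' - 1], both of size [rho]. *)
Lemma lam0_small (G : set M) x e : G `<=` pseudo_unitary (R := R) p q -> 0 < e ->
  exists2 rho, 0 < rho &
  forall g g', G g -> G g' -> nball S 1%:M rho g -> nball S 1%:M rho g' ->
    `|lam0 x (g - g')| <= e * nrm S (g - g').
Proof.
move=> Gp e0; pose s := nrm S Sg + 1; have s0 : 0 < s by rewrite ltr_wpDl ?nrm_ge0.
exists (e / (2 * s)); first by rewrite divr_gt0// mulr_gt0.
move=> g g' /Gp gu /Gp gu'; rewrite /nball /= => gb gb'.
apply: le_trans (mco_le_nrm _ _) _; set D := g - g'.
have -> : adjoint_mx D *m Sg + Sg *m D =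
    - (adjoint_mx D *m Sg *m (g - 1%:M) + adjoint_mx (g' - 1%:M) *m Sg *m D).
  have h : adjoint_mx D *m Sg *m g + adjoint_mx g' *m Sg *m D = 0.
    by rewrite /D (adjointB S) !mulmxBl mulmxBr gu gu' addrA subrK subrr.
  clearbody D; rewrite mulmxBr mulmx1 (adjointB S) (adjoint1 S) !mulmxBl mul1mx.
  by rewrite addrACA h add0r opprD !opprK.
rewrite nrmN; apply: le_trans (nrmD _ _ _) _.
have h1 : nrm S (adjoint_mx D *m Sg *m (g - 1%:M)) <= nrm S D * s * (e / (2 * s)).
  apply: le_trans (nrmM _ _ _) _; apply: ler_pM; [exact: nrm_ge0|exact: nrm_ge0| |exact: ltW].
  apply: le_trans (nrmM _ _ _) _; rewrite nrm_adjoint ler_wpM2l ?nrm_ge0//.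
  by rewrite /s lerDl.
have h2 : nrm S (adjoint_mx (g' - 1%:M) *m Sg *m D) <= e / (2 * s) * s * nrm S D.
  apply: le_trans (nrmM _ _ _) _; apply: ler_pM; rewrite ?nrm_ge0//.
  apply: le_trans (nrmM _ _ _) _; rewrite nrm_adjoint; apply: ler_pM; [exact: nrm_ge0|exact: nrm_ge0|exact: ltW|].
  by rewrite /s lerDl.
apply: le_trans (lerD h1 h2) _; rewrite le_eqVlt; apply/orP; left; apply/eqP.
by field; rewrite gt_eqF.
Qed.

Definition plane i l (u : F) : M := u *: delta_mx i l - conj u *: delta_mx l i.

Lemma planeM i l u A k b : i != l -> (plane i l u *m A) k b =
  if k == i then u * A l b else if k == l then - (conj u * A i b) else 0.
Proof.
move=> il; rewrite mxE.
have [->|ki] := eqVneq k i.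
  rewrite (bigD1 l)//= big1 ?addr0 => [|j /negPf jl].
    by rewrite !mxE !eqxx (negPf il) /= mulr0 subr0 mulr1.
  by rewrite !mxE eqxx (negPf il) jl /= !mulr0 subr0 mul0r.
have [->|kl] := eqVneq k l.
  rewrite (bigD1 i)//= big1 ?addr0 => [|j /negPf ji].
    by rewrite !mxE !eqxx (eq_sym l i) (negPf il) /= mulr0 sub0r mulr1 mulNr.
  by rewrite !mxE eqxx (eq_sym l i) (negPf il) ji /= !mulr0 subr0 mul0r.
by rewrite big1// => j _; rewrite !mxE (negPf ki) (negPf kl) /= !mulr0 subr0 mul0r.
Qed.

Lemma planeE i l u k b : i != l -> plane i l u k b =
  if k == i then u * (l == b)%:R else if k == l then - (conj u * (i == b)%:R) else 0.
Proof. by move=> il; rewrite -[plane i l u]mulmx1 planeM// !mxE. Qed.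

Lemma plane_adj i l u : adjoint_mx (plane i l u) = - plane i l u.
Proof.
apply/matrixP => a b; rewrite !mxE (hconjD S) (hconjN S) !(hconjM S) (hconjK S).
have e (c : bool) : conj (c%:R : F) = c%:R by case: c; rewrite ?(hconj1 S) ?(hconj0 S).
rewrite !e opprB; congr (_ - _).
  by rewrite andbC; case: (_ && _); rewrite ?mulr1 ?mulr0 ?mul1r ?mul0r.
by rewrite andbC; case: (_ && _); rewrite ?mulr1 ?mulr0 ?mul1r ?mul0r.
Qed.

Lemma plane_cube i l u : i != l -> u * conj u = 1 -> conj u * u = 1 ->
  plane i l u *m plane i l u *m plane i l u = - plane i l u.
Proof.
move=> il u1 u2; apply/matrixP => a b; rewrite -mulmxA !planeM// [RHS]mxE !eqxx.
rewrite (eq_sym l i) (negPf il).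
have [->|ai] := eqVneq a i; first by rewrite mulrN mulrA u1 mul1r.
have [->|al] := eqVneq a l; first by rewrite mulrA u2 mul1r.
by rewrite planeE// (negPf ai) (negPf al) oppr0.
Qed.

Lemma plane_block i l u : i != l -> same i l -> plane i l u *m Sg = Sg *m plane i l u.
Proof.
move=> il sil; apply: sig_commute_block => a b; rewrite planeE//.
have [->|ai] := eqVneq a i.
  by case: eqP => [<-|_]; rewrite ?sil ?mulr0.
have [->|al //] := eqVneq a l.
by case: eqP => [<-|_]; rewrite ?mulr0 ?oppr0// /same eq_sym [_ == _]sil.
Qed.

Lemma rodr_plane i l u t A k b : i != l -> u * conj u = 1 -> conj u * u = 1 ->
  (rodr (plane i l u) t *m A) k b =
  if k == i then of_real (cos t) * A i b + of_real (sin t) * (u * A l b)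
  else if k == l then of_real (cos t) * A l b - of_real (sin t) * (conj u * A i b)
  else A k b.
Proof.
move=> il u1 u2; rewrite (rodr_mulE S) -[plane i l u *m plane i l u *m A]mulmxA.
have e (X Y : M) : (A + X + rscale (cos t) (- X) + rscale (sin t) Y) k b =
    A k b + X k b - of_real (cos t) * X k b + of_real (sin t) * Y k b.
  by rewrite !mxE mulrN.
rewrite e !planeM// !eqxx (eq_sym l i) (negPf il).
have [->|ki] := eqVneq k i; first by
  rewrite (_ : u * - (conj u * A i b) = - A i b) ?subrr ?sub0r ?mulrN ?opprK// mulrA u1 mul1r.
have [->|kl] := eqVneq k l.
  by rewrite (_ : conj u * (u * A l b) = A l b) ?subrr ?sub0r ?mulrN ?opprK// mulrA u2 mul1r.
by rewrite !mulr0 subr0 !addr0.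
Qed.

(** What elimination has to know of [h]: other rows are untouched, and a column that already
    vanishes in both rows stays as it is. In this form the property is stable under products. *)
Definition planar i l h := forall A k b,
  (k != i) && (k != l) \/ A i b = 0 /\ A l b = 0 -> (h *m A) k b = A k b.

Lemma planarM i l h h' : planar i l h -> planar i l h' -> planar i l (h *m h').
Proof.
move=> ph ph' A k b c; rewrite -mulmxA ph; first exact: ph'.
by case: c => [|[Ai Al]]; [left|right; rewrite !ph'//; right].
Qed.

Lemma planar_rodr i l u t : i != l -> u * conj u = 1 -> conj u * u = 1 ->
  planar i l (rodr (plane i l u) t).
Proof.
move=> il u1 u2 A k b c; rewrite rodr_plane//.
have [ki|ki] := eqVneq k i.
  by case: c => [|[Ai Al]]; rewrite ki ?eqxx// Ai Al !mulr0 addr0.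
have [kl|//] := eqVneq k l.
by case: c => [|[Ai Al]]; rewrite kl ?eqxx ?andbF// Ai Al !mulr0 subr0.
Qed.

(* Rotating in the plane [(i, l)] by [atan r] when the entries are proportional. *)
Lemma plane_kill (gens : seq M) i l A b : i != l -> plane i l 1 \in gens ->
  (A i b = 0 \/ exists r, A l b = of_real r * A i b) ->
  exists h, [/\ generated gens h, planar i l h & (h *m A) l b = 0].
Proof.
move=> il pg Ar; have c1 : conj 1 = 1 :> F by exact: (hconj1 S).
have [t ht] : exists t, of_real (cos t) * A l b - of_real (sin t) * A i b = 0.
  case: Ar => [Ai|[r ->]].
    by exists (pi / 2); rewrite cos_pihalf (of_real0 S) mul0r Ai mulr0 subr0.
  exists (atan r); have c0 : cos (atan r) != 0.
    by rewrite gt_eqF// cos_gt0_pihalf// atan_gtNpi2 atan_ltpi2.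
  have -> : sin (atan r) = r * cos (atan r).
    by rewrite -[LHS](divfK c0) -/(tan _) atanK.
  by rewrite mulrA -(of_realM S) [cos _ * _]mulrC subrr.
exists (rodr (plane i l 1) t); split.
- exact: generated_rodr.
- by apply: planar_rodr; rewrite ?c1 ?mul1r.
- by rewrite rodr_plane ?c1 ?mul1r// eq_sym (negPf il) eqxx.
Qed.

End block_matrices.

(** * Elimination by plane rotations *)

Section elimination.
Context (R : realType) (F : hypercomplexType R) (S : scalar_structure F).
Context (p q : nat).
Local Notation M := 'M[F]_(p + q).
Local Notation N := (p + q)%N.
Local Notation Sg := (signature_mx p q : M).
Implicit Types (g h : M) (i l k : 'I_N).
Variables (K : set M) (gens : seq M).
Hypothesis KM : forall g h, K g -> K h -> K (g *m h).
Hypothesis K_adj : forall g, K g -> K (adjoint_mx g).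
Hypothesis K_unitary : K `<=` unitary (R := R) N.
Hypothesis K_sig : forall g, K g -> g *m Sg = Sg *m g.
Hypothesis gens_K : forall C t, C \in gens -> K (rodr C t).

Definition fixes (A : pred 'I_N) g := forall k j, A k -> g j k = (j == k)%:R.

Lemma fixesM A g h : fixes A g -> fixes A h -> fixes A (g *m h).
Proof.
move=> fg fh k j Ak; rewrite mxE (bigD1 k)//= big1 ?addr0 => [|m /negPf mk].
  by rewrite (fh _ _ Ak) eqxx mulr1 fg.
by rewrite (fh _ _ Ak) mk mulr0.
Qed.

Lemma fixes_row A g k j : unitary (R := R) N g -> fixes A g -> A k -> g k j = (k == j)%:R.
Proof.
move=> gu fg Ak; have := congr1 (fun B : M => B j k) gu; rewrite [RHS]mxE mxE.
rewrite (bigD1 k)//= big1 ?addr0 => [|m /negPf mk]; last by rewrite (fg _ _ Ak) mk mulr0.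
rewrite (fg _ _ Ak) eqxx mulr1 !mxE => h.
rewrite -[LHS](hconjK S) h eq_sym; case: eqP => _; [exact: (hconj1 S)|exact: (hconj0 S)].
Qed.

Lemma planar_fixes A i l h : ~~ A i -> ~~ A l -> planar i l h -> fixes A h.
Proof.
move=> Ai Al ph k j Ak; have c : (1%:M : M) i k = 0 /\ (1%:M : M) l k = 0.
  rewrite !mxE; split; case: eqP => // e; move: Ak; rewrite -e ?(negPf Ai) ?(negPf Al)//.
by rewrite -[h]mulmx1 (ph _ _ _ (or_intror c)) mxE.
Qed.

Hypothesis K1 : K 1%:M.
(* A plane rotation, preceded by phases, annihilates one entry. *)
Hypothesis kill : forall i l g b, i != l -> same i l ->
  exists h, [/\ generated gens h, planar i l h & (h *m g) l b = 0].
Hypothesis normalize : forall (A : pred 'I_N) i g, K g -> fixes A g -> ~~ A i ->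
  (forall l, l != i -> g l i = 0) ->
  exists h, [/\ generated gens h, fixes A h & (h *m g) i i = 1 /\
    forall l, l != i -> (h *m g) l i = 0].

Lemma generated_K h : generated gens h -> K h.
Proof. by elim=> [//|C t g Cg _ Kg]; apply: KM => //; exact: gens_K. Qed.

Lemma kill_column (A : pred 'I_N) i g (s : seq 'I_N) : K g -> ~~ A i ->
  (forall l, l \in s -> l != i /\ ~~ A l) ->
  exists h, [/\ generated gens h, fixes A h & forall l, l \in s -> (h *m g) l i = 0].
Proof.
move=> Kg Ai; elim: s => [|l s ih] hs.
  exists 1%:M; split => //; first exact: generated1.
  by move=> k j _; rewrite mxE.
have [|h [gh fh zh]] := ih; first by move=> k ks; apply: hs; rewrite inE ks orbT.
have [li Al] := hs l (mem_head _ _).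
have [sil|sil] := boolP (same i l); last first.
  exists h; split => // k; rewrite inE => /orP[/eqP ->|]; last exact: zh.
  have Khg : K (h *m g) by apply: KM => //; exact: generated_K.
  have [_ nz] := sig_commuteP S (K_sig Khg); apply: nz.
  by move: sil; rewrite /same eq_sym.
have [|h' [gh' ph' zh']] := @kill i l (h *m g) i _ sil; first by rewrite eq_sym.
exists (h' *m h); split.
- exact: generatedM.
- by apply: fixesM => //; exact: planar_fixes ph'.
- move=> k; rewrite inE -mulmxA => /orP[/eqP -> //|ks].
  have [->//|kl] := eqVneq k l.
  have ki : k != i by have [] := hs k; rewrite ?inE ?ks ?orbT.
  have c : (k != i) && (k != l) by rewrite ki kl.
  by rewrite (ph' _ _ _ (or_introl c)) zh.
Qed.

(** Columns are made those of the identity one at a time. Rotations among the free indices clear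
    column [i]; its entries in the fixed rows vanish by unitarity ([fixes_row]), and [normalize]
    turns the remaining diagonal entry into 1. All factors fix the columns already treated. *)
Lemma eliminate m (A : pred 'I_N) g : #|predC A| = m -> K g -> fixes A g ->
  exists2 h, generated gens h & h *m g = 1%:M.
Proof.
elim: m A g => [|m ih] A g cA Kg fg.
  exists 1%:M; first exact: generated1.
  rewrite mul1mx; apply/matrixP => j k; rewrite mxE fg//.
  by have /card0_eq/(_ k) := cA; rewrite !inE => /negbFE.
have [i Ai] : exists i, ~~ A i.
  have : (0 < #|predC A|)%N by rewrite cA.
  by case/card_gt0P => i; rewrite !inE => Ai; exists i.
have [|h1 [gh1 fh1 zh1]] := @kill_column A i g [seq l <- enum 'I_N | (l != i) && ~~ A l] Kg Ai.
  by move=> l; rewrite mem_filter => /andP[/andP[]].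
have Kg1 : K (h1 *m g) by apply: KM => //; exact: generated_K.
have fg1 : fixes A (h1 *m g) by exact: fixesM.
have z1 l : l != i -> (h1 *m g) l i = 0.
  move=> li; have [Al|Al] := boolP (A l); last by apply: zh1; rewrite mem_filter li Al mem_enum.
  by rewrite (fixes_row i (K_unitary Kg1) fg1 Al) (negPf li).
have [h2 [gh2 fh2 [w2 z2]]] := normalize Kg1 fg1 Ai z1.
pose A' : pred 'I_N := predU1 i A.
have [|||h3 gh3 e3] := ih A' (h2 *m (h1 *m g)).
- have := cardC1 i; have := cardD1 i (predC A); rewrite inE/= Ai cA => -[->] _.
  by apply: eq_card => k; rewrite !inE negb_or.
- by apply: KM => //; exact: generated_K.
- move=> k j /predU1P[->|Ak]; last exact: (fixesM fh2 fg1).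
  by have [->|/z2] := eqVneq j i.
by exists (h3 *m (h2 *m h1)); rewrite -?mulmxA//; do 2 (apply: generatedM => //).
Qed.

Lemma K_generated g : K g -> generated gens g.
Proof.
move=> Kg; have Ka := K_adj Kg.
(* Elimination produces a generated left inverse, so it is applied to the adjoint, whose inverse is
   [g] itself. *)
have [//|h gh hg] := @eliminate _ pred0 (adjoint_mx g) erefl Ka.
have -> // : g = h.
by rewrite -[h]mulmx1 -(K_unitary Kg) mulmxA hg mul1mx.
Qed.

End elimination.

Section skew_orthogonality.
Context (R : realType) (F : hypercomplexType R) (S : scalar_structure F).
Context (p q : nat).
Local Notation M := 'M[F]_(p + q).
Local Notation N := (p + q)%N.
Local Notation Sg := (signature_mx p q : M).
Local Notation re := (@co R F S (re_idx S)).
Variable Z : M.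
Hypothesis Zskew : adjoint_mx Z *m Sg + Sg *m Z = 0.

Lemma skew_entry i l : same i l -> conj (Z l i) = - Z i l.
Proof.
move=> sil; have := congr1 (fun A : M => A i l) Zskew.
rewrite mxE sigMl sigMr !mxE -(same_eps F sil) -epsC -mulrDr => /(congr1 (fun x => eps F i * x)).
by rewrite eps_mul_sqr mulr0 => /eqP; rewrite addr_eq0 => /eqP.
Qed.

Lemma retr_plane i l u : i != l -> retr S (Z *m plane i l u) = re (Z l i * u) - re (Z i l * conj u).
Proof.
move=> il; rewrite /retr /mxtrace -coB; congr re.
have e a : (Z *m plane i l u) a a = (Z a i * u) *+ (l == a) - (Z a l * conj u) *+ (i == a).
  rewrite mxE (bigD1 i)//= (bigD1 l)/=; last by rewrite eq_sym.
  rewrite big1 ?addr0 => [|k /andP[/negPf ki /negPf kl]]; last first.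
    by rewrite planeE// ki kl mulr0.
  rewrite !planeE// !eqxx (eq_sym l i) (negPf il).
  by case: (l == a); case: (i == a); rewrite /= ?mulr1 ?mulr0 ?mulr0n ?mulr1n ?oppr0 ?mulr0 ?mulrN.
under eq_bigr do rewrite e; rewrite sumrB (bigD1 l)//= eqxx mulr1n [X in _ + X - _]big1 ?addr0; last first.
  by move=> k kl; rewrite eq_sym (negPf kl).
rewrite (bigD1 i)//= eqxx mulr1n [X in _ - (_ + X)]big1 ?addr0// => k ki.
by rewrite eq_sym (negPf ki).
Qed.

(** Inside a diagonal block [Z] is skew, so the two terms of the trace against a plane generator
    coincide; letting the unit vary kills every coordinate of the entry. *)
Lemma orth_planes : (forall i l e, i != l -> same i l -> retr S (Z *m plane i l (@un R F S e)) = 0) ->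
  (forall i, Z i i = 0) -> ulsubmx Z = 0 /\ drsubmx Z = 0.
Proof.
move=> o d.
have Z0 i l : same i l -> Z i l = 0.
  move=> sil; have [->//|il] := eqVneq i l.
  have sli : same l i by rewrite /same eq_sym.
  apply: (re_un_eq0 (S := S)) => e.
  have := o l i e; rewrite eq_sym => /(_ il sli); rewrite retr_plane 1?eq_sym//.
  have h := skew_entry sli.
  have -> : re (Z l i * conj (@un R F S e)) = - re (Z i l * @un R F S e).
    rewrite -[Z l i]opprK -h mulNr coN -(hconjM S) re_conj.
    by rewrite reM.
  by rewrite opprK => /eqP; rewrite -mulr2n mulrn_eq0 => /eqP.
split; apply/matrixP => a b; rewrite !mxE; apply: Z0.
  by rewrite /same /= !ltn_ord.
by rewrite /same /= !ltnNge !leq_addr.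
Qed.

End skew_orthogonality.

Section plane_generators.
Context (R : realType) (F : hypercomplexType R) (S : scalar_structure F).
Context (p q : nat).
Local Notation M := 'M[F]_(p + q).
Local Notation N := (p + q)%N.
Local Notation Sg := (signature_mx p q : M).
Local Notation un := (@un R F S).
Implicit Types (g h : M) (i l k : 'I_N).

Definition planes : seq M :=
  [seq plane x.1.1 x.1.2 (un x.2) | x <- [seq y <- enum {: 'I_N * 'I_N * 'I_(sdim S)} |
    (y.1.1 != y.1.2) && same y.1.1 y.1.2]].

Lemma mem_planes i l e : i != l -> same i l -> plane i l (un e) \in planes.
Proof.
move=> il sil; apply/mapP; exists (i, l, e) => //.
by rewrite mem_filter /= il sil mem_enum.
Qed.

Lemma planesP C : C \in planes -> exists i l e,
  [/\ i != l, same i l & C = plane i l (un e)].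
Proof.
move=> /mapP[[[i l] e]]; rewrite mem_filter /= => /andP[/andP[il sil] _] ->.
by exists i, l, e.
Qed.

Lemma planes_skew C : C \in planes -> adjoint_mx C = - C.
Proof. by move=> /planesP[i [l [e [_ _ ->]]]]; exact: (plane_adj S). Qed.

Lemma planes_cube C : C \in planes -> C *m C *m C = - C.
Proof.
by move=> /planesP[i [l [e [il _ ->]]]]; apply: plane_cube; rewrite ?un_conjr ?un_conjl.
Qed.

Lemma planes_block C : C \in planes -> C *m Sg = Sg *m C.
Proof. by move=> /planesP[i [l [e [il sil ->]]]]; exact: plane_block. Qed.

Lemma ul_mul_block g h : g *m Sg = Sg *m g -> ulsubmx (g *m h) = ulsubmx g *m ulsubmx h.
Proof.
move=> /(sig_commuteP S)[e _]; rewrite {1}e -{1}[h]submxK /block_diag_mx mulmx_block block_mxKul.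
by rewrite mul0mx addr0.
Qed.

Lemma dr_mul_block g h : g *m Sg = Sg *m g -> drsubmx (g *m h) = drsubmx g *m drsubmx h.
Proof.
move=> /(sig_commuteP S)[e _]; rewrite {1}e -{1}[h]submxK /block_diag_mx mulmx_block block_mxKdr.
by rewrite mul0mx add0r.
Qed.

End plane_generators.

(** * The orthogonal, unitary and symplectic pairs *)

Section special_orthogonal.
Context (R : realType) (p q : nat).
Hypothesis pq : (p <= q)%N.
Local Notation M := 'M[R]_(p + q).
Local Notation N := (p + q)%N.
Local Notation Sg := (signature_mx p q : M).
Local Notation S := (real_structure R).
Local Notation gens := (planes S p q).
Implicit Types (g h : M) (i l k : 'I_N).

Definition Kso g := [/\ unitary (R := R) N g, g *m Sg = Sg *m g, \det (ulsubmx g) = 1 &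
  \det (drsubmx g) = 1].

Lemma SO_x_SOP g : SO_x_SO p q g <-> Kso g.
Proof.
split=> [[k1 [k2 [[u1 d1] [u2 d2] ->]]]|[gu gS d1 d2]].
  split.
  - by apply/(block_diag_unitary S).
  - exact: block_diag_sig.
  - by rewrite /block_diag_mx block_mxKul.
  - by rewrite /block_diag_mx block_mxKdr.
have [e _] := sig_commuteP S gS; move: gu; rewrite e => /(block_diag_unitary S)[u1 u2].
by exists (ulsubmx g), (drsubmx g); split.
Qed.

Lemma KsoM g h : Kso g -> Kso h -> Kso (g *m h).
Proof.
move=> [gu gS g1 g2] [hu hS h1 h2]; split.
- exact: (unitaryM S).
- by rewrite -mulmxA hS !mulmxA gS.
- by rewrite (ul_mul_block S)// det_mulmx g1 h1 mulr1.
- by rewrite (dr_mul_block S)// det_mulmx g2 h2 mulr1.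
Qed.

Lemma adjoint_tr m n (A : 'M[R]_(m, n)) : adjoint_mx A = A^T.
Proof. by apply/matrixP => i j; rewrite !mxE. Qed.

Lemma Kso_adj g : Kso g -> Kso (adjoint_mx g).
Proof.
move=> [gu gS g1 g2]; split.
- exact: (unitary_adj S).
- exact: (adj_commute S).
- by rewrite adjoint_tr -trmx_ulsub det_tr.
- by rewrite adjoint_tr -trmx_drsub det_tr.
Qed.

(** Orthogonality gives each block a determinant of square 1, and the rotation by t is the square of
    the rotation by t/2. *)
Lemma Kso_rodr C t : C \in gens -> Kso (rodr C t).
Proof.
move=> Cg; have C3 := planes_cube Cg; have CN := planes_skew Cg; have CS := planes_block Cg.
have h s : [/\ unitary (R := R) N (rodr C s), rodr C s *m Sg = Sg *m rodr C s &
    \det (ulsubmx (rodr C s)) ^+ 2 = 1 /\ \det (drsubmx (rodr C s)) ^+ 2 = 1].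
  have u : unitary (R := R) N (rodr C s) by exact: (rodr_unitary S).
  have c := rodr_commute S s CS; split => //.
  have [e _] := sig_commuteP S c; move: u; rewrite e => /(block_diag_unitary S)[u1 u2].
  have d n (A : 'M[R]_n) : unitary (R := R) n A -> \det A ^+ 2 = 1.
    by move=> /(congr1 determinant); rewrite det_mulmx adjoint_tr det_tr det1.
  by rewrite /block_diag_mx block_mxKul block_mxKdr !d.
have [u c _] := h t; have [u' c' [d1 d2]] := h (t / 2); split => //.
  by rewrite (splitr t) -(rodrD S)// (ul_mul_block S)// det_mulmx -expr2.
by rewrite (splitr t) -(rodrD S)// (dr_mul_block S)// det_mulmx -expr2.
Qed.

Lemma Kso_kill i l g b : i != l -> same i l ->
  exists h, [/\ generated gens h, planar i l h & (h *m g) l b = 0].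
Proof.
move=> il sil; apply: (plane_kill S il); first exact: (@mem_planes _ _ S p q i l (@ord0 0)).
have [->|g0] := eqVneq (g i b) 0; first by left.
by right; exists (g l b / g i b); rewrite /= divfK.
Qed.

Lemma one_neqN1 : (1 : R) <> -1.
Proof. by move=> h; lra. Qed.

(** The diagonal entry is 1 or -1. A rotation by pi with another free index of the same block
    repairs -1. If no such index is left, that block is diagonal with a single -1, against
    determinant 1. *)
Lemma Kso_normalize (A : pred 'I_N) i g : Kso g -> fixes A g -> ~~ A i ->
  (forall l, l != i -> g l i = 0) ->
  exists h, [/\ generated gens h, fixes A h & (h *m g) i i = 1 /\
    forall l, l != i -> (h *m g) l i = 0].
Proof.
move=> [gu gS g1 g2] fg Ai zg.
have : g i i * g i i = 1.
  have := congr1 (fun B : M => B i i) gu; rewrite adjoint_tr !mxE eqxx (bigD1 i)//=.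
  by rewrite !mxE big1 ?addr0// => l li; rewrite zg// mulr0.
move=> /eqP; rewrite -expr2 sqrf_eq1 => /orP[/eqP w1|/eqP w1].
  exists 1%:M; split; [exact: generated1|by move=> k j _; rewrite mxE|].
  by rewrite mul1mx.
have [[l [li sil Al]]|nl] := pselect (exists l, [/\ l != i, same i l & ~~ A l]).
  have il : i != l by rewrite eq_sym.
  have pg : plane i l 1 \in gens by exact: (@mem_planes _ _ S p q i l (@ord0 0)).
  exists (rodr (plane i l 1) pi); split.
  - exact: generated_rodr.
  - by apply: (planar_fixes Ai Al); apply: (planar_rodr S) => //; rewrite mulr1.
  have E := rodr_plane S pi g _ i il (mulr1 1) (mulr1 1).
  split; first by rewrite E eqxx w1 cospi sinpi (of_real0 S) mul0r addr0 (of_realN S) (of_real1 S) mulrNN mulr1.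
  move=> k ki; rewrite E (negPf ki); case: eqP => [_|_]; last exact: zg.
  by rewrite sinpi zg// mulr0 (of_real0 S) mul0r subr0.
have gE a b : same i b -> g a b = (if b == i then -1 else 1) *+ (a == b).
  move=> sib; have [->|bi] := eqVneq b i.
    by have [->|ai] := eqVneq a i; [exact: w1|rewrite zg].
  rewrite fg//; apply/negPn/negP => Ab; apply: nl; exists b; split => //.
have [ip|ip] := boolP (i < p)%N.
  suff : \det (ulsubmx g) = -1 by rewrite g1 => /one_neqN1.
  have -> : ulsubmx g = diag_mx (\row_b (if lshift q b == i then -1 else 1)).
    apply/matrixP => a b; rewrite !mxE gE; last by rewrite /same ip /= ltn_ord.
    by rewrite (inj_eq (@lshift_inj _ _)); case: (eqVneq a b) => [->|].
  have ei : i = lshift q (Ordinal ip) by exact: val_inj.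
  rewrite det_diag (bigD1 (Ordinal ip))//= mxE -ei eqxx big1 ?mulr1// => b bi.
  by rewrite mxE ei (inj_eq (@lshift_inj _ _)) (negPf bi).
have pi' : (p <= i)%N by rewrite leqNgt.
have iq : (i - p < q)%N by move: pi' (ltn_ord i); clear; lia.
have ei : i = rshift p (Ordinal iq) by apply: val_inj; rewrite /= subnKC.
suff : \det (drsubmx g) = -1 by rewrite g2 => /one_neqN1.
have -> : drsubmx g = diag_mx (\row_b (if rshift p b == i then -1 else 1)).
  apply/matrixP => a b; rewrite !mxE gE; last by rewrite /same (negPf ip) /= ltnNge leq_addr.
  by rewrite (inj_eq (@rshift_inj _ _)); case: (eqVneq a b) => [->|].
rewrite det_diag (bigD1 (Ordinal iq))//= mxE -ei eqxx big1 ?mulr1// => b bi.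
by rewrite mxE ei (inj_eq (@rshift_inj _ _)) (negPf bi).
Qed.

Lemma Kso_generated g : Kso g -> generated gens g.
Proof.
apply: (@K_generated _ _ S p q [set g | Kso g] gens).
- exact: KsoM.
- exact: Kso_adj.
- by move=> k [].
- by move=> k [].
- by move=> C t; exact: Kso_rodr.
- by apply/SO_x_SOP; exists 1%:M, 1%:M; split; [split|split|];
    rewrite /unitary /= ?adjoint_tr ?trmx1 ?mulmx1 ?det1// /block_diag_mx -scalar_mx_block.
- exact: Kso_kill.
- exact: Kso_normalize.
Qed.

Lemma SO_pqM g h : SO_pq p q g -> SO_pq p q h -> SO_pq p q (g *m h).
Proof.
by move=> [gu g1] [hu h1]; split; [exact: (pseudoM S)|rewrite det_mulmx g1 h1 mulr1].
Qed.

Lemma SO0_M g h : SO0_pq p q g -> SO0_pq p q h -> SO0_pq p q (g *m h).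
Proof.
move=> g0 h0; rewrite /SO0_pq (same_connected_component g0).
apply: (@connected_component_max _ _ ((fun x : M => g *m x) @` SO0_pq p q)).
- exists 1%:M; last by rewrite mulmx1.
  by apply: connected_component_refl; split; [exact: (pseudo1 S)|exact: det1].
- move=> _ [x /connected_component_sub x0 <-]; apply: SO_pqM => //.
  exact: connected_component_sub g0.
- apply: connected_continuous_connected; first exact: component_connected.
  apply: continuous_subspaceT => x; apply: (@matrix_continuous R N N) x => i j.
  under eq_fun do rewrite mxE; apply: (@hcontinuous_sum R R) => k.
  by apply: (@hcontinuousM R R); [exact: cst_continuous|exact: entry_continuous].
- by exists h.
Qed.

Lemma SO0_path (f : R -> M) t : continuous f -> (forall s, SO_pq p q (f s)) ->
  f 0 = 1%:M -> SO0_pq p q (f t).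
Proof.
move=> cf fS f0.
apply: (@connected_component_max _ _ (range f)).
- by exists 0.
- by move=> _ [s _ <-]; exact: fS.
- apply: connected_continuous_connected; last exact: continuous_subspaceT.
  by apply/connected_intervalP => x y _ _ z _.
- by exists t.
Qed.

Lemma SO0_adj g : SO0_pq p q g -> SO0_pq p q (Sg *m adjoint_mx g *m Sg).
Proof.
move=> g0.
apply: (@connected_component_max _ _ ((fun x : M => Sg *m adjoint_mx x *m Sg) @` SO0_pq p q)).
- exists 1%:M; last by rewrite adjoint_tr trmx1 mulmx1 sig_sqr.
  by apply: connected_component_refl; split; [exact: (pseudo1 S)|exact: det1].
- move=> _ [x /connected_component_sub[xu x1] <-]; split.
    have e := pinvE x; rewrite -e; apply: (pseudo_of_pinv).
    by rewrite (pinvK S) (pseudo_pinvr S).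
  have s2 : \det Sg * \det Sg = 1 by rewrite -det_mulmx sig_sqr det1.
  by rewrite !det_mulmx adjoint_tr det_tr x1 mulr1.
- apply: connected_continuous_connected; first exact: component_connected.
  apply: continuous_subspaceT => x; apply: (@matrix_continuous R N N) x => i j.
  under eq_fun do rewrite sigMr sigMl adjoint_tr mxE.
  apply: (@hcontinuousM R R); last exact: cst_continuous.
  by apply: (@hcontinuousM R R); [exact: cst_continuous|exact: entry_continuous].
- by exists g.
Qed.

Lemma cont_affine (m n : nat) (A0 A1 A2 : 'M[R]_(m, n)) (a b : R -> R) :
  continuous a -> continuous b -> continuous (fun s => A0 + a s *: A1 + b s *: A2).
Proof.
move=> ca cb s; apply: (@matrix_continuous R m n) s => i j.
under eq_fun do rewrite !mxE.
apply: (@hcontinuousD R R); last by apply: (@hcontinuousM R R) => //; exact: cst_continuous.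
apply: (@hcontinuousD R R); first exact: cst_continuous.
by apply: (@hcontinuousM R R) => //; exact: cst_continuous.
Qed.

Lemma SO0_rodr C t : C \in gens -> SO0_pq p q (rodr C t).
Proof.
move=> Cg; apply: (@SO0_path (rodr C)).
- have := @cont_affine N N 1%:M C (C *m C) (@sin R) (fun s => 1 - cos s).
  apply; first exact: continuous_sin.
  by move=> s; apply: cvgB; [exact: cvg_cst|exact: continuous_cos].
- move=> s; have [u c d1 d2] := Kso_rodr s Cg; split; first exact: unitary_pseudo.
  have [-> _] := sig_commuteP S c.
  by rewrite /block_diag_mx det_ublock d1 d2 mulr1.
- by rewrite (rodr0 S).
Qed.

Lemma Kso_SO0 g : Kso g -> SO0_pq p q g.
Proof.
move/Kso_generated; elim=> [|C t h Cg _ ih].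
  by apply: connected_component_refl; split; [exact: (pseudo1 S)|exact: det1].
by apply: SO0_M => //; exact: SO0_rodr.
Qed.

(** Conjugation by [Sg] inverts [cart q H], so its determinant has square 1; and [cart q H] is the
    square of such a matrix. *)
Lemma det_cart (H : 'rV[R]_p) : \det (cart q H) = 1.
Proof.
have d2 (H' : 'rV[R]_p) : \det (cart q H') ^+ 2 = 1.
  have s2 : \det Sg * \det Sg = 1 by rewrite -det_mulmx sig_sqr det1.
  have := congr1 determinant (cartNK pq H'); rewrite det_mulmx det1 -(sig_cart _ pq) !det_mulmx.
  by rewrite [\det Sg * _]mulrC -[_ * \det Sg * \det Sg]mulrA s2 mulr1 expr2.
by rewrite -(cart_half pq) det_mulmx -expr2.
Qed.

Lemma cart_continuous (H : 'rV[R]_p) : continuous (fun s : R => cart q (s *: H)).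
Proof.
move=> s; apply: (@matrix_continuous R N N) s => i j.
have -> : (fun s => cart q (s *: H) i j) = fun s => \sum_k (
   (expR (s * H 0 k) + expR (- (s * H 0 k))) / 2 * hypm0 q (delta_mx 0 k) (0 : 'rV[R]_p) i j +
   (expR (s * H 0 k) - expR (- (s * H 0 k))) / 2 * hypm0 q (0 : 'rV[R]_p) (delta_mx 0 k) i j)
   + hyp_rest R p q i j.
  apply/funext => s; rewrite /cart /hypm hypm0_delta [LHS]mxE summxE; congr (_ + _).
  apply: eq_bigr => k _; rewrite [LHS]mxE; congr (_ + _); rewrite [LHS]mxE; congr (_ * _).
    by rewrite !mxE.
  by rewrite !mxE.
apply: (@hcontinuousD R R); last exact: cst_continuous.
apply: (@hcontinuous_sum R R) => k.
have ce (a : R) : continuous (fun s : R => expR (s * a)).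
  move=> s; apply: continuous_comp; last exact: continuous_expR.
  by apply: cvgM; [exact: cvg_id|exact: cvg_cst].
have ce' (a : R) : continuous (fun s : R => expR (- (s * a))).
  by under eq_fun do rewrite -mulrN; exact: ce.
apply: (@hcontinuousD R R); apply: (@hcontinuousM R R); try exact: cst_continuous.
  apply: (@hcontinuousM R R); last exact: cst_continuous.
  by apply: (@hcontinuousD R R); [exact: ce|exact: ce'].
apply: (@hcontinuousM R R); last exact: cst_continuous.
by move=> s; apply: cvgB; [exact: ce|exact: ce'].
Qed.

Lemma SO0_cart (H : 'rV[R]_p) : SO0_pq p q (real_mx R (cart q H)).
Proof.
have -> : real_mx R (cart q H) = cart q H by apply/matrixP => i j; rewrite !mxE.
rewrite -[H]scale1r; apply: (@SO0_path (fun s => cart q (s *: H))).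
- exact: cart_continuous.
- move=> s; split; last exact: det_cart.
  have := pseudo_cart S (s *: H) pq.
  by rewrite (_ : real_mx R _ = cart q (s *: H))//; apply/matrixP => i j; rewrite !mxE.
- by rewrite scale0r cart0.
Qed.

Lemma so_orth Z : (forall x, lam0 (S := S) x Z = 0) ->
  (forall C, C \in gens -> retr S (Z *m C) = 0) -> ulsubmx Z = 0 /\ drsubmx Z = 0.
Proof.
move=> /lam0_skew Zs oZ; apply: (orth_planes Zs) => [i l e il sil|i].
  by apply: oZ; exact: mem_planes.
have h : Z i i = - Z i i := skew_entry Zs (eqxx _); lra.
Qed.

Definition so_pair : cartan_pair S (SO0_pq p q) (SO_x_SO p q).
Proof.
have Gp : SO0_pq p q `<=` pseudo_unitary (R := R) p q.
  by move=> g /connected_component_sub[].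
apply: (@CartanPair R R S p q _ _ gens (coidx S N N) (@lam0 _ _ S p q)).
- exact: lam0_linear.
- by move=> x e; exact: lam0_small.
- exact: lam0_skew.
- exact: lam0_conj.
- exact: so_orth.
- exact: planes_skew.
- exact: planes_block.
- exact: planes_cube.
- by move=> C t Cg; apply/SO_x_SOP; exact: Kso_rodr.
- by move=> g /SO_x_SOP; exact: Kso_generated.
- by move=> g h /SO_x_SOP gK /SO_x_SOP hK; apply/SO_x_SOP; exact: KsoM.
- by move=> g /SO_x_SOP gK; apply/SO_x_SOP; exact: Kso_adj.
- by move=> g /SO_x_SOP[].
- by move=> g /SO_x_SOP; exact: Kso_SO0.
- move=> k1 k2 h1 h2; exists k1, k2; split=> //; congr block_diag_mx;
    by apply/matrixP => i j; rewrite !mxE.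
- exact: SO0_M.
- exact: SO0_adj.
- exact: Gp.
- exact: SO0_cart.
Defined.

End special_orthogonal.

(** * Diagonal rotations, polar form and the determinant near the identity *)

Section diagonal_generators.
Context (R : realType) (F : hypercomplexType R) (S : scalar_structure F).
Context (p q : nat).
Local Notation M := 'M[F]_(p + q).
Local Notation N := (p + q)%N.
Local Notation Sg := (signature_mx p q : M).
Local Notation of_real := (of_real : R -> F).
Implicit Types (A : M) (d : 'rV[F]_N) (i l k : 'I_N).

Lemma diag_skew d : (forall k, conj (d 0 k) = - d 0 k) ->
  adjoint_mx (diag_mx d) = - diag_mx d.
Proof.
move=> h; apply/matrixP => a b; rewrite !mxE eq_sym.
by case: eqP => [->|_]; rewrite ?mulr1n ?h// mulr0n (hconj0 S) oppr0.
Qed.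

Lemma diag_cube d : (forall k, d 0 k * d 0 k * d 0 k = - d 0 k) ->
  diag_mx d *m diag_mx d *m diag_mx d = - diag_mx d.
Proof.
move=> h; apply/matrixP => a b; rewrite !mul_mx_diag !mxE.
by case: eqP => [->|_]; rewrite ?mulr1n ?h// !mulr0n !mul0r oppr0.
Qed.

Lemma diag_block d : diag_mx d *m Sg = Sg *m diag_mx d.
Proof.
apply: sig_commute_block => a b ab; rewrite mxE; case: eqP => // e.
by rewrite e /same eqxx in ab.
Qed.

Lemma rodr_diag d t A k b : (rodr (diag_mx d) t *m A) k b = A k b +
  of_real (sin t) * (d 0 k * A k b) + of_real (1 - cos t) * (d 0 k * (d 0 k * A k b)).
Proof.
have dE (B : M) : (diag_mx d *m B) k b = d 0 k * B k b by rewrite mul_diag_mx mxE.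
have e (X Y : M) : (A + X + rscale (cos t) (- X) + rscale (sin t) Y) k b =
    A k b + X k b - of_real (cos t) * X k b + of_real (sin t) * Y k b.
  by rewrite !mxE mulrN.
rewrite (rodr_mulE S) -[diag_mx d *m diag_mx d *m A]mulmxA e !dE.
rewrite (of_realB S) (of_real1 S) mulrBl mul1r -!addrA; congr (_ + _).
by rewrite [RHS]addrC -addrA.
Qed.

Lemma rodr_diag0 d t A k b : d 0 k = 0 -> (rodr (diag_mx d) t *m A) k b = A k b.
Proof. by move=> d0; rewrite rodr_diag d0 !mul0r !mulr0 !addr0. Qed.

Lemma rodr_diag1 d t A k b : d 0 k * d 0 k = -1 -> (rodr (diag_mx d) t *m A) k b =
  of_real (cos t) * A k b + of_real (sin t) * (d 0 k * A k b).
Proof.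
move=> d1; rewrite rodr_diag [d 0 k * (d 0 k * _)]mulrA d1 mulN1r mulrN.
by rewrite (of_realB S) mulrBl (of_real1 S) mul1r opprB addrC addrA subrK.
Qed.

Lemma planar_diag i l d t : (forall k, k != i -> k != l -> d 0 k = 0) ->
  planar i l (rodr (diag_mx d) t).
Proof.
move=> d0 A k b [/andP[ki kl]|[Ai Al]]; first by rewrite rodr_diag0// d0.
have [ki|ki] := eqVneq k i; first by rewrite ki rodr_diag Ai !mulr0 !addr0.
have [kl|kl] := eqVneq k l; first by rewrite kl rodr_diag Al !mulr0 !addr0.
by rewrite rodr_diag0// d0.
Qed.

End diagonal_generators.

Section polar_form.
Context (R : realType).
Local Open Scope complex_scope.

Lemma unit_circle_param (a b : R) : a ^+ 2 + b ^+ 2 = 1 -> exists s, cos s = a /\ sin s = b.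
Proof.
move=> ab; have a1 : -1 <= a <= 1.
  by rewrite -ler_norml -(ler_pXn2r (n := 2)) ?nnegrE// expr1n real_normK ?num_real//; nra.
have [_ ca] := acos_def a1.
have : sin (acos a) ^+ 2 = b ^+ 2 by have := cos2Dsin2 (acos a); rewrite ca; lra.
move=> /eqP; rewrite eqf_sqr => /orP[/eqP e|/eqP e].
  by exists (acos a).
by exists (- acos a); rewrite cosN sinN e opprK.
Qed.

Lemma polar (z : R[i]) : exists r s : R, z = r%:C * circ s.
Proof.
case: z => a b; pose r := Num.sqrt (a ^+ 2 + b ^+ 2).
have r2 : r ^+ 2 = a ^+ 2 + b ^+ 2 by rewrite sqr_sqrtr// addr_ge0// sqr_ge0.
have [r0|r0] := eqVneq r 0.
  exists 0, 0; move: r2; rewrite r0 expr0n /= => /esym/eqP.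
  by rewrite paddr_eq0 ?sqr_ge0// !sqrf_eq0 => /andP[/eqP -> /eqP ->]; rewrite mul0r.
have [|s [cs ss]] := @unit_circle_param (a / r) (b / r).
  by rewrite !expr_div_n -mulrDl -r2 divff// expf_neq0.
exists r, s; rewrite /circ cs ss; apply/eqP; rewrite eq_complex /=.
by apply/andP; split; apply/eqP; field.
Qed.

Lemma circM (s t : R) : circ s * circ t = circ (s + t).
Proof.
by apply/eqP; rewrite eq_complex /= cosD sinD; apply/andP; split; apply/eqP; ring.
Qed.

Lemma circ0 : circ (0 : R) = 1.
Proof. by rewrite /circ cos0 sin0. Qed.

Lemma circE (s : R) (z : R[i]) : (cos s)%:C * z + (sin s)%:C * ((0 +i* 1) * z) = circ s * z.
Proof.
by case: z => a b; apply/eqP; rewrite eq_complex /=; apply/andP; split; apply/eqP; ring.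
Qed.

End polar_form.

Section det_expansion.
Context (C : numFieldType).

Lemma sum_norm_le (I : Type) (s : seq I) (a : I -> C) e :
  (forall i, `|a i| <= e) -> `|\sum_(i <- s) a i| <= (size s)%:R * e.
Proof.
move=> ae; elim: s => [|i s ih]; first by rewrite big_nil normr0 mul0r.
rewrite big_cons /= -nat1r mulrDl mul1r; apply: le_trans (ler_normD _ _) _.
exact: lerD.
Qed.

Lemma prod_expansion (I : Type) (s : seq I) (a : I -> C) e : 0 <= e ->
  (forall i, `|a i| <= e) -> e <= 1 ->
  `|\prod_(i <- s) (1 + a i) - 1 - \sum_(i <- s) a i| <= (3 ^ size s)%:R * e ^+ 2.
Proof.
move=> e0 ae e1; elim: s => [|i s ih].
  by rewrite !big_nil subrr subr0 normr0 mulr_ge0// exprn_ge0.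
have T_le := sum_norm_le s ae.
rewrite !big_cons /=; set P := \prod_(_ <- _) _ in ih *; set T := \sum_(_ <- _) _ in ih T_le *.
have -> : (1 + a i) * P - 1 - (a i + T) = (1 + a i) * (P - 1 - T) + a i * T by ring.
apply: le_trans (ler_normD _ _) _; rewrite !normrM.
have h1 : `|1 + a i| <= 2 by apply: le_trans (ler_normD _ _) _; rewrite normr1 lerD2l (le_trans (ae i)).
apply: (@le_trans _ _ (2 * ((3 ^ size s)%:R * e ^+ 2) + e * ((size s)%:R * e))).
  by apply: lerD; apply: ler_pM.
have -> : e * ((size s)%:R * e) = (size s)%:R * e ^+ 2 by ring.
rewrite mulrA -mulrDl ler_wpM2r ?exprn_ge0//.
rewrite -(natrM _ 2) -natrD ler_nat expnS; have := @ltn_expl 3 (size s) isT.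
by move: (3 ^ size s)%N (size s) => x y; lia.
Qed.

(** The identity permutation contributes 1 plus the trace up to second order. Any other permutation
    moves two indices, [i] and [s i], and so brings two off-diagonal factors of size [e]. *)
Lemma det_expansion n (y : 'M[C]_n) e : 0 <= e -> e <= 1 -> (forall i j, `|y i j| <= e) ->
  `|\det (1%:M + y) - 1 - \tr y| <= (3 ^ n + n`! * 2 ^ n)%:R * e ^+ 2.
Proof.
move=> e0 e1 ye.
have E i j : (1%:M + y) i j = (i == j)%:R + y i j by rewrite !mxE.
rewrite /determinant (bigD1 (1 : {perm 'I_n})%g)//= odd_perm1 expr0 mul1r.
under eq_bigr do rewrite perm1 E eqxx.
set P := \prod_(_ < n) _; set T := \sum_(_ | _) _.
rewrite -addrA addrAC -addrA [X in `|X|]addrC; rewrite [X in `|X|](_ : _ = (P - 1 - \tr y) + T); last first.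
  by ring.
apply: le_trans (ler_normD _ _) _; rewrite natrD mulrDl; apply: lerD.
  rewrite -[n in (3 ^ n)%N]size_enum_ord /P /mxtrace -!big_enum /=.
  exact: (prod_expansion (enum 'I_n) (a := fun i => y i i)).
apply: le_trans (ler_norm_sum _ _ _) _.
apply: (@le_trans _ _ (\sum_(s : {perm 'I_n}) (2 ^ n)%:R * e ^+ 2)); last first.
  by rewrite sumr_const card_Sn natrM -mulrA [leRHS]mulr_natl.
rewrite big_mkcond; apply: ler_sum => s _; case: ifP => [s1|_]; last first.
  by rewrite mulr_ge0// exprn_ge0.
have [i si] : exists i, s i != i.
  apply: contrapT => h; move/eqP: s1; apply; apply/permP => i; rewrite perm1.
  by apply/eqP/negPn/negP => si; apply: h; exists i.
have ssi : s (s i) != s i by rewrite (inj_eq perm_inj).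
rewrite normrM normrX normrN1 expr1n mul1r normr_prod (bigD1 i)//= (bigD1 (s i))//=.
have b2 a b : `|(1%:M + y) a b| <= 2.
  rewrite E; apply: le_trans (ler_normD _ _) _; rewrite -[2]/(1 + 1); apply: lerD.
    by case: eqP; rewrite ?normr1 ?normr0.
  exact: le_trans (ye _ _) e1.
have small a b : a != b -> `|(1%:M + y) a b| <= e by move=> /negPf ab; rewrite E ab add0r.
rewrite mulrA mulrC expr2; apply: ler_pM; rewrite ?mulr_ge0 ?prodr_ge0//; last first.
  by apply: ler_pM; rewrite // small// eq_sym.
apply: (@le_trans _ _ (\prod_(k | (k != i) && (k != s i)) 2)).
  by apply: ler_prod => k _; rewrite normr_ge0 b2.
rewrite prodr_const natrX ler_eXn2l ?ler1n// ?(ltr_nat _ 1 2)//.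
by apply: leq_trans (max_card _) _; rewrite card_ord.
Qed.

End det_expansion.

(** * The unitary pair *)

Section special_unitary.
Context (R : realType) (p q : nat).
Hypothesis pq : (p <= q)%N.
Local Open Scope complex_scope.
Local Notation M := 'M[R[i]]_(p + q).
Local Notation N := (p + q)%N.
Local Notation Sg := (signature_mx p q : M).
Local Notation S := (complex_structure R).
Local Notation I := (0 +i* 1 : R[i]).
Implicit Types (g h : M) (i l k : 'I_N).

(** Opposite phases keep the determinant 1. The indices may lie in different blocks, since only the
    product of the two block determinants is constrained. *)
Definition phase_row i l : 'rV[R[i]]_N :=
  \row_k (if k == i then I else if k == l then - I else 0).

Definition phase i l : M := diag_mx (phase_row i l).

Definition su_gens : seq M := planes S p q ++
  [seq phase x.1 x.2 | x <- enum {: 'I_N * 'I_N} & x.1 != x.2].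

Lemma I_sqr : I * I = -1.
Proof. by apply/eqP; rewrite eq_complex /=; apply/andP; split; apply/eqP; ring. Qed.

Lemma mem_phase i l : i != l -> phase i l \in su_gens.
Proof.
move=> il; rewrite mem_cat; apply/orP; right; apply/mapP; exists (i, l) => //.
by rewrite mem_filter /= il mem_enum.
Qed.

Lemma su_gensP (Q : M -> Prop) : (forall C, C \in planes S p q -> Q C) ->
  (forall i l, i != l -> Q (phase i l)) -> forall C, C \in su_gens -> Q C.
Proof.
move=> h1 h2 C; rewrite mem_cat => /orP[/h1//|/mapP[[i l]]].
by rewrite mem_filter /= => /andP[il _] ->; exact: h2.
Qed.

Lemma mem_plane1 i l : i != l -> same i l -> plane i l 1 \in su_gens.
Proof.
move=> il sil; rewrite mem_cat; apply/orP; left.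
have u1 : @un R R[i] S (@ord0 1) = 1 by [].
by have := @mem_planes _ _ S p q i l (@ord0 1) il sil; rewrite u1.
Qed.

Lemma su_skew C : C \in su_gens -> adjoint_mx C = - C.
Proof.
move: C; apply: su_gensP => [C|i l il]; first exact: planes_skew.
apply: (diag_skew S) => k; rewrite mxE.
have cI : conj I = - I by apply/eqP; rewrite eq_complex /= oppr0 !eqxx.
case: ifP => _; first exact: cI.
by case: ifP => _; rewrite ?oppr0 ?(hconjN S) ?cI ?(hconj0 S).
Qed.

Lemma su_cube C : C \in su_gens -> C *m C *m C = - C.
Proof.
move: C; apply: su_gensP => [C|i l il]; first exact: planes_cube.
apply: diag_cube => k; rewrite mxE; have I2 := I_sqr.
case: ifP => _; first by rewrite I2 mulN1r.
by case: ifP => _; rewrite ?mulr0 ?oppr0// mulrNN I2 mulN1r.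
Qed.

Lemma su_block C : C \in su_gens -> C *m Sg = Sg *m C.
Proof.
by move: C; apply: su_gensP => [C|i l il]; [exact: planes_block|exact: diag_block].
Qed.

Lemma rodr_phase i l t g k b : i != l -> (rodr (phase i l) t *m g) k b =
  if k == i then circ t * g k b else if k == l then circ (- t) * g k b else g k b.
Proof.
move=> il; have [ki|ki] := eqVneq k i.
  by rewrite (rodr_diag1 S) ?mxE ki ?eqxx ?I_sqr// -circE.
have [kl|kl] := eqVneq k l.
  have li : (l == i) = false by rewrite eq_sym (negPf il).
  rewrite (rodr_diag1 S) ?mxE kl li ?eqxx ?mulrNN ?I_sqr// -circE cosN sinN.
  by congr (_ + _); rewrite mulNr mulrN rmorphN mulNr.
by rewrite (rodr_diag0 S)// mxE (negPf ki) (negPf kl).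
Qed.

Definition Ksu g := [/\ unitary (R := R) N g, g *m Sg = Sg *m g & \det g = 1].

Lemma S_UxUP g : S_UxU p q g <-> Ksu g.
Proof.
split=> [[k1 [k2 [u1 u2 d e]]]|[gu gS d]].
  split=> //; first by rewrite e; apply/(block_diag_unitary S).
  by rewrite e; exact: block_diag_sig.
have [e _] := sig_commuteP S gS; move: gu; rewrite {1}e => /(block_diag_unitary S)[u1 u2].
by exists (ulsubmx g), (drsubmx g); split.
Qed.

Lemma KsuM g h : Ksu g -> Ksu h -> Ksu (g *m h).
Proof.
move=> [gu gS g1] [hu hS h1]; split.
- exact: (unitaryM S).
- by rewrite -mulmxA hS !mulmxA gS.
- by rewrite det_mulmx g1 h1 mulr1.
Qed.

Lemma det_adj n (g : 'M[R[i]]_n) : \det (adjoint_mx g) = (\det g)^*.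
Proof.
by rewrite /adjoint_mx det_tr -[RHS](det_map_mx (Num.conj : {rmorphism R[i] -> R[i]})).
Qed.

Lemma Ksu_adj g : Ksu g -> Ksu (adjoint_mx g).
Proof.
move=> [gu gS g1]; split.
- exact: (unitary_adj S).
- exact: (adj_commute S).
- by rewrite det_adj g1 rmorph1.
Qed.

(* A matrix conjugating [C] to [- C] identifies the determinants at [t] and [- t]. *)
Lemma det_rodr_plane i l u t : i != l -> u * conj u = 1 -> conj u * u = 1 ->
  \det (rodr (plane i l u : M) t) = 1.
Proof.
move=> il u1 u2; set C := plane i l u.
have C3 : C *m C *m C = - C by exact: plane_cube.
pose D : M := diag_mx (\row_k (if k == i then -1 else 1)).
have DD : D *m D = 1%:M.
  apply/matrixP => a b; rewrite mul_diag_mx !mxE.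
  by case: ifP; case: (a == b); rewrite ?mulr1n ?mulr0n ?mulr0// ?mulrNN mulr1.
have DC : D *m C *m D = - C.
  apply/matrixP => a b; rewrite [RHS]mxE.
  have -> : (D *m C *m D) a b = (if a == i then -1 else 1) * C a b * (if b == i then -1 else 1).
    by rewrite /D mul_mx_diag mxE mul_diag_mx mxE; congr (_ * _ * _); rewrite mxE.
  have [ai|ai] := eqVneq a i; rewrite /C planeE// ?ai ?eqxx ?(negPf ai).
    case: (eqVneq l b) => [<-|lb]; last by rewrite mulr0 !(mulr0, mul0r) oppr0.
    by rewrite eq_sym (negPf il) !mulr1 mulN1r.
  have [al|al] := eqVneq a l; last by rewrite mulr0 mul0r oppr0.
  rewrite [b == i]eq_sym; case: (i == b); last by rewrite !(mulr0, oppr0, mul0r).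
  by rewrite mul1r mulrN1.
clearbody C.
have CC : D *m (C *m C) *m D = C *m C.
  have -> : D *m (C *m C) *m D = (D *m C *m D) *m (D *m C *m D).
    by rewrite !mulmxA -[_ *m D *m D]mulmxA DD mulmx1.
  by rewrite DC mulNmx mulmxN opprK.
have h s : \det (rodr C s) = \det (rodr C (- s)).
  have -> : rodr C (- s) = D *m rodr C s *m D.
    rewrite /rodr !(mulmxDl, mulmxDr) mulmx1 DD sinN cosN; congr (_ + _ + _).
      by rewrite (rscaleAr S) rscaleAl DC; apply/matrixP => a b; rewrite !mxE (of_realN S) mulNr mulrN.
    by rewrite (rscaleAr S) rscaleAl CC.
  by rewrite !det_mulmx mulrAC -det_mulmx DD det1 mul1r.
have h2 s : \det (rodr C s) ^+ 2 = 1.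
  by rewrite expr2 {1}h -det_mulmx (rodrNK S)// det1.
by rewrite (splitr t) -(rodrD S)// det_mulmx -expr2.
Qed.

Lemma Ksu_rodr C t : C \in su_gens -> Ksu (rodr C t).
Proof.
move=> Cg; split.
- by apply: (rodr_unitary S); [exact: su_skew|exact: su_cube].
- by apply: (rodr_commute S); exact: su_block.
- move: C Cg; apply: su_gensP => [C /planesP[i [l [e [il _ ->]]]]|i l il].
    by apply: det_rodr_plane; rewrite ?un_conjr ?un_conjl.
  rewrite -[rodr _ _]mulmx1.
  have -> : rodr (phase i l) t *m 1%:M = diag_mx (\row_k (if k == i then circ t else
      if k == l then circ (- t) else 1)).
    apply/matrixP => a b; rewrite rodr_phase// !mxE.
    by case: ifP => _; [|case: ifP => _]; rewrite ?mulr_natr.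
  rewrite det_diag (bigD1 i)//= (bigD1 l)/=; last by rewrite eq_sym.
  rewrite big1 => [|k /andP[/negPf ki /negPf kl]]; last by rewrite mxE ki kl.
  by rewrite !mxE !eqxx eq_sym (negPf il) mulr1 circM subrr circ0.
Qed.

(** Opposite half phases make the ratio of the two entries real; a real plane rotation then
    annihilates one of them. *)
Lemma Ksu_kill i l g b : i != l -> same i l ->
  exists h, [/\ generated su_gens h, planar i l h & (h *m g) l b = 0].
Proof.
move=> il sil; have pg := mem_plane1 il sil.
have [x0|x0] := eqVneq (g i b) 0; first by apply: (plane_kill S il pg); left.
have [r [s zE]] := polar (g l b / g i b).
have yE : g l b = r%:C * circ s * g i b by rewrite -zE divfK.
pose f : M := rodr (phase i l) (s / 2).
have [|h [gh ph zh]] := plane_kill (A := f *m g) (b := b) S il pg.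
  right; exists r; rewrite !rodr_phase// !eqxx eq_sym (negPf il) yE.
  transitivity (r%:C * ((circ (- (s / 2)) * circ s) * g i b)); first by ring.
  by rewrite circM; congr (_ * (circ _ * _)); field.
exists (h *m f); split.
- by apply: generatedM => //; apply: generated_rodr; exact: mem_phase.
- apply: planarM => //; apply: (planar_diag S) => k ki kl.
  by rewrite mxE (negPf ki) (negPf kl).
- by rewrite -mulmxA.
Qed.

(** The diagonal entry has modulus 1 and its phase is passed on to another free index. When none is
    left, determinant 1 says that the entry is already 1. *)
Lemma Ksu_normalize (A : pred 'I_N) i g : Ksu g -> fixes A g -> ~~ A i ->
  (forall l, l != i -> g l i = 0) ->
  exists h, [/\ generated su_gens h, fixes A h & (h *m g) i i = 1 /\
    forall l, l != i -> (h *m g) l i = 0].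
Proof.
move=> [gu gS g1] fg Ai zg.
have [[l [li Al]]|nl] := pselect (exists l, l != i /\ ~~ A l); last first.
  exists 1%:M; split; [exact: generated1|by move=> k j _; rewrite mxE|].
  rewrite mul1mx; split=> //; rewrite -g1.
  have -> : g = diag_mx (\row_k (if k == i then g i i else 1)).
    apply/matrixP => a b; rewrite !mxE; have [->|bi] := eqVneq b i.
      by have [->|ai] := eqVneq a i; [rewrite mulr1n|rewrite zg].
    rewrite fg; last by apply/negPn/negP => Ab; apply: nl; exists b.
    by case: eqVneq => [->|_]; rewrite ?(negPf bi).
  rewrite det_diag (bigD1 i)//= !mxE !eqxx big1 ?mulr1// => k ki.
  by rewrite mxE (negPf ki).
have il : i != l by rewrite eq_sym.
have w1 : conj (g i i) * g i i = 1.
  have := congr1 (fun B : M => B i i) gu; rewrite !mxE eqxx (bigD1 i)//=.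
  by rewrite !mxE big1 ?addr0// => k ki; rewrite (zg k ki) mulr0.
have [s sE] : exists s, g i i = circ s.
  case: (g i i) w1 => a b /eqP; rewrite eq_complex /= => /andP[/eqP ab _].
  have [|s [cs ss]] := @unit_circle_param R a b; first by rewrite -ab; ring.
  by exists s; rewrite /circ cs ss.
exists (rodr (phase i l) (- s)); split.
- by apply: generated_rodr; exact: mem_phase.
- apply: (planar_fixes Ai Al); apply: (planar_diag S) => k ki kl.
  by rewrite mxE (negPf ki) (negPf kl).
split; first by rewrite rodr_phase// eqxx sE circM addNr circ0.
move=> k ki; rewrite rodr_phase// (negPf ki) zg//.
by case: ifP; rewrite ?mulr0.
Qed.

Lemma Ksu_generated g : Ksu g -> generated su_gens g.
Proof.
apply: (@K_generated _ _ S p q [set g | Ksu g] su_gens).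
- exact: KsuM.
- exact: Ksu_adj.
- by move=> k [].
- by move=> k [].
- by move=> C t; exact: Ksu_rodr.
- by split; rewrite ?mul1mx ?mulmx1 ?det1// /unitary /= (adjoint1 S) mulmx1.
- exact: Ksu_kill.
- exact: Ksu_normalize.
Qed.

(** The differential of the determinant condition; the real part of the trace vanishes by
    skewness. *)
Definition imtr (Z : M) : R := complex.Im (\tr Z).

Lemma ImD (x y : R[i]) : complex.Im (x + y) = complex.Im x + complex.Im y.
Proof. by case: x y => a b []. Qed.

Lemma imtr_linear : real_linear imtr.
Proof.
split=> [A B|a A]; rewrite /imtr; first by rewrite mxtraceD ImD.
by rewrite mxtraceZ /=; case: (\tr A) => b c /=; rewrite mul0r addr0.
Qed.

Lemma sum_co (z : R[i]) : \sum_e `|@co R R[i] S e z| = `|complex.Re z| + `|complex.Im z|.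
Proof. by rewrite -[LHS]/(\sum_(e < 2) `|@co R R[i] S e z|) big_ord_recl big_ord1. Qed.

Lemma imtr_le (Z : M) : `|imtr Z| <= nrm S Z.
Proof.
rewrite /imtr /mxtrace (big_morph _ ImD (erefl : complex.Im 0 = 0)).
apply: le_trans (ler_norm_sum _ _ _) _; rewrite nrmE; apply: ler_sum => k _.
rewrite (bigD1 k)//=; apply: ler_wpDr; first by do 2 (apply: sumr_ge0 => ? _).
by rewrite sum_co lerDr.
Qed.

Lemma norm_entry_le (Z : M) k b : `|Z k b| <= (nrm S Z)%:C.
Proof.
apply: le_trans (normc_le _) _; rewrite lecR nrmE (bigD1 k)//= (bigD1 b)//=.
rewrite sum_co -addrA lerDl addr_ge0//.
  by do 2 (apply: sumr_ge0 => ? _).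
by do 3 (apply: sumr_ge0 => ? _).
Qed.

(** With y = g'^-1 (g - g'), the matrix 1 + y has determinant 1, so [det_expansion] makes the trace
    of y quadratically small. The difference of [g - g'] and y is (g' - 1) y, also of second
    order. *)
Lemma imtr_small e : 0 < e -> exists2 rho, 0 < rho &
  forall g g', SU_pq p q g -> SU_pq p q g' -> nball S 1%:M rho g -> nball S 1%:M rho g' ->
    `|imtr (g - g')| <= e * nrm S (g - g').
Proof.
move=> e0; pose B := (nrm S Sg * nrm S Sg) * (nrm S (1%:M : M) + 1) + 1.
have B0 : 0 < B by rewrite ltr_wpDl// !mulr_ge0 ?addr_ge0 ?nrm_ge0.
pose c : R := (3 ^ N + N`! * 2 ^ N)%:R.
have c0 : 0 <= c by rewrite ler0n.
(* [B] bounds the inverse of g'. The three bounds serve that estimate, the condition [nrm S y <= 1]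
   of the expansion, and the final comparison with [e]. *)
pose rho := Num.min 1 (Num.min (2 * B)^-1 (e / (B * (2 * c * B + 1)))).
have d0 : 0 < B * (2 * c * B + 1) by rewrite mulr_gt0// ltr_wpDl// !mulr_ge0// ltW.
have r0 : 0 < rho by rewrite !lt_min ltr01 invr_gt0 mulr_gt0//= divr_gt0.
have r1 : rho <= 1 by rewrite ge_min lexx.
have r2 : rho <= (2 * B)^-1 by rewrite !ge_min lexx orbT.
have r3 : rho <= e / (B * (2 * c * B + 1)) by rewrite !ge_min lexx !orbT.
exists rho => // g g' [gu g1] [gu' g1']; rewrite /nball /= => gb gb'.
set D := g - g'; pose y := pinv g' *m D.
have nD : nrm S D <= 2 * rho.
  apply: le_trans (nrm_triangle S 1%:M _ _) _; rewrite [nrm S (1%:M - _)]nrmBC mulr_natl mulr2n.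
  by apply: lerD; exact: ltW.
have npinv : nrm S (pinv g') <= B.
  rewrite pinvE; apply: le_trans (nrmM _ _ _) _; rewrite /B.
  apply: (@le_trans _ _ (nrm S Sg * nrm S Sg * (nrm S (1%:M : M) + 1))); last by rewrite lerDl.
  rewrite [leRHS]mulrAC ler_wpM2r ?nrm_ge0//; apply: le_trans (nrmM _ _ _) _.
  rewrite ler_wpM2l ?nrm_ge0// nrm_adjoint -[g'](subrK 1%:M) addrC.
  apply: le_trans (nrmD _ _ _) _; rewrite lerD2l; apply: le_trans (ltW gb') r1.
have ny : nrm S y <= B * nrm S D.
  by apply: le_trans (nrmM _ _ _) _; rewrite ler_wpM2r ?nrm_ge0.
have ny1 : nrm S y <= 1.
  apply: le_trans ny _; apply: (@le_trans _ _ (B * (2 * (2 * B)^-1))).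
    by apply: (ler_wpM2l (ltW B0)); apply: le_trans nD _; rewrite ler_wpM2l.
  by rewrite le_eqVlt; apply/orP; left; apply/eqP; field; rewrite gt_eqF.
have y1 : \det (1%:M + y) = 1.
  have -> : 1%:M + y = pinv g' *m g by rewrite /y /D mulmxBr pseudo_pinv// addrC subrK.
  have := congr1 determinant (pseudo_pinv gu'); rewrite !det_mulmx det1 g1 g1' !mulr1.
  by [].
have try : `|imtr y| <= c * nrm S y ^+ 2.
  have := @det_expansion R[i] N y (nrm S y)%:C; rewrite y1 subrr sub0r normrN.
  rewrite lecR nrm_ge0 (_ : (1 : R[i]) = 1%:C)// lecR => /(_ isT ny1 (norm_entry_le y)).
  rewrite -rmorphXn -(rmorph_nat (real_complex R)) -rmorphM /= => h.
  by rewrite -lecR; apply: le_trans h; exact: (Re_Im_le _).2.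
have DE : D = y + (g' - 1%:M) *m y.
  by rewrite mulmxBl mul1mx addrC subrK /y mulmxA (pseudo_pinvr S)// mul1mx.
have h1 : `|imtr D| <= c * nrm S y ^+ 2 + rho * nrm S y.
  rewrite {1}DE imtr_linear.1; apply: le_trans (ler_normD _ _) _; apply: lerD => //.
  apply: le_trans (imtr_le _) _; apply: le_trans (nrmM _ _ _) _.
  by rewrite ler_wpM2r ?nrm_ge0// ltW.
apply: le_trans h1 _.
have -> : c * nrm S y ^+ 2 + rho * nrm S y = (c * nrm S y + rho) * nrm S y by ring.
apply: (@le_trans _ _ ((c * (B * (2 * rho)) + rho) * (B * nrm S D))).
  apply: ler_pM; [|exact: nrm_ge0| |exact: ny].
    by rewrite addr_ge0 ?(ltW r0)// mulr_ge0// nrm_ge0.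
  rewrite lerD2r; apply: (ler_wpM2l c0); apply: le_trans ny _.
  exact: (ler_wpM2l (ltW B0)).
have -> : (c * (B * (2 * rho)) + rho) * (B * nrm S D) =
  rho * (B * (2 * c * B + 1)) * nrm S D by ring.
by rewrite ler_wpM2r ?nrm_ge0// -ler_pdivlMr.
Qed.

Definition su_lam (x : option (coidx S N N)) : M -> R :=
  if x is Some y then @lam0 _ _ S p q y else imtr.

Lemma su_lam0 Z : (forall x, su_lam x Z = 0) -> (forall y, lam0 (S := S) y Z = 0) /\ imtr Z = 0.
Proof. by move=> h; split=> [y|]; [exact: (h (Some y))|exact: (h None)]. Qed.

(** On the diagonal, skewness removes real parts, orthogonality to the phases makes the imaginary
    parts equal, and the trace condition makes their common value zero. *)
Lemma su_orth Z : (forall x, su_lam x Z = 0) ->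
  (forall C, C \in su_gens -> retr S (Z *m C) = 0) -> ulsubmx Z = 0 /\ drsubmx Z = 0.
Proof.
move=> /su_lam0[/lam0_skew Zs tZ] oZ; apply: (orth_planes Zs) => [i l e il sil|i].
  by apply: oZ; rewrite mem_cat mem_planes.
have Re0 k : complex.Re (Z k k) = 0.
  have := skew_entry Zs (eqxx _ : same k k); case: (Z k k) => a b /eqP.
  by rewrite eq_complex /= => /andP[/eqP + _] => h; lra.
have Im_eq k l : complex.Im (Z k k) = complex.Im (Z l l).
  have [->//|kl] := eqVneq k l; have := oZ _ (mem_phase kl).
  rewrite /retr /mxtrace (bigD1 k)//= (bigD1 l)/=; last by rewrite eq_sym.
  rewrite big1 ?addr0 => [|j /andP[/negPf jk /negPf jl]]; last first.
    by rewrite mul_mx_diag !mxE jk jl mulr0.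
  rewrite !mul_mx_diag !mxE !eqxx (eq_sym l k) (negPf kl).
  move=> h; have {}h : complex.Re (Z k k * I + Z l l * - I) = 0 := h.
  by move: h; case: (Z k k) (Z l l) => a b [a' b'] /=; lra.
have : \sum_(k < N) complex.Im (Z k k) = 0.
  by move: tZ; rewrite /imtr /mxtrace (big_morph _ ImD (erefl : complex.Im 0 = 0)).
rewrite (eq_bigr (fun=> complex.Im (Z i i))); last by move=> k _; exact: Im_eq.
rewrite sumr_const card_ord => /eqP; rewrite mulrn_eq0 => /orP[/eqP N0|/eqP im0].
  by move: (leq_ltn_trans (leq0n i) (ltn_ord i)); rewrite {1}N0.
by move: (Re0 i) im0; case: (Z i i) => a b /= -> ->.
Qed.

Lemma SU_M g h : SU_pq p q g -> SU_pq p q h -> SU_pq p q (g *m h).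
Proof.
by move=> [gu g1] [hu h1]; split; [exact: (pseudoM S)|rewrite det_mulmx g1 h1 mulr1].
Qed.

Definition su_pair : cartan_pair S (SU_pq p q) (S_UxU p q).
Proof.
apply: (@CartanPair R R[i] S p q _ _ su_gens (option (coidx S N N)) su_lam).
- by move=> [y|]; [exact: lam0_linear|exact: imtr_linear].
- move=> [y|] e e0; last exact: imtr_small.
  by apply: lam0_small => // g [].
- by move=> Z /su_lam0[+ _]; exact: lam0_skew.
- move=> h h' Z hu hh' h'h /su_lam0[Z0 tZ] [y|]; first exact: lam0_conj.
  by rewrite /= /imtr mxtrace_mulC mulmxA hh' mul1mx.
- exact: su_orth.
- exact: su_skew.
- exact: su_block.
- exact: su_cube.
- by move=> C t Cg; apply/S_UxUP; exact: Ksu_rodr.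
- by move=> g /S_UxUP; exact: Ksu_generated.
- by move=> g h /S_UxUP gK /S_UxUP hK; apply/S_UxUP; exact: KsuM.
- by move=> g /S_UxUP gK; apply/S_UxUP; exact: Ksu_adj.
- by move=> g /S_UxUP[].
- by move=> g /S_UxUP[gu gS g1]; split => //; exact: unitary_pseudo.
- move=> k1 k2 [u1 d1] [u2 d2].
  have ru n (k : 'M[R]_n) : unitary (R := R) n k -> unitary (R := R) n (real_mx R[i] k).
    rewrite /unitary /= (adjoint_real S) -(real_mxM S) => e.
    by rewrite -(real_mx1 S) -e; congr (real_mx _ (_ *m _)); apply/matrixP => a b; rewrite !mxE.
  have rd n (k : 'M[R]_n) : \det (real_mx R[i] k) = (\det k)%:C by exact: (det_map_mx (real_complex R)).
  exists (real_mx R[i] k1), (real_mx R[i] k2); split; [exact: ru|exact: ru| |by []].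
  by rewrite /block_diag_mx det_ublock !rd d1 d2 mulr1.
- exact: SU_M.
- move=> g [gu g1]; split.
    by rewrite -pinvE; apply: pseudo_of_pinv; rewrite (pinvK S) (pseudo_pinvr S).
  have s2 : \det Sg * \det Sg = 1 by rewrite -det_mulmx sig_sqr det1.
  by rewrite !det_mulmx det_adj g1 rmorph1 mulr1.
- by move=> g [].
- move=> H; split; first exact: (pseudo_cart S).
  by rewrite (det_map_mx (real_complex R)) det_cart.
Defined.

End special_unitary.

(** * The symplectic pair *)

Section compact_symplectic.
Context (R : realType) (p q : nat).
Hypothesis pq : (p <= q)%N.
Local Open Scope complex_scope.
Local Notation H := (quaternion R).
Local Notation M := 'M[quaternion R]_(p + q).
Local Notation N := (p + q)%N.
Local Notation Sg := (signature_mx p q : M).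
Local Notation S := (quaternion_structure R).
Local Notation SC := (complex_structure R).
Local Notation un := (@un R H S).
Implicit Types (g h : M) (i l k : 'I_N).

Definition qphase_row i (e : 'I_4) : 'rV[H]_N := \row_k (if k == i then un e else 0).

Definition qphase i e : M := diag_mx (qphase_row i e).

Definition sp_gens : seq M := planes S p q ++
  [seq qphase x.1 x.2 | x <- enum {: 'I_N * 'I_4} & x.2 != ord0].

Lemma mem_qphase i e : e != ord0 -> qphase i e \in sp_gens.
Proof.
move=> e0; rewrite mem_cat; apply/orP; right; apply/mapP; exists (i, e) => //.
by rewrite mem_filter /= e0 mem_enum.
Qed.

Lemma sp_gensP (Q : M -> Prop) : (forall C, C \in planes S p q -> Q C) ->
  (forall i e, e != ord0 -> Q (qphase i e)) -> forall C, C \in sp_gens -> Q C.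
Proof.
move=> h1 h2 C; rewrite mem_cat => /orP[/h1//|/mapP[[i l]]].
by rewrite mem_filter /= => /andP[il _] ->; exact: h2.
Qed.

Lemma qplane1 i l : i != l -> same i l -> plane i l 1 \in sp_gens.
Proof.
move=> il sil; rewrite mem_cat; apply/orP; left.
have u1 : un (@ord0 3) = 1 by [].
by have := @mem_planes _ _ S p q i l (@ord0 3) il sil; rewrite u1.
Qed.

Lemma un_conj_imag (e : 'I_4) : e != ord0 -> conj (un e) = - un e :> H.
Proof.
case: e => -[|[|[|[|//]]]] ? // _; congr pair; apply/eqP;
  rewrite ?eq_complex /= ?oppr0 ?eqxx//.
Qed.

Lemma un_sqr (e : 'I_4) : e != ord0 -> un e * un e = -1 :> H.
Proof.
move=> e0; rewrite -[un e in X in _ * X]opprK -(un_conj_imag e0) mulrN.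
by rewrite un_conjr.
Qed.

Lemma sp_skew C : C \in sp_gens -> adjoint_mx C = - C.
Proof.
move: C; apply: sp_gensP => [C|i e e0]; first exact: planes_skew.
apply: (diag_skew S) => k; rewrite mxE; case: ifP => _; first exact: un_conj_imag.
by rewrite (hconj0 S) oppr0.
Qed.

Lemma sp_cube C : C \in sp_gens -> C *m C *m C = - C.
Proof.
move: C; apply: sp_gensP => [C|i e e0]; first exact: planes_cube.
apply: diag_cube => k; rewrite mxE; case: ifP => _; first by rewrite un_sqr// mulN1r.
by rewrite mulr0 oppr0.
Qed.

Lemma sp_block C : C \in sp_gens -> C *m Sg = Sg *m C.
Proof.
by move: C; apply: sp_gensP => [C|i e _]; [exact: planes_block|exact: diag_block].
Qed.

Lemma rodr_qphase i e t g k b : e != ord0 -> (rodr (qphase i e) t *m g) k b =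
  if k == i then (of_real (cos t) + of_real (sin t) * un e) * g k b else g k b.
Proof.
move=> e0; have [ki|ki] := eqVneq k i.
  by rewrite (rodr_diag1 S) ?mxE ki ?eqxx ?un_sqr// mulrDl mulrA.
by rewrite (rodr_diag0 S)// mxE (negPf ki).
Qed.

Lemma qphase_planar i l e t : planar l i (rodr (qphase i e) t).
Proof. by apply: (planar_diag S) => k _ ki; rewrite mxE (negPf ki). Qed.

(* Euler angles: a unit quaternion is [e^(i m) e^(j b) e^(i n)]. *)
Lemma unit_quaternion_phase i l (w : H) : w * conj w = 1 ->
  exists h, [/\ generated sp_gens h, planar l i h &
    forall g k b, (h *m g) k b = if k == i then w * g k b else g k b].
Proof.
case: w => -[a1 a2] [b1 b2] ww.
have w1 : a1 ^+ 2 + a2 ^+ 2 + (b1 ^+ 2 + b2 ^+ 2) = 1.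
  by move: ww => /(congr1 (fun x : H => complex.Re x.1)) /= <-; ring.
have [ra [sa az]] := polar (a1 +i* a2); have [rb [sb bz]] := polar (b1 +i* b2).
have rr : ra ^+ 2 + rb ^+ 2 = 1.
  have sq (x y r s : R) : x +i* y = r%:C * circ s -> x ^+ 2 + y ^+ 2 = r ^+ 2.
    move=> /eqP; rewrite eq_complex /= => /andP[/eqP -> /eqP ->].
    rewrite !mul0r subr0 addr0 !exprMn -mulrDr cos2Dsin2 mulr1.
    by [].
  by rewrite -(sq _ _ _ _ az) -(sq _ _ _ _ bz).
have [t [ct st]] := unit_circle_param rr.
pose i1 : 'I_4 := lift ord0 ord0; pose i2 : 'I_4 := lift ord0 (lift ord0 ord0).
pose m := (sa + sb) / 2; pose n := (sa - sb) / 2.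
exists (rodr (qphase i i1) m *m (rodr (qphase i i2) t *m rodr (qphase i i1) n)); split.
- by do 2 (apply: generatedM; first by apply: generated_rodr; exact: mem_qphase);
    apply: generated_rodr; exact: mem_qphase.
- by do 2 (apply: planarM; first exact: qphase_planar); exact: qphase_planar.
move=> g k b; rewrite -!mulmxA !rodr_qphase//; have [_|ki] := eqVneq k i; last by [].
rewrite !mulrA; congr (_ * _).
have e1 (s : R) : of_real (cos s) + of_real (sin s) * un i1 = (circ s, 0) :> H.
  congr pair; apply/eqP; rewrite eq_complex /=; apply/andP; split; apply/eqP; ring.
have e2 : of_real (cos t) + of_real (sin t) * un i2 = (ra%:C, rb%:C) :> H.
  rewrite ct st; congr pair; apply/eqP; rewrite eq_complex /=; apply/andP; split; apply/eqP; ring.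
have cc (s : R) : (circ s)^* = circ (- s) by rewrite /circ cosN sinN.
rewrite !e1 e2 az bz; have -> : sa = m + n by rewrite /m /n; field.
have -> : sb = m - n by rewrite /m /n; field.
have qM (x y u v : R[i]) : ((x, y) : H) * (u, v) =
  (x * u - y * conj v, x * v + y * conj u) by [].
rewrite !qM (hconj0 SC) !(mul0r, mulr0, subr0, addr0, add0r) [conj (circ n)]cc -!circM.
by congr pair => /=; ring.
Qed.

Definition Ksp g := unitary (R := R) N g /\ g *m Sg = Sg *m g.

Lemma Sp_x_SpP g : Sp_x_Sp p q g <-> Ksp g.
Proof.
split=> [[k1 [k2 [u1 u2 ->]]]|[gu gS]].
  by split; [apply/(block_diag_unitary S)|exact: block_diag_sig].
have [e _] := sig_commuteP S gS; move: gu; rewrite e => /(block_diag_unitary S)[u1 u2].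
by exists (ulsubmx g), (drsubmx g); split.
Qed.

Lemma KspM g h : Ksp g -> Ksp h -> Ksp (g *m h).
Proof.
move=> [gu gS] [hu hS]; split; first exact: (unitaryM S).
by rewrite -mulmxA hS !mulmxA gS.
Qed.

Lemma Ksp_adj g : Ksp g -> Ksp (adjoint_mx g).
Proof. by move=> [gu gS]; split; [exact: (unitary_adj S)|exact: (adj_commute S)]. Qed.

Lemma Ksp_rodr C t : C \in sp_gens -> Ksp (rodr C t).
Proof.
move=> Cg; split; first by apply: (rodr_unitary S); [exact: sp_skew|exact: sp_cube].
by apply: (rodr_commute S); exact: sp_block.
Qed.

Definition qabs2 (x : H) : R := \sum_e co (s := S) e x * co (s := S) e x.

Lemma qabs2E (x : H) : conj x * x = of_real (qabs2 x) /\ x * conj x = of_real (qabs2 x).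
Proof.
have -> : qabs2 x = \sum_(e < 4) co (s := S) e x * co (s := S) e x by [].
case: x => -[a b] [c d]; rewrite !big_ord_recl big_ord0 /=.
by split; congr pair; apply/eqP; rewrite eq_complex /=; apply/andP; split; apply/eqP; ring.
Qed.

Lemma qabs2_gt0 (x : H) : x != 0 -> 0 < qabs2 x.
Proof.
move=> x0; rewrite lt_neqAle sumr_ge0 ?andbT => [|e _]; last by rewrite -expr2 sqr_ge0.
apply/negP => /eqP/esym q0; move/eqP: x0; apply; apply: (re_mul_self_eq0 (S := S)).
by rewrite re_conjM.
Qed.

(** A unit quaternion w applied to row [l] makes the lower entry a real multiple of the upper one,
    after which the real plane rotation works. *)
Lemma Ksp_kill i l g b : i != l -> same i l ->
  exists h, [/\ generated sp_gens h, planar i l h & (h *m g) l b = 0].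
Proof.
move=> il sil; have pg := qplane1 il sil.
set x := g i b; set y := g l b.
have [x0|x0] := eqVneq x 0; first by apply: (plane_kill S il pg); left.
have [y0|y0] := eqVneq y 0.
  apply: (plane_kill S il pg); right; exists 0.
  by rewrite -/y y0 (of_real0 S) mul0r.
have qx := qabs2_gt0 x0; have qy := qabs2_gt0 y0.
pose r := Num.sqrt (qabs2 y / qabs2 x).
have r2 : r * r = qabs2 y / qabs2 x by rewrite -expr2 sqr_sqrtr// divr_ge0// ltW.
have r0 : r != 0 by rewrite gt_eqF// sqrtr_gt0 divr_gt0.
(* Chosen so that w y = r x; the value of [r] gives w norm 1. *)
pose w : H := of_real (r / qabs2 y) * (x * conj y).
have ww : w * conj w = 1.
  rewrite /w (hconjM S) (hconj_real S) (hconjM S) (hconjK S) -!mulrA.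
  rewrite [conj y * (y * _)]mulrA (qabs2E y).1 [of_real (qabs2 y) * (conj x * _)]mulrA.
  rewrite [of_real (qabs2 y) * conj x](of_realC S) -!mulrA [x * (conj x * _)]mulrA (qabs2E x).2.
  rewrite -!(of_realM S) -(of_real1 S); congr (of_real _).
  transitivity ((r * r) * (qabs2 x / qabs2 y)); first by field; rewrite gt_eqF.
  by rewrite r2; field; rewrite !gt_eqF.
have [f [gf pf fE]] := unit_quaternion_phase l i ww.
have [|h [gh ph zh]] := plane_kill (A := f *m g) (b := b) S il pg.
  right; exists r; rewrite !fE eqxx (negPf il) -/x -/y.
  rewrite /w -!mulrA (qabs2E y).1 -(of_realC S) mulrA -(of_realM S).
  by rewrite divfK ?gt_eqF.
exists (h *m f); split; [exact: generatedM|exact: planarM|by rewrite -mulmxA].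
Qed.

Lemma Ksp_normalize (A : pred 'I_N) i g : Ksp g -> fixes A g -> ~~ A i ->
  (forall l, l != i -> g l i = 0) ->
  exists h, [/\ generated sp_gens h, fixes A h & (h *m g) i i = 1 /\
    forall l, l != i -> (h *m g) l i = 0].
Proof.
move=> [gu gS] fg Ai zg.
have w1 : conj (g i i) * g i i = 1.
  have := congr1 (fun B : M => B i i) gu; rewrite !mxE eqxx (bigD1 i)//=.
  by rewrite !mxE big1 ?addr0// => k ki; rewrite (zg k ki) mulr0.
have [|h [gh ph hE]] := @unit_quaternion_phase i i (conj (g i i)); first by rewrite (hconjK S).
exists h; split=> //; first exact: planar_fixes ph.
split; first by rewrite hE eqxx.
by move=> k ki; rewrite hE (negPf ki) zg.
Qed.

Lemma Ksp_generated g : Ksp g -> generated sp_gens g.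
Proof.
apply: (@K_generated _ _ S p q [set g | Ksp g] sp_gens).
- exact: KspM.
- exact: Ksp_adj.
- by move=> k [].
- by move=> k [].
- by move=> C t; exact: Ksp_rodr.
- by split; rewrite ?mul1mx ?mulmx1// /unitary /= (adjoint1 S) mulmx1.
- exact: Ksp_kill.
- exact: Ksp_normalize.
Qed.

Local Notation cmx := (@complexify_mx R N).

Lemma complexifyM g h : cmx (g *m h) = cmx g *m cmx h.
Proof.
rewrite /complexify_mx mulmx_block; congr block_mx; apply/matrixP => i j; rewrite !mxE.
- rewrite (big_morph (fun x : H => x.1) (fun x y => erefl) (erefl : (0 : H).1 = 0)).
  rewrite -big_split; apply: eq_bigr => k _; rewrite !mxE /=.
  by rewrite mulrN.
- rewrite (big_morph (fun x : H => x.2) (fun x y => erefl) (erefl : (0 : H).2 = 0)).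
  by rewrite -big_split; apply: eq_bigr => k _; rewrite !mxE.
- rewrite (big_morph (fun x : H => x.2) (fun x y => erefl) (erefl : (0 : H).2 = 0)).
  rewrite (hconj_sum SC) -big_split -sumrN; apply: eq_bigr => k _; rewrite !mxE /=.
  by rewrite (hconjD SC) !(hconjM SC) (hconjK SC); ring.
- rewrite (big_morph (fun x : H => x.1) (fun x y => erefl) (erefl : (0 : H).1 = 0)).
  rewrite (hconj_sum SC) -big_split; apply: eq_bigr => k _; rewrite !mxE /=.
  by rewrite (hconjD SC) (hconjN SC) !(hconjM SC) (hconjK SC); ring.
Qed.

Lemma complexify1 : cmx 1%:M = 1%:M.
Proof.
rewrite /complexify_mx [RHS]scalar_mx_block; congr block_mx; apply/matrixP => i j; rewrite !mxE;
  by case: (i == j) => //=; rewrite ?(hconj0 SC) ?(hconj1 SC) ?oppr0.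
Qed.

Lemma complexify_adj g : cmx (adjoint_mx g) = adjoint_mx (cmx g).
Proof.
rewrite /complexify_mx adjoint_block; congr block_mx; apply/matrixP => i j; rewrite !mxE /= ?conjCK//.
- by rewrite (hconjN SC) (hconjK SC).
- by rewrite (hconjN SC) opprK.
Qed.

Lemma block_mx_rot (A : pzRingType) n (a b c d : 'M[A]_n) :
  block_mx 0 1%:M (- 1%:M) 0 *m block_mx a b c d *m block_mx 0 (- 1%:M) 1%:M 0 =
  block_mx d (- c) (- b) a.
Proof.
rewrite !mulmx_block !(mul0mx, mulmx0, mul1mx, mulmx1, addr0, add0r).
by rewrite !(mulNmx, mulmxN, mul1mx, mulmx1, opprK).
Qed.

(* [complexify_mx g] commutes with the antilinear structure map. *)
Lemma complexify_det_real g : (\det (cmx g))^* = \det (cmx g).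
Proof.
pose a := map_mx (fun x : H => x.1 : R[i]) g.
pose b := map_mx (fun x : H => x.2 : R[i]) g.
pose J : 'M[R[i]]_(N + N) := block_mx 0 (- 1%:M) 1%:M 0.
pose J' : 'M[R[i]]_(N + N) := block_mx 0 1%:M (- 1%:M) 0.
have JJ : J' *m J = 1%:M.
  rewrite mulmx_block !(mul0mx, mulmx0, mul1mx, mulmx1, addr0, add0r, mulNmx, mulmxN, opprK).
  by rewrite -scalar_mx_block.
have cJ : map_mx (Num.conj : {rmorphism R[i] -> R[i]}) (cmx g) = J' *m cmx g *m J.
  have cK (A : 'M[R[i]]_N) : map_mx conj (map_mx conj A) = A.
    by apply/matrixP => i j; rewrite !mxE; exact: conjCK.
  have cN (A : 'M[R[i]]_N) : map_mx Num.conj (- map_mx conj A) = - A.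
    by apply/matrixP => i j; rewrite !mxE rmorphN; congr (- _); exact: conjCK.
  rewrite /complexify_mx map_block_mx -/a -/b block_mx_rot.
  by congr block_mx; [rewrite opprK|exact: cN|exact: cK].
rewrite -[LHS](det_map_mx (Num.conj : {rmorphism R[i] -> R[i]})) cJ !det_mulmx mulrAC -det_mulmx JJ.
by rewrite det1 mul1r.
Qed.

Lemma complexify_unitary_det g : unitary (R := R) N g -> \det (cmx g) ^+ 2 = 1.
Proof.
move=> gu; have := congr1 (fun A => \det (cmx A)) gu; rewrite complexifyM det_mulmx complexify1 det1.
by rewrite complexify_adj det_adj complexify_det_real expr2.
Qed.

(** The determinant of the complexification is real and of square 1 on unitary matrices, and each
    generating rotation is a square. *)
Lemma Ksp_det g : Ksp g -> \det (cmx g) = 1.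
Proof.
move/Ksp_generated; elim=> [|C t h Cg _ ih]; first by rewrite complexify1 det1.
rewrite complexifyM det_mulmx ih mulr1 (splitr t) -(rodrD S) ?sp_cube//.
rewrite complexifyM det_mulmx -expr2 complexify_unitary_det//.
by have [] := Ksp_rodr (t / 2) Cg.
Qed.

Lemma Sp_M g h : Sp_pq p q g -> Sp_pq p q h -> Sp_pq p q (g *m h).
Proof.
move=> [gu g1] [hu h1]; split; first exact: (pseudoM S).
by rewrite complexifyM det_mulmx g1 h1 mulr1.
Qed.

Lemma Sp_adj g : Sp_pq p q g -> Sp_pq p q (Sg *m adjoint_mx g *m Sg).
Proof.
move=> [gu g1]; split.
  by rewrite -pinvE; apply: pseudo_of_pinv; rewrite (pinvK S) (pseudo_pinvr S).
have s2 : \det (cmx Sg) * \det (cmx Sg) = 1.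
  by rewrite -det_mulmx -complexifyM sig_sqr complexify1 det1.
by rewrite !complexifyM !det_mulmx complexify_adj det_adj g1 rmorph1 mulr1.
Qed.

Lemma Sp_cart (X : 'rV[R]_p) : Sp_pq p q (real_mx H (cart q X)).
Proof.
split; first exact: (pseudo_cart S).
have cE (A : 'M[R]_N) : cmx (real_mx H A) =
    block_mx (map_mx (real_complex R) A) 0 0 (map_mx (real_complex R) A).
  rewrite /complexify_mx; congr block_mx; apply/matrixP => i j; rewrite !mxE /=.
  - by [].
  - by [].
  - by rewrite (hconj0 SC) oppr0.
  - exact: (hconj_real SC).
by rewrite cE det_ublock !det_map_mx det_cart// rmorph1 mulr1.
Qed.

Lemma sp_orth Z : (forall x, lam0 (S := S) x Z = 0) ->
  (forall C, C \in sp_gens -> retr S (Z *m C) = 0) -> ulsubmx Z = 0 /\ drsubmx Z = 0.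
Proof.
move=> /lam0_skew Zs oZ; apply: (orth_planes Zs) => [i l e il sil|i].
  by apply: oZ; rewrite mem_cat mem_planes.
apply: (re_un_eq0 (S := S)) => e; have [->|e0] := eqVneq e ord0.
  have -> : un ord0 = 1 by [].
  have := skew_entry Zs (eqxx _ : same i i); rewrite mulr1 => /(congr1 (co (s := S) (re_idx S))).
  by rewrite re_conj coN => h; lra.
rewrite -(oZ _ (mem_qphase i e0)) /retr /mxtrace (bigD1 i)//= big1 ?addr0 => [|k /negPf ki].
  by rewrite mul_mx_diag !mxE eqxx.
by rewrite mul_mx_diag !mxE ki mulr0.
Qed.

Definition sp_pair : cartan_pair S (Sp_pq p q) (Sp_x_Sp p q).
Proof.
apply: (@CartanPair R H S p q _ _ sp_gens (coidx S N N) (@lam0 _ _ S p q)).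
- exact: lam0_linear.
- by move=> x e; apply: lam0_small => g [].
- exact: lam0_skew.
- exact: lam0_conj.
- exact: sp_orth.
- exact: sp_skew.
- exact: sp_block.
- exact: sp_cube.
- by move=> C t Cg; apply/Sp_x_SpP; exact: Ksp_rodr.
- by move=> g /Sp_x_SpP; exact: Ksp_generated.
- by move=> g h /Sp_x_SpP gK /Sp_x_SpP hK; apply/Sp_x_SpP; exact: KspM.
- by move=> g /Sp_x_SpP gK; apply/Sp_x_SpP; exact: Ksp_adj.
- by move=> g /Sp_x_SpP[].
- move=> g /Sp_x_SpP gK; split; last exact: Ksp_det.
  by case: gK => gu gS; exact: unitary_pseudo.
- move=> k1 k2 [u1 _] [u2 _].
  have ru n (k : 'M[R]_n) : unitary (R := R) n k -> unitary (R := R) n (real_mx H k).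
    rewrite /unitary /= (adjoint_real S) -(real_mxM S) => e.
    by rewrite -(real_mx1 S) -e; congr (real_mx _ (_ *m _)); apply/matrixP => a b; rewrite !mxE.
  by exists (real_mx H k1), (real_mx H k2); split; [exact: ru|exact: ru|].
- exact: Sp_M.
- exact: Sp_adj.
- by move=> g [].
- exact: Sp_cart.
Defined.

End compact_symplectic.

(** * Sharpness of the exponent p *)

Lemma one_nonzero_entry_nz (R : realType) p q (X : 'M[R]_(p + q)) :
  (p <= q)%N -> one_nonzero_entry X -> X <> 0.
Proof.
move=> pq [H -> H1] X0; have [i Hi] := mem_card1 H1.
have := Hi i; rewrite !inE eqxx => /negP; apply; apply/eqP.
have qi : (i < q)%N by apply: leq_trans pq.
have := congr1 (fun A : 'M[R]_(p + q) => A (lshift q i) (rshift p (Ordinal qi))) X0.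
by rewrite /cartan_mx block_mxEur !mxE /= eqxx.
Qed.

Lemma cartan_pair_sharp (R : realType) (F : hypercomplexType R) (S : scalar_structure F)
    (p q : nat) (G K : set 'M[F]_(p + q)) (mK : probability (borel_mx F (p + q)) R)
    (haarG : {measure set (borel_mx F (p + q)) -> \bar R}) :
  cartan_pair S G K -> (0 < sdim S)%N -> (0 < p)%N -> (p < q)%N ->
  haar_measure K mK -> haar_measure G haarG ->
  [/\ (1 < p)%N ->
      forall X : 'M[R]_(p + q), cartan_space p q X -> X <> 0 ->
        convolution_pow (delta_natural mK X) p `<< haarG,
      forall X : 'M[R]_(p + q), one_nonzero_entry X ->
        mutually_singular (convolution_pow (delta_natural mK X) p.-1) haarG &
      forall l : nat,
        (forall X : 'M[R]_(p + q), cartan_space p q X -> X <> 0 ->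
          convolution_pow (delta_natural mK X) l `<< haarG) ->
        (p <= l)%N].
Proof.
move=> P d0 p0 pq hK hG; split.
- by move=> p1 X; exact: (pair_dominated P).
- by move=> X; apply: (pair_singular P) => //; rewrite prednK.
move=> l dom; rewrite leqNgt; apply/negP => lp.
(* For l < p this single [X] refutes domination: its power is singular, so a dominated one would
   vanish both on [A] and on its complement, against total mass 1. *)
pose X := cartan_mx q (delta_mx 0 (Ordinal p0) : 'rV[R]_p).
have X1 : one_nonzero_entry X.
  exists (delta_mx 0 (Ordinal p0)) => //; apply: etrans (card1 (Ordinal p0)).
  by apply: eq_card => i; rewrite !inE mxE eqxx /= pnatr_eq0 eqb0 negbK.
have [A [mA nA hA]] := pair_singular P pq hG d0 lp hK X1.
have X0 := one_nonzero_entry_nz (ltnW pq) X1.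
have nAC : convolution_pow (delta_natural mK X) l (~` A) = 0%E.
  apply: (dom X _ X0 (~` A)) => //; [by exists (delta_mx 0 (Ordinal p0))| |exact: measurableC].
  by move=> B mB BA; apply: subset_measure0 BA hA => //; exact: measurableC.
have : convolution_pow (delta_natural mK X) l setT = 0%E.
  by rewrite -(setUv A) measureU0 //; exact: measurableC.
by rewrite probability_setT => /eqP; rewrite onee_eq0.
Qed.

Theorem theorem17 (R : realType) (p q : nat) (F : hypercomplexType R)
    (G K : set 'M[F]_(p + q)) (mK : probability (borel_mx F (p + q)) R)
    (haarG : {measure set (borel_mx F (p + q)) -> \bar R}) :
  (0 < p)%N -> (p < q)%N ->
  symmetric_pair p q G K ->
  haar_measure K mK ->
  haar_measure G haarG ->
  [/\ (1 < p)%N ->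
      forall X : 'M[R]_(p + q), cartan_space p q X -> X <> 0 ->
        convolution_pow (delta_natural mK X) p `<< haarG,
      forall X : 'M[R]_(p + q), one_nonzero_entry X ->
        mutually_singular (convolution_pow (delta_natural mK X) p.-1) haarG &
      forall l : nat,
        (forall X : 'M[R]_(p + q), cartan_space p q X -> X <> 0 ->
          convolution_pow (delta_natural mK X) l `<< haarG) ->
        (p <= l)%N].
Proof.
move=> p0 pq pair; case: F G K / pair mK haarG => mK haarG.
- exact: (cartan_pair_sharp (so_pair R (ltnW pq)) isT p0 pq).
- exact: (cartan_pair_sharp (su_pair R (ltnW pq)) isT p0 pq).
- exact: (cartan_pair_sharp (sp_pair R (ltnW pq)) isT p0 pq).
Qed.
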